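(* Let $A$ be a simple $C^*$-algebra which is essentially tracially in $\mathcal C_{\mathcal Z}$, the class of separable $\mathcal Z$-stable $C^*$-algebras. If $A$ is not purely infinite, then $A$ has stable rank one if $A$ is unital, and $A$ almost has stable rank one if $A$ is not unital.
   Context: $\mathcal Z$ is the Jiang–Su algebra; $D$ is $\mathcal Z$-stable if $D\otimes\mathcal Z\cong D$. For positive $a,b\in A$, $a\lesssim b$ means there are $x_i\in A$ with $\|a-x_i^*bx_i\|\to0$. A simple $C^*$-algebra $A$ is purely infinite iff every nonzero $a\in\mathrm{Ped}(A)_+$ (Pedersen ideal) is infinite, i.e. there are nonzero $b,c\in\mathrm{Ped}(A)_+$ with $bc=cb=0$, $b+c\lesssim c$, $c\lesssim a$. A non-unital $C^*$-algebra $A$ *almost has stable rank one* if every hereditary $C^*$-subalgebra $B\subset A$ lies in the closure of the invertible elements of its unitization $\widetilde B$. **Essential tracial approximation.** $A_+^1$ is the set of positive elements of norm $\le1$; $a\in_\varepsilon S$ means $\|a-x\|<\varepsilon$ for some $x\in S$. Let $\mathcal P$ be a class of $C^*$-algebras. A simple $C^*$-algebra $A$ is *essentially tracially in* $\mathcal P$ if for any finite $\mathcal F\subset A$, $\varepsilon>0$ and $s\in A_+\setminus\{0\}$ there are $e\in A_+^1$ and a nonzero $C^*$-subalgebra $B\subset A$ with $B\in\mathcal P$ such that (1) $\|ex-xe\|<\varepsilon$ for all $x\in\mathcal F$; (2) $(1-e)x\in_\varepsilon B$ and $\|(1-e)x\|\ge\|x\|-\varepsilon$ for all $x\in\mathcal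 F$; (3) $e\lesssim s$. (Here $1$ is the unit of $A$, or of the unitization if $A$ is non-unital.) *)

(* Defs.v *)
From HB Require Import structures.
From mathcomp Require Import all_boot all_order all_algebra.
From mathcomp Require Import all_classical all_reals all_analysis.
From mathcomp Require Import complex mxtens.

Set Implicit Arguments.
Unset Strict Implicit.
Unset Printing Implicit Defensive.

Import Order.TTheory GRing.Theory Num.Theory.
Import numFieldNormedType.Exports.

Local Open Scope classical_set_scope.
Local Open Scope ring_scope.

(* Going through [numClosedFieldType] gives access to the topology that
   MathComp-Analysis puts on every such field.  Norms take values in this
   field; its order makes only elements with equal imaginary parts comparable,
   so [0 < eps] says in particular that [eps] is real. *)
Definition Cplx (R : realType) : numClosedFieldType := R[i].

(* A C*-algebra need not have a unit, so the MathComp ring structures do not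
   apply. *)
HB.mixin Record isCstarAlgebra (R : realType) A
    of CompleteNormedModule (Cplx R) A := {
  cmul : A -> A -> A;
  star : A -> A;
  cmulA : forall x y z : A, cmul x (cmul y z) = cmul (cmul x y) z;
  cmul_linearl : forall (k : Cplx R) (x y z : A),
    cmul (k *: x + y) z = k *: cmul x z + cmul y z;
  cmul_linearr : forall (k : Cplx R) (x y z : A),
    cmul z (k *: x + y) = k *: cmul z x + cmul z y;
  star_antilinear : forall (k : Cplx R) (x y : A),
    star (k *: x + y) = Num.conj k *: star x + star y;
  starK : forall x : A, star (star x) = x;
  star_cmul : forall x y : A, star (cmul x y) = cmul (star y) (star x);
  normr_cmul : forall x y : A, `|cmul x y| <= `|x| * `|y|;
  normr_cstar : forall x : A, `|cmul (star x) x| = `|x| ^+ 2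
}.

#[short(type="cstarAlgType")]
HB.structure Definition CstarAlgebra (R : realType) :=
  {A of CompleteNormedModule (Cplx R) A & isCstarAlgebra R A}.

Notation "x ** y" := (cmul x y) (at level 40, left associativity) : ring_scope.

Section Basics.
Variables (R : realType) (A : cstarAlgType R).
Implicit Types (a b c e u x y : A) (I B : set A).

Definition unit_of u := forall x, u ** x = x /\ x ** u = x.

Definition unital := exists u, unit_of u.

(* The invertible elements with respect to the unit [u]. *)
Definition GL u : set A := [set x | exists y, x ** y = u /\ y ** x = u].

Definition positive a := exists x, a = star x ** x.

Definition cuntz_le a b :=
  exists x : nat -> A, (fun n => star (x n) ** b ** x n) @ \oo --> a.

Definition is_subspace B :=
  B 0 /\ forall (k : Cplx R) x y, B x -> B y -> B (k *: x + y).

Definition is_ideal I :=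
  is_subspace I /\ forall a x, I x -> I (a ** x) /\ I (x ** a).

Definition simple :=
  (exists a, a != 0) /\
  forall I, is_ideal I -> closed I -> I = [set 0] \/ I = setT.

(* The Pedersen ideal is the least dense two-sided ideal. *)
Definition Ped : set A :=
  [set a | forall I, is_ideal I -> dense I -> I a].

Definition is_cstar_subalgebra B :=
  [/\ is_subspace B, closed B,
      forall x y, B x -> B y -> B (x ** y) &
      forall x, B x -> B (star x)].

Definition hereditary B :=
  forall a b, B b -> positive b -> positive a -> positive (b - a) -> B a.

Definition is_separable := exists2 S : set A, countable S & dense S.

Definition infinite_elt a :=
  exists b c, [/\ b <> 0, c <> 0,
    Ped b /\ positive b, Ped c /\ positive c &
    [/\ b ** c = 0, c ** b = 0, cuntz_le (b + c) c & cuntz_le c a]].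

Definition purely_infinite :=
  forall a, a <> 0 -> Ped a -> positive a -> infinite_elt a.

Definition tracial_state u (tau : A -> Cplx R) :=
  [/\ scalar tau, forall a, positive a -> 0 <= tau a, tau u = 1 &
      forall a b, tau (a ** b) = tau (b ** a)].

Definition lin_indep n (v : 'I_n -> A) :=
  forall k : 'I_n -> Cplx R, \sum_i k i *: v i = 0 -> forall i, k i = 0.

End Basics.

Arguments unital {R} A.
Arguments simple {R} A.
Arguments Ped {R} A.
Arguments is_separable {R} A.
Arguments purely_infinite {R} A.

Definition star_hom (R : realType) (A B : cstarAlgType R) (f : A -> B) :=
  [/\ linear f, forall x y, f (x ** y) = f x ** f y &
      forall x, f (star x) = star (f x)].

Definition star_isomorphic (R : realType) (A B : cstarAlgType R) :=
  exists f : A -> B, star_hom f /\ bijective f.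

(* The C*-subalgebra [B] belongs to the (isomorphism-closed) class [P].  A
   subalgebra is a set, not a type, hence the detour through an algebra [D]
   mapped isomorphically onto it. *)
Definition subalgebra_in (R : realType) (A : cstarAlgType R)
    (P : cstarAlgType R -> Prop) (B : set A) :=
  is_cstar_subalgebra B /\
  exists (D : cstarAlgType R) (f : D -> A),
    [/\ P D, star_hom f, injective f & range f = B].

(* [T] is a C*-completion of the algebraic tensor product of [A] and [B], with
   [t a b] the image of the elementary tensor.  The third condition is the
   injectivity of the map from the algebraic tensor product to [T].  When [A]
   or [B] is nuclear there is exactly one such completion, and no choice of
   C*-norm is involved. *)
Definition is_tensor_product (R : realType) (A B T : cstarAlgType R)
    (t : A -> B -> T) :=
  [/\ (forall b, linear (t^~ b)) /\ (forall a, linear (t a)),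
      (forall a b a' b', t a b ** t a' b' = t (a ** a') (b ** b')) /\
      (forall a b, star (t a b) = t (star a) (star b)),
      forall n (a : 'I_n -> A) (b : 'I_n -> B),
        lin_indep b -> \sum_i t (a i) (b i) = 0 -> forall i, a i = 0 &
      dense [set x | exists n (a : 'I_n -> A) (b : 'I_n -> B),
        x = \sum_i t (a i) (b i)]].

Section JiangSu.
Variable R : realType.
Local Notation C := (Cplx R).

(* The dimension drop algebra of continuous f : [0,1] -> M_p (x) M_q with f(0)
   in M_p (x) 1 and f(1) in 1 (x) M_q.  Its elements are represented by
   functions on the whole of [R], of which only the values on [0,1] matter. *)
Definition dimdrop (p q : nat) : set (R -> 'M[C]_(p * q)) :=
  [set f | [/\ forall i j, {within `[0%R, 1%R], continuous (fun t : R => f t i j : C)},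
    exists M : 'M[C]_p, f 0 = M *t (1%:M : 'M[C]_q) &
    exists N : 'M[C]_q, f 1 = (1%:M : 'M[C]_p) *t N]].

(* A unital *-isomorphism of the dimension drop algebra onto its image in [Z];
   as an injective *-homomorphism it is automatically isometric, with closed
   image. *)
Definition dimdrop_embedding (Z : cstarAlgType R) (u : Z) (p q : nat)
    (phi : (R -> 'M[C]_(p * q)) -> Z) :=
  [/\ forall f g, dimdrop f -> dimdrop g ->
        (phi f = phi g <-> {in `[0, 1], f =1 g}),
      forall (k : C) f g, dimdrop f -> dimdrop g ->
        phi (fun t => k *: f t + g t) = k *: phi f + phi g,
      forall f g, dimdrop f -> dimdrop g ->
        phi (fun t => f t *m g t) = phi f ** phi g,
      forall f, dimdrop f ->
        phi (fun t => map_mx Num.conj (f t)^T) = star (phi f) &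
      phi (fun=> 1%:M) = u].

Definition prime_dimdrop_subalgebra (Z : cstarAlgType R) (u : Z) (S : set Z) :=
  exists (p q : nat) (phi : (R -> 'M[C]_(p * q)) -> Z),
    [/\ (0 < p)%N, (0 < q)%N, coprime p q, dimdrop_embedding u phi &
        S = phi @` @dimdrop p q].

(* By the theorem of Jiang and Su, up to isomorphism there is exactly one simple
   unital infinite-dimensional inductive limit of prime dimension drop algebras
   with a unique tracial state.  The connecting maps are injective, so the
   limit is the closure of an increasing union of unital subalgebras; it is
   infinite-dimensional because each of these is. *)
Definition is_jiang_su (Z : cstarAlgType R) :=
  exists u : Z, [/\ unit_of u, simple Z,
    exists! tau : Z -> C, tracial_state u tau &
    exists S : nat -> set Z,
      [/\ forall n, prime_dimdrop_subalgebra u (S n),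
          forall n, S n `<=` S n.+1 &
          dense (\bigcup_n S n)]].

Definition jiang_su_stable (D : cstarAlgType R) :=
  exists (Z T : cstarAlgType R) (t : D -> Z -> T),
    [/\ is_jiang_su Z, is_tensor_product t & star_isomorphic T D].

Definition separable_jiang_su_stable (D : cstarAlgType R) :=
  is_separable D /\ jiang_su_stable D.

End JiangSu.

(* [x - e ** x] is (1 - e)x; no unit of [A] is needed to write it. *)
Definition essentially_tracially_in (R : realType)
    (P : cstarAlgType R -> Prop) (A : cstarAlgType R) :=
  forall (F : set A) (eps : Cplx R) (s : A),
    finite_set F -> 0 < eps -> positive s -> s <> 0 ->
  exists (e : A) (B : set A),
    [/\ positive e /\ `|e| <= 1,
        subalgebra_in P B /\ B <> [set 0],
        forall x, F x -> `|e ** x - x ** e| < eps,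
        forall x, F x ->
          (exists y, B y /\ `|(x - e ** x) - y| < eps) /\
          `|x| - eps <= `|x - e ** x| &
        cuntz_le e s].

Definition stable_rank_one (R : realType) (A : cstarAlgType R) :=
  exists2 u : A, unit_of u & dense (GL u).

(* The unitization of a non-unital [D]: the pair [(d, k)] stands for d + k1.  Its
   norm is that of left multiplication by d + k1 on [D]. *)
Section Unitization.
Variables (R : realType) (D : cstarAlgType R).

Definition unitization : Type := (D * Cplx R)%type.

Definition unitization_mul (x y : unitization) : unitization :=
  (x.1 ** y.1 + y.2 *: x.1 + x.2 *: y.1, x.2 * y.2).

Definition unitization_one : unitization := (0, 1).

Definition unitization_norm (x : unitization) : R :=
  sup [set complex.Re (`|x.1 ** d + x.2 *: d| : R[i]) | d in
    [set d : D | `|d| <= 1]].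

Definition unitization_GL : set unitization :=
  [set x | exists y, unitization_mul x y = unitization_one /\
                     unitization_mul y x = unitization_one].

(* [D] lies in the closure of the invertible elements of its unitization, which
   is [D] itself when [D] is unital. *)
Definition in_closure_GL_unitization :=
  (forall u : D, unit_of u -> dense (GL u)) /\
  (~ unital D -> forall (d : D) (eps : R), 0 < eps ->
     exists x : unitization, unitization_GL x /\
       unitization_norm (d - x.1, - x.2) < eps).

End Unitization.

Definition almost_stable_rank_one (R : realType) (A : cstarAlgType R) :=
  forall B : set A, is_cstar_subalgebra B -> hereditary B ->
    subalgebra_in (@in_closure_GL_unitization R) B.

(* Main.v *)
(* In a Jiang-Su algebra the fibres of the connecting maps can be joined by paths of matrices
along which n equivalent orthogonal projections, and a partition of unity made of n copies and
a small rest, persist; so such elements exist almost centrally in every Z-stable algebra and,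
up to an e, in A. They turn an x with a two-sided annihilator, up to a small error, into a
product u v of two nilpotents, and (u + t)(v + t) is invertible. An x without nearby invertibles
lacks such annihilators only if some left invertible is not invertible; this gives an infinite
projection, and by division A is purely infinite. *)
From HB Require Import structures.
Require Import Defs.
From mathcomp Require Import all_boot all_order all_algebra.
From mathcomp Require Import all_classical all_reals all_analysis.
From mathcomp Require Import complex mxtens spectral ring lra zify.
Set Implicit Arguments.
Unset Strict Implicit.
Unset Printing Implicit Defensive.

Import Order.TTheory GRing.Theory Num.Theory.
Import numFieldNormedType.Exports.

Local Open Scope classical_set_scope.
Local Open Scope ring_scope.

(** * Deciding identities in noncommutative rings *)

Section NcRing.

(** The fibre of a connecting map at [t] is a representation of a dimension drop algebra by
    matrices, and the obstacle is that its spectrum moves with [t]. Tuples commuting with one fibre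
    are easy once the interval is cut into short pieces whose cut-off functions become projections:
    each piece then carries matrix units with a large commutant. But a cut-off becomes a projection
    only if the fibre kills a neighbourhood of the cut, so the cuts must change with [t]. Two
    systems of cuts share a large part of each piece, and only the remainders left by dividing by
    [n] have to be moved across. The room for them comes from simplicity: far enough along the limit
    no fibre kills any of many bumps inside a piece. At the two ends the fibre lives in a smaller
    matrix algebra and tuples are found there, so the path obeys the boundary conditions. In [A],
    relations up to [eps] become exact in the ring of bounded sequences modulo null ones, where
    factorizations are plain algebra. Positivity, roots and cut-offs in [A] are built from norm
    estimates and limits of polynomials. *)

Inductive ncexp :=
| NcVar of nat | NcZero | NcOne | NcAdd of ncexp & ncexp
| NcMul of ncexp & ncexp | NcOpp of ncexp.

Fixpoint nc_eval (R: pzRingType) (e: seq R) (t: ncexp): R :=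
 match t with
 | NcVar i => nth 0 e i
 | NcZero => 0
 | NcOne => 1
 | NcAdd a b => nc_eval e a + nc_eval e b
 | NcMul a b => nc_eval e a * nc_eval e b
 | NcOpp a => - nc_eval e a
 end.

Definition nc_mul (s t: seq (bool * seq nat)) :=
 [seq (x.1 (+) y.1, x.2 ++ y.2) | x <- s, y <- t].

Fixpoint nc_mon (t: ncexp): seq (bool * seq nat) :=
 match t with
 | NcVar i => [:: (false, [:: i])]
 | NcZero => [::]
 | NcOne => [:: (false, [::])]
 | NcAdd a b => nc_mon a ++ nc_mon b
 | NcMul a b => nc_mul (nc_mon a) (nc_mon b)
 | NcOpp a => [seq (~~ x.1, x.2) | x <- nc_mon a]
 end.

Fixpoint nc_null n (s: seq (bool * seq nat)) :=
 match n, s with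
 | _, [::] => true
 | 0%N, _ => false
 | n'.+1, m :: s' =>
 let m':=(~~ m.1, m.2) in (m' \in s') && nc_null n' (rem m' s')
 end.

Variables (R: pzRingType) (e: seq R).

Definition nc_meval (m: bool * seq nat): R :=
 (-1) ^+ m.1 * \prod_(i <- m.2) nth 0 e i.

Lemma nc_meval_mul s t :
 \sum_(m <- nc_mul s t) nc_meval m =
 (\sum_(m <- s) nc_meval m) * (\sum_(m <- t) nc_meval m).
rewrite /nc_mul big_allpairs_dep /= big_distrlr /=.
apply: eq_bigr => x _;apply: eq_bigr => y _.
rewrite /nc_meval signr_addb big_cat /= -!mulrA;congr (_ * _).
by rewrite !mulr_sign;case: y.1;rewrite ?mulrN.
Qed.

Lemma nc_monE t: \sum_(m <- nc_mon t) nc_meval m = nc_eval e t.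
elim: t => //=.
- by move=> i;rewrite big_seq1 /nc_meval /= big_seq1 mul1r.
- by rewrite big_nil.
- by rewrite big_seq1 /nc_meval big_nil mulr1.
- by move=> a <- b <-;rewrite big_cat.
- by move=> a <- b <-;rewrite nc_meval_mul.
- move=> a <-;rewrite big_map -sumrN;apply: eq_bigr => m _.
 by rewrite /nc_meval;case: m.1;rewrite /= ?expr1 ?expr0 ?mulN1r ?mul1r ?opprK.
Qed.

Lemma nc_nullP n s: nc_null n s -> \sum_(m <- s) nc_meval m = 0.
elim: n s => [|n IH] [|m s] //=;rewrite ?big_nil // big_cons.
case/andP => ms /IH;rewrite (perm_big _ (perm_to_rem ms)) /= big_cons => ->.
rewrite addr0 /nc_meval /=.
by case: m.1;rewrite /= ?expr1 ?expr0 ?mulN1r ?mul1r ?addNr ?subrr.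
Qed.

Lemma nc_correct a b :
 (let s:=nc_mon (NcAdd a (NcOpp b)) in nc_null (size s) s) ->
 nc_eval e a = nc_eval e b.
by move=> /nc_nullP;rewrite nc_monE /= => /eqP;rewrite subr_eq0 => /eqP.
Qed.

End NcRing.

(** The dummy match on [Set] gives backtracking to a tactic that returns a term. Unification with an
    atom is tried only after syntactic comparison with it and all attempts on the rest of the list
    have failed. *)
Ltac nc_index t l :=
 lazymatch l with
 | cons ?y ?l' =>
 match constr:(Set) with
 | _ => let _:=match goal with _ => constr_eq t y end in constr:(O)
 | _ => let i:=nc_index t l' in constr:(S i)
 | _ => let _:=match goal with _ => unify t y end in constr:(O)
 end
 end.

Ltac nc_atoms l t :=
 lazymatch t with
 | @GRing.add _ ?a ?b => let l:=nc_atoms l a in nc_atoms l b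
 | @GRing.mul _ ?a ?b => let l:=nc_atoms l a in nc_atoms l b
 | @GRing.opp _ ?a => nc_atoms l a
 | @GRing.zero _ => l
 | @GRing.one _ => l
 | _ => match constr:(Set) with
 | _ => let _:=nc_index t l in l
 | _ => constr:(cons t l)
 end
 end.

Ltac nc_reify l t :=
 lazymatch t with
 | @GRing.add _ ?a ?b =>
 let x:=nc_reify l a in let y:=nc_reify l b in constr:(NcAdd x y)
 | @GRing.mul _ ?a ?b =>
 let x:=nc_reify l a in let y:=nc_reify l b in constr:(NcMul x y)
 | @GRing.opp _ ?a => let x:=nc_reify l a in constr:(NcOpp x)
 | @GRing.zero _ => constr:(NcZero)
 | @GRing.one _ => constr:(NcOne)
 | _ => let i:=nc_index t l in constr:(NcVar i)
 end.

Ltac nc_ring :=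
 lazymatch goal with
 | |- @eq ?T ?a ?b =>
 let l:=nc_atoms (@nil T) a in
 let l:=nc_atoms l b in
 let x:=nc_reify l a in
 let y:=nc_reify l b in
 refine (@nc_correct _ l x y _);vm_compute;reflexivity
 end.

(** * Absolute values of complex numbers, with values in the reals *)

Section Modulus.
Variable R: realType.

Definition rc (r: R): Cplx R:=(r%:C)%C.

(** Norms in [Cplx R] are complex numbers; with values in [R] estimates are open to [lra] and
    [nra]. *)
Definition absC (k: Cplx R): R:=complex.Re `|k|.

Lemma rcE (k: Cplx R): `|k| = rc (absC k).
by rewrite /absC /rc -[LHS]RRe_real ?normr_real. Qed.

Lemma rc0: rc 0 = 0. Proof. by []. Qed.
Lemma rc1: rc 1 = 1. Proof. by []. Qed.
Lemma rcD r s: rc (r + s) = rc r + rc s. Proof. exact: rmorphD. Qed.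
Lemma rcN r: rc (- r) = - rc r. Proof. exact: rmorphN. Qed.
Lemma rcB r s: rc (r - s) = rc r - rc s. Proof. exact: rmorphB. Qed.
Lemma rcM r s: rc (r * s) = rc r * rc s. Proof. exact: rmorphM. Qed.
Lemma rcV r: rc r^-1 = (rc r)^-1. Proof. exact: fmorphV. Qed.
Lemma rcX r n: rc (r ^+ n) = rc r ^+ n. Proof. exact: rmorphXn. Qed.
Lemma rc_inj: injective rc. Proof. exact: fmorph_inj. Qed.
Lemma rc_le r s: (rc r <= rc s) = (r <= s). Proof. exact: lecR. Qed.
Lemma rc_lt r s: (rc r < rc s) = (r < s). Proof. exact: ltcR. Qed.
Lemma rc_conj r: Num.conj (rc r) = rc r. Proof. exact: conjc_real. Qed.
Lemma rc_sum (I: Type) (s: seq I) P (F: I -> R) :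
 rc (\sum_(i <- s | P i) F i) = \sum_(i <- s | P i) rc (F i).
exact: rmorph_sum. Qed.

Lemma absC_rc r: absC (rc r) = `|r|.
by apply: rc_inj;rewrite -rcE normc_def /= expr0n addr0 sqrtr_sqr. Qed.
Lemma abs0 k: 0 <= absC k. Proof. by rewrite -rc_le -rcE normr_ge0. Qed.
Lemma absC_eq0 k: absC k = 0 -> k = 0.
by move=> h;apply/eqP;rewrite -normr_eq0 rcE h. Qed.
Lemma absC0: absC 0 = 0. Proof. by rewrite -rc0 absC_rc normr0. Qed.
Lemma absC1: absC 1 = 1. Proof. by rewrite -rc1 absC_rc normr1. Qed.
Lemma absCN k: absC (- k) = absC k. Proof. by rewrite /absC normrN. Qed.
Lemma absCM k l: absC (k * l) = absC k * absC l.
by apply: rc_inj;rewrite rcM -!rcE normrM. Qed.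
Lemma absCD k l: absC (k + l) <= absC k + absC l.
by rewrite -rc_le rcD -!rcE ler_normD. Qed.
Lemma absC_conj k: absC (Num.conj k) = absC k.
by apply: rc_inj;rewrite -!rcE norm_conjC. Qed.
Lemma absC_sqr k: rc (absC k ^+ 2) = k * Num.conj k.
by rewrite rcX -rcE normCK. Qed.

End Modulus.

(** * Unital C*-algebras with a real-valued norm *)

Definition nlim (K: numDomainType) (V: zmodType) (nm: V -> K) (u: nat -> V) l :=
 forall e, 0 < e -> exists N, forall n, (N <= n)%N -> nm (u n - l) < e.
Definition ncauchy (K: numDomainType) (V: zmodType) (nm: V -> K) (u: nat -> V) :=
 forall e, 0 < e -> exists N, forall m n, (N <= m)%N -> (N <= n)%N -> nm (u m - u n) < e.
(** One notion for every group with a size function, so that completeness passes from [A] and the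
    scalars to the unitization before that carries a topology. *)
Definition ncomplete (K: numDomainType) (V: zmodType) (nm: V -> K) :=
 forall u, ncauchy nm u -> exists l, nlim nm u l.

Lemma norm_complete (K: numFieldType) (V: completeNormedModType K): ncomplete (fun x: V => `|x|).
move=> u h;have cu: cauchy (u @ \oo).
 apply/cauchy_ballP => e /h[N H].
 exists (u @` [set n | (N <= n)%N], u @` [set n | (N <= n)%N]) => /=.
 by split;exists N => // n /= Nn;exists n.
 by move=> [x y] /= [[m /= Nm <-] [n /= Nn <-]];rewrite -ball_normE /=;apply: H.
have /cvg_ex[l /cvgrPdist_lt hl]: cvg (u @ \oo) by apply: cauchy_cvg.
by exists l => e /hl[N _ H];exists N => n /H /=;rewrite distrC.
Qed.

(** Functional calculus needs a unit; the instance in use is the unitization of a given algebra. *)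
HB.mixin Record isUCStar (R: realType) U of GRing.Algebra (Cplx R) U :={
 adj: U -> U;
 nrm: U -> R;
 adjD: forall x y, adj (x + y) = adj x + adj y;
 adjZ: forall (k: Cplx R) x, adj (k *: x) = Num.conj k *: adj x;
 adjM: forall x y, adj (x * y) = adj y * adj x;
 adjK: forall x, adj (adj x) = x;
 nrm_eq0: forall x, nrm x = 0 -> x = 0;
 nrmD: forall x y, nrm (x + y) <= nrm x + nrm y;
 nrmZ: forall (k: Cplx R) x, nrm (k *: x) = absC k * nrm x;
 nrmM: forall x y, nrm (x * y) <= nrm x * nrm y;
 nrm_cstar: forall x, nrm (adj x * x) = nrm x ^+ 2;
 nrm_complete: ncomplete nrm
}.

#[short(type="ucsType")]
HB.structure Definition UCStar (R: realType) :=
 {U of GRing.Algebra (Cplx R) U & isUCStar R U}.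

Section Basics.
Variables (R: realType) (U: ucsType R).
Implicit Types (x y z: U) (k: Cplx R) (r: R).

Lemma adj0: adj (0: U) = 0.
by have:=adjZ 0 (0: U);rewrite !scale0r conjC0 scale0r. Qed.
Lemma adjN x: adj (- x) = - adj x.
by rewrite -scaleN1r adjZ rmorphN1 scaleN1r. Qed.
Lemma adjB x y: adj (x - y) = adj x - adj y.
by rewrite adjD adjN. Qed.
Lemma adj1: adj (1: U) = 1.
by have:=adjM (1: U) (adj 1);rewrite mul1r adjK mul1r => <-. Qed.
Lemma adjR r x: adj (rc r *: x) = rc r *: adj x.
by rewrite adjZ rc_conj. Qed.

Lemma nrm0: nrm (0: U) = 0.
by rewrite -(scale0r (0: U)) nrmZ absC0 mul0r. Qed.
Lemma nrmN x: nrm (- x) = nrm x.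
by rewrite -scaleN1r nrmZ absCN absC1 mul1r. Qed.
Lemma nrmge0 x: 0 <= nrm x.
have:=nrmD x (- x);rewrite subrr nrm0 nrmN => h;lra.
Qed.
Lemma nrmC x y: nrm (x - y) = nrm (y - x).
by rewrite -nrmN opprB. Qed.
Lemma nrmB x y: nrm (x - y) <= nrm x + nrm y.
by rewrite -(nrmN y) nrmD. Qed.
Lemma nrm_dist x y z: nrm (x - z) <= nrm (x - y) + nrm (y - z).
have -> : x - z = (x - y) + (y - z) by nc_ring. exact: nrmD. Qed.
Lemma nrmR r x: nrm (rc r *: x) = `|r| * nrm x.
by rewrite nrmZ absC_rc. Qed.
Lemma nrm_gt0 x: x <> 0 -> 0 < nrm x.
by move=> h;rewrite lt_def nrmge0 andbT;apply/eqP => /nrm_eq0. Qed.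
Lemma nrm_adj x: nrm (adj x) = nrm x.
have h y: nrm y <= nrm (adj y).
 have [->|/eqP y0]:=eqVneq y 0;first by rewrite adj0.
 rewrite -(ler_pM2r (nrm_gt0 y0)) -expr2 -nrm_cstar;exact: nrmM.
by apply/eqP;rewrite eq_le h -{2}(adjK x) h.
Qed.
Lemma nrm1: nrm (1: U) = 1.
have h: 0 < nrm (1: U) by apply: nrm_gt0;exact/eqP/oner_neq0.
have:=nrm_cstar (1: U);rewrite adj1 mulr1 => e.
by apply: (mulfI (lt0r_neq0 h));rewrite mulr1 -expr2 -e.
Qed.
Lemma nrm_scal r: nrm (rc r *: (1: U)) = `|r|.
by rewrite nrmR nrm1 mulr1. Qed.
Lemma nrm_sum (I: Type) (s: seq I) P (F: I -> U) :
 nrm (\sum_(i <- s | P i) F i) <= \sum_(i <- s | P i) nrm (F i).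
elim/big_ind2: _ => [|x1 x2 y1 y2 h1 h2|//];first by rewrite nrm0.
by apply: le_trans (nrmD _ _) _;rewrite lerD.
Qed.
Lemma nrmX x n: nrm (x ^+ n) <= nrm x ^+ n.
elim: n => [|n IH];first by rewrite !expr0 nrm1.
by rewrite !exprS;apply: le_trans (nrmM _ _) _;rewrite ler_wpM2l ?nrmge0.
Qed.
Lemma nrmM_le x y (a b: R): nrm x <= a -> nrm y <= b -> nrm (x * y) <= a * b.
by move=> h h';apply: le_trans (nrmM _ _) _;rewrite ler_pM ?nrmge0. Qed.
Lemma nrm_sa_sqr x: adj x = x -> nrm (x ^+ 2) = nrm x ^+ 2.
by move=> h;rewrite expr2 -{1}h nrm_cstar. Qed.
Lemma cstar0 x: adj x * x = 0 -> x = 0.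
move=> h;apply: nrm_eq0;have:=nrm_cstar x;rewrite h nrm0 => /esym/eqP.
by rewrite sqrf_eq0 => /eqP.
Qed.
Lemma nrm_le_eps x: (forall eps: R, 0 < eps -> nrm x <= eps) -> x = 0.
move=> h;apply: nrm_eq0;apply/eqP;rewrite eq_le nrmge0 andbT.
by apply/ler_addgt0Pr => e e0;rewrite add0r h.
Qed.

Definition tends (u: nat -> U) l:=forall eps: R, 0 < eps ->
 exists N, forall n, (N <= n)%N -> nrm (u n - l) < eps.

Lemma tendsC l: tends (fun=> l) l.
by move=> e e0;exists 0%N => n _;rewrite subrr nrm0. Qed.
Lemma tendsD u v l m: tends u l -> tends v m -> tends (fun n => u n + v n) (l + m).
move=> h1 h2 e e0;have e2: 0 < e / 2 by lra.
have [N1 H1]:=h1 _ e2;have [N2 H2]:=h2 _ e2.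
exists (maxn N1 N2) => n;rewrite geq_max => /andP[/H1 a /H2 b].
rewrite opprD addrACA;apply: le_lt_trans (nrmD _ _) _;lra.
Qed.
Lemma tendsZ k u l: tends u l -> tends (fun n => k *: u n) (k *: l).
move=> h e e0;have k1: 0 < absC k + 1 by have:=abs0 k;lra.
have [N H]:=h _ (divr_gt0 e0 k1);exists N => n /H a.
rewrite -scalerBr nrmZ;move: a;rewrite ltr_pdivlMr // => a.
by have:=abs0 k;have:=nrmge0 (u n - l);nra.
Qed.
Lemma tendsN u l: tends u l -> tends (fun n => - u n) (- l).
by move=> /(tendsZ (-1));rewrite scaleN1r;under eq_fun do rewrite scaleN1r.
Qed.
Lemma tendsB u v l m: tends u l -> tends v m -> tends (fun n => u n - v n) (l - m).
by move=> h h';apply: tendsD => //;apply: tendsN. Qed.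
Lemma tends_adj u l: tends u l -> tends (fun n => adj (u n)) (adj l).
by move=> h e /h[N H];exists N => n /H;rewrite -adjB nrm_adj. Qed.
Lemma tendsM u v l m: tends u l -> tends v m -> tends (fun n => u n * v n) (l * m).
move=> h1 h2 e e0;have l0:=nrmge0 l;have m0:=nrmge0 m.
have [d [d0 d1 dK]]: exists d, [/\ 0 < d, d <= 1 & d * (nrm l + nrm m + 2) <= e].
 have K0: 0 < nrm l + nrm m + 2 by lra.
 exists (Num.min 1 (e / (nrm l + nrm m + 2))).
 by rewrite -ler_pdivlMr // lt_min ltr01 divr_gt0 // !ge_min !lexx orbT.
have [N1 H1]:=h1 _ d0;have [N2 H2]:=h2 _ d0.
exists (maxn N1 N2) => n;rewrite geq_max => /andP[/H1/ltW a /H2/ltW b].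
have -> : u n * v n - l * m = (u n - l) * (v n - m) + (u n - l) * m + l * (v n - m) by nc_ring.
have:=nrmD ((u n - l) * (v n - m) + (u n - l) * m) (l * (v n - m)).
have:=nrmD ((u n - l) * (v n - m)) ((u n - l) * m).
have:=nrmM_le a b;have:=nrmM_le a (lexx (nrm m));have:=nrmM_le (lexx (nrm l)) b;nra.
Qed.
Lemma tends_uniq u l m: tends u l -> tends u m -> l = m.
move=> h1 h2;apply/eqP;rewrite -subr_eq0;apply/eqP/nrm_le_eps => e e0.
have e2: 0 < e / 2 by lra.
have [N1 H1]:=h1 _ e2;have [N2 H2]:=h2 _ e2.
have:=nrm_dist l (u (maxn N1 N2)) m.
have:=H1 _ (leq_maxl N1 N2);rewrite nrmC;have:=H2 _ (leq_maxr N1 N2);lra.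
Qed.
Lemma tends_nrm_le u l r: tends u l -> (forall n, nrm (u n) <= r) -> nrm l <= r.
move=> h b;apply/ler_addgt0Pr => e e0;have [N H]:=h _ e0.
have:=H N (leqnn _);have:=b N;have:=nrm_dist l (u N) 0.
rewrite !subr0 nrmC;lra.
Qed.
Lemma tends_ext u v l: (forall n, u n = v n) -> tends u l -> tends v l.
by move=> h;have -> : u = v by apply/funext. Qed.
Definition invertible x:=exists y, x * y = 1 /\ y * x = 1.

(* A set closed under the operations, limits and containing [1] also contains
   the inverse produced by the Neumann series. *)
Lemma neumann (S: set U) h: nrm h < 1 -> S 1 -> S h ->
 (forall x y, S x -> S y -> S (x + y)) -> (forall x y, S x -> S y -> S (x * y)) ->
 (forall u l, (forall n, S (u n)) -> tends u l -> S l) ->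
 exists y, [/\ S y, (1 - h) * y = 1 & y * (1 - h) = 1].
move=> h1 S1 Sh SD SM SL;pose s n:=iter n (fun x => 1 + h * x) 1.
have cm n: s n * h = h * s n.
 elim: n => [|n IH];first by rewrite mul1r mulr1.
 by rewrite /s iterS mulrDl mulrDr mul1r mulr1 -mulrA IH.
have e n: s n = h * s n + (1 - h ^+ n.+1).
 elim: n => [|n IH];first by rewrite mulr1 expr1 addrC subrK.
 by rewrite {1}/s iterS -/(s n) {1}IH mulrDr mulrBr mulr1 -exprS;move: (h ^+ _) => p;rewrite /s iterS -/(s n);nc_ring.
have hn0: tends (fun n => h ^+ n.+1) 0.
 move=> e' e0;have /cvgrPdist_lt/(_ _ e0) [N _ HN]: (fun n => nrm h ^+ n) @ \oo --> (0: R).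
 by apply: cvg_expr;rewrite ger0_norm ?nrmge0.
 exists N => n /leqW/HN;rewrite /= sub0r normrN subr0 ger0_norm ?exprn_ge0 ?nrmge0 //.
 exact/le_lt_trans/nrmX.
have d0: 0 < 1 - nrm h by lra.
have [l sl]: exists l, tends s l.
 apply: nrm_complete => e' e0;have [|N H]:=hn0 (e' / 2 * (1 - nrm h));first by rewrite mulr_gt0 ?divr_gt0.
 exists N => m n /H + /H;rewrite !subr0.
 have: s m - s n = h * (s m - s n) + (h ^+ n.+1 - h ^+ m.+1).
 by rewrite {1}(e m) {1}(e n);move: (h ^+ n.+1) (h ^+ m.+1) => p q;nc_ring.
 move: (s m - s n) => D DE h2 h3;have:=nrmD (h * D) (h ^+ n.+1 - h ^+ m.+1);rewrite -DE.
 have:=nrmB (h ^+ n.+1) (h ^+ m.+1);have:=nrmM h D;rewrite -(ltr_pM2r d0);lra.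
have lE: 1 + h * l = l.
 apply: (@tends_uniq (fun n => s n.+1));first exact: tendsD (tendsC 1) (tendsM (tendsC h) sl).
 by move=> e' /sl[N H];exists N => n Nn;apply: H;apply: leqW.
have lh: l * h = h * l.
 by apply: tends_uniq (tendsM sl (tendsC h)) _;apply: tends_ext (tendsM (tendsC h) sl) => n /=;rewrite cm.
exists l;rewrite mulrBr mulrBl mulr1 mul1r lh;have -> : l - h * l = 1 by rewrite -{1}lE addrK.
split=> //.
by apply: (SL) sl => n;elim: n => //= n IH;apply: (SD) => //;exact: SM.
Qed.

Lemma rcVK r x: 0 < r -> rc r^-1 *: (rc r *: x) = x.
by move=> r0;rewrite scalerA -rcM mulVf ?gt_eqF // scale1r. Qed.
Lemma rcK r x: 0 < r -> rc r *: (rc r^-1 *: x) = x.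
by move=> r0;rewrite scalerA -rcM mulfV ?gt_eqF // scale1r. Qed.
Lemma proj_nrm x: adj x = x -> x * x = x -> nrm x <= 1.
by move=> sx xx;have:=nrm_cstar x;rewrite sx xx;have:=nrmge0 x;nra. Qed.
Lemma sa_inv x y: adj x = x -> x * y = 1 -> y * x = 1 -> adj y = y.
by move=> sx xy yx;rewrite -[LHS]mulr1 -xy mulrA -{1}sx -adjM xy adj1 mul1r. Qed.

End Basics.

(** * Square roots and positivity from norm estimates *)

Section Roots.
Variables (R: realType) (U: ucsType R).
Implicit Types (a b x y z: U) (r t: R).

Lemma half2 x: rc 2^-1 *: (x + x) = x.
rewrite scalerDr -scalerDl -rcD (_: 2^-1 + 2^-1 = 1 :> R) ?rc1 ?scale1r //;lra.
Qed.

Lemma inv_small (K eps: R): 0 < eps -> exists N: nat, forall n, (N <= n)%N ->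
 K / n.+1%:R < eps.
move=> e0;have [N _ HN]:=@near_infty_natSinv_lt R (PosNum (divr_gt0 e0 (ltr_wpDl (normr_ge0 K) ltr01))).
exists N => n /HN /=;have K1: 0 < `|K| + 1 by rewrite ltr_wpDl.
rewrite ltr_pdivlMr // => h;apply: le_lt_trans h;rewrite mulrC ler_wpM2l ?invr_ge0 //.
by rewrite (le_trans (ler_norm _)) // ler_wpDr.
Qed.

Definition subalg (S: set U) :=
 [/\ S 1, forall x y, S x -> S y -> S (x + y), forall x y, S x -> S y -> S (x * y),
 forall (k: Cplx R) x, S x -> S (k *: x) &
 forall u l, (forall n, S (u n)) -> tends u l -> S l].

(** Means that [x] is a limit of polynomials in [a]. The quantified form yields both commutation
    with whatever commutes with [a] and membership in the unitization of a hereditary subalgebra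
    that contains [a]. *)
Definition lpoly a x:=forall S, subalg S -> S a -> S x.

Lemma lp_comm a x b: a * b = b * a -> lpoly a x -> x * b = b * x.
move=> ab /(_ [set y | y * b = b * y]);apply=> //.
split=> /= [|y z yb zb|y z yb zb|k y yb|u l h hl];first by rewrite mul1r mulr1.
- by rewrite mulrDl mulrDr yb zb.
- by rewrite -mulrA zb mulrA yb mulrA.
- by rewrite -scalerAl -scalerAr yb.
by apply: tends_uniq (tendsM hl (tendsC b)) _;apply: tends_ext (tendsM (tendsC b) hl) => n /=;rewrite h.
Qed.

(* The iteration [q := (a + q^2) / 2], whose fixed point is [1 - sqrt (1 - a)];
   it is dominated in norm by the same iteration for [a = 1] in [R]. *)
Fixpoint sqp a n: U:=if n is m.+1 then rc 2^-1 *: (a + sqp a m * sqp a m) else 0.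
Fixpoint sq1 n: R:=if n is m.+1 then 2^-1 * (1 + sq1 m * sq1 m) else 0.

Lemma sqp_inter a b z n: a * z = z * b -> sqp a n * z = z * sqp b n.
move=> h;elim: n => [|n IH] /=;first by rewrite mul0r mulr0.
by rewrite -scalerAl -scalerAr mulrDl mulrDr h -mulrA IH mulrA IH mulrA.
Qed.

(** For [d = 1 - q] the iteration is [d (1 - d / 2)], which decays like [2 / n]; the induction rests
    on the product of nonnegative factors in [e]. *)
Lemma sq1P n: 0 <= sq1 n /\ 0 <= 1 - sq1 n <= 2 / n.+1%:R.
elim: n => [|n [q0 /andP[h1 h2]]] /=;first by split=> //;rewrite divr1;lra.
move: (sq1 n) q0 h1 h2 => q q0 h1 h2;split;first by rewrite mulr_ge0 ?invr_ge0 ?addr_ge0 ?mulr_ge0.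
have n1: 0 < n.+1%:R :> R by rewrite ltr0n.
move: h2;rewrite ler_pdivlMr // => h2;apply/andP;split;first by nra.
rewrite ler_pdivlMr ?ltr0n //;move: n1 h2;rewrite -[n.+2%:R]natr1.
move: (n.+1%:R: R) => c c0 h2.
have e: 0 <= (2 - (1 - q) * c) * (1 - (1 - q) / 2) by rewrite mulr_ge0 //;lra.
have:=sqr_ge0 (1 - q);nra.
Qed.

Lemma sqp_nrm a n: nrm a <= 1 -> nrm (sqp a n) <= sq1 n.
move=> a1;elim: n => [|n IH] /=;first by rewrite nrm0.
rewrite nrmR ger0_norm ?invr_ge0 // ler_wpM2l ?invr_ge0 //.
by apply: le_trans (nrmD _ _) _;rewrite lerD ?nrmM_le.
Qed.

(** The two iterates commute, so the difference of their squares factors as [(x - y) * (x + y)]; the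
    scalar iteration has the same factorization and bounds both factors. *)
Lemma sqp_mono a m k: nrm a <= 1 -> nrm (sqp a (m + k) - sqp a m) <= sq1 (m + k) - sq1 m.
move=> a1;elim: m => [|m IH];first by rewrite !subr0;apply: sqp_nrm.
rewrite addSn /= -scalerBr nrmR ger0_norm ?invr_ge0 // -mulrBr ler_wpM2l ?invr_ge0 //.
have xy: sqp a (m + k) * sqp a m = sqp a m * sqp a (m + k) by apply/sqp_inter/esym/sqp_inter.
have h:=le_trans (nrmD _ _) (lerD (sqp_nrm (m + k) a1) (sqp_nrm m a1)).
move: xy IH h;move: (sqp a (m + k)) (sqp a m) (sq1 (m + k)) (sq1 m) => x y X Y xy IH h.
have -> : a + x * x - (a + y * y) = (x - y) * (x + y) by rewrite mulrBl !mulrDr xy;nc_ring.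
have -> : 1 + X * X - (1 + Y * Y) = (X - Y) * (X + Y) by ring.
exact: nrmM_le.
Qed.

Lemma sqrt1m a: nrm a <= 1 -> exists r: U,
 [/\ tends (fun n => 1 - sqp a n) r, r * r = 1 - a, nrm (1 - r) <= 1, lpoly a r &
 adj a = a -> adj r = r].
move=> a1;have b N k: (N <= k)%N -> nrm (sqp a k - sqp a N) <= 2 / N.+1%:R.
 move=> /subnKC <-;apply: le_trans (sqp_mono _ _ a1) _.
 have [_ /andP[h1 _]]:=sq1P (N + (k - N));have [_ /andP[_ h2]]:=sq1P N.
 by apply: le_trans h2;move: h1;lra.
have [l sl]: exists l, tends (sqp a) l.
 apply: nrm_complete => e e0;have [|N H]:=@inv_small 2 (e / 2);[by rewrite divr_gt0|exists N => m n /b h1 /b h2].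
 rewrite nrmC in h2;apply: le_lt_trans (nrm_dist _ (sqp a N) _) _.
 by have:=H N (leqnn N);move: (2 / _) h1 h2 => q;lra.
have rl: tends (fun n => 1 - sqp a n) (1 - l):=tendsB (tendsC 1) sl.
exists (1 - l);split=> // [||S [S1 SD SM SZ SL] Sa|sa].
- have e: rc 2^-1 *: (a + l * l) = l.
 apply: (@tends_uniq _ _ (fun n => sqp a n.+1));first exact: tendsZ (tendsD (tendsC a) (tendsM sl sl)).
 by move=> e /sl[N H];exists N => n Nn;apply: H;apply: leqW.
 have e2: l + l = a + l * l by rewrite -{1 2}e -scalerDr half2.
 have -> : (1 - l) * (1 - l) = 1 - (l + l) + l * l by nc_ring.
 by rewrite e2;nc_ring.
- rewrite opprB addrC subrK;apply: tends_nrm_le sl _ => n.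
 by apply: le_trans (sqp_nrm n a1) _;have [_ /andP[+ _]]:=sq1P n;lra.
- apply: (SL _ _ _ rl) => n;apply: (SD) => //;rewrite -scaleN1r;apply: (SZ).
 elim: n => [|n IH] /=;first by rewrite -(scale0r (1: U));apply: SZ.
 by apply/SZ/SD => //;apply: SM.
apply: tends_uniq (tends_adj rl) _;apply: tends_ext rl => n /=;rewrite adjB adj1;congr (_ - _).
by elim: n => [|n IH] /=;rewrite ?adj0 // adjR adjD adjM sa -IH.
Qed.

(** [v = x + i y] is unitary, and [x] is the mean of [v] and its adjoint. *)
Lemma sa_cos x y: adj x = x -> adj y = y -> x * y = y * x ->
 x * x + y * y = 1 -> nrm x <= 1.
move=> hx hy xy h;pose i: Cplx R :='i;pose v:=x + i *: y.
have av: adj v = x - i *: y by rewrite /v adjD adjZ hx hy conjCi scaleNr.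
have v1: adj v * v = 1.
 rewrite av /v mulrBl !mulrDr -!scalerAl -!scalerAr scalerA -[i * i]expr2 [i ^+ 2]sqrCi xy.
 by rewrite scaleN1r opprD opprK addrA addrK.
have nv: nrm v = 1.
 have:=nrm_cstar v;rewrite v1 nrm1 => e;have v0:=nrmge0 v.
 by apply/eqP;rewrite -(@eqrXn2 _ 2) // expr1n -e.
have -> : x = rc 2^-1 *: (v + adj v).
 by rewrite av /v addrACA subrr addr0 half2.
rewrite nrmR ger0_norm ?invr_ge0 ?ler0n //.
by have:=nrmD v (adj v);rewrite nrm_adj nv;lra.
Qed.

(** Positivity without spectra: for self-adjoint [a] with [nrm a <= t], the bound on [t - a] says
    that the spectrum lies between 0 and [t]. Sums are then immediate, and the hard fact is
    [padjM]. *)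
Definition pos a:=adj a = a /\ exists t, nrm a <= t /\ nrm (rc t *: 1 - a) <= t.

(** The root [r] of [1 - h * h] commutes with [h] and [r * r + h * h = 1], so [sa_cos] bounds
    [r]. *)
Lemma nrm_1m_sqr (h: U): adj h = h -> nrm h <= 1 -> nrm (1 - h * h) <= 1.
move=> ha h1;have hh: nrm (h * h) <= 1.
 by rewrite -[1]mulr1;apply: nrmM_le.
have [r [_ rr _ lr sr]]:=sqrt1m hh;have {}sr: adj r = r by apply: sr;rewrite adjM ha.
have cr: r * h = h * r by apply: lp_comm lr;rewrite mulrA.
rewrite -rr -[1]mulr1;have r1: nrm r <= 1.
 by apply: sa_cos sr ha cr _;rewrite rr subrK.
exact: nrmM_le.
Qed.

Lemma pos_sa a: pos a -> adj a = a. Proof. by case. Qed.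
Lemma pos0: pos 0.
by split;[exact: adj0|exists 0;rewrite nrm0 scale0r subrr nrm0]. Qed.
Lemma posD a b: pos a -> pos b -> pos (a + b).
move=> [sa [s [s1 s2]]] [sb [t [t1 t2]]];split;first by rewrite adjD sa sb.
exists (s + t);split;first by have:=nrmD a b;lra.
rewrite rcD scalerDl opprD addrACA;apply: le_trans (nrmD _ _) _;lra.
Qed.
Lemma posR r a: 0 <= r -> pos a -> pos (rc r *: a).
move=> r0 [sa [s [s1 s2]]];split;first by rewrite adjR sa.
exists (r * s);rewrite nrmR ger0_norm // ler_wpM2l //;split=> //.
by rewrite rcM -scalerA -scalerBr nrmR ger0_norm // ler_wpM2l.
Qed.
Lemma pos_scal r: 0 <= r -> pos (rc r *: 1).
move=> r0;split;first by rewrite adjR adj1.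
by exists r;rewrite nrm_scal ger0_norm // subrr nrm0.
Qed.
Lemma pos1: pos 1.
by rewrite -[1](scale1r (1: U)) -rc1;apply: pos_scal. Qed.

Lemma pos_sqr (h: U): adj h = h -> pos (h * h).
move=> ha;split;first by rewrite adjM ha.
exists (nrm h ^+ 2);split;first by rewrite expr2 nrmM.
have [->|/eqP h0]:=eqVneq h 0.
 by rewrite nrm0 mulr0 subr0 expr0n scale0r nrm0.
have n0:=nrm_gt0 h0;set k:=rc (nrm h)^-1 *: h.
have -> : h = rc (nrm h) *: k by rewrite rcK //.
have k1: nrm k = 1 by rewrite nrmR ger0_norm ?invr_ge0 // ?ltW // mulVf // gt_eqF.
rewrite nrmR k1 mulr1 gtr0_norm // -scalerAl -scalerAr scalerA -rcM -expr2 -scalerBr.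
rewrite nrmR ger0_norm ?sqr_ge0 // ler_piMr ?sqr_ge0 //.
by apply: nrm_1m_sqr;rewrite ?k1 // adjR ha.
Qed.

Definition sqf T a n: U:=rc (Num.sqrt T) *: (1 - sqp (1 - rc T^-1 *: a) n).

Lemma sqrt_lim T a: 0 < T -> adj a = a -> nrm (rc T *: 1 - a) <= T ->
 exists s, [/\ pos s, s * s = a, tends (sqf T a) s & lpoly a s].
move=> T0 sa aT;pose h:=1 - rc T^-1 *: a.
have sh: adj h = h by rewrite adjB adj1 adjR sa.
have h1: nrm h <= 1.
 have -> : h = rc T^-1 *: (rc T *: 1 - a) by rewrite scalerBr rcVK.
 by rewrite nrmR gtr0_norm ?invr_gt0 // ler_pdivrMl // mulr1.
have [r [rl rr r1 lr sr]]:=sqrt1m h1.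
have pr: pos r.
 split;first exact: sr.
 exists 2;split;last first.
 have -> : rc 2 *: 1 - r = 1 + (1 - r) :> U.
 by rewrite (_: 2 = 1 + 1 :> R) // rcD scalerDl scale1r addrA.
 by apply: le_trans (nrmD _ _) _;rewrite nrm1;lra.
 have -> : r = 1 - (1 - r) by nc_ring.
 by apply: le_trans (nrmB _ _) _;rewrite nrm1;lra.
exists (rc (Num.sqrt T) *: r);split;first exact: posR (sqrtr_ge0 _) pr.
- rewrite -scalerAl -scalerAr scalerA -rcM -expr2 sqr_sqrtr ?ltW // rr /h.
 by rewrite subKr rcK.
- exact: tendsZ.
move=> S cS Sa;have [S1 SD _ SZ _]:=cS;apply: (SZ);apply: lr => //;apply: SD => //.
by rewrite -scaleN1r;apply/SZ/SZ.
Qed.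

Lemma psqrt a: pos a -> exists s, [/\ adj s = s, pos s, s * s = a & lpoly a s].
move=> [sa [t [t1 t2]]];have t0: 0 < t + 1 by have:=nrmge0 a;lra.
have [|s [ps ss _ sl]]:=sqrt_lim t0 sa;last by exists s;split=> //;case: ps.
by rewrite rcD scalerDl addrAC;apply: le_trans (nrmD _ _) _;rewrite nrm_scal normr1 lerD2r.
Qed.

Lemma pos_comm a b: pos a -> pos b -> a * b = b * a -> pos (a * b).
move=> pa pb ab;have [s [ss _ s2 ls]]:=psqrt pa.
have [t [st _ t2 lt]]:=psqrt pb.
have sb: s * b = b * s:=lp_comm ab ls.
have st': t * s = s * t by apply: lp_comm lt;rewrite sb.
have -> : a * b = (s * t) * (s * t).
 by rewrite -s2 -t2 !mulrA;congr (_ * t);rewrite -!mulrA -st'.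
by apply: pos_sqr;rewrite adjM ss st.
Qed.

Lemma nrm_le_of_sqr x: adj x = x -> pos (1 - x * x) -> nrm x <= 1.
move=> sx p;have [w [sw _ w2 lw]]:=psqrt p.
apply: (sa_cos sx sw);last by rewrite w2 addrC subrK.
by apply/esym;apply: lp_comm lw;rewrite mulrBl mulrBr mulr1 mul1r mulrA.
Qed.

(** For [u] the root of [a / r], the element [1 - u * u] is positive; its root and [u] lie on the
    unit circle, so [nrm u <= 1]. *)
Lemma pos_nrm_gt0 a r: 0 < r -> pos a -> pos (rc r *: 1 - a) -> nrm a <= r.
move=> r0 pa pr;have [s [ss _ s2 _]]:=psqrt pa.
have q0: 0 < Num.sqrt r by rewrite sqrtr_gt0.
pose u:=rc (Num.sqrt r)^-1 *: s.
have uu: u * u = rc r^-1 *: a.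
 by rewrite -scalerAl -scalerAr scalerA -rcM -invfM -expr2 sqr_sqrtr ?ltW // s2.
have u1: nrm u <= 1.
 apply: nrm_le_of_sqr;first by rewrite adjR ss.
 have:=posR (ltW (_: 0 < r^-1)) pr;rewrite invr_gt0 => /(_ r0).
 by rewrite scalerBr rcVK // uu.
have: nrm (u * u) <= 1 by rewrite -[1]mulr1;apply: nrmM_le.
by rewrite uu nrmR gtr0_norm ?invr_gt0 // ler_pdivrMl // mulr1.
Qed.

Lemma pos_nrm a r: 0 <= r -> pos a -> pos (rc r *: 1 - a) -> nrm a <= r.
move=> r0 pa pr;apply/ler_addgt0Pr => e e0;apply: pos_nrm_gt0 => //;first lra.
by rewrite rcD scalerDl addrAC;apply: posD => //;apply: pos_scal;lra.
Qed.

Lemma pos_of_nrm a r: adj a = a -> nrm a <= r -> pos (rc r *: 1 - a).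
move=> sa ar;have r0: 0 <= r:=le_trans (nrmge0 a) ar.
split;first by rewrite adjB adjR adj1 sa.
exists (r + r);split.
 apply: le_trans (nrmB _ _) _;rewrite nrm_scal ger0_norm //;lra.
have -> : rc (r + r) *: 1 - (rc r *: 1 - a) = rc r *: 1 + a.
 by rewrite rcD scalerDl;nc_ring.
apply: le_trans (nrmD _ _) _;rewrite nrm_scal ger0_norm //;lra.
Qed.

(** Hence any bound of the norm can serve as the witness [t] in [pos a]. *)
Lemma pos_nrm_sub a r: pos a -> nrm a <= r -> nrm (rc r *: 1 - a) <= r.
move=> pa ar;have r0: 0 <= r:=le_trans (nrmge0 a) ar.
apply: pos_nrm => //;first by apply: pos_of_nrm => //;apply: pos_sa.
by rewrite opprB addrCA subrr addr0.
Qed.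

Lemma pos_anti a: pos a -> pos (- a) -> a = 0.
move=> pa pn;apply/nrm_eq0/le_anti;rewrite nrmge0 andbT.
by apply: pos_nrm => //;rewrite scale0r sub0r.
Qed.

(** For [a = s - t] one has [(s + t) * a = 0], so [s * (a * a)] and [t * (a * a)] are positive and
    opposite, hence zero, and the cube of [a] vanishes. *)
Lemma sqrt_uniq (s t: U): pos s -> pos t -> s * t = t * s -> s * s = t * t -> s = t.
move=> ps pt st e;pose a:=s - t;have sa: adj a = a by rewrite adjB !pos_sa.
have h (x: U): pos x -> x * a = a * x -> pos (x * (a * a)).
 by move=> px xa;apply: pos_comm (pos_sqr sa) _;rewrite // !mulrA xa -!mulrA xa.
have hs: pos (s * (a * a)) by apply: h;rewrite // mulrBr mulrBl st.
have ht: pos (t * (a * a)) by apply: h;rewrite // mulrBr mulrBl st.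
have z: s * (a * a) = - (t * (a * a)).
 have st0: (s + t) * a = 0 by rewrite /a mulrBr !mulrDl e st;nc_ring.
 by apply/eqP;rewrite -addr_eq0 -mulrDl mulrA st0 mul0r.
have s0: s * (a * a) = 0 by apply: pos_anti;rewrite // z opprK.
have t0: t * (a * a) = 0 by apply: pos_anti;rewrite // -z.
have a3: a * (a * a) = 0 by rewrite {1}/a mulrBl s0 t0 subrr.
apply/eqP;rewrite -subr_eq0 -/a;apply/eqP;do 2!apply: cstar0.
by rewrite adjM !sa -mulrA a3 mulr0.
Qed.

(** A common bound [T] makes both roots limits of the same polynomials, in [s * s] and in [t * t],
    and [z] passes through each polynomial. *)
Lemma sqrt_inter (s t z: U): pos s -> pos t -> s * s * z = z * (t * t) -> s * z = z * t.
move=> ps pt h;pose T:=nrm (s * s) + nrm (t * t) + 1.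
have ns:=nrmge0 (s * s);have nt:=nrmge0 (t * t).
have T0: 0 < T by rewrite /T;lra.
have lim x: pos x -> nrm (x * x) <= T -> tends (sqf T (x * x)) x.
 move=> px xT;have xx:=pos_sqr (pos_sa px).
 have [y [py yy yl ly]]:=sqrt_lim T0 (pos_sa xx) (pos_nrm_sub xx xT).
 have yx: y * x = x * y by apply: lp_comm ly;rewrite mulrA.
 by rewrite (sqrt_uniq py px yx yy) in yl.
have ls: tends (sqf T (s * s)) s by apply: lim;rewrite // /T;lra.
have lt: tends (sqf T (t * t)) t by apply: lim;rewrite // /T;lra.
apply: tends_uniq (tendsM ls (tendsC z)) _.
apply: tends_ext (tendsM (tendsC z) lt) => n /=.
rewrite -scalerAl -scalerAr mulrBl mulrBr (sqp_inter (b:=1 - rc T^-1 *: (t * t))) ?mul1r ?mulr1 //.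
by rewrite mulrBl mulrBr -scalerAl h -scalerAr mul1r mulr1.
Qed.

(* [a |a| = 2 s |a|] is positive, and its square is [|a|^4]. *)
Lemma pos_of_sqr s a: pos s -> adj a = a -> a * s = s * a -> a * a = (s + s) * a -> pos a.
move=> ps sa as' aa;have [b [sb pb bb lb]]:=psqrt (pos_sqr sa).
have ba: b * a = a * b by apply: lp_comm lb;rewrite mulrA.
have bs: b * s = s * b by apply: lp_comm lb;rewrite -mulrA as' mulrA as' mulrA.
have ab: a * b = (s + s) * b.
 have: (a - (s + s)) * b = 0.
 have: (a - (s + s)) * a = 0 by rewrite mulrBl aa subrr.
 have: (a - (s + s)) * b = b * (a - (s + s)) by rewrite mulrBl mulrBr mulrDl mulrDr bs ba.
 have: adj (a - (s + s)) = a - (s + s) by rewrite adjB adjD sa pos_sa.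
 move: (a - _) => c sc cb ca;apply: cstar0.
 by rewrite adjM sb sc -cb -mulrA [b * _]mulrA -cb -mulrA bb [c * (a * a)]mulrA ca mul0r mulr0.
 by rewrite mulrBl => /eqP;rewrite subr_eq0 => /eqP.
have p2: pos (a * b).
 by rewrite ab;apply: pos_comm;[exact: posD|done|rewrite mulrDl mulrDr bs].
have abb: a * b = b * b.
 apply: (sqrt_uniq p2 (pos_sqr sb));first by rewrite -(mulrA b b) [b * (a * b)]mulrA ba !mulrA ba.
 by rewrite -{1}ba -mulrA [a * (a * b)]mulrA -bb !mulrA.
suff -> : a = b by [].
apply/eqP;rewrite -subr_eq0;apply/eqP/cstar0;rewrite adjB sa sb.
have -> : (a - b) * (a - b) = a * a - a * b + (b * b - b * a) by nc_ring.
by rewrite ba abb bb !subrr addr0.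
Qed.

(** Here [s] is the absolute value of [h], and [a = s - h] satisfies [a * a = (s + s) * a]. *)
Lemma abs_sub_pos (s h: U): pos s -> adj h = h -> s * s = h * h -> pos (s - h).
move=> ps sh e;have sc: s * h = h * s by apply: sqrt_inter;rewrite // e mulrA.
apply: (pos_of_sqr ps);first by rewrite adjB sh pos_sa.
 by rewrite mulrBl mulrBr sc.
by rewrite mulrBl mulrDl !mulrBr -e sc;nc_ring.
Qed.

End Roots.

(** * Positivity of [adj y * y] and its consequences *)

Section Positivity.
Variables (R: realType) (U: ucsType R).
Implicit Types (a b c x y z: U) (r: R).

(** Squaring loses the sign: [c * c * z = z * (b * b)], so the roots satisfy [c * z = z * b] as
    well. *)
Lemma pos_antiinter c b z: pos c -> pos b -> c * z = - (z * b) -> z * b = 0.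
move=> pc pb h;have: c * z = z * b by apply: sqrt_inter;rewrite // -mulrA h mulrN [c * _]mulrA h mulNr opprK mulrA.
by rewrite h => e;rewrite -[LHS]half2 -{1}e addNr scaler0.
Qed.

(* Kelley-Vaught: for [a = y* y] and [e = |a| - a], the element [z = y e] has
   [z* z <= 0 <= z z*], which forces [e = 0]. *)
Lemma padjM y: pos (adj y * y).
set a:=adj y * y;have sa: adj a = a by rewrite adjM adjK.
have [m [sm pm mm lm]]:=psqrt (pos_sqr sa).
have ma: m * a = a * m by apply: lp_comm lm;rewrite mulrA.
have [s [ss _ s2 ls]]:=psqrt pm.
set e:=m - a;have se: adj e = e by rewrite adjB sm sa.
have es: s * e = e * s by apply: lp_comm ls;rewrite mulrBl mulrBr ma.
have ea: e * a = - (e * m).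
 by apply/eqP;rewrite -addr_eq0 mulrBl mulrBl ma mm addrC subrKA subrr.
set z:=y * e;set b:=e * m * e.
have zz: adj z * z = - b.
 by rewrite adjM se !mulrA -(mulrA e) -/a -[e * a * e]/((e * a) * e) ea mulNr.
have pb: pos b.
 have -> : b = (s * e) * (s * e) by rewrite {1}es /b -s2 !mulrA.
 by apply: pos_sqr;rewrite adjM ss se es.
have pc: pos (z * adj z).
 pose i: Cplx R :='i;pose P:=z + adj z;pose Q:=i *: (z - adj z).
 have sP: adj P = P by rewrite adjD adjK addrC.
 have sQ: adj Q = Q by rewrite adjZ conjCi adjB adjK scaleNr -scalerN opprB.
 have QQ: Q * Q = - ((z - adj z) * (z - adj z)).
 by rewrite -scalerAl -scalerAr scalerA -[i * i]expr2 [i ^+ 2]sqrCi scaleN1r.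
 have -> : z * adj z = rc 2^-1 *: (P * P + Q * Q) + b.
 rewrite -[LHS](half2 (z * adj z)) -[b]half2 -scalerDr;congr (_ *: _).
 by rewrite QQ -[b]opprK -zz /P;nc_ring.
 apply: posD => //;apply: posR;first by rewrite invr_ge0 ler0n.
 by apply: posD;apply: pos_sqr.
have zb: z * b = 0.
 by apply: (pos_antiinter pc pb);rewrite -mulrA zz mulrN.
have b0: b = 0.
 apply: cstar0;rewrite (pos_sa pb).
 by rewrite -[X in X * b]opprK -zz mulNr -mulrA zb mulr0 oppr0.
have em: e * m = 0.
 have se0: s * e = 0.
 by apply: cstar0;rewrite adjM ss se -mulrA (mulrA s s) s2 mulrA -/b.
 by rewrite -s2 mulrA -es se0 mul0r.
have e0: e = 0.
 by apply: cstar0;rewrite se {2}/e mulrBr ea em oppr0 subr0.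
by have -> : a = m by apply/esym/eqP;rewrite -subr_eq0 -/e e0.
Qed.

Lemma padjM2 y: pos (y * adj y).
by rewrite -{1}(adjK y);apply: padjM. Qed.

Lemma pos_conj a z: pos a -> pos (adj z * a * z).
move=> /psqrt[s [ss _ <- _]].
by have:=padjM (s * z);rewrite adjM ss !mulrA.
Qed.

Lemma nrm_mono a b: pos a -> pos (b - a) -> nrm a <= nrm b.
move=> pa pba;apply: pos_nrm => //;first exact: nrmge0.
have pb: pos b by have:=posD pba pa;rewrite subrK.
by rewrite -(subrKA b);apply: posD => //;apply: pos_of_nrm => //;apply: pos_sa.
Qed.

Lemma adjM_le y r: nrm y <= r -> pos (rc (r ^+ 2) *: 1 - adj y * y).
move=> yr;apply: pos_of_nrm;first by rewrite adjM adjK.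
by rewrite nrm_cstar lerXn2r // nnegrE ?nrmge0 // (le_trans (nrmge0 y)).
Qed.

(** With [T = nrm s + r] the difference [T - s] is positive and at most [nrm s < T], so the Neumann
    series inverts [s / T] inside [S]. *)
Lemma pinv_ (S: set U) (s: U) r: subalg S -> S s -> pos s -> 0 < r ->
 pos (s - rc r *: 1) ->
 exists k, [/\ S k, s * k = 1, k * s = 1 & adj k = k].
move=> [S1 SD SM SZ SL] Ss ps r0 psr;set T:=nrm s + r.
have s0:=nrmge0 s;have T0: 0 < T by rewrite /T;lra.
pose h:=1 - rc T^-1 *: s.
have Sh: S h by apply: SD => //;rewrite -scaleN1r;apply: (SZ _ _ (SZ _ _ Ss)).
have h1: nrm h < 1.
 have -> : h = rc T^-1 *: (rc T *: 1 - s).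
 by rewrite scalerBr rcVK //.
 rewrite nrmR gtr0_norm ?invr_gt0 // ltr_pdivrMl // mulr1.
 apply: (@le_lt_trans _ _ (nrm s));last by rewrite /T;lra.
 apply: pos_nrm => //;first by apply: pos_of_nrm;rewrite ?(pos_sa ps) // /T;lra.
 rewrite (_: _ - _ = s - rc r *: 1) // /T rcD scalerDl opprB opprD addrCA.
 by nc_ring.
have [y [Sy y1 y2]]:=neumann h1 S1 Sh SD SM SL.
have eh: 1 - h = rc T^-1 *: s by rewrite subKr.
rewrite eh in y1 y2;exists (rc T^-1 *: y).
have k1: s * (rc T^-1 *: y) = 1 by rewrite -scalerAr scalerAl.
have k2: (rc T^-1 *: y) * s = 1 by rewrite -scalerAl scalerAr.
split=> //;first exact: SZ.
by apply: sa_inv k1 k2;exact: pos_sa.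
Qed.

(** The square of the norm is in the spectrum of [b * b]: an inverse [k] of [c] gives [c >= 1 / K]
    for [K >= nrm k], so [b * b] would stay below its own norm by [1 / K]. *)
Lemma nrm_not_invertible b: adj b = b -> 0 < nrm b ->
 ~ exists k: U, (rc (nrm b ^+ 2) *: 1 - b * b) * k = 1 /\ k * (rc (nrm b ^+ 2) *: 1 - b * b) = 1.
move=> sb b0 [k []];set l:=nrm b ^+ 2.
have nbb: nrm (b * b) = l by rewrite -expr2 nrm_sa_sqr.
have pb:=pos_sqr sb.
have pc: pos (rc l *: 1 - b * b) by apply: pos_of_nrm;rewrite ?nbb // pos_sa.
set c:=_ - _ in pc *;move=> ck kc.
have sk: adj k = k by apply: sa_inv ck kc;exact: pos_sa.
have l0: 0 < l by rewrite exprn_gt0.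
(* The summand [l^-1] keeps [l - K^-1] nonnegative, as [pos_nrm] requires. *)
pose K:=nrm k + l^-1;have K0: 0 < K by rewrite ltr_wpDl ?nrmge0 ?invr_gt0.
have: nrm (b * b) <= l - K^-1.
 apply: pos_nrm => //;first by rewrite subr_ge0 invf_ple ?posrE // lerDr nrmge0.
 have -> : rc (l - K^-1) *: 1 - b * b = rc K^-1 *: (rc K *: c - 1).
 by rewrite scalerBr rcVK // rcB scalerBl addrAC.
 apply: posR;first by rewrite invr_ge0 ltW.
 have -> : rc K *: c - 1 = c * (rc K *: 1 - k) by rewrite mulrBr -scalerAr mulr1 ck.
 apply: pos_comm => //;first by apply: pos_of_nrm;rewrite // lerDl invr_ge0 ltW.
 by rewrite [LHS]mulrBr [RHS]mulrBl ck kc -scalerAl -scalerAr mul1r mulr1.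
by rewrite nbb;have:=K0;rewrite -invr_gt0;lra.
Qed.

(* A left inverse of [w] bounds [w* w] below, so its square root is invertible. *)
Lemma linv_polar (S: set U) (w l: U): l * w = 1 -> subalg S -> S (adj w * w) ->
 exists k, [/\ S k, adj k = k, adj (w * k) * (w * k) = 1 & invertible k].
move=> lw cS Sc;set c:=adj w * w in Sc *;have pc: pos c:=padjM w.
set K:=nrm l;have K0: 0 < K.
 apply: nrm_gt0 => l0;have:=nrm1 U;rewrite -lw l0 mul0r nrm0 => /eqP.
 by rewrite eq_sym oner_eq0.
have K2: 0 < K ^+ 2 by rewrite exprn_gt0.
have p1: pos (rc (K ^+ 2) *: c - 1).
 have:=pos_conj w (adjM_le (lexx K));rewrite mulrBr mulrBl.
 by rewrite -scalerAr mulr1 -scalerAl -/c (mulrA (adj w) (adj l)) -adjM lw adj1 mul1r lw.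
have [s [ss ps s2 ls]]:=psqrt pc.
have s0: 0 < nrm s.
 apply: nrm_gt0 => s0;move: p1;rewrite -s2 s0 mulr0 scaler0 sub0r => p1.
 have:=pos_anti (@pos1 _ U) p1 => /eqP;rewrite oner_eq0 //.
have p2: pos (s - rc ((K ^+ 2)^-1 * (nrm s)^-1) *: 1).
 have -> : s - rc ((K ^+ 2)^-1 * (nrm s)^-1) *: 1 =
 rc (nrm s)^-1 *: (s * (rc (nrm s) *: 1 - s)) +
 rc ((nrm s)^-1 * (K ^+ 2)^-1) *: (rc (K ^+ 2) *: c - 1).
 rewrite mulrBr s2 -scalerAr mulr1 !scalerBr !scalerA -!rcM mulVf ?gt_eqF //.
 by rewrite divfK ?gt_eqF // rc1 scale1r addrA subrK [_^-1 * _]mulrC.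
 apply: posD;apply: posR;rewrite ?mulr_ge0 ?invr_ge0 ?ltW //.
 apply: pos_comm => //;first exact: pos_of_nrm.
 by rewrite mulrBr mulrBl -scalerAl -scalerAr mul1r mulr1.
have hr: 0 < (K ^+ 2)^-1 * (nrm s)^-1 by rewrite mulr_gt0 ?invr_gt0.
have [k [Sk k1 k2 sk]]:=pinv_ cS (ls _ cS Sc) ps hr p2.
exists k;split=> //;last by exists s.
by rewrite adjM sk -mulrA (mulrA (adj w)) -/c -s2 -!mulrA k1 mulr1 k2.
Qed.

End Positivity.

(** * Cut-offs of a positive element *)

Section Cut.
Variables (R: realType) (U: ucsType R) (d: R).
Hypothesis d0: 0 < d.
Implicit Types (w y z: U).

(* With [v = w / d] these are [|v - 1|], [min (1, v)], [max (1, v)] and [1 - 1 / max (1, v)]. *)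
Definition dist1 w: U :=
 xget 0 [set s | pos s /\ s * s = (rc d^-1 *: w - 1) * (rc d^-1 *: w - 1)].
Definition lcut w: U:=locked (rc 2^-1 *: (1 + rc d^-1 *: w - dist1 w)).
Definition cap w: U:=locked (1 + rc d^-1 *: w - lcut w).
Definition hcut w: U :=
 locked (1 - xget 0 [set g | cap w * g = 1 /\ g * cap w = 1]).

Lemma posV w: pos w -> pos (rc d^-1 *: w).
by apply: posR;rewrite invr_ge0 ltW. Qed.

Lemma sa_V1 w: pos w -> adj (rc d^-1 *: w - 1) = rc d^-1 *: w - 1.
by move=> /posV /pos_sa pw;rewrite adjB pw adj1. Qed.

Lemma dist1P w: pos w -> pos (dist1 w) /\
 dist1 w * dist1 w = (rc d^-1 *: w - 1) * (rc d^-1 *: w - 1).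
move=> pw;rewrite /dist1;case: xgetP => [s _ //|no].
by have [s [_ ps ss _]]:=psqrt (pos_sqr (sa_V1 pw));case: (no s).
Qed.

Lemma dist1_inter w w' z: pos w -> pos w' -> w * z = z * w' -> dist1 w * z = z * dist1 w'.
move=> pw pw' h;have [ps ss]:=dist1P pw;have [pt tt]:=dist1P pw'.
have e: (rc d^-1 *: w - 1) * z = z * (rc d^-1 *: w' - 1).
 by rewrite mulrBl mulrBr -scalerAl h -scalerAr mul1r mulr1.
by apply: sqrt_inter;rewrite // ss tt -mulrA e mulrA e mulrA.
Qed.

Lemma low_inter w w' z: pos w -> pos w' -> w * z = z * w' -> lcut w * z = z * lcut w'.
move=> pw pw' h;rewrite /lcut -!lock -scalerAl -scalerAr;congr (_ *: _).
by rewrite mulrBl mulrBr (dist1_inter pw pw' h) mulrDl mulrDr -scalerAl h -scalerAr mul1r mulr1.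
Qed.

Lemma cap_inter w w' z: pos w -> pos w' -> w * z = z * w' -> cap w * z = z * cap w'.
move=> pw pw' h;rewrite /cap -!lock mulrBl mulrBr (low_inter pw pw' h);congr (_ - _).
by rewrite mulrDl mulrDr -scalerAl h -scalerAr mul1r mulr1.
Qed.

(** The two factors are half of [1 + v - s] and of [1 + v + s], where [s * s] is the square of
    [v - 1]; so the product is a quarter of [(1 + v)^2 - (v - 1)^2], that is [v]. *)
Lemma low_cap w: pos w -> [/\ pos (1 - lcut w), pos (cap w - 1),
 lcut w * cap w = rc d^-1 *: w & cap w * lcut w = rc d^-1 *: w].
move=> pw;have [ps ss]:=dist1P pw;have s1:=sa_V1 pw.
have vs:=dist1_inter pw pw (erefl (w * w));rewrite /cap /lcut -!lock.
have {vs} : rc d^-1 *: w * dist1 w = dist1 w * (rc d^-1 *: w) by rewrite -scalerAl -scalerAr vs.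
move: ps ss s1;move: (rc d^-1 *: w) (dist1 w) => v s ps ss s1 vs.
have e1: 1 - rc 2^-1 *: (1 + v - s) = rc 2^-1 *: (s - (v - 1)).
 by rewrite -[X in X - _]half2 -scalerBr;congr (_ *: _);nc_ring.
have e2: 1 + v - rc 2^-1 *: (1 + v - s) = rc 2^-1 *: (1 + v + s).
 by rewrite -[X in X - _]half2 -scalerBr;congr (_ *: _);nc_ring.
have e3: rc 2^-1 *: (1 + v + s) - 1 = rc 2^-1 *: (s - - (v - 1)).
 by rewrite -[X in _ - X]half2 -scalerBr;congr (_ *: _);nc_ring.
have h0: 0 <= 2^-1 :> R by rewrite invr_ge0.
have e4 x y: x * y = v + v + (v + v) -> (rc 2^-1 *: x) * (rc 2^-1 *: y) = v.
 by move=> xy;rewrite -scalerAl -scalerAr xy !half2.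
rewrite e2 e1 e3;split.
- by apply: posR => //;exact: abs_sub_pos.
- by apply: posR => //;apply: abs_sub_pos;rewrite // ?adjN ?s1 // mulrNN.
- apply: e4;have -> : (1 + v - s) * (1 + v + s) = 1 + v + v + v * v + (v * s - s * v) - s * s by nc_ring.
 by rewrite vs ss;nc_ring.
- apply: e4;have -> : (1 + v + s) * (1 + v - s) = 1 + v + v + v * v - (v * s - s * v) - s * s by nc_ring.
 by rewrite vs ss;nc_ring.
Qed.

(** [xget] picks the inverse of [cap w] in the whole algebra; since inverses are unique, it lies in
    each closed subalgebra that contains [w]. *)
Lemma high_inv w: pos w -> [/\ cap w * (1 - hcut w) = 1, (1 - hcut w) * cap w = 1 &
 forall S, subalg S -> S w -> S (1 - hcut w)].
move=> pw;have [_ pc _ _]:=low_cap pw;have pc': pos (cap w).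
 by rewrite -[cap w](subrK 1);apply: posD => //;exact: pos1.
rewrite -[X in _ - X]scale1r -rc1 in pc.
have [|g [_ g1 g2 _]]:=pinv_ (S:=setT) _ I pc' ltr01 pc;first by [].
rewrite /hcut -lock subKr;case: xgetP => [h _ /= [h1 h2]|/(_ g) []//];split=> // S cS Sw.
have [S1 SD SM SZ SL]:=cS.
have SB x y: S x -> S y -> S (x - y).
 by move=> Sx Sy;apply: SD => //;rewrite -scaleN1r;exact: SZ.
have [ps ss]:=dist1P pw;have [s [_ pt tt /(_ _ cS) St]]:=psqrt (pos_sqr (sa_V1 pw)).
have Ss: S (dist1 w).
 rewrite -[dist1 w]mulr1 (sqrt_inter (z:=1) ps pt) ?ss ?tt ?mulr1 ?mul1r //.
 by apply: St;apply: SM;apply: SB => //;exact: SZ.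
have Sc: S (cap w).
 rewrite /cap /lcut -!lock;apply: (SB);[|apply: (SZ);apply: SB];rewrite //;apply: (SD) => //;exact: SZ.
have [k [Sk _ k2 _]]:=pinv_ cS Sc pc' ltr01 pc.
by rewrite -[h]mul1r -k2 -mulrA h1 mulr1.
Qed.

Lemma high_inter w w' z: pos w -> pos w' -> w * z = z * w' -> hcut w * z = z * hcut w'.
move=> pw pw' h;have [_ e1 _]:=high_inv pw;have [e2 _ _]:=high_inv pw';have e3:=cap_inter pw pw' h.
suff e: (1 - hcut w) * z = z * (1 - hcut w').
 by have:=congr1 (fun x => z - x) e;rewrite mulrBl mulrBr mul1r mulr1 !subKr.
transitivity ((1 - hcut w) * (z * cap w' * (1 - hcut w'))).
 by rewrite -[z * _ * _]mulrA e2 mulr1.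
by rewrite -e3 !mulrA e1 mul1r.
Qed.

(* [g = 1 - hcut w] and [v = w / d] *)
Lemma cutP w (l:=lcut w) (k:=hcut w) (v:=rc d^-1 *: w): pos w ->
 [/\ [/\ adj l = l, adj k = k & pos l /\ pos (1 - l)],
 [/\ pos k, pos (1 - k) & pos (v - l)],
 [/\ k * l = k, l * k = k & v * k = cap w * k],
 v * (1 - k) = l /\ (1 - k) * v = l &
 pos (1 - l * (1 - k))].
move=> pw;have [p1 pc lc cl]:=low_cap pw;have [cg gc _]:=high_inv pw.
have pv:=posV pw;have p1':=pos1 U.
have kE: k = 1 - (1 - k) by rewrite subKr.
have cE: cap w = 1 + v - l by rewrite /cap -lock.
move: p1 pc lc cl cg gc pv cE kE;rewrite -/l -/k -/v;move: (cap w) l v (1 - k) => c l' v' g.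
move: k => k p1 pc lc cl cg gc pv cE kE.
have pcc: pos c by rewrite -[c](subrK 1);exact: posD.
have sg: adj g = g by apply: sa_inv cg gc;exact: pos_sa.
have pg: pos g by have:=pos_conj g pcc;rewrite sg gc mul1r.
have vg: v' * g = l' by rewrite -lc -mulrA cg mulr1.
have gv: g * v' = l' by rewrite -cl mulrA gc mul1r.
have pk: pos k.
 have -> : k = (c - 1) * g by rewrite mulrBl cg mul1r kE.
 by apply: pos_comm => //;rewrite mulrBl mulrBr cg gc mulr1 mul1r.
have pl: pos l' by rewrite -vg;apply: pos_comm;rewrite // vg gv.
have gl: g * l' = l' * g by rewrite -{1}vg mulrA gv.
(* [max (1, v) - 1] and [1 - min (1, v)] live on opposite sides of [v = 1]. *)
have z: (c - 1) * (1 - l') = 0.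
 by rewrite mulrBr mulr1 mulrBl cl mul1r cE;nc_ring.
have kl1: k * l' = k.
 apply/esym/eqP;rewrite -subr_eq0 -[X in X - _]mulr1 -mulrBr.
 have -> : k = g * (c - 1) by rewrite mulrBr gc mulr1 kE.
 by rewrite -mulrA z mulr0.
have lk: l' * k = k by rewrite -[RHS]kl1 kE mulrBl mulrBr gl mul1r mulr1.
split;[by split;rewrite ?pos_sa|split=> //| |by []|].
- by have -> : v' - l' = c - 1 by rewrite cE;nc_ring.
- by split=> //;rewrite cE mulrBl lk mulrDl mul1r addrC addKr.
- have -> : 1 - l' * g = 1 - l' + k by rewrite -[in RHS]lk kE;nc_ring.
 exact: posD.
Qed.

(** With [g = 1 - hcut w] the square of [y * g] is below [g * w * g = d lcut w g <= d]. So
    multiplying by [hcut w] costs at most the square root of [d] for everything that [w]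
    dominates. *)
Lemma hcut_close w y: pos w -> pos (w - adj y * y) ->
 nrm (y - y * hcut w) ^+ 2 <= d.
move=> pw pwy;have [[_ sk _] [_ _ _] _ [vg gv] p1]:=cutP pw.
have sg: adj (1 - hcut w) = 1 - hcut w by rewrite adjB adj1 sk.
have -> : y - y * hcut w = y * (1 - hcut w) by rewrite mulrBr mulr1.
set g:=1 - _ in vg gv p1 sg *;rewrite -nrm_cstar adjM sg mulrA -(mulrA _ (adj y)).
apply: le_trans (nrm_mono (b:=g * w * g) _ _) _.
- by rewrite -{1}sg;apply: pos_conj;apply: padjM.
- rewrite -mulrBl -mulrBr -{1}sg;exact: pos_conj.
apply: (pos_nrm (ltW d0));first by rewrite -{1}sg;exact: pos_conj.
have -> : g * w * g = rc d *: (lcut w * g).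
 by rewrite -gv -scalerAr -scalerAl rcK //.
by rewrite -scalerBr;apply: posR => //;exact: ltW.
Qed.

Lemma hcut_neq0 w: pos w -> d < nrm w -> hcut w != 0.
move=> pw dw;have [s [ss _ s2 _]]:=psqrt pw.
have ps: pos (w - adj s * s) by rewrite ss s2 subrr;apply: pos0.
have:=hcut_close pw ps;apply: contraTneq => ->.
by rewrite mulr0 subr0 -nrm_cstar ss s2 -ltNge.
Qed.

(** The square of [lcut w] is below [lcut w], which is below [w / d]. *)
Lemma lcut_mul w y: pos w -> nrm (lcut w * y) ^+ 2 <= d^-1 * nrm (adj y * w * y).
move=> pw;have [[sl _ [pl p1]] [_ _ pv] _ _ _]:=cutP pw.
rewrite -nrm_cstar adjM sl.
have -> : d^-1 * nrm (adj y * w * y) = nrm (adj y * (rc d^-1 *: w) * y).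
 by rewrite -scalerAr -scalerAl nrmR gtr0_norm // invr_gt0.
have -> : adj y * lcut w * (lcut w * y) = adj y * (lcut w * lcut w) * y by rewrite !mulrA.
apply: nrm_mono;first by apply: pos_conj;apply: pos_sqr.
rewrite -mulrBl -mulrBr;apply: pos_conj.
rewrite -(subrKA (lcut w)) -{2}[lcut w]mulr1 -mulrBr;apply: posD => //.
by apply: pos_comm => //;rewrite mulrBl mulrBr mul1r mulr1.
Qed.

Lemma nrm_cut w: pos w -> nrm (hcut w) <= 1 /\ nrm (lcut w) <= 1.
move=> pw;have [[_ _ [pl pl1]] [pk pk1 _] _ _ _]:=cutP pw.
by split;apply: pos_nrm => //;rewrite rc1 scale1r.
Qed.

Lemma cut_mull0 w y: pos w -> w * y = 0 -> lcut w * y = 0 /\ hcut w * y = 0.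
move=> pw wy;have [_ _ [kl _ _] [_ gv] _]:=cutP pw.
have l0: lcut w * y = 0 by rewrite -gv -mulrA -scalerAl wy scaler0 mulr0.
by rewrite -kl -mulrA l0 mulr0.
Qed.

Lemma cut_mulr0 w y: pos w -> y * w = 0 -> y * lcut w = 0 /\ y * hcut w = 0.
move=> pw yw;have [[sl sk _] _ _ _ _]:=cutP pw.
have [h1 h2]: lcut w * adj y = 0 /\ hcut w * adj y = 0.
 by apply: cut_mull0;rewrite // -[w]pos_sa // -adjM yw adj0.
by split;rewrite -[LHS]adjK adjM ?sl ?sk ?h1 ?h2 adj0.
Qed.

End Cut.

(** * C*-algebras that may lack a unit, with a real-valued norm *)

Section StarOps.
Variables (R: realType) (A: cstarAlgType R).
Implicit Types (x y z: A) (k: Cplx R).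

Lemma cmulDl x y z: (x + y) ** z = x ** z + y ** z.
by have:=cmul_linearl 1 x y z;rewrite !scale1r. Qed.
Lemma cmulDr x y z: x ** (y + z) = x ** y + x ** z.
by have:=cmul_linearr 1 y z x;rewrite !scale1r. Qed.
Lemma cmul0l x: 0 ** x = 0.
by apply: (addrI (0 ** x));rewrite -cmulDl !addr0. Qed.
Lemma cmul0r x: x ** 0 = 0.
by apply: (addrI (x ** 0));rewrite -cmulDr !addr0. Qed.
Lemma cmulZl k x y: (k *: x) ** y = k *: (x ** y).
by have:=cmul_linearl k x 0 y;rewrite !addr0 cmul0l addr0. Qed.
Lemma cmulZr k x y: x ** (k *: y) = k *: (x ** y).
by have:=cmul_linearr k y 0 x;rewrite !addr0 cmul0r addr0. Qed.
Lemma starD x y: star (x + y) = star x + star y.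
by have:=star_antilinear 1 x y;rewrite conjC1 !scale1r. Qed.
Lemma star0: star (0: A) = 0.
by apply: (addrI (star 0));rewrite -starD !addr0. Qed.
Lemma starZ k x: star (k *: x) = Num.conj k *: star x.
by have:=star_antilinear k x 0;rewrite !addr0 star0 addr0. Qed.
Lemma cmulNl x y: (- x) ** y = - (x ** y).
by rewrite -scaleN1r cmulZl scaleN1r. Qed.
Lemma cmulNr x y: x ** (- y) = - (x ** y).
by rewrite -scaleN1r cmulZr scaleN1r. Qed.

Definition nA x: R:=complex.Re (`|x| : R[i]).

Lemma nAE x: `|x| = rc (nA x).
by rewrite /nA /rc -[LHS]RRe_real ?ger0_real ?normr_ge0. Qed.
Lemma nAge0 x: 0 <= nA x.
by rewrite -rc_le -nAE normr_ge0. Qed.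
Lemma nA_eq0 x: nA x = 0 -> x = 0.
by move=> h;apply/eqP;rewrite -normr_eq0 nAE h. Qed.
Lemma nA_gt0 x: x != 0 -> 0 < nA x.
by move=> x0;rewrite lt_def nAge0 andbT;apply: contra_neq x0 => /nA_eq0. Qed.
Lemma nA0: nA 0 = 0. Proof. by rewrite /nA normr0. Qed.
Lemma nAD x y: nA (x + y) <= nA x + nA y.
by rewrite -rc_le rcD -!nAE ler_normD. Qed.
Lemma nAZ k x: nA (k *: x) = absC k * nA x.
by apply: rc_inj;rewrite rcM -!nAE -rcE normrZ. Qed.
Lemma nAM x y: nA (x ** y) <= nA x * nA y.
by rewrite -rc_le rcM -!nAE normr_cmul. Qed.
Lemma nA_cstar x: nA (star x ** x) = nA x ^+ 2.
by apply: rc_inj;rewrite rcX -!nAE normr_cstar. Qed.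
Lemma nAN x: nA (- x) = nA x. Proof. by rewrite /nA normrN. Qed.
Lemma nA_star x: nA (star x) = nA x.
have h y: nA y <= nA (star y).
 have [->|y0]:=eqVneq y 0;first by rewrite star0.
 rewrite -(ler_pM2r (nA_gt0 y0)) -expr2 -nA_cstar;exact: nAM.
by apply/eqP;rewrite eq_le h -{2}(starK x) h.
Qed.

Lemma cplx_pos (e: Cplx R): 0 < e -> exists2 r: R, 0 < r & e = rc r.
move=> e0;have er: e = rc (complex.Re e) by rewrite -[LHS]RRe_real // gtr0_real.
by exists (complex.Re e) => //;rewrite -rc_lt -er.
Qed.

Lemma cvg_nAP (u: nat -> A) l: u @ \oo --> l <->
 nlim nA u l.
split=> [/cvgrPdist_lt h e e0|h].
 have /h[N _ HN]: 0 < rc e by rewrite -rc0 rc_lt.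
 by exists N => n /HN /=;rewrite distrC nAE rc_lt.
apply/cvgrPdist_lt => e /cplx_pos[r r0 ->];have [N H]:=h _ r0.
by exists N => // n /= /H;rewrite distrC nAE rc_lt.
Qed.

Lemma nA_complete: ncomplete nA.
move=> u h;have [|l hl]:=@norm_complete _ A u.
 by move=> e /cplx_pos[r r0 ->];have [N H]:=h _ r0;exists N => m n /H{}H /H;rewrite nAE rc_lt.
by exists l;apply/cvg_nAP/cvgrPdist_lt => e /hl[N H];exists N => // n /H;rewrite distrC.
Qed.

End StarOps.

Lemma absC_complete (R: realType): ncomplete (@absC R).
move=> k h;have part (f: Cplx R -> R): (forall x y, `|f x - f y| <= absC (x - y)) ->
 exists l, nlim (fun x: R => `|x|) (fun n => f (k n)) l.
 move=> hf;apply: (@norm_complete R R^o) => e /h[N H];exists N => m n Nm Nn.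
 by apply: le_lt_trans (hf _ _) (H _ _ Nm Nn).
have [|a ha]:=part (@complex.Re R).
 by move=> [a b] [c d];rewrite /absC normc_def /= -sqrtr_sqr ler_wsqrtr // lerDl sqr_ge0.
have [|b hb]:=part (@complex.Im R).
 by move=> [? b] [c d];rewrite /absC normc_def /= -sqrtr_sqr ler_wsqrtr // lerDr sqr_ge0.
exists (rc a + 'i * rc b) => e e0;have e2: 0 < e / 2 by lra.
have [N1 H1]:=ha _ e2;have [N2 H2]:=hb _ e2;exists (maxn N1 N2) => n.
rewrite geq_max => /andP[/H1 h1 /H2 h2].
have -> : k n - (rc a + 'i * rc b) = rc (complex.Re (k n) - a) + 'i * rc (complex.Im (k n) - b).
 have ek: k n = rc (complex.Re (k n)) + 'i * rc (complex.Im (k n)) by rewrite [LHS]complexE.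
 by rewrite {1}ek !rcB;ring.
apply: le_lt_trans (absCD _ _) _;rewrite absCM !absC_rc.
have -> : absC ('i: Cplx R) = 1 by rewrite /absC normCi.
lra.
Qed.

(** * The unitization as a unital C*-algebra *)

Section Unitz.
Variables (R: realType) (A: cstarAlgType R).

Definition unitz: Type:=(A * (Cplx R)^o)%type.
HB.instance Definition _:=GRing.Lmodule.copy unitz (A * (Cplx R)^o)%type.

Implicit Types (x y z: unitz).

Definition uz_mul x y: unitz:=(x.1 ** y.1 + y.2 *: x.1 + x.2 *: y.1, x.2 * y.2).
Definition uz_one: unitz:=(0, 1).

Lemma uz_mulA: associative uz_mul.
move=> [a k] [b l] [c m];rewrite /uz_mul /=;congr pair;last by rewrite mulrA.
rewrite !(cmulDl, cmulDr, cmulZl, cmulZr, scalerDr, scalerA) cmulA.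
rewrite -!addrA;congr (_ + _);rewrite [m * l]mulrC.
rewrite !addrA [X in _ = X + _]addrC !addrA;congr (_ + _).
by rewrite [LHS](ACl (5*2*4*1*3)) [m * k]mulrC.
Qed.
Lemma uz_mul1l: left_id uz_one uz_mul.
by move=> [a k];rewrite /uz_mul /= cmul0l scaler0 scale1r !add0r mul1r. Qed.
Lemma uz_mul1r: right_id uz_one uz_mul.
by move=> [a k];rewrite /uz_mul /= cmul0r scaler0 scale1r add0r addr0 mulr1. Qed.
Lemma uz_mulDl: left_distributive uz_mul +%R.
move=> [a k] [b l] [c m];rewrite /uz_mul /=;congr pair;last by rewrite mulrDl.
by rewrite cmulDl !scalerDr scalerDl /= [RHS](AC (3*3) ((1*4)*(2*5)*(3*6))).
Qed.
Lemma uz_mulDr: right_distributive uz_mul +%R.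
move=> [a k] [b l] [c m];rewrite /uz_mul /=;congr pair;last by rewrite mulrDr.
by rewrite cmulDr !scalerDr scalerDl /= [RHS](AC (3*3) ((1*4)*(2*5)*(3*6))).
Qed.
Lemma uz_one_neq0: uz_one != 0.
by apply/eqP => -[] /eqP;rewrite oner_eq0. Qed.

HB.instance Definition _:=GRing.Zmodule_isNzRing.Build unitz
 uz_mulA uz_mul1l uz_mul1r uz_mulDl uz_mulDr uz_one_neq0.

Lemma uz_eq x y: x.1 = y.1 -> x.2 = y.2 -> x = y.
by case: x y => [a k] [b l] /= -> ->. Qed.
Lemma uz_mul_1 x y: (x * y).1 = x.1 ** y.1 + y.2 *: x.1 + x.2 *: y.1. Proof. by []. Qed.
Lemma uz_mul_2 x y: (x * y).2 = x.2 * y.2 :> Cplx R. Proof. by []. Qed.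
Lemma uz_scale_1 (k: Cplx R) x: (k *: x).1 = k *: x.1. Proof. by []. Qed.
Lemma uz_scale_2 (k: Cplx R) x: (k *: x).2 = k * x.2 :> Cplx R. Proof. by []. Qed.

Lemma uz_scaleAl (k: Cplx R) x y: k *: (x * y) = (k *: x) * y.
apply: uz_eq;last by rewrite !(uz_mul_2, uz_scale_2) mulrA.
by rewrite !(uz_mul_1, uz_scale_1, uz_scale_2) !scalerDr cmulZl !scalerA [y.2 * k]mulrC.
Qed.
HB.instance Definition _:=GRing.Lmodule_isLalgebra.Build (Cplx R) unitz uz_scaleAl.
Lemma uz_scaleAr (k: Cplx R) x y: k *: (x * y) = x * (k *: y).
apply: uz_eq;last by rewrite !(uz_mul_2, uz_scale_2) mulrCA.
by rewrite !(uz_mul_1, uz_scale_1, uz_scale_2) !scalerDr cmulZr !scalerA [x.2 * k]mulrC.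
Qed.
HB.instance Definition _:=GRing.Lalgebra_isAlgebra.Build (Cplx R) unitz uz_scaleAr.

Definition uz_adj x: unitz:=(star x.1, Num.conj x.2).

Definition uz_act x (d: A): A:=x.1 ** d + x.2 *: d.

Lemma uz_actM x y d: uz_act (x * y) d = uz_act x (uz_act y d).
case: x y => [a k] [b l];rewrite /uz_act /= !cmulDl cmulDr !cmulZl cmulZr cmulA.
by rewrite scalerDr scalerA -!addrA.
Qed.
Lemma uz_actD x y d: uz_act (x + y) d = uz_act x d + uz_act y d.
by rewrite /uz_act /= cmulDl scalerDl addrACA. Qed.
Lemma uz_actZ k x d: uz_act (k *: x) d = k *: uz_act x d.
by rewrite /uz_act /= cmulZl scalerDr scalerA. Qed.
Lemma uz_act_scale k x d: uz_act x (k *: d) = k *: uz_act x d.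
by rewrite /uz_act cmulZr scalerDr !scalerA [k * _]mulrC. Qed.
Lemma uz_act_adj x d: star (uz_act x d) ** uz_act x d = star d ** uz_act (uz_adj x * x) d.
rewrite uz_actM;set e:=uz_act x d.
have -> : star e = star d ** star x.1 + Num.conj x.2 *: star d.
 by rewrite /e /uz_act starD star_cmul starZ.
by rewrite /uz_act /= cmulDl cmulDr cmulZl cmulZr cmulA.
Qed.

Definition uz_nset x :=[set nA (uz_act x d) | d in [set d: A | nA d <= 1]].
Definition opn x: R:=sup (uz_nset x).

Lemma act_bound x d: nA d <= 1 -> nA (uz_act x d) <= nA x.1 + absC x.2.
move=> d1;apply: le_trans (nAD _ _) _;rewrite nAZ;apply: lerD.
 by apply: le_trans (nAM _ _) _;rewrite ler_piMr ?nAge0.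
by rewrite ler_piMr ?abs0.
Qed.

Lemma uz_nset_nonempty x: uz_nset x !=set0.
by exists (nA (uz_act x 0));exists 0 => //=;rewrite nA0. Qed.

Lemma opn_ub x d: nA d <= 1 -> nA (uz_act x d) <= opn x.
move=> d1;apply: ub_le_sup;last by exists d.
by exists (nA x.1 + absC x.2) => _ [e /= e1 <-];apply: act_bound.
Qed.

Lemma opn_le x M: (forall d, nA d <= 1 -> nA (uz_act x d) <= M) -> opn x <= M.
move=> h;apply: ge_sup;first exact: uz_nset_nonempty.
by move=> _ [d /= d1 <-];apply: h.
Qed.

Lemma opn_act x d: nA (uz_act x d) <= opn x * nA d.
have [->|d0]:=eqVneq d 0.
 by rewrite /uz_act cmul0r scaler0 addr0 nA0 mulr0.
have n0:=nA_gt0 d0.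
have:=@opn_ub x (rc (nA d)^-1 *: d);rewrite nAZ absC_rc gtr0_norm ?invr_gt0 //.
rewrite mulVf ?gt_eqF // => /(_ (lexx _)).
by rewrite uz_act_scale nAZ absC_rc gtr0_norm ?invr_gt0 // ler_pdivrMl // mulrC.
Qed.

Lemma opn_ge0 x: 0 <= opn x.
by apply: le_trans (@opn_ub x 0 _);rewrite ?nAge0 // nA0. Qed.

Lemma opnM x y: opn (x * y) <= opn x * opn y.
apply: opn_le => d d1;rewrite uz_actM;apply: le_trans (opn_act _ _) _.
by rewrite ler_wpM2l ?opn_ge0 // opn_ub.
Qed.

Lemma opn_sqr x: opn x ^+ 2 <= opn (uz_adj x * x).
suff h: opn x <= Num.sqrt (opn (uz_adj x * x)).
 rewrite -[X in _ <= X]sqr_sqrtr ?opn_ge0 //.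
 by rewrite lerXn2r // nnegrE ?opn_ge0 ?sqrtr_ge0.
apply: opn_le => d d1;rewrite -(@ler_pXn2r _ 2) ?nnegrE ?nAge0 ?sqrtr_ge0 //.
rewrite sqr_sqrtr ?opn_ge0 // -nA_cstar uz_act_adj.
apply: le_trans (nAM _ _) _;rewrite nA_star.
have:=opn_ub (uz_adj x * x) d1;have:=nAge0 d.
have:=nAge0 (uz_act (uz_adj x * x) d);nra.
Qed.

Lemma uz_adjK x: uz_adj (uz_adj x) = x.
by case: x => a k;rewrite /uz_adj /= starK conjCK. Qed.

Lemma opn_adj x: opn (uz_adj x) = opn x.
have h y: opn y <= opn (uz_adj y).
 have:=le_trans (opn_sqr y) (opnM _ _);have:=opn_ge0 (uz_adj y).
 have:=opn_ge0 y;nra.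
by apply/eqP;rewrite eq_le h -{2}(uz_adjK x) h.
Qed.

(** If [A] has a unit [u], then [(- u, 1)] acts as zero and the operator norm alone is only a
    seminorm. The maximum with the scalar part is a C*-norm in every case, so one unitization serves
    all algebras. *)
Definition uz_nrm x: R:=Num.max (absC x.2) (opn x).

Lemma uz_adjD x y: uz_adj (x + y) = uz_adj x + uz_adj y.
by rewrite /uz_adj /= starD rmorphD. Qed.
Lemma uz_adjZ (k: Cplx R) x: uz_adj (k *: x) = Num.conj k *: uz_adj x.
by rewrite /uz_adj /= starZ rmorphM. Qed.
Lemma uz_adjM x y: uz_adj (x * y) = uz_adj y * uz_adj x.
case: x y => [a k] [b l];congr pair => /=;last by rewrite rmorphM mulrC.
by rewrite !starD star_cmul !starZ addrAC.
Qed.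
(** Up to scaling, the norm is attained at [star a], by the C*-identity. *)
Lemma opn_pair (a: A): opn (a, 0) = nA a.
apply/eqP;rewrite eq_le;apply/andP;split.
 by apply: opn_le => d /(act_bound (a, 0));rewrite absC0 addr0.
have [->|a0]:=eqVneq a 0;first by rewrite nA0 opn_ge0.
rewrite -(ler_pM2r (nA_gt0 a0));apply: le_trans (_: opn (a, 0) * nA (star a) <= _).
 apply: le_trans (opn_act _ _);rewrite /uz_act /= scale0r addr0.
 by rewrite -[a in a ** _]starK nA_cstar nA_star expr2.
by rewrite nA_star.
Qed.
Lemma uz_nrm_eq0 x: uz_nrm x = 0 -> x = 0.
case: x => a k;rewrite /uz_nrm /= => h.
have k0: k = 0.
 by apply: absC_eq0;apply/le_anti;rewrite abs0 andbT -h le_max lexx.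
move: h;rewrite k0 opn_pair => h;congr pair.
by apply: nA_eq0;apply/le_anti;rewrite nAge0 andbT -h le_max lexx orbT.
Qed.
Lemma uz_nrmD x y: uz_nrm (x + y) <= uz_nrm x + uz_nrm y.
rewrite /uz_nrm ge_max;apply/andP;split.
 by apply: le_trans (absCD _ _) _;rewrite lerD // le_max lexx.
apply: opn_le => d d1;rewrite uz_actD;apply: le_trans (nAD _ _) _.
by rewrite lerD // le_max opn_ub ?orbT.
Qed.
Lemma uz_nrmZ k x: uz_nrm (k *: x) = absC k * uz_nrm x.
have h l y: uz_nrm (l *: y) <= absC l * uz_nrm y.
 rewrite /uz_nrm ge_max;apply/andP;split.
 by rewrite absCM ler_wpM2l ?abs0 // le_max lexx.
 apply: opn_le => d d1;rewrite uz_actZ nAZ ler_wpM2l ?abs0 //.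
 by rewrite le_max opn_ub ?orbT.
apply/eqP;rewrite eq_le h /=;have [->|k0]:=eqVneq k 0.
 by rewrite absC0 mul0r /uz_nrm le_max abs0.
have kp: 0 < absC k.
 by rewrite lt_def abs0 andbT;apply: contra_neq k0 => /absC_eq0.
have:=h k^-1 (k *: x);rewrite scalerA mulVf // scale1r.
have -> : absC k^-1 = (absC k)^-1.
 by apply: (mulfI (lt0r_neq0 kp));rewrite -absCM mulfV // absC1 mulfV // gt_eqF.
by rewrite mulrC ler_pdivlMr // mulrC.
Qed.
Lemma uz_nrmM x y: uz_nrm (x * y) <= uz_nrm x * uz_nrm y.
rewrite /uz_nrm ge_max;apply/andP;split.
 by rewrite absCM ler_pM ?abs0 // le_max lexx.
apply: le_trans (opnM _ _) _.
by rewrite ler_pM ?opn_ge0 // le_max lexx orbT.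
Qed.
Lemma uz_nrm_cstar x: uz_nrm (uz_adj x * x) = uz_nrm x ^+ 2.
have e: opn (uz_adj x * x) = opn x ^+ 2.
 apply/eqP;rewrite eq_le opn_sqr andbT expr2.
 by apply: le_trans (opnM _ _) _;rewrite opn_adj.
rewrite /uz_nrm e /= absCM absC_conj -expr2.
have [h|h]:=leP (absC x.2) (opn x).
 by rewrite max_r // lerXn2r // nnegrE ?abs0 ?opn_ge0.
by rewrite max_l // lerXn2r // ?nnegrE ?abs0 ?opn_ge0 // ltW.
Qed.
Lemma uz_nrm_complete: ncomplete uz_nrm.
move=> u h;have n2 x: absC x.2 <= uz_nrm x by rewrite le_max lexx.
have n1 x: nA x.1 <= uz_nrm x + absC x.2.
 rewrite -opn_pair;have -> : (x.1, 0) = x + - (0, x.2) :> unitz.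
 by case: x => a k;congr pair => /=;rewrite ?subr0 ?subrr.
 have:=@uz_nrmD x (- (0, x.2));rewrite {1}/uz_nrm ge_max => /andP[_ /le_trans];apply.
 rewrite lerD2l -scaleN1r uz_nrmZ absCN absC1 mul1r /uz_nrm ge_max lexx /=.
 by apply: opn_le => d /(act_bound (0, x.2));rewrite nA0 add0r.
have nx x: uz_nrm x <= nA x.1 + absC x.2.
 rewrite /uz_nrm ge_max;apply/andP;split;first by rewrite ler_wpDl ?nAge0.
 by apply: opn_le => d;apply: act_bound.
have [k hk]: exists l, nlim (@absC R) (fun n => (u n).2) l.
 apply: absC_complete => e /h[N H];exists N => m n Nm Nn.
 exact: le_lt_trans (n2 (u m - u n)) (H _ _ Nm Nn).
have [a ha]: exists l, nlim (@nA R A) (fun n => (u n).1) l.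
 apply: nA_complete => e e0;have e2: 0 < e / 2 by lra.
 have [N H]:=h _ e2;exists N => m n Nm Nn.
 have:=n1 (u m - u n);have:=n2 (u m - u n);have:=H _ _ Nm Nn => /=;lra.
exists (a, k) => e e0;have e2: 0 < e / 2 by lra.
have [N1 H1]:=ha _ e2;have [N2 H2]:=hk _ e2;exists (maxn N1 N2) => n.
rewrite geq_max => /andP[/H1 h1 /H2 h2];have:=nx (u n - (a, k)) => /=;lra.
Qed.

HB.instance Definition _:=@isUCStar.Build R unitz uz_adj uz_nrm uz_adjD uz_adjZ uz_adjM
 uz_adjK uz_nrm_eq0 uz_nrmD uz_nrmZ uz_nrmM uz_nrm_cstar uz_nrm_complete.

Definition ui (a: A): unitz:=(a, 0).

Lemma uiD a b: ui (a + b) = ui a + ui b.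
by congr pair;rewrite /= addr0. Qed.
Lemma uiN a: ui (- a) = - ui a.
by congr pair;rewrite /= oppr0. Qed.
Lemma uiB a b: ui (a - b) = ui a - ui b.
by rewrite uiD uiN. Qed.
Lemma uiZ k a: ui (k *: a) = k *: ui a.
by congr pair;rewrite /= scaler0. Qed.
Lemma ui0: ui 0 = 0. Proof. by []. Qed.
Lemma uiM a b: ui (a ** b) = ui a * ui b.
by congr pair;rewrite /= ?mulr0 // !scale0r !addr0. Qed.
Lemma ui_adj a: ui (star a) = adj (ui a).
by congr pair;rewrite /= conjC0. Qed.
Lemma ui_nrm a: nrm (ui a) = nA a.
by change (uz_nrm (ui a) = nA a);rewrite /uz_nrm /= absC0 opn_pair max_r ?nAge0. Qed.
Lemma ui_inj: injective ui. Proof. by move=> a b []. Qed.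
Lemma ui_mulr a x: ui a * x = ui (a ** x.1 + x.2 *: a).
by congr pair => /=;rewrite ?mul0r // scale0r addr0. Qed.
Lemma ui_mull a x: x * ui a = ui (x.1 ** a + x.2 *: a).
by congr pair => /=;rewrite ?mulr0 // scale0r addr0. Qed.
Lemma ui_sum (I: Type) (s: seq I) P (F: I -> A) :
 ui (\sum_(i <- s | P i) F i) = \sum_(i <- s | P i) ui (F i).
exact: (big_morph _ uiD ui0). Qed.

End Unitz.

Arguments ui {R A} a.

(** * Products of two nilpotents in an arbitrary ring *)

Lemma sum_pick (V: nmodType) (m a: nat) (F: nat -> V): (a < m)%N ->
 (forall i, (i < m)%N -> i != a -> F i = 0) -> \sum_(i < m) F i = F a.
move=> am h;rewrite (bigD1 (Ordinal am)) //= big1 ?addr0 // => i ia.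
by apply: h => //;apply: contra_neq ia => e;apply/val_inj.
Qed.

Definition raising (Q: pzRingType) n (p X: nat -> Q) :=\sum_(i < n.-1) p i.+1 * X i.
Definition lowering (Q: pzRingType) n (q Z: nat -> Q) :=\sum_(i < n.-1) Z i * q i.+1.

(** [X a] on the left of the sum leaves only the term ending in [X a.-1], and none for [a = 0]; so
    [X a] kills the power [a.+1]. *)
Lemma raising_nil (Q: pzRingType) n (p X: nat -> Q): (0 < n)%N ->
 (forall i j, (i < n)%N -> (j < n)%N -> i != j -> X i * p j = 0) ->
 raising n p X ^+ n = 0.
move=> n0 Xp;set N:=raising n p X.
have XN a: (a < n)%N -> X a * N ^+ a.+1 = 0.
 elim: a => [|a IH] an;rewrite exprS mulrA mulr_sumr.
 rewrite big1 ?mul0r // => i _;rewrite mulrA Xp ?mul0r //.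
 by have:=ltn_ord i;lia.
 rewrite (@sum_pick _ n.-1 a (fun i => X a.+1 * (p i.+1 * X i)));first last.
- by move=> i im ia;rewrite mulrA Xp ?mul0r //;lia.
- by lia.
 by rewrite -!mulrA IH ?mulr0 //;lia.
rewrite -(prednK n0) exprS {1}/N /raising mulr_suml big1 // => i _.
have im: (i < n.-1)%N:=ltn_ord i.
rewrite -mulrA -[in X in _ * (_ * X)](subnKC im) exprD [X i * (_ * _)]mulrA XN ?mul0r ?mulr0 //.
by lia.
Qed.

(** In the opposite ring this is the statement on [raising]. *)
Lemma lowering_nil (Q: pzRingType) n (q Z: nat -> Q): (0 < n)%N ->
 (forall i j, (i < n)%N -> (j < n)%N -> i != j -> q j * Z i = 0) ->
 lowering n q Z ^+ n = 0.
by move=> n0 h;have:=@raising_nil Q^c n q Z n0 h;rewrite revrX. Qed.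

Section Nilpotent.
Variables (Q: pzRingType) (n: nat).
Variables (k: nat) (p q X Z A B: nat -> Q) (E c C D x t tb: Q).
Hypotheses (n_gt0: (0 < n)%N) (kn: (k * 2 <= n)%N).

Let g:=q 0%N * p 0%N.
Let y l:=X (n.-1 + l)%N.
Let w l:=Z (n.-1 + l)%N.
Hypothesis qp: forall i j, (i < n)%N -> (j < n)%N -> q i * p j = if i == j then g else 0.
Hypothesis gX: forall i, g * X i = X i.
Hypothesis Xp: forall i j, (i < n)%N -> (j < n)%N -> i != j -> X i * p j = 0.
Hypothesis qZ: forall i j, (i < n)%N -> (j < n)%N -> i != j -> q j * Z i = 0.

Definition bcent f:=forall i, [/\ f * p i = p i * f, f * q i = q i * f,
 f * X i = X i * f & f * Z i = Z i * f].

Lemma comm_mull (u v s: Q): u * s = s * u -> v * s = s * v -> u * v * s = s * (u * v).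
by move=> us vs;rewrite -mulrA vs mulrA us mulrA. Qed.

Lemma bcentM f f': bcent f -> bcent f' -> bcent (f * f').
by move=> h h' i;have [????]:=h i;have [????]:=h' i;split;apply: comm_mull. Qed.

Hypotheses (cC: bcent C) (cD: bcent D) (cx: bcent (x * C ^+ 3)).
Hypotheses (cA: forall i, (i < k)%N -> bcent (A i)) (cB: forall i, (i < k)%N -> bcent (B i)).
Hypotheses (C_D: C * D = 0) (D_C: D * C = 0) (C_t: C * t = 0) (c_D: c * D = 0)
 (c_t: c * t = 0) (tb_C: tb * C = 0) (D_t: D * t = 0) (tb_D: tb * D = 0)
 (D_x: D * x = 0) (tb_x: tb * x = 0).
Hypotheses (CE: C = E * c) (cE: E * c = c * E) (tbt: tb * t = 1 - E).
Hypothesis unity: C * (\sum_(i < n.+1) Z i * X i) = C.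

Let slot i l:=(i * 2 + l)%N.
(** The product of the two shifts gives [C ^+ 6] times the terms [i < n.-1] of the unity. Its last
    two terms are carried by [T1' * T1] through [k * 2] orthogonal slots inside [D], provided the
    sum of the [A i * (D * D) * B i] is close to [C ^+ 4]. Finally [T2' * T2] completes [C ^+ 6] to
    [c ^+ 6], because [tb * t = 1 - E] and the powers of [E] telescope. *)
Let T1 :=\sum_(i < k) \sum_(l < 2) D * p (slot i l) * B i * y l * C.
Let T1' :=\sum_(i < k) \sum_(l < 2) C * w l * A i * q (slot i l) * D.
Let T2:=t * c ^+ 3.
Let T2':=c ^+ 3 * (\sum_(i < 6) E ^+ i) * tb.
Definition nilp_right:=raising n p X * C ^+ 3 + (T1 + T2).
Definition nilp_left:=C ^+ 3 * lowering n q Z + (T1' + T2').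

Let slot_lt i l: (i < k)%N -> (l < 2)%N -> (slot i l < n)%N.
by rewrite /slot;lia. Qed.

Let raise_C f: bcent f -> f * raising n p X = raising n p X * f.
move=> h;rewrite mulr_sumr mulr_suml;apply: eq_bigr => i _.
by have [e _ _ _]:=h i.+1;have [_ _ e' _]:=h i;rewrite mulrA e -!mulrA e'.
Qed.
Let lower_C f: bcent f -> f * lowering n q Z = lowering n q Z * f.
move=> h;rewrite mulr_sumr mulr_suml;apply: eq_bigr => i _.
by have [_ e _ _]:=h i.+1;have [_ _ _ e']:=h i;rewrite mulrA e' -!mulrA e.
Qed.
Let C3: bcent (C ^+ 3).
by rewrite !exprS expr0 mulr1;do 2?apply: bcentM. Qed.
Let lower_raise: lowering n q Z * raising n p X = \sum_(i < n.-1) Z i * X i.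
rewrite mulr_suml;apply: eq_bigr => i _;have ip:=ltn_ord i.
rewrite mulr_sumr (@sum_pick _ n.-1 i (fun j => Z i * q i.+1 * (p j.+1 * X j))) //.
 by rewrite -mulrA (mulrA (q _)) qp ?eqxx ?gX //;lia.
move=> j jn ji;rewrite -mulrA (mulrA (q _)) qp;[|lia|lia].
by rewrite eqSS eq_sym (negbTE ji) mul0r mulr0.
Qed.

Let T1_T1: T1' * T1 = C * (\sum_(i < k) A i * (D * D) * B i) *
 (\sum_(l < 2) w l * y l) * C.
have e (i l i' l': nat): (i < k)%N -> (l < 2)%N -> (i' < k)%N -> (l' < 2)%N ->
 C * w l * A i * q (slot i l) * D * (D * p (slot i' l') * B i' * y l' * C) =
 if slot i l == slot i' l' then C * (A i * (D * D) * B i') * (w l * y l') * C else 0.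
 move=> ik lL ik' lL';have s1:=slot_lt ik lL;have s2:=slot_lt ik' lL'.
 have -> : C * w l * A i * q (slot i l) * D * (D * p (slot i' l') * B i' * y l' * C) =
 C * w l * A i * (q (slot i l) * ((D * D) * p (slot i' l'))) * B i' * y l' * C.
 by rewrite !mulrA.
 have [DDp _ _ _]:=bcentM cD cD (slot i' l');have [_ DDq _ _]:=bcentM cD cD (slot i l).
 rewrite (mulrA (q _)) -DDq -(mulrA _ (q _)) qp //;case: eqP => _;last by rewrite !(mulr0, mul0r).
 have [Bp Bq _ _]:=cB ik' 0%N.
 have gB: g * B i' = B i' * g by rewrite /g -mulrA -Bp mulrA -Bq mulrA.
 have [_ _ _ wA]:=bcentM (bcentM (cA ik) (bcentM cD cD)) (cB ik') (n.-1 + l).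
 have -> : C * w l * A i * (D * D * g) * B i' * y l' * C =
 C * (w l * (A i * (D * D) * (g * B i'))) * y l' * C by rewrite !mulrA.
 rewrite gB (mulrA _ (B i') g) (mulrA (w l)) -wA -(mulrA C _ (y l')).
 by rewrite -(mulrA _ g (y l')) gX // !mulrA.
transitivity (\sum_(i < k) \sum_(l < 2) C * (A i * (D * D) * B i) * (w l * y l) * C).
 rewrite /T1' mulr_suml;apply: eq_bigr => i _;rewrite mulr_suml.
 apply: eq_bigr => l _;rewrite /T1 mulr_sumr (bigD1 i) //= [X in _ + X]big1 ?addr0 => [|j ji].
 rewrite mulr_sumr (bigD1 l) //= big1 ?addr0 => [|j ji];first by rewrite e ?eqxx.
 rewrite e //;case: eqP => // h;case/eqP: ji;exact/val_inj/(addnI (esym h)).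
 rewrite mulr_sumr big1 // => l' _;rewrite e //;case: eqP => // h.
 case/eqP: ji;apply: val_inj;move: h (ltn_ord l) (ltn_ord l');rewrite /slot /=;lia.
rewrite [C * (\sum_(i < k) _)]mulr_sumr mulr_suml mulr_suml;apply: eq_bigr => i _.
by rewrite mulr_sumr mulr_suml.
Qed.

Let C_T: C * (T1 + T2) = 0.
rewrite mulrDr /T2 mulrA C_t mul0r addr0 mulr_sumr big1 // => i _.
by rewrite mulr_sumr big1 // => l _;rewrite -!mulrA (mulrA C) C_D mul0r.
Qed.
Let c_T: c * (T1 + T2) = 0.
rewrite mulrDr /T2 mulrA c_t mul0r addr0 mulr_sumr big1 // => i _.
by rewrite mulr_sumr big1 // => l _;rewrite -!mulrA (mulrA c) c_D mul0r.
Qed.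

Let raise_T: C ^+ 3 * lowering n q Z * (T1 + T2) = 0.
by rewrite lower_C // exprSr -!mulrA C_T !mulr0. Qed.

Let T_raise: (T1' + T2') * (raising n p X * C ^+ 3) = 0.
have DC3 f: f * D * C ^+ 3 = 0 by rewrite !exprS expr0 mulr1 -!mulrA (mulrA D C) D_C !(mul0r, mulr0).
have tC3 f: f * tb * C ^+ 3 = 0 by rewrite !exprS expr0 mulr1 -!mulrA (mulrA tb C) tb_C !(mul0r, mulr0).
rewrite -raise_C // mulrA mulrDl tC3 addr0 [X in X * _ = _](_: _ = 0) ?mul0r //.
rewrite /T1' mulr_suml big1 // => i _.
by rewrite mulr_suml big1 // => l _;rewrite DC3.
Qed.

Let T1_T2: T1' * T2 = 0.
rewrite /T1' mulr_suml big1 // => i _;rewrite mulr_suml big1 // => l _.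
by rewrite /T2 -!mulrA !(mulrA D t) D_t !(mul0r, mulr0).
Qed.
Let T2_T1: T2' * T1 = 0.
rewrite /T1 mulr_sumr big1 // => i _;rewrite mulr_sumr big1 // => l _.
by rewrite /T2' -!mulrA !(mulrA tb D) tb_D !(mul0r, mulr0).
Qed.

Lemma nilp_left_right: nilp_left * nilp_right = c ^+ 6 +
 C * (\sum_(i < k) A i * (D * D) * B i - C ^+ 4) * (\sum_(l < 2) Z (n.-1 + l)%N * X (n.-1 + l)%N) * C.
have Ec m: E ^+ m * c = c * E ^+ m.
 elim: m => [|m IH];first by rewrite expr0 mul1r mulr1.
 by rewrite exprSr -mulrA cE mulrA IH -mulrA.
have C6: C ^+ 6 = c ^+ 6 * E ^+ 6.
 rewrite CE;elim: (6%N) => [|m IH];first by rewrite !expr0 mulr1.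
 by rewrite exprSr IH mulrA -(mulrA (c ^+ m)) -exprSr -mulrA Ec mulrA -exprSr.
have eT2: T2' * T2 = c ^+ 6 - c ^+ 6 * E ^+ 6.
 rewrite /T2 /T2' mulrA -(mulrA _ tb t) tbt;set G :=\sum_(i < 6) _.
 have GE: G * (1 - E) = 1 - E ^+ 6.
 by rewrite /G !big_ord_recr big_ord0 /= !exprS !expr0;nc_ring.
 rewrite -(mulrA _ G) GE mulrBr mulr1 mulrBl -(mulrA _ (E ^+ 6)).
 have c3: E ^+ 6 * c ^+ 3 = c ^+ 3 * E ^+ 6.
 by apply: commrX;apply: Ec.
 by rewrite c3 mulrA -!exprD.
rewrite /nilp_left /nilp_right mulrDl mulrDr raise_T addr0 mulrDr T_raise add0r.
rewrite (mulrDl T1') (mulrDr T1') (mulrDr T2') T1_T2 T2_T1 addr0 add0r eT2 T1_T1.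
have -> : C ^+ 3 * lowering n q Z * (raising n p X * C ^+ 3) =
 C ^+ 6 * (\sum_(i < n.-1) Z i * X i).
 rewrite -raise_C // -mulrA [lowering _ _ _ * (_ * _)]mulrA -lower_C // -mulrA lower_raise.
 by rewrite mulrA -exprD.
set S :=\sum_(i < n.-1) _;set Th :=\sum_(i < k) _;set W :=\sum_(l < 2) _.
have WC: W * C = C * W.
 rewrite mulr_suml mulr_sumr;apply: eq_bigr => l _.
 by have [_ _ e1 e2]:=cC (n.-1 + l)%N;rewrite -mulrA -e1 !mulrA e2.
have eS: \sum_(i < n.+1) Z i * X i = S + W.
 by rewrite -[in LHS](prednK n_gt0) 2!big_ord_recr /W big_ord_recl big_ord1 /= /w /y addn0 addn1 addrA.
have e6: C ^+ 6 * S + C ^+ 6 * W = C ^+ 6 by rewrite -mulrDr exprSr -mulrA -eS unity.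
have -> : C * (Th - C ^+ 4) * W * C = C * Th * W * C - C ^+ 6 * W.
 rewrite mulrBr !mulrBl;congr (_ - _).
 by rewrite -mulrA WC mulrA -exprS -exprSr.
have -> : C ^+ 6 * S = C ^+ 6 - C ^+ 6 * W by apply/eqP;rewrite eq_sym subr_eq e6.
by rewrite C6;nc_ring.
Qed.

(** All of [V] kills [T1 + T2] from the left, so a power of [V] is [V] times a power of [S], and [S]
    is nilpotent because [C] commutes with the shift. *)
Lemma nilp_right_nil: nilp_right ^+ n.+1 = 0.
set N:=raising n p X;set V:=nilp_right;set S:=N * C ^+ 3.
have VT: V * (T1 + T2) = 0.
 have e1: S * (T1 + T2) = 0 by rewrite /S exprSr -!mulrA C_T !mulr0.
 have e2: T2 * (T1 + T2) = 0 by rewrite {1}/T2 exprSr -!mulrA c_T !mulr0.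
 have e3: T1 * (T1 + T2) = 0.
 rewrite {1}/T1 mulr_suml big1 // => i _;rewrite mulr_suml big1 // => l _.
 by rewrite -!mulrA C_T !mulr0.
 by rewrite /V /nilp_right mulrDl -/N -/S e1 add0r mulrDl e3 e2 addr0.
have VV: V * V = V * S by rewrite {2}/V /nilp_right mulrDr VT addr0.
have Vm m: V ^+ m.+1 = V * S ^+ m.
 elim: m => [|m IH];first by rewrite expr1 expr0 mulr1.
 by rewrite exprS IH mulrA VV -mulrA -exprS.
rewrite Vm /S exprMn_comm;last by apply/commr_sym;apply: raise_C.
by rewrite raising_nil // mul0r mulr0.
Qed.

Lemma nilp_left_nil: (x * nilp_left) ^+ n.+1 = 0.
set M:=lowering n q Z;set V:=nilp_left;set S:=x * C ^+ 3 * M.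
have Tx: (T1' + T2') * x = 0.
 rewrite mulrDl /T2' -!mulrA tb_x !mulr0 addr0 mulr_suml big1 // => i _.
 by rewrite mulr_suml big1 // => l _;rewrite -!mulrA D_x !mulr0.
have xV: x * V = S + x * (T1' + T2') by rewrite /V /nilp_left mulrDr /S !mulrA.
have VV: (x * V) * (x * V) = S * (x * V).
 rewrite {1}xV mulrDl [X in _ + X](_: _ = 0) ?addr0 //.
 by rewrite -(mulrA x) (mulrA _ x) Tx mul0r mulr0.
have Vm m: (x * V) ^+ m.+1 = S ^+ m * (x * V).
 elim: m => [|m IH];first by rewrite expr1 expr0 mul1r.
 by rewrite exprSr IH -mulrA VV mulrA -exprSr.
rewrite Vm /S exprMn_comm;last exact: lower_C.
by rewrite lowering_nil // mulr0 mul0r.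
Qed.

End Nilpotent.

(** * Bounded sequences modulo null sequences *)

Section Asymptotic.
Variables (R: realType) (U: ucsType R).
Implicit Types (u v: nat -> U).

Definition bdd u:=exists M: R, forall n, nrm (u n) <= M.
Definition bseq :={u: nat -> U | `[<bdd u>]}.
HB.instance Definition _:=gen_eqMixin bseq.
HB.instance Definition _:=gen_choiceMixin bseq.

Definition nulseq u:=tends u 0.

Lemma nulseqD u v: nulseq u -> nulseq v -> nulseq (fun n => u n + v n).
by move=> hu hv;have:=tendsD hu hv;rewrite addr0. Qed.
Lemma nulseqN u: nulseq u -> nulseq (fun n => - u n).
by move=> hu;have:=tendsN hu;rewrite oppr0. Qed.
Lemma nulseq0: nulseq (fun=> 0). Proof. exact: tendsC. Qed.
Lemma nulseqMl u v: nulseq u -> bdd v -> nulseq (fun n => u n * v n).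
move=> hu [M hM] e e0;have M1: 0 < `|M| + 1 by rewrite ltr_wpDl.
have [N H]:=hu _ (divr_gt0 e0 M1);exists N => n /H;rewrite !subr0 ltr_pdivlMr // => h.
apply: le_lt_trans (nrmM _ _) _;apply: le_lt_trans h.
rewrite ler_wpM2l ?nrmge0 // (le_trans (hM n)) // (le_trans (ler_norm _)) // lerDl ler01 //.
Qed.
Lemma nulseq_adj u: nulseq u -> nulseq (fun n => adj (u n)).
by move=> hu;have:=tends_adj hu;rewrite adj0. Qed.
Lemma bdd_adj u: bdd u -> bdd (fun n => adj (u n)).
by move=> [M h];exists M => n;rewrite nrm_adj. Qed.
Lemma nulseqMr u v: bdd u -> nulseq v -> nulseq (fun n => u n * v n).
move=> /bdd_adj hu /nulseq_adj hv;have:=nulseq_adj (nulseqMl hv hu).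
by under eq_fun do rewrite adjM !adjK.
Qed.
Lemma bddD u v: bdd u -> bdd v -> bdd (fun n => u n + v n).
by move=> [M hM] [N hN];exists (M + N) => n;rewrite (le_trans (nrmD _ _)) // lerD.
Qed.
Lemma bddN u: bdd u -> bdd (fun n => - u n).
by move=> [M h];exists M => n;rewrite nrmN. Qed.
Lemma bddM u v: bdd u -> bdd v -> bdd (fun n => u n * v n).
by move=> [M hM] [N hN];exists (M * N) => n;apply: nrmM_le.
Qed.
Lemma bddC (a: U): bdd (fun=> a). Proof. by exists (nrm a). Qed.

Definition bseq_equiv (s t: bseq): bool :=`[<nulseq (fun n => sval s n - sval t n)>].

Lemma bseq_equiv_refl: reflexive bseq_equiv.
by move=> s;apply/asboolP;under eq_fun do rewrite subrr;apply: nulseq0. Qed.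
Lemma bseq_equiv_sym: symmetric bseq_equiv.
by move=> s t;apply/asboolP/asboolP => /nulseqN;under eq_fun do rewrite opprB.
Qed.
Lemma bseq_equiv_trans: transitive bseq_equiv.
move=> t s r /asboolP h1 /asboolP h2;apply/asboolP;have:=nulseqD h1 h2.
by under eq_fun do rewrite addrA subrK.
Qed.
Canonical bseq_equiv_rel :=
 EquivRel bseq_equiv bseq_equiv_refl bseq_equiv_sym bseq_equiv_trans.

Definition qasy :={eq_quot bseq_equiv}%qT.
HB.instance Definition _:=EqQuotient.on qasy.
HB.instance Definition _:=Choice.on qasy.

Definition mkbseq u (h: bdd u): bseq:=exist _ u (asboolT h).
Definition piqasy: bseq -> qasy :=\pi%qT.
(** Unbounded sequences go to 0, so that terms carry no proof of boundedness. *)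
Definition toqa u: qasy :=
 if pselect (bdd u) is left h then piqasy (mkbseq h)
 else piqasy (mkbseq (bddC 0)).
Definition ofqa (x: qasy): nat -> U:=sval (repr x).

Lemma ofqa_bdd x: bdd (ofqa x).
by apply/asboolP;exact: (svalP (repr x)). Qed.

Lemma toqa_eq u v: bdd u -> bdd v ->
 toqa u = toqa v <-> nulseq (fun n => u n - v n).
move=> hu hv;rewrite /toqa;case: pselect => // hu';case: pselect => // hv';rewrite /piqasy.
split=> [/eqP|h];first by rewrite piE => /asboolP.
by apply/eqP;rewrite piE;apply/asboolP.
Qed.

Lemma ofqaK x: toqa (ofqa x) = x.
rewrite /toqa;case: pselect => [h|[]];last exact: ofqa_bdd.
rewrite -[RHS]reprK;congr (piqasy _);apply: val_inj => //.
Qed.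

Lemma toqaK u: bdd u -> nulseq (fun n => ofqa (toqa u) n - u n).
by move=> hu;apply/toqa_eq => //;[exact: ofqa_bdd|rewrite ofqaK]. Qed.

Definition qasy_zero:=toqa (fun=> 0).
Definition qasy_one:=toqa (fun=> 1).
Definition qasy_add (x y: qasy):=toqa (fun n => ofqa x n + ofqa y n).
Definition qasy_opp (x: qasy):=toqa (fun n => - ofqa x n).
Definition qasy_mul (x y: qasy):=toqa (fun n => ofqa x n * ofqa y n).

Lemma toqa_add u v: bdd u -> bdd v ->
 qasy_add (toqa u) (toqa v) = toqa (fun n => u n + v n).
move=> hu hv;apply/toqa_eq;try by apply: bddD => //;apply: ofqa_bdd.
have:=nulseqD (toqaK hu) (toqaK hv).
by under eq_fun do rewrite addrACA -opprD.
Qed.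
Lemma toqa_opp u: bdd u -> qasy_opp (toqa u) = toqa (fun n => - u n).
move=> hu;apply/toqa_eq;try by apply: bddN => //;apply: ofqa_bdd.
by have:=nulseqN (toqaK hu);under eq_fun do rewrite opprD.
Qed.
Lemma toqa_mul u v: bdd u -> bdd v ->
 qasy_mul (toqa u) (toqa v) = toqa (fun n => u n * v n).
move=> hu hv;apply/toqa_eq;try by apply: bddM => //;apply: ofqa_bdd.
have:=nulseqD (nulseqMl (toqaK hu) (ofqa_bdd (toqa v))) (nulseqMr hu (toqaK hv)).
by under eq_fun do rewrite mulrBl mulrBr addrA subrK.
Qed.

Lemma qasy_ind (P: qasy -> Prop): (forall u, bdd u -> P (toqa u)) -> forall x, P x.
by move=> h x;rewrite -(ofqaK x);apply/h/ofqa_bdd. Qed.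

Local Opaque qasy_add qasy_mul qasy_opp.

Ltac bdd_solve :=
 by repeat first [assumption|exact: bddC|apply: bddD|apply: bddM|
 apply: bddN].
Ltac qa_intro:=repeat (elim/qasy_ind => ? ?);rewrite /qasy_zero /qasy_one;
 repeat (first [rewrite toqa_opp|rewrite toqa_add|rewrite toqa_mul];try bdd_solve).

Lemma qasy_addA: associative qasy_add.
by qa_intro;congr toqa;apply/funext => n;rewrite addrA. Qed.
Lemma qasy_addC: commutative qasy_add.
by qa_intro;congr toqa;apply/funext => n;rewrite addrC. Qed.
Lemma qasy_add0: left_id qasy_zero qasy_add.
by qa_intro;congr toqa;apply/funext => n;rewrite add0r. Qed.
Lemma qasy_addN: left_inverse qasy_zero qasy_opp qasy_add.
by qa_intro;congr toqa;apply/funext => n;rewrite addNr. Qed.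
HB.instance Definition _:=GRing.isZmodule.Build qasy qasy_addA qasy_addC qasy_add0 qasy_addN.

Lemma qasy_mulA: associative qasy_mul.
by qa_intro;congr toqa;apply/funext => n;rewrite mulrA. Qed.
Lemma qasy_mul1l: left_id qasy_one qasy_mul.
by qa_intro;congr toqa;apply/funext => n;rewrite mul1r. Qed.
Lemma qasy_mul1r: right_id qasy_one qasy_mul.
by qa_intro;congr toqa;apply/funext => n;rewrite mulr1. Qed.
Lemma qasy_mulDl: left_distributive qasy_mul qasy_add.
elim/qasy_ind=> u hu;elim/qasy_ind=> v hv;elim/qasy_ind=> w hw.
rewrite (toqa_add hu hv) !toqa_mul ?toqa_add;try bdd_solve.
by congr toqa;apply/funext => n;rewrite mulrDl.
Qed.
Lemma qasy_mulDr: right_distributive qasy_mul qasy_add.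
elim/qasy_ind=> w hw;elim/qasy_ind=> u hu;elim/qasy_ind=> v hv.
rewrite (toqa_add hu hv) !toqa_mul ?toqa_add;try bdd_solve.
by congr toqa;apply/funext => n;rewrite mulrDr.
Qed.
HB.instance Definition _:=GRing.Zmodule_isPzRing.Build qasy
 qasy_mulA qasy_mul1l qasy_mul1r qasy_mulDl qasy_mulDr.

(* Sealing the quotient behind an opaque proof keeps unification from unfolding it. *)
Record asy_spec:=AsySpec {
 asy: pzRingType;
 toasy: (nat -> U) -> asy;
 ofasy: asy -> nat -> U;
 ofasy_bdd: forall x, bdd (ofasy x);
 toasy_eq: forall u v, bdd u -> bdd v ->
 toasy u = toasy v <-> nulseq (fun n => u n - v n);
 ofasyK: forall x, toasy (ofasy x) = x;
 toasyD: forall u v, bdd u -> bdd v ->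
 toasy (fun n => u n + v n) = toasy u + toasy v;
 toasyN: forall u, bdd u -> toasy (fun n => - u n) = - toasy u;
 toasyM: forall u v, bdd u -> bdd v ->
 toasy (fun n => u n * v n) = toasy u * toasy v;
 toasy0: toasy (fun=> 0) = 0;
 toasy1: toasy (fun=> 1) = 1
}.

Lemma the_asy: asy_spec.
by exists qasy toqa ofqa;[exact: ofqa_bdd|exact: toqa_eq|exact: ofqaK|move=> *;exact/esym/toqa_add|
 move=> *;exact/esym/toqa_opp|move=> *;exact/esym/toqa_mul|by []|by []].
Qed.

End Asymptotic.

Section AsyTheory.
Variables (R: realType) (U: ucsType R).
Implicit Types (u v: nat -> U).
Local Notation asy:=(asy (the_asy U)).
Local Notation toasy:=(@toasy _ _ (the_asy U)).

Lemma toasyB u v: bdd u -> bdd v ->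
 toasy (fun n => u n - v n) = toasy u - toasy v.
by move=> hu hv;rewrite toasyD ?toasyN //;apply: bddN. Qed.
Lemma toasy_eq0 u: bdd u -> toasy u = 0 <-> nulseq u.
move=> hu;rewrite -toasy0 toasy_eq //;last exact: bddC.
by under eq_fun do rewrite subr0.
Qed.
Lemma bdd_sum m (F: nat -> nat -> U): (forall i, bdd (F i)) ->
 bdd (fun n => \sum_(i < m) F i n).
move=> h;elim: m => [|m IH].
 by under eq_fun do rewrite big_ord0;apply: bddC.
by under eq_fun do rewrite big_ord_recr;apply: bddD.
Qed.
Lemma toasy_sum m (F: nat -> nat -> U): (forall i, bdd (F i)) ->
 toasy (fun n => \sum_(i < m) F i n) = \sum_(i < m) toasy (F i).
move=> h;elim: m => [|m IH].
 by under eq_fun do rewrite big_ord0;rewrite big_ord0 toasy0.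
under eq_fun do rewrite big_ord_recr;rewrite /= toasyD ?big_ord_recr ?IH //.
exact: bdd_sum.
Qed.
Lemma bddX u m: bdd u -> bdd (fun n => u n ^+ m).
move=> h;elim: m => [|m IH];first by under eq_fun do rewrite expr0;apply: bddC.
by under eq_fun do rewrite exprS;apply: bddM.
Qed.
Lemma toasyX u m: bdd u -> toasy (fun n => u n ^+ m) = toasy u ^+ m.
move=> h;elim: m => [|m IH];first by under eq_fun do rewrite expr0;rewrite expr0 toasy1.
by under eq_fun do rewrite exprS;rewrite toasyM ?IH ?exprS //;apply: bddX.
Qed.

End AsyTheory.

Notation asyR U:=(asy (the_asy U)).
Arguments toasy {R U a} u.
Arguments ofasy {R U a} x.
Lemma left_right_inverse (Q: pzRingType) (x l r: Q) :
 x * r = 1 -> l * x = 1 -> r * x = 1.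
by move=> xr lx;rewrite -[r]mul1r -lx -(mulrA l) xr mulr1 lx. Qed.

(** * Hereditary subalgebras, their invertibles, and simplicity *)

Section Simplicity.
Variables (R: realType) (A: cstarAlgType R).
Local Notation U:=(unitz A).
Implicit Types (x y z: U) (H: set U).

Definition inA: set U:=range (@ui R A).

Lemma inAE x: inA x <-> x.2 = 0.
split=> [[a _ <-] //|h];exists x.1 => //;case: x h => a k /= ->;by [].
Qed.
Lemma inA_ui a: inA (ui a). Proof. by exists a. Qed.
Lemma inAMl x y: inA x -> inA (x * y).
by case=> a _ <-;rewrite ui_mulr;apply: inA_ui. Qed.
Lemma inAMr x y: inA y -> inA (x * y).
by case=> a _ <-;rewrite ui_mull;apply: inA_ui. Qed.
Lemma inAD x y: inA x -> inA y -> inA (x + y).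
by case=> a _ <- [b _ <-];rewrite -uiD;apply: inA_ui. Qed.
Lemma inAZ k x: inA x -> inA (k *: x).
by case=> a _ <-;rewrite -uiZ;apply: inA_ui. Qed.
Lemma inA0: inA 0. Proof. by rewrite -ui0;apply: inA_ui. Qed.
Lemma inAN x: inA x -> inA (- x).
by rewrite -scaleN1r;apply: inAZ. Qed.
Lemma inA_adj x: inA x -> inA (adj x).
by case=> a _ <-;rewrite -ui_adj;apply: inA_ui. Qed.
Lemma inA_sum m (F: nat -> U): (forall i, (i < m)%N -> inA (F i)) ->
 inA (\sum_(i < m) F i).
by move=> h;apply: (big_ind inA) => //;[exact: inA0|exact: inAD|move=> i _;apply: h]. Qed.
Lemma scalar_part x: absC x.2 <= nrm x.
by change (absC x.2 <= uz_nrm x);rewrite /uz_nrm le_max lexx. Qed.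
Lemma inA_lim u x: (forall n, inA (u n)) -> tends u x -> inA x.
move=> hu ux;apply/inAE/absC_eq0/le_anti;rewrite abs0 andbT.
apply/ler_addgt0Pr => e e0;rewrite add0r;have [N /(_ N (leqnn _)) H]:=ux _ e0.
have:=scalar_part (u N - x);have /inAE uN:=hu N.
rewrite (_: (u N - x).2 = - x.2 :> Cplx R);last by rewrite /= uN sub0r.
by rewrite absCN => h;apply: ltW;apply: le_lt_trans H.
Qed.

(** Hereditary subalgebras in the form in which they are used: [H A H] lies in [H]. The passage from
    the definition by order is [hereditary_mid]. *)
Definition her H :=[/\ H `<=` inA, H 0, forall k x y, H x -> H y -> H (k *: x + y) &
 forall x, H x -> H (adj x)] /\
 [/\ forall u x, (forall n, H (u n)) -> tends u x -> H x,
 forall x y, H x -> H y -> H (x * y) &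
 forall x a y, H x -> inA a -> H y -> H (x * a * y)].

Section Hereditary.
Variable H: set U.
Hypothesis hH: her H.

Lemma her_inA x: H x -> inA x. Proof. by case: hH => [[h _ _ _] _] /h. Qed.
Lemma her0: H 0. Proof. by case: hH => [[]]. Qed.
Lemma herD x y: H x -> H y -> H (x + y).
case: hH => [[_ _ h _] _] hx hy;by rewrite -[x]scale1r;apply: h. Qed.
Lemma herZ k x: H x -> H (k *: x).
case: hH => [[_ h0 h _] _] hx;by rewrite -[_ *: _]addr0;apply: h. Qed.
Lemma herN x: H x -> H (- x).
by rewrite -scaleN1r;apply: herZ. Qed.
Lemma herB x y: H x -> H y -> H (x - y).
by move=> hx hy;apply: herD => //;apply: herN. Qed.
Lemma her_adj x: H x -> H (adj x). Proof. by case: hH => [[_ _ _ h] _];apply: h. Qed.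
Lemma her_lim u x: (forall n, H (u n)) -> tends u x -> H x.
by case: hH => [_ [h _ _]];apply: h. Qed.
Lemma herM x y: H x -> H y -> H (x * y).
by case: hH => [_ [_ h _]];apply: h. Qed.
Lemma her_mid x a y: H x -> inA a -> H y -> H (x * a * y).
by case: hH => [_ [_ _ h]];apply: h. Qed.

(** The unitization of [H] taken inside that of [A]: its unit is the one of [unitz A], even if [H]
    has a unit of its own. *)
Definition her1: set U :=[set x | exists h k, H h /\ x = h + k *: 1].

Lemma her1_H x: H x -> her1 x.
by move=> hx;exists x, 0;rewrite scale0r addr0. Qed.
Lemma her1_scal k: her1 (k *: 1).
by exists 0, k;rewrite add0r;split=> //;apply: her0. Qed.

Lemma her1C: subalg her1.
split.
- by have:=her1_scal 1;rewrite scale1r.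
- move=> _ _ [a [k [ha ->]]] [b [l [hb ->]]];exists (a + b), (k + l).
 by rewrite addrACA scalerDl;split=> //;apply: herD.
- move=> _ _ [a [k [ha ->]]] [b [l [hb ->]]];exists (a * b + l *: a + k *: b), (k * l).
 split;first by apply: herD;[apply: herD;[exact: herM|exact: herZ]|exact: herZ].
 by rewrite mulrDl !mulrDr -!scalerAl -!scalerAr !mulr1 !mul1r scalerA !addrA.
- move=> k _ [a [l [ha ->]]];exists (k *: a), (k * l).
 by rewrite scalerDr scalerA;split=> //;apply: herZ.
- move=> u x hu ux;exists (x - x.2 *: 1), x.2;split;last by rewrite subrK.
 apply: (@her_lim (fun n => u n - (u n).2 *: 1)).
 move=> n;have [a [k [ha e]]]:=hu n;rewrite e.
 have /inAE a2:=her_inA ha.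
 rewrite (_: (a + k *: 1).2 = k :> Cplx R) ?addrK //.
 by change (a.2 + k * 1 = k :> Cplx R);rewrite a2 add0r mulr1.
 apply: tendsB => // e e0;have [N HN]:=ux _ e0;exists N => n /HN h.
 rewrite -scalerBl nrmZ nrm1 mulr1;apply: le_lt_trans h.
 by have:=scalar_part (u n - x).
Qed.

Lemma her1_mul h x: H h -> her1 x -> H (h * x).
move=> Hh [k [c [Hk ->]]];rewrite mulrDr -scalerAr mulr1.
by apply: herD;[apply: herM|apply: herZ].
Qed.

Lemma her_cut d w: 0 < d -> pos w -> H w -> H (lcut d w) /\ H (hcut d w).
move=> d0 pw Hw;have [_ _ [kl lk _] [vg _] _]:=cutP d0 pw.
have [_ _ S]:=high_inv d0 pw;have Sg:=S _ her1C (her1_H Hw).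
have Hl: H (lcut d w) by rewrite -vg;apply: her1_mul => //;exact: herZ.
have [_ cD _ cZ _]:=her1C;split=> //;rewrite -lk;apply: her1_mul => //.
rewrite -[hcut d w](subKr 1);apply: (cD);first by rewrite -[1]scale1r;exact: her1_scal.
by rewrite -scaleN1r;exact: cZ.
Qed.

Definition GLher: set U :=[set x | exists y, [/\ her1 x, her1 y, x * y = 1 & y * x = 1]].

Lemma GLherM x y: GLher x -> GLher y -> GLher (x * y).
have [_ _ cM _ _]:=her1C.
move=> [x' [h1 h2 h3 h4]] [y' [k1 k2 k3 k4]];exists (y' * x');split;try exact: cM.
 by rewrite mulrA -(mulrA x) k3 mulr1 h3.
by rewrite mulrA -(mulrA y') h4 mulr1 k4.
Qed.

Definition GLnear x:=forall eps: R, 0 < eps -> exists2 y, GLher y & nrm (x - y) < eps.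

Lemma GLn_closed x: (forall eps: R, 0 < eps -> exists2 y, GLnear y & nrm (x - y) < eps) ->
 GLnear x.
move=> h e e0;have e2: 0 < e / 2 by lra.
have [y hy xy]:=h _ e2;have [z hz yz]:=hy _ e2;exists z => //.
by have:=nrm_dist x y z;lra.
Qed.

Lemma GLnear_mulr x w: GLher w -> GLnear (x * w) -> GLnear x.
move=> hw hx e e0;have [w' [k1 k2 k3 k4]]:=hw.
have w0: 0 < nrm w' + 1 by rewrite ltr_wpDl ?nrmge0.
have [y hy xy]:=hx _ (divr_gt0 e0 w0);exists (y * w').
 by apply: GLherM => //;exists w.
have -> : x - y * w' = (x * w - y) * w' by rewrite mulrBl -mulrA k3 mulr1.
apply: le_lt_trans (nrmM _ _) _;move: xy;rewrite ltr_pdivlMr // => xy.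
have:=nrmge0 (x * w - y);lra.
Qed.

Lemma GLher_scal r: 0 < r -> GLher (rc r *: 1).
move=> r0;exists (rc r^-1 *: 1);split;try exact: her1_scal.
 by rewrite -scalerAl mul1r rcK.
by rewrite -scalerAl mul1r rcVK.
Qed.

(** A geometric sum inverts [1 - w] up to [1 - w ^+ m], and the latter by the Neumann series. A
    small power instead of a zero one is allowed, since nilpotency will hold only modulo null
    sequences. *)
Lemma nilpotent_shift u m (t: R): H u -> 0 < t -> nrm (u ^+ m) < t ^+ m ->
 GLher (u + rc t *: 1).
move=> hu t0 um;have [c1 cD cM cZ cL]:=her1C;pose w:=rc (- t^-1) *: u.
have hw: her1 w by apply/cZ/her1_H.
have hX k: her1 (w ^+ k) by elim: k => [|k IH];rewrite ?expr0 // exprS;apply: cM.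
pose s :=\sum_(i < m) w ^+ i;have hs: her1 s.
 by rewrite /s;elim/big_ind: _ => [||i _] //;rewrite -(scale0r (1: U));apply: her1_scal.
have hn: nrm (w ^+ m) < 1.
 by rewrite exprZn -rcX nrmR normrX normrN normfV gtr0_norm // exprVn ltr_pdivrMl ?exprn_gt0 // mulr1.
have [y [hy y1 y2]]:=neumann hn c1 (hX m) cD cM cL.
have e: (1 - w) * s = 1 - w ^+ m by rewrite -[LHS]opprK -mulNr opprB -subrX1 opprB.
have e': s * (1 - w) = 1 - w ^+ m.
 rewrite -e mulrBl mulrBr mul1r mulr1 mulr_suml mulr_sumr;congr (_ - _).
 by apply: eq_bigr => i _;rewrite -exprSr exprS.
have -> : u + rc t *: 1 = rc t *: 1 * (1 - w).
 by rewrite -scalerAl mul1r scalerBr /w rcN scaleNr scalerN rcK // opprK addrC.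
apply: (GLherM (GLher_scal t0));exists (s * y);split;[|exact: cM|by rewrite mulrA e|].
 by apply: cD => //;rewrite -scaleN1r;exact: cZ.
by apply: (@left_right_inverse _ _ (y * s));rewrite ?mulrA ?e // -mulrA e'.
Qed.

End Hereditary.

(** The limits of such sums form a closed ideal [J]. Without a unit it is not obvious that [J]
    contains [d], so that [J] is not zero is seen on [star d ** d ** (star d ** d)]. *)
Lemma simple_span (d z: U) (eps: R): simple A -> inA d -> d != 0 -> inA z -> 0 < eps ->
 exists k (a b: nat -> U), [/\ forall i, inA (a i), forall i, inA (b i) &
 nrm (\sum_(i < k) a i * d * b i - z) < eps].
move=> sA [d' _ <-] d0 [z' _ <-] e0;move: d' z' d0 => {d z} d z d0.
pose S (s: seq (A * A)) :=\sum_(p <- s) p.1 ** d ** p.2.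
pose J :=[set z: A | forall eps: R, 0 < eps -> exists s, nA (S s - z) < eps].
have Jm a b: J (a ** d ** b) by move=> e e1;exists [:: (a, b)];rewrite /S big_seq1 subrr nA0.
have maps (f: A -> A) (M: R): 0 <= M -> (forall y: A, nA (f y) <= M * nA y) -> (forall a b: A, f (a - b) = f a - f b) ->
 (forall a b: A, exists p, f (a ** d ** b) = p.1 ** d ** p.2) -> forall x: A, J x -> J (f x).
 move=> M0 fM fB fs x Jx e e1;have M1: 0 < M + 1 by lra.
 have [s h]:=Jx _ (divr_gt0 e1 M1).
 have fD (a b: A): f (a + b) = f a + f b by have:=fB (a + b) b;rewrite addrK => ->;rewrite subrK.
 have [s' h']: exists s', f (S s) = S s'.
 elim: s {h} => [|[a b] s [s' IH]];first by exists [::];have:=fB 0 0;rewrite /S !big_nil !subrr.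
 by have [p pE]:=fs a b;exists (p :: s');rewrite /S !big_cons fD IH pE.
 exists s';rewrite -h' -fB;apply: le_lt_trans (fM _) _;move: h;rewrite ltr_pdivlMr //.
 by have:=nAge0 (S s - x);nra.
have Jid: is_ideal J.
 split=> [|y x Jx];first split=> [e e1|k x y Jx Jy e e1].
- by exists [::];rewrite /S big_nil subr0 nA0.
- have Jk: J (k *: x).
 apply: (maps (fun y: A => k *: y) (absC k)) Jx => [|w|a b|a b];[exact: abs0|by rewrite nAZ|exact: scalerBr|].
 by exists (k *: a, b);rewrite /= !cmulZl.
 have e2: 0 < e / 2 by lra.
 have [s h]:=Jk _ e2;have [s' h']:=Jy _ e2;exists (s ++ s').
 by rewrite /S big_cat opprD addrACA;apply: le_lt_trans (nAD _ _) _;lra.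
 split.
 apply: (maps (cmul y) (nA y)) Jx => [|w|a b|a b];[exact: nAge0|exact: nAM|by rewrite cmulDr cmulNr|].
 by exists (y ** a, b);rewrite !cmulA.
 apply: (maps (cmul^~ y) (nA y)) Jx => [|w|a b|a b];[exact: nAge0|by rewrite mulrC nAM|by rewrite cmulDl cmulNl|].
 by exists (a, b ** y);rewrite !cmulA.
have Jcl: closed J.
 move=> x cx e e1;have e2: 0 < e / 2 by lra.
 have e2': 0 < rc (e / 2) by rewrite -rc0 rc_lt.
 have [y [Jy /=]]:=cx _ (nbhsx_ballx x _ e2').
 rewrite -ball_normE /= nAE rc_lt => xy.
 have [s h]:=Jy _ e2;exists s.
 rewrite -(subrKA y);apply: le_lt_trans (nAD _ _) _.
 by rewrite -(nAN (y - x)) opprB;lra.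
have [J0|JT]:=sA.2 J Jid Jcl;last first.
 have: J z by rewrite JT.
 move=> /(_ _ e0)[s h];exists (size s), (fun i => ui (nth 0 s i).1), (fun i => ui (nth 0 s i).2).
 split=> [i|i|];[exact: inA_ui|exact: inA_ui|];rewrite -ui_nrm uiB ui_sum (big_nth 0) big_mkord in h.
 by under eq_bigr do rewrite -!uiM.
exfalso;move/eqP: d0;apply;rewrite -[RHS]ui0;congr ui.
have:=Jm (star d) (star d ** d);rewrite J0 /= cmulA => h.
have dd: star d ** d = 0.
 apply: nA_eq0;apply/eqP;rewrite -sqrf_eq0 -nA_cstar star_cmul starK cmulA h nA0 //.
by apply: nA_eq0;apply/eqP;rewrite -sqrf_eq0 -nA_cstar dd nA0.
Qed.

End Simplicity.

Arguments inA {R A} _.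

(** * Tracial division and its exact form in the sequence ring *)

Section Division.
Variables (R: realType) (A: cstarAlgType R).
Local Notation U:=(unitz A).

(* The relations that only hold approximately are tested against the elements [(1 - e) f]. *)
Definition tdiv:=forall (F: seq U) (s: U) (n: nat) (eps: R),
 (forall f, f \in F -> inA f) -> inA s -> pos s -> s != 0 -> (0 < n)%N -> 0 < eps ->
 exists (e: U) (p X: nat -> U),
 [/\ [/\ inA e, adj e = e, nrm e <= 1 & exists2 z, inA z & nrm (e - adj z * s * z) < eps],
 forall f, f \in F -> nrm (e * f - f * e) < eps /\ nrm f - eps <= nrm (f - e * f),
 forall i, (inA (p i) /\ nrm (p i) <= 1) /\ (inA (X i) /\ nrm (X i) <= 1),
 [/\ forall i j, (i < n)%N -> (j < n)%N ->
 adj (p i) * p j = if i == j then adj (p 0%N) * p 0%N else 0,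
 forall i, adj (p 0%N) * p 0%N * X i = X i &
 forall i j, (i < n)%N -> (j < n)%N -> i != j -> X i * p j = 0] &
 forall f, f \in F -> let f':=f - e * f in
 [/\ forall i, nrm (f' * p i - p i * f') < eps,
 forall i, nrm (f' * X i - X i * f') < eps &
 nrm (f' * (\sum_(i < n.+1) adj (X i) * X i) - f') < eps]].

Definition asy_in (S: set U) (x: asyR U) :=
 exists u, [/\ bdd u, toasy u = x & forall n, S (u n)].

Definition acst (a: U): asyR U:=toasy (fun=> a).

Lemma acstD a b: acst (a + b) = acst a + acst b.
by rewrite /acst -toasyD //;apply: bddC. Qed.
Lemma acstM a b: acst (a * b) = acst a * acst b.
by rewrite /acst -toasyM //;apply: bddC. Qed.
Lemma acst1: acst 1 = 1. Proof. exact: toasy1. Qed.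
Lemma acst0: acst 0 = 0. Proof. exact: toasy0. Qed.
Lemma acstX a m: acst (a ^+ m) = acst a ^+ m.
by elim: m => [|m IH];rewrite ?expr0 ?acst1 // !exprS acstM IH. Qed.
Lemma acst_sum m (F: nat -> U): acst (\sum_(i < m) F i) = \sum_(i < m) acst (F i).
exact: (big_morph _ acstD acst0). Qed.

Lemma asy_inD (S: set U) x y: (forall a b, S a -> S b -> S (a + b)) ->
 asy_in S x -> asy_in S y -> asy_in S (x + y).
move=> SD [u [hu <- Su]] [v [hv <- Sv]];exists (fun n => u n + v n).
by rewrite toasyD //;split=> //;[exact: bddD|move=> n;apply: SD].
Qed.
Lemma asy_in_sum (S: set U) m (F: nat -> asyR U): S 0 -> (forall a b, S a -> S b -> S (a + b)) ->
 (forall i, (i < m)%N -> asy_in S (F i)) -> asy_in S (\sum_(i < m) F i).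
move=> S0 SD h;apply: (big_ind (asy_in S)) => [|x y|i _].
- by exists (fun=> 0);split=> //;[apply: bddC|apply: toasy0].
- exact: asy_inD.
- exact: h.
Qed.
Lemma asy_inAl (x y: asyR U): asy_in (@inA R A) x -> asy_in (@inA R A) (x * y).
move=> [u [hu <- Su]];exists (fun n => u n * ofasy y n);split.
- by apply: bddM => //;apply: ofasy_bdd.
- by rewrite toasyM ?ofasyK //;apply: ofasy_bdd.
- by move=> n;apply: inAMl.
Qed.
Lemma asy_inAr (x y: asyR U): asy_in (@inA R A) y -> asy_in (@inA R A) (x * y).
move=> [u [hu <- Su]];exists (fun n => ofasy x n * u n);split.
- by apply: bddM => //;apply: ofasy_bdd.
- by rewrite toasyM ?ofasyK //;apply: ofasy_bdd.
- by move=> n;apply: inAMr.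
Qed.
Lemma asy_in_mid (H: set U) a b (x: asyR U): her H -> H a -> H b ->
 asy_in (@inA R A) x -> asy_in H (acst a * x * acst b).
move=> hH ha hb [u [hu <- Su]];exists (fun n => a * u n * b);split.
- by do 2?apply: bddM => //;apply: bddC.
- by rewrite /acst !toasyM //;do ?apply: bddM => //;apply: bddC.
- by move=> n;apply: her_mid.
Qed.

(** A bound on one representative stands in for a quotient norm; [asy_le_close] turns it into an
    eventual bound on any other representative. *)
Definition asy_le (x: asyR U) (K: R):=exists2 u, toasy u = x & forall n, nrm (u n) <= K.

Lemma asy_leD x y a b: asy_le x a -> asy_le y b -> asy_le (x + y) (a + b).
move=> [u <- hu] [v <- hv];exists (fun n => u n + v n).
 by rewrite toasyD //;[exists a|exists b].
by move=> n;apply: le_trans (nrmD _ _) _;rewrite lerD.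
Qed.
Lemma asy_leM x y a b: asy_le x a -> asy_le y b -> asy_le (x * y) (a * b).
move=> [u <- hu] [v <- hv];exists (fun n => u n * v n).
 by rewrite toasyM //;[exists a|exists b].
by move=> n;apply: nrmM_le.
Qed.
Lemma asy_leC a: asy_le (acst a) (nrm a). Proof. by exists (fun=> a). Qed.
Lemma asy_leX x a m: asy_le x a -> asy_le (x ^+ m) (a ^+ m).
move=> h;elim: m => [|m IH];last by rewrite !exprS;apply: asy_leM.
by exists (fun=> 1) => [|n];rewrite ?toasy1 ?nrm1 ?expr0.
Qed.
Lemma asy_le_sum m (F: nat -> asyR U) a: (forall i, (i < m)%N -> asy_le (F i) a) ->
 asy_le (\sum_(i < m) F i) (m%:R * a).
elim: m => [|m IH] h;first by rewrite big_ord0 mul0r;exists (fun=> 0) => [|n];rewrite ?toasy0 ?nrm0.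
rewrite big_ord_recr -natr1 mulrDl mul1r;apply: asy_leD;last exact: h.
by apply: IH => i im;apply: h;apply: ltnW.
Qed.
Lemma asy_le_close u v a (e: R): bdd u -> bdd v -> 0 < e ->
 asy_le (toasy u - toasy v) a ->
 exists N, forall n, (N <= n)%N -> nrm (u n - v n) <= a + e.
move=> hu hv e0 [w wE hw];have bw: bdd w by exists a.
have b2:=bddD hu (bddN hv).
have h: nulseq (fun n => w n - (u n - v n)) by apply/(toasy_eq (the_asy U) bw b2);rewrite wE toasyB.
have [N H]:=h _ e0.
exists N => n /H;have:=hw n;rewrite subr0 => h1 h2.
have -> : u n - v n = w n - (w n - (u n - v n)) by nc_ring.
by apply: le_trans (nrmB _ _) _;lra.
Qed.

(** [tdiv] along [eps = 1 / k.+1]; the relations that are exact there stay exact for each [k]. The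
    smallness of [e] is recorded by [t], which begins with the factor [s]. *)
Record divseq (F: seq U) (n: nat) (s: U) (e t: nat -> U) (p X: nat -> nat -> U): Prop:=Divseq {
 ds_e: forall k, [/\ inA (e k), adj (e k) = e k & nrm (e k) <= 1];
 ds_t: bdd t /\ forall k, exists2 z, inA z & t k = s * z;
 ds_tt: nulseq (fun k => adj (t k) * t k - e k);
 ds_p: forall i k, inA (p i k) /\ nrm (p i k) <= 1;
 ds_X: forall i k, inA (X i k) /\ nrm (X i k) <= 1;
 ds_qp: forall k i j, (i < n)%N -> (j < n)%N ->
 adj (p i k) * p j k = if i == j then adj (p 0%N k) * p 0%N k else 0;
 ds_gX: forall k i, adj (p 0%N k) * p 0%N k * X i k = X i k;
 ds_Xp: forall k i j, (i < n)%N -> (j < n)%N -> i != j -> X i k * p j k = 0;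
 ds_eF: forall f, f \in F -> nulseq (fun k => e k * f - f * e k) /\
 forall k, nrm f - k.+1%:R^-1 <= nrm (f - e k * f);
 ds_cp: forall i f, f \in F -> nulseq (fun k => (f - e k * f) * p i k - p i k * (f - e k * f));
 ds_cX: forall i f, f \in F -> nulseq (fun k => (f - e k * f) * X i k - X i k * (f - e k * f));
 ds_unity: forall f, f \in F -> nulseq (fun k => (f - e k * f) *
 (\sum_(i < n.+1) adj (X i k) * X i k) - (f - e k * f))
}.

Lemma nulseq_inv (u: nat -> U): (forall k, nrm (u k) < k.+1%:R^-1) -> nulseq u.
move=> h e /(inv_small 1)[N H];exists N => k /H;rewrite subr0 div1r.
exact: lt_trans.
Qed.

(** [tdiv] is applied to [s * s], so that [e] is close to [adj t * t] for [t = s * z]: what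
    annihilates [s] then annihilates [t]. *)
Lemma div_ex F n s: tdiv ->
 (forall f, f \in F -> inA f) -> inA s -> adj s = s -> s != 0 -> (0 < n)%N ->
 exists e t p X, divseq F n s e t p X.
move=> TD FA sA ss s0 n0.
have ps: pos (s * s) by apply: pos_sqr.
have ss0: s * s != 0.
 by apply: contra_neq s0 => h;apply: cstar0;rewrite ss.
have e0 k: 0 < k.+1%:R^-1 :> R by rewrite invr_gt0.
have /choice[e he]:=fun k => TD F (s * s) n _ FA (inAMl _ sA) ps ss0 n0 (e0 k).
have /choice[p hp]:=he;have /choice[X hy]:=hp.
have /choice[z hz] k: exists z, inA z /\ nrm (e k - adj z * (s * s) * z) < k.+1%:R^-1.
 by have [[_ _ _ [z ? ?]] _ _ _ _]:=hy k;exists z.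
exists e, (fun k => s * z k), (fun i k => p k i), (fun i k => X k i).
have tt k: adj (s * z k) * (s * z k) = adj (z k) * (s * s) * z k.
 by rewrite adjM ss !mulrA.
split.
- by move=> k;have [[? ? ?]]:=hy k.
- split;last by move=> k;exists (z k) => //;have []:=hz k.
 exists 2 => k;rewrite -(@ler_pXn2r _ 2) ?nnegrE ?nrmge0 // -nrm_cstar tt.
 have [[_ _ e1 _] _ _ _ _]:=hy k;have [_ h]:=hz k.
 have:=nrm_dist (adj (z k) * (s * s) * z k) (e k) 0;rewrite !subr0 => h2.
 rewrite nrmC in h;have -> : 2 ^+ 2 = 4 :> R by ring.
 have: k.+1%:R^-1 <= 1 :> R by rewrite invf_le1 ?ltr0n // ler1n.
 by move=> /(lt_le_trans h) h';lra.
- by apply: nulseq_inv => k;rewrite tt nrmC;have []:=hz k.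
- by move=> i k;have [_ _ /(_ i)[] ]:=hy k.
- by move=> i k;have [_ _ /(_ i)[] ]:=hy k.
- by move=> k;have [_ _ _ [? ? ?] _]:=hy k.
- by move=> k;have [_ _ _ [? ? ?] _]:=hy k.
- by move=> k;have [_ _ _ [? ? ?] _]:=hy k.
- move=> f fF;split;first by apply: nulseq_inv => k;have [_ /(_ f fF)[]]:=hy k.
 by move=> k;have [_ /(_ f fF)[]]:=hy k.
- by move=> i f fF;apply: nulseq_inv => k;have [_ _ _ _ /(_ f fF)[]]:=hy k.
- by move=> i f fF;apply: nulseq_inv => k;have [_ _ _ _ /(_ f fF)[]]:=hy k.
- by move=> f fF;apply: nulseq_inv => k;have [_ _ _ _ /(_ f fF)[]]:=hy k.
Qed.

Lemma adj_family (G: seq (nat -> U)) N: (forall j i, inA (nth (fun=> 0) G j i)) ->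
 exists F: seq U, [/\ forall j i, (j < size G)%N -> (i < N)%N -> nth (fun=> 0) G j i \in F,
 forall f, f \in F -> inA f & forall f, f \in F -> adj f \in F].
move=> GA;pose F :=[seq nth (fun=> 0) G j i | j <- iota 0 (size G), i <- iota 0 N].
have FA f: f \in F -> inA f by case/allpairsP=> -[j i] [_ _ ->].
exists (F ++ [seq adj f | f <- F]);split=> [j i jG iN|f|f];rewrite mem_cat.
- by rewrite allpairs_f ?mem_iota.
- by case/orP=> [/FA //|/mapP[g /FA gA ->]];exact: inA_adj.
by case/orP=> [fF|/mapP[g gF ->]];rewrite mem_cat ?adjK ?gF // map_f ?orbT.
Qed.

Section AsyDivision.
Variables (F: seq U) (n: nat) (s: U) (e t: nat -> U) (p X: nat -> nat -> U).
Hypothesis D: divseq F n s e t p X.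
Hypothesis F_adj: forall f, f \in F -> adj f \in F.

Definition adE: asyR U:=toasy (fun k => 1 - e k).
Definition adt: asyR U:=toasy t.
Definition adtb: asyR U:=toasy (fun k => adj (t k)).
Definition adp i: asyR U:=toasy (p i).
Definition adq i: asyR U:=toasy (fun k => adj (p i k)).
Definition adX i: asyR U:=toasy (X i).
Definition adZ i: asyR U:=toasy (fun k => adj (X i k)).

Lemma bdd_e: bdd e. Proof. by exists 1 => k;have []:=ds_e D k. Qed.
Lemma bdd_E: bdd (fun k => 1 - e k).
by apply: bddD (bddC _) (bddN bdd_e). Qed.
Lemma bdd_t: bdd t. Proof. by have []:=ds_t D. Qed.
Lemma bdd_p i: bdd (p i). Proof. by exists 1 => k;have []:=ds_p D i k. Qed.
Lemma bdd_X i: bdd (X i). Proof. by exists 1 => k;have []:=ds_X D i k. Qed.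
Hint Resolve bdd_e bdd_E bdd_t bdd_p bdd_X bdd_adj bddC bddM: core.

Lemma adtbt: adtb * adt = 1 - adE.
rewrite /adtb /adt -toasyM;[|by auto|by auto].
have -> : 1 - adE = toasy e.
 rewrite /adE -toasy1 -toasyB //;congr toasy;apply/funext => k;nc_ring.
by apply/toasy_eq;[auto|auto|exact: ds_tt D].
Qed.

Lemma ad_left a: a * s = 0 -> acst a * adt = 0.
move=> as0;rewrite /acst /adt -toasyM //.
rewrite (_: (fun k => a * t k) = fun=> 0) ?toasy0 //;apply/funext => k.
by have [z _ ->]:=(ds_t D).2 k;rewrite mulrA as0 mul0r.
Qed.

Lemma ad_right a: adj s = s -> s * a = 0 -> adtb * acst a = 0.
move=> ss sa0;rewrite /acst /adtb -toasyM;[|by auto|by auto].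
rewrite (_: (fun k => adj (t k) * a) = fun=> 0) ?toasy0 //;apply/funext => k.
by have [z _ ->]:=(ds_t D).2 k;rewrite adjM ss -mulrA sa0 mulr0.
Qed.

Lemma ad_mid (H: set U) (x: asyR U) h: her H -> H s -> adj s = s -> H h ->
 asy_in H (adt * x * acst h) /\ asy_in H (acst h * x * adtb).
move=> hH Hs ss Hh;have bx:=ofasy_bdd x;split.
 exists (fun k => t k * ofasy x k * h);split;first by auto.
 by rewrite /adt /acst !toasyM ?ofasyK;auto.
 move=> k;have [z zA ->]:=(ds_t D).2 k;rewrite -[s * z * _]mulrA.
 by apply: her_mid => //;apply: inAMl.
exists (fun k => h * ofasy x k * adj (t k));split;first by auto.
 by rewrite /adtb /acst !toasyM ?ofasyK;auto.
move=> k;have [z zA ->]:=(ds_t D).2 k;rewrite adjM ss mulrA -[h * _ * _]mulrA.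
by apply: her_mid => //;apply: inAMr;apply: inA_adj.
Qed.

Lemma ad_inA_seq (u: nat -> U): bdd u -> (forall k, inA (u k)) ->
 asy_in (@inA R A) (toasy u).
by move=> hu h;exists u. Qed.

Lemma ad_inA: [/\ asy_in (@inA R A) adt, asy_in (@inA R A) adtb,
 forall i, asy_in (@inA R A) (adp i) & forall i, asy_in (@inA R A) (adX i)].
have tA k: inA (t k) by have [z zA ->]:=(ds_t D).2 k;apply: inAMr.
split=> [||i|i];apply: ad_inA_seq;auto.
- by move=> k;apply: inA_adj.
- by move=> k;have []:=ds_p D i k.
- by move=> k;have []:=ds_X D i k.
Qed.
Lemma ad_inA_q i: asy_in (@inA R A) (adq i).
by apply: ad_inA_seq;auto => k;apply: inA_adj;have []:=ds_p D i k. Qed.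

Lemma ad_le: [/\ asy_le adE 2, forall i, asy_le (adX i) 1 & forall i, asy_le (adZ i) 1].
split=> [|i|i].
- exists (fun k => 1 - e k) => // k;apply: le_trans (nrmB _ _) _;rewrite nrm1.
 by have [_ _]:=ds_e D k;lra.
- by exists (X i) => // k;have []:=ds_X D i k.
- by exists (fun k => adj (X i k)) => // k;rewrite nrm_adj;have []:=ds_X D i k.
Qed.

Lemma ad_qp i j: (i < n)%N -> (j < n)%N ->
 adq i * adp j = if i == j then adq 0%N * adp 0%N else 0.
move=> im jm;rewrite /adq /adp -!toasyM;try by auto.
under eq_fun do rewrite (ds_qp D) //.
by case: eqP => // _;rewrite toasy0.
Qed.
Lemma ad_g: adq 0%N * adp 0%N = toasy (fun k => adj (p 0%N k) * p 0%N k).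
by rewrite /adq /adp -toasyM;auto. Qed.
Lemma ad_gX i: adq 0%N * adp 0%N * adX i = adX i.
rewrite ad_g /adX -toasyM;try by auto.
by under eq_fun do rewrite (ds_gX D) //.
Qed.
Lemma ad_Xp i j: (i < n)%N -> (j < n)%N -> i != j -> adX i * adp j = 0.
move=> im jm ij;rewrite /adX /adp -toasyM //.
by under eq_fun do rewrite (ds_Xp D) //;rewrite toasy0.
Qed.
Lemma ad_qZ i j: (i < n)%N -> (j < n)%N -> i != j -> adq j * adZ i = 0.
move=> im jm ij;rewrite /adZ /adq -toasyM;try by auto.
by under eq_fun do rewrite -adjM (ds_Xp D) // adj0;rewrite toasy0.
Qed.

Lemma ad_EF f: f \in F -> adE * acst f = acst f * adE.
move=> /(ds_eF D)[h _];rewrite /adE /acst -!toasyM //.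
apply/toasy_eq;try by apply: bddM;auto.
have:=nulseqN h;congr nulseq;apply/funext => k;nc_ring.
Qed.
Lemma ad_mul f m g: f \in F -> adE * acst f * (adE ^+ m * acst g) = adE ^+ m.+1 * acst (f * g).
move=> /ad_EF Ef;have h: adE ^+ m * acst f = acst f * adE ^+ m.
 by elim: m => [|m IH];rewrite ?expr0 ?mul1r ?mulr1 // exprS -mulrA IH mulrA Ef -mulrA.
by rewrite -mulrA (mulrA (acst f)) -h -mulrA -acstM mulrA -exprS.
Qed.

Lemma ad_Ef f: toasy (fun k => f - e k * f) = adE * acst f.
rewrite /adE /acst -toasyM //;congr toasy;apply/funext => k;nc_ring.
Qed.

(** Commutation with [adj u] is the adjoint of the commutation of [adj f] with [u]; this is why [F]
    is closed under adjoints. *)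
Lemma ad_comm1 f (u: nat -> U): f \in F -> bdd u ->
 (forall f, f \in F -> nulseq (fun k => (f - e k * f) * u k - u k * (f - e k * f))) ->
 adE * acst f * toasy u = toasy u * (adE * acst f) /\
 adE * acst f * toasy (fun k => adj (u k)) = toasy (fun k => adj (u k)) * (adE * acst f).
move=> fF hu h;have bf g: bdd (fun k => g - e k * g).
 by apply: bddD;[auto|apply: bddN;apply: bddM;auto].
have e1 g: g \in F -> adE * acst g * toasy u = toasy u * (adE * acst g).
 move=> gF;rewrite -ad_Ef -!toasyM //.
 by apply/toasy_eq;[exact: bddM|exact: bddM|exact: h].
split;first exact: e1.
have bfs g: bdd (fun k => adj (g - e k * g)) by auto.
have e2: adE * acst f = toasy (fun k => adj (adj f - e k * adj f)).
 rewrite ad_EF // /adE /acst -toasyM;try by auto.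
 congr toasy;apply/funext => k;rewrite adjB adjM adjK;have [_ -> _]:=ds_e D k.
 nc_ring.
rewrite e2 -!toasyM;try by auto.
under eq_fun do rewrite -adjM;under [in RHS]eq_fun do rewrite -adjM.
apply/toasy_eq;try by apply: bdd_adj;apply: bddM.
have:=nulseqN (nulseq_adj (h _ (F_adj fF)));congr nulseq;apply/funext => k.
by rewrite -adjB -adjN opprB.
Qed.

Lemma ad_comm f: f \in F -> bcent adp adq adX adZ (adE * acst f).
move=> fF i;have [h1 h2]:=ad_comm1 fF (bdd_p i) (ds_cp D i).
by have [h3 h4]:=ad_comm1 fF (bdd_X i) (ds_cX D i).
Qed.

Lemma ad_unity f: f \in F -> adE * acst f * (\sum_(i < n.+1) adZ i * adX i) = adE * acst f.
move=> fF;have bf: bdd (fun k => f - e k * f).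
 by apply: bddD;[auto|apply: bddN;apply: bddM;auto].
pose G i k:=adj (X i k) * X i k;have bG i: bdd (G i) by rewrite /G;auto.
have -> : \sum_(i < n.+1) adZ i * adX i = toasy (fun k => \sum_(i < n.+1) G i k).
 by rewrite toasy_sum //;apply: eq_bigr => i _;rewrite /adZ /adX -toasyM;auto.
have b1: bdd (fun k => \sum_(i < n.+1) G i k) by exact: bdd_sum.
rewrite -ad_Ef -toasyM //;apply/toasy_eq => //;first exact: bddM.
exact: ds_unity D _ fF.
Qed.

End AsyDivision.

End Division.

(** * Approximation by products of two nilpotents *)

Section NilApprox.
Variables (R: realType) (A: cstarAlgType R).
Local Notation U:=(unitz A).
Hypotheses (A_simple: simple A) (TD: tdiv A).
Variable H: set U.
Hypothesis hH: her H.

(* If [u v] is close to [x] modulo null sequences for two nilpotents [u] and [v],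
   then [(u + t) (v + t)] with small [t] is an invertible close to [x]. *)
Lemma nilp_near (u v: nat -> U) m (x: U) (K eps: R) :
 bdd u -> bdd v -> (forall k, H (u k)) -> (forall k, H (v k)) ->
 nulseq (fun k => u k ^+ m) -> nulseq (fun k => v k ^+ m) -> K < eps ->
 (forall d: R, 0 < d -> exists N, forall k, (N <= k)%N -> nrm (u k * v k - x) <= K + d) ->
 exists2 y, GLher H y & nrm (x - y) < eps.
move=> [Mu hu] [Mv hv] Hu Hv nu nv Ke near.
have Mu0: 0 <= Mu:=le_trans (nrmge0 _) (hu 0%N).
have Mv0: 0 <= Mv:=le_trans (nrmge0 _) (hv 0%N).
pose d:=(eps - K) / 4;have d0: 0 < d by rewrite /d;lra.
pose t:=Num.min 1 (d / (Mu + Mv + 1)).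
have S0: 0 < Mu + Mv + 1 by lra.
have t0: 0 < t by rewrite lt_min ltr01 divr_gt0.
have t1: t <= 1 by rewrite ge_min lexx.
have tS: t * (Mu + Mv + 1) <= d by rewrite -ler_pdivlMr // ge_min lexx orbT.
have tm: 0 < t ^+ m by rewrite exprn_gt0.
have [N1 H1]:=nu _ tm;have [N2 H2]:=nv _ tm;have [N3 H3]:=near _ d0.
pose k:=maxn N1 (maxn N2 N3).
have k1: (N1 <= k)%N by rewrite leq_maxl.
have k2: (N2 <= k)%N by rewrite (leq_trans (leq_maxl N2 N3)) ?leq_maxr.
have k3: (N3 <= k)%N by rewrite (leq_trans (leq_maxr N2 N3)) ?leq_maxr.
exists ((u k + rc t *: 1) * (v k + rc t *: 1)).
 apply: GLherM => //;apply: (@nilpotent_shift _ _ _ hH _ m) => //.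
 by have:=H1 _ k1;rewrite subr0.
 by have:=H2 _ k2;rewrite subr0.
have -> : x - (u k + rc t *: 1) * (v k + rc t *: 1) =
- (u k * v k - x) - (rc t *: (u k + v k) + rc (t * t) *: 1).
 rewrite mulrDl !mulrDr -!scalerAl -!scalerAr !mul1r mulr1 scalerA -rcM scalerDr.
 by rewrite opprB !opprD !addrA;congr (_ - _);rewrite -!addrA;congr (_ + _);rewrite addrC addrA.
apply: le_lt_trans (nrmB _ _) _;rewrite nrmN;have h3:=H3 _ k3.
have h4:=nrmD (rc t *: (u k + v k)) (rc (t * t) *: 1).
rewrite nrmR nrm_scal !gtr0_norm ?mulr_gt0 // in h4.
have h5: t * nrm (u k + v k) <= t * (Mu + Mv).
 by rewrite ler_wpM2l ?(ltW t0) // (le_trans (nrmD _ _)) // lerD.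
have h6: t * t <= t * 1 by rewrite ler_wpM2l // ltW.
rewrite /d in h3 tS;lra.
Qed.

(** Of the two orthogonal elements beside [x], [d1] makes room for the error [e], through
    [t = d1 * z], and [d2] for the last two terms of the unity, since simplicity writes [c ^+ 4]
    nearly as a sum of [a i * (d2 * d2) * b i]. As [x * c ^+ 6 = x], the product of the nilpotents
    differs from [x] by a multiple of the error [r] of that sum. *)
Lemma nilp_approx (x c d1 d2: U) :
 H x -> H c -> H d1 -> H d2 -> adj c = c -> adj d1 = d1 -> adj d2 = d2 ->
 x * c = x -> c * x = x -> c * d1 = 0 -> c * d2 = 0 -> d1 * d2 = 0 ->
 d1 != 0 -> d2 != 0 -> GLnear H x.
move=> Hx Hc Hd1 Hd2 sc sd1 sd2 xc cx cd1 cd2 d12 d10 d20 eps eps0.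
have d1c: d1 * c = 0 by rewrite -sc -sd1 -adjM cd1 adj0.
have d2c: d2 * c = 0 by rewrite -sc -sd2 -adjM cd2 adj0.
have d21: d2 * d1 = 0 by rewrite -sd1 -sd2 -adjM d12 adj0.
have d2x: d2 * x = 0 by rewrite -cx mulrA d2c mul0r.
have d1x: d1 * x = 0 by rewrite -cx mulrA d1c mul0r.
(* The error is [x C (E ^+ 4 r) W C]: six factors [E] of norm at most 2 and the two terms of [W]
   make [2 ^+ 7]; the 1 makes [K0] positive. *)
pose K0:=nrm x * nrm c ^+ 2 * 2 ^+ 7 + 1.
have K0p: 0 < K0.
 by rewrite ltr_wpDl // !mulr_ge0 ?nrmge0 ?exprn_ge0 ?nrmge0.
have dd0: d2 * d2 != 0.
 by apply: contra_neq d20 => h;apply: cstar0;rewrite sd2.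
have inH:=her_inA hH.
have cA: inA (c ^+ 4) by rewrite exprS;apply: inAMl;apply: inH.
have [k [a [b [aA bA ab]]]]:=simple_span A_simple (inAMl d2 (inH _ Hd2)) dd0 cA
 (divr_gt0 eps0 K0p).
set r :=\sum_(i < k) a i * (d2 * d2) * b i - c ^+ 4 in ab.
(* Each of the [k] summands needs two slots; the successor keeps [n] positive. *)
pose n:=(k * 2).+1;have n0: (0 < n)%N by [].
have [|F [inF FA F_adj]]:=@adj_family _ _ [:: a;b;fun=> x;fun=> c;fun=> d2] k.+1.
 by move=> [|[|[|[|[|j]]]]] i //=;rewrite ?nth_nil;[exact: inH|exact: inH|exact: inH|exact: inA0].
have xF: x \in F:=inF 2%N 0%N isT isT;have cF: c \in F:=inF 3%N 0%N isT isT.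
have dF: d2 \in F:=inF 4%N 0%N isT isT.
have aF i: (i < k)%N -> a i \in F by move/leqW;exact: (inF 0%N).
have bF i: (i < k)%N -> b i \in F by move/leqW;exact: (inF 1%N).
have [e [t [p [X D]]]]:=div_ex TD FA (inH _ Hd1) sd1 d10 n0.
have:=ad_comm D F_adj;have:=ad_unity D;have:=ad_EF D;have:=ad_mul D.
have:=ad_qp D;have:=ad_gX D;have:=ad_Xp D;have:=ad_qZ D.
have:=adtbt D;have:=ad_left D;have:=fun a => @ad_right _ _ _ _ _ _ _ _ _ D a sd1.
have:=fun x h => @ad_mid _ _ _ _ _ _ _ _ _ D H x h hH Hd1 sd1.
have:=ad_inA D;have:=ad_inA_q D;have:=ad_le D.
move: (adE e) (adt t) (adtb t) (adp p) (adq p) (adX X) (adZ X).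
move=> {e t p X D} E t tb p q X Z [Ele Xle Zle] qA [tA tbA pA XA] tmid.
move=> tbr tl tbt qZ Xp gX qp mulE EF unity comm.
have [C CE]: exists C, C = E * acst c by eexists.
have [D DE]: exists D, D = E * acst d2 by eexists.
have cdE f g: f \in F -> g \in F -> f * g = 0 -> E * acst f * (E * acst g) = 0.
 by move=> fF gF fg;have:=mulE f 1%N g fF;rewrite expr1 fg acst0 mulr0.
have Et f: f * d1 = 0 -> E * acst f * t = 0.
 by move=> /tl h;rewrite -mulrA h mulr0.
have tE f: f \in F -> d1 * f = 0 -> tb * (E * acst f) = 0.
 by move=> fF /tbr h;rewrite EF // mulrA h mul0r.
have xC3: bcent p q X Z (acst x * C ^+ 3).
 have xC: acst x * C = E * acst x by rewrite CE (EF _ cF) mulrA -acstM xc (EF _ xF).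
 have -> : acst x * C ^+ 3 = E * acst x * C * C.
 by rewrite exprSr expr2 (mulrA _ (C * C)) (mulrA _ C) xC.
 by apply: bcentM;[apply: bcentM|];rewrite ?CE;exact: comm.
have qp': forall i j, (i < n)%N -> (j < n)%N -> q i * p j = if i == j then q 0%N * p 0%N else 0 by [].
have cC: bcent p q X Z C by rewrite CE;exact: comm.
have cD: bcent p q X Z D by rewrite DE;exact: comm.
have cAi i: (i < k)%N -> bcent p q X Z (E * acst (a i)) by move=> /aF /comm.
have cBi i: (i < k)%N -> bcent p q X Z (E * acst (b i)) by move=> /bF /comm.
have kL: (k * 2 <= n)%N by rewrite /n leqnSn.
have C_D: C * D = 0 by rewrite CE DE;apply: cdE.
have D_C: D * C = 0 by rewrite CE DE;apply: cdE.
have C_t: C * t = 0 by rewrite CE;apply: Et.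
have tb_C: tb * C = 0 by rewrite CE;apply: tE.
have D_t: D * t = 0 by rewrite DE;apply: Et.
have tb_D: tb * D = 0 by rewrite DE;apply: tE.
have un: C * (\sum_(i < n.+1) Z i * X i) = C by rewrite CE unity.
have lr:=nilp_left_right n0 kL qp' gX cC cD cAi cBi C_D D_C C_t tb_C D_t tb_D
 CE (EF _ cF) tbt un.
have c_D: acst c * D = 0 by rewrite DE (EF _ dF) mulrA -acstM cd2 acst0 mul0r.
have D_x: D * acst x = 0 by rewrite DE -mulrA -acstM d2x acst0 mulr0.
have rnil:=nilp_right_nil k (fun i => E * acst (b i)) n0 Xp cC C_D C_t c_D (tl _ cd1).
have lnil:=nilp_left_nil k (fun i => E * acst (a i)) E (acst c) n0 qZ xC3 D_x (tbr _ d1x).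
have SA0: @inA R A 0 by exact: inA0.
have HD:=@herD _ _ _ hH;have H0:=her0 hH.
(* As [H] is hereditary, a term lies in it as soon as it begins and ends with an element of [H]. *)
have mid f g (s: asyR U): H f -> H g -> asy_in inA s -> asy_in H (acst f * s * acst g).
 by move=> Hf Hg;apply: asy_in_mid.
have cEc f: C * f * C = acst c * (E * f * E) * acst c.
 by rewrite {1}CE (EF _ cF) CE !mulrA.
have rH: asy_in H (nilp_right n k p X (fun i => E * acst (b i)) (acst c) C D t).
 apply: (asy_inD HD);last apply: (asy_inD HD).
- rewrite mulr_suml;apply: (asy_in_sum (F:=fun i => p i.+1 * X i * C ^+ 3)) => // i im.
 have [Cp _ _ _]:=cC i.+1;have [_ _ CX _]:=cC i.
 have -> : p i.+1 * X i * C ^+ 3 = C * (p i.+1 * X i * C) * C.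
 by rewrite exprSr expr2 !mulrA Cp -(mulrA (p i.+1) C) CX !mulrA.
 by rewrite cEc;apply: mid => //;apply: asy_inAl;apply: asy_inAr;do 2!apply: asy_inAl.
- apply: (asy_in_sum (F:=fun i => \sum_(l < 2) D * p (i * 2 + l)%N * (E * acst (b i)) *
 X (n.-1 + l)%N * C)) => // i im.
 apply: (asy_in_sum (F:=fun l => D * p (i * 2 + l)%N * (E * acst (b i)) *
 X (n.-1 + l)%N * C)) => // l lm.
 have -> : D * p (i * 2 + l)%N * (E * acst (b i)) * X (n.-1 + l)%N * C =
 acst d2 * (E * (p (i * 2 + l)%N * ((E * acst (b i)) * X (n.-1 + l)%N * E))) * acst c.
 by rewrite DE (EF _ dF) CE !mulrA.
 by apply: mid => //;apply: asy_inAr;apply: asy_inAl.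
- have:=(tmid 1 (c ^+ 3) _).1;rewrite mulr1 acstX;apply.
 by rewrite !exprS expr0 mulr1;do 2!apply: herM => //.
have lH: asy_in H (acst x * nilp_left n k q Z (fun i => E * acst (a i)) E (acst c) C D tb).
 rewrite /nilp_left !mulrDr;apply: (asy_inD HD);last apply: (asy_inD HD).
- rewrite mulrA mulr_sumr;apply: (asy_in_sum (F:=fun i => acst x * C ^+ 3 * (Z i * q i.+1))) => // i im.
 have [_ Cq _ _]:=cC i.+1;have [_ _ _ CZ]:=cC i.
 have -> : acst x * C ^+ 3 * (Z i * q i.+1) = acst x * (C * C * (Z i * (q i.+1 * E))) * acst c.
 rewrite [C ^+ 3]exprSr expr2 -!mulrA;congr (_ * (_ * (_ * _))).
 by rewrite (mulrA C (Z i)) CZ -(mulrA (Z i)) Cq CE !mulrA.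
 by apply: mid => //;do 2!apply: asy_inAr;apply: asy_inAl.
- rewrite mulr_sumr;apply: (asy_in_sum (F:=fun i => acst x * \sum_(l < 2) C * Z (n.-1 + l)%N *
 (E * acst (a i)) * q (i * 2 + l)%N * D)) => // i im.
 rewrite mulr_sumr;apply: (asy_in_sum (F:=fun l => acst x * (C * Z (n.-1 + l)%N *
 (E * acst (a i)) * q (i * 2 + l)%N * D))) => // l lm.
 have -> : acst x * (C * Z (n.-1 + l)%N * (E * acst (a i)) * q (i * 2 + l)%N * D) =
 acst x * (C * Z (n.-1 + l)%N * (E * acst (a i)) * (q (i * 2 + l)%N * E)) * acst d2.
 by rewrite DE !mulrA.
 by apply: mid => //;apply: asy_inAr;apply: asy_inAl.
- have:=(tmid (acst (c ^+ 3) * (\sum_(i < 6) E ^+ i)) x Hx).2.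
 by rewrite acstX !mulrA.
have [u [bu uE Hu]]:=lH;have [v [bv vE Hv]]:=rH.
have un0: nulseq (fun j => u j ^+ n.+1).
 by apply/(toasy_eq0 (bddX _ bu));rewrite toasyX // uE lnil.
have vn0: nulseq (fun j => v j ^+ n.+1).
 by apply/(toasy_eq0 (bddX _ bv));rewrite toasyX // vE rnil.
pose W :=\sum_(l < 2) Z (n.-1 + l)%N * X (n.-1 + l)%N.
have Th: \sum_(i < k) E * acst (a i) * (D * D) * (E * acst (b i)) - C ^+ 4 = E ^+ 4 * acst r.
 have CX m: C ^+ m.+1 = E ^+ m.+1 * acst (c ^+ m.+1).
 elim: m => [|m IH];first by rewrite !expr1 CE.
 by rewrite exprS IH CE mulE // -exprS.
 rewrite CX;have -> : acst r = \sum_(i < k) acst (a i * (d2 * d2) * b i) - acst (c ^+ 4).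
 rewrite -(acst_sum _ (fun i => a i * (d2 * d2) * b i)).
 have -> : \sum_(i < k) a i * (d2 * d2) * b i = r + c ^+ 4 by rewrite /r subrK.
 by rewrite (acstD r) addrK.
 rewrite mulrBr mulr_sumr;congr (_ - _);apply: eq_bigr => i _.
 have e1: D * (E * acst (b i)) = E ^+ 2 * acst (d2 * b i).
 by have:=mulE d2 1%N (b i) dF;rewrite expr1 -DE.
 have e2: D * (E ^+ 2 * acst (d2 * b i)) = E ^+ 3 * acst (d2 * (d2 * b i)).
 by rewrite DE;apply: mulE.
 rewrite -(mulrA (E * acst (a i))) -(mulrA D) e1 e2 mulE;last exact: aF.
 by congr (_ * acst _);rewrite !mulrA.
have key: toasy (fun j => u j * v j) - acst x = acst x * (C * (E ^+ 4 * acst r) * W * C).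
 rewrite toasyM // uE vE -(mulrA (acst x)) lr Th mulrDr -acstX -acstM.
 have -> : x * c ^+ 6 = x by rewrite !exprS expr0 mulr1 !mulrA !xc.
 by rewrite addrAC subrr add0r.
pose K:=nrm x * (2 * nrm c * (2 ^+ 4 * nrm r) * (2%:R * (1 * 1)) * (2 * nrm c)).
have hK: asy_le (toasy (fun j => u j * v j) - acst x) K.
 rewrite key;apply: asy_leM;first exact: asy_leC.
 have cle: asy_le C (2 * nrm c) by rewrite CE;apply: asy_leM => //;exact: asy_leC.
 apply: asy_leM => //;apply: asy_leM.
 by apply: asy_leM => //;apply: asy_leM;[exact: asy_leX|exact: asy_leC].
 by apply: (asy_le_sum (F:=fun l => Z (n.-1 + l)%N * X (n.-1 + l)%N)) => l _;exact: asy_leM.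
have Ke: K < eps.
 have -> : K = (K0 - 1) * nrm r by rewrite /K /K0;ring.
 have r0:=nrmge0 r;have: nrm r * K0 < eps by rewrite -ltr_pdivlMr.
 lra.
apply: (nilp_near bu bv Hu Hv un0 vn0 Ke) => d d0.
have:=asy_le_close (bddM bu bv) (bddC x) d0 hK;apply.
Qed.

End NilApprox.

(** * Orthogonal elements below given ones *)

Section Orthogonal.
Variables (R: realType) (A: cstarAlgType R).
Local Notation U:=(unitz A).
Hypotheses (A_simple: simple A) (TD: tdiv A).
Variable H: set U.
Hypothesis hH: her H.

(* [a_1 >= a_0] and [a_0 a_1] small would force [a_0] to be small. *)
Lemma not_dominated (a b: U) (r: R): pos a -> 0 < r -> r <= nrm a -> nrm (a * b) < r ^+ 2 ->
 ~ pos (b - a).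
move=> pa r0 ra ab pba;have sa:=pos_sa pa.
have h: nrm (a * a * a) <= nrm (a * b * a).
 apply: nrm_mono;first by rewrite -{1}sa;apply: pos_conj.
 by rewrite -mulrBl -mulrBr -{1}sa;apply: pos_conj.
have a0: 0 < nrm a:=lt_le_trans r0 ra.
have e2: nrm (a * a) = nrm a ^+ 2 by rewrite -{1}sa nrm_cstar.
have e4: nrm a ^+ 4 <= nrm (a * a * a) * nrm a.
 rewrite (_: nrm a ^+ 4 = nrm (a * a) ^+ 2);last by rewrite e2 -exprM.
 rewrite -nrm_cstar adjM sa mulrA;exact: nrmM.
have h2:=le_trans h (nrmM (a * b) a).
have h3: nrm a ^+ 4 <= nrm (a * b) * nrm a * nrm a by apply: le_trans e4 _;rewrite ler_wpM2r // ltW.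
have h4: nrm a ^+ 2 <= nrm (a * b).
 rewrite -(ler_pM2r (exprn_gt0 2 a0)) -exprD expr2 mulrA;exact: h3.
have: r ^+ 2 <= nrm a ^+ 2 by rewrite lerXn2r // nnegrE ltW.
lra.
Qed.

(** With [m] the absolute value of [h = a - b], the two elements are twice the squares of the
    positive and negative parts of [h], up to sign. If one vanished, [b] would dominate [a] or
    conversely. The left factor [a - b] lets them inherit left annihilators. *)
Lemma orthogonal_parts (a b: U) (r: R): H a -> H b -> pos a -> pos b -> 0 < r ->
 r <= nrm a -> r <= nrm b -> nrm (a * b) < r ^+ 2 ->
 exists d1 d2, [/\ H d1 /\ H d2, adj d1 = d1 /\ adj d2 = d2, d1 != 0, d2 != 0 &
 d1 * d2 = 0 /\ exists z1 z2, d1 = (a - b) * z1 /\ d2 = (a - b) * z2].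
move=> Ha Hb pa pb r0 ra rb ab;have [h hE]: exists h, h = a - b by eexists.
have sa:=pos_sa pa;have sb:=pos_sa pb.
have sh: adj h = h by rewrite hE adjB sa sb.
have Hh: H h by rewrite hE;apply: (herB hH).
have [m [sm pm mm lm]]:=psqrt (pos_sqr sh).
have hm: m * h = h * m by apply: lp_comm lm;rewrite mulrA.
have Hm: her1 H m.
 by apply: lm;[exact: her1C|apply: her1_H;apply: (herM hH)].
have Hh1: her1 H h:=her1_H Hh.
have [c1 cD cM cZ cL]:=her1C hH.
have HN x: her1 H x -> her1 H (- x) by rewrite -scaleN1r;apply: cZ.
have nz (s: U): adj s = s -> s * s = h * h -> m * s = s * m -> h * (m + s) = 0 ->
 (s = h \/ s = - h) -> m + s = 0.
 move=> ss s2 ms h0 hs;apply: cstar0;rewrite adjD sm ss.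
 have sms: s * (m + s) = 0 by case: hs h0 => [<- //|e];rewrite e mulNr -e => ->;rewrite oppr0.
 have mms: m * (m + s) = 0 by rewrite mulrDr mm ms -s2 -mulrDr addrC.
 by rewrite mulrDl sms mms addr0.
have ba: nrm (b * a) < r ^+ 2 by rewrite -nrm_adj adjM sa sb.
exists (h * (m + h)), (h * (m - h));split.
- by split;apply: her1_mul => //;apply: cD => //;apply: HN.
- split;first by rewrite adjM adjD sm sh mulrDl mulrDr hm.
 by rewrite adjM adjB sm sh mulrBl mulrBr hm.
- apply/eqP => h0;have:=nz h sh erefl hm h0 (or_introl erefl) => mh0.
 apply: (not_dominated pa r0 ra ab).
 by have -> : b - a = m by rewrite -[RHS](addrK h) mh0 hE;nc_ring.
- apply/eqP => h0;have mh0: m - h = 0.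
 apply: (nz (- h)) => //;[by rewrite adjN sh|by rewrite mulrNN|by rewrite mulrN mulNr hm|by right].
 apply: (not_dominated pb r0 rb ba).
 by rewrite -hE -[h](addr0) -mh0 addrC subrK.
- split;last by exists (m + h), (m - h);rewrite hE.
 have e: (m + h) * (m - h) = 0 by rewrite mulrDl !mulrBr mm hm;nc_ring.
 rewrite mulrA -(mulrA h (m + h) h) (_: (m + h) * h = h * (m + h));last by rewrite mulrDl mulrDr hm.
 by rewrite -!mulrA e !mulr0.
Qed.

(* The elements are [d_a (1 - e) p_a p_a^* (1 - e) d_a]; they stay away from [0]
   because the [X_a^* X_a] add up to [1]. *)
Lemma aorth (dd: nat -> U): (forall i, H (dd i)) -> (forall i, adj (dd i) = dd i) ->
 (forall i, dd i != 0) ->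
 exists2 r: R, 0 < r & forall eta: R, 0 < eta -> exists a z: nat -> U,
 [/\ forall i, [/\ H (a i), pos (a i) & a i = dd i * z i],
 r <= nrm (a 0%N), r <= nrm (a 1%N) & nrm (a 0%N * a 1%N) < eta].
move=> Hd sd d0;have dA i:=her_inA hH (Hd i).
have [|F [inF FA F_adj]]:=@adj_family _ _ [:: dd] 2.
 by move=> [|j] i //=;rewrite nth_nil;exact: inA0.
have dF i: (i < 2)%N -> dd i \in F:=inF 0%N i isT.
(* Two copies suffice; the unity then has three terms, whence the factor 3 below. *)
have [e [t [p [X D]]]]:=div_ex TD FA (dA 0%N) (sd 0%N) (d0 0%N) (ltn0Sn 1).
pose u i k:=dd i * ((1 - e k) * p i k).
pose a i k:=u i k * adj (u i k).
have be: bdd (fun k => 1 - e k):=bdd_E D.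
have bp i: bdd (p i):=bdd_p D i.
have bu i: bdd (u i) by apply: bddM;[exact: bddC|exact: bddM].
have ba i: bdd (a i) by apply: bddM => //;apply: bdd_adj.
have uE i: toasy (u i) = acst (dd i) * (adE e * adp p i).
 by rewrite /acst /adE /adp -!toasyM //;[exact: bddC|exact: bddM].
have Ha i k: H (a i k).
 have -> : a i k = dd i * ((1 - e k) * p i k * adj ((1 - e k) * p i k)) * dd i.
 by rewrite /a /u !adjM sd !mulrA.
 apply: (her_mid hH) => //;apply: inAMl;apply: inAMr.
 by have []:=ds_p D i k.
have dE i h:=ad_EF D (dF i h);have comm i h:=ad_comm D F_adj (dF i h).
have un i h:=ad_unity D (dF i h).
have qp:=ad_qp D;have gX:=ad_gX D.
have orth: toasy (fun k => a 0%N k * a 1%N k) = 0 :> asyR U.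
 have bus i: bdd (fun k => adj (u i k)) by apply: bdd_adj.
 have -> : toasy (fun k => a 0%N k * a 1%N k) =
 toasy (u 0%N) * (toasy (fun k => adj (u 0%N k)) * toasy (u 1%N)) * toasy (fun k => adj (u 1%N k)) :> asyR U.
 by rewrite -!toasyM //;do ?apply: bddM => //;congr toasy;apply/funext => k;rewrite /a !mulrA.
 have -> : toasy (fun k => adj (u 0%N k)) = adq p 0%N * (adE e * acst (dd 0%N)).
 have -> : (fun k => adj (u 0%N k)) = (fun k => adj (p 0%N k) * ((1 - e k) * dd 0%N)).
 by apply/funext => k;rewrite /u !adjM sd adjB adj1 mulrA;have [_ -> _]:=ds_e D k.
 by rewrite /acst /adE /adq -!toasyM //;do ?apply: bddM => //; (exact: bddC) || exact: bdd_adj.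
 have [_ c3 _ _]:=comm 0%N isT 0%N;have [_ c1 _ _]:=comm 1%N isT 0%N.
 rewrite !uE;set w:=toasy _.
 have -> : adq p 0%N * (adE e * acst (dd 0%N)) * (acst (dd 1%N) * (adE e * adp p 1%N)) =
 adE e * acst (dd 0%N) * (adE e * acst (dd 1%N)) * (adq p 0%N * adp p 1%N).
 rewrite (mulrA (acst (dd 1%N))) -dE // -c3.
 move: (adE e * acst (dd 1%N)) c1 => T c1;rewrite -!(mulrA (adE e * acst (dd 0%N)));congr (_ * _).
 by rewrite !mulrA c1.
 by rewrite qp // mulr0 mulr0 mul0r.
have dp i: 0 < nrm (dd i).
 by rewrite lt_neqAle nrmge0 andbT eq_sym;apply: contra_neq (d0 i) => /nrm_eq0.
(* Up to a null sequence [(1 - e) * dd i] is the sum of the three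
   [adj (X j) * (adj (p i) * u i) * X j], so [u i] cannot be small. *)
have large i: (i < 2)%N -> exists N, forall k, (N <= k)%N -> nrm (dd i) / 2 <= 3 * nrm (u i k).
 move=> i2.
 have bq: bdd (fun k => adj (p i k)) by apply: bdd_adj.
 have bX j: bdd (X j):=bdd_X D j.
 pose G j k:=adj (X j k) * (adj (p i k) * u i k) * X j k;pose f k :=\sum_(j < 3) G j k.
 have bG j: bdd (G j) by do !apply: bddM => //;apply: bdd_adj.
 have bf: bdd f by apply: (@bdd_sum _ _ 3 G).
 have fE: toasy f = adE e * acst (dd i).
 rewrite (@toasy_sum _ _ 3 G) // -[RHS](un i i2) mulr_sumr;apply: eq_bigr => j _.
 have [_ c2 _ _]:=comm i i2 i;have [_ _ _ c4]:=comm i i2 j.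
 have eg: adE e * acst (dd i) * (adq p 0%N * adp p 0%N) = adq p i * toasy (u i).
 by have:=qp i i i2 i2;rewrite eqxx => <-;rewrite mulrA c2 uE dE // !mulrA.
 rewrite mulrA c4 -[in RHS](gX j) -[RHS]mulrA (mulrA (adE e * _)) eg [RHS]mulrA /adZ /adX /adq.
 by rewrite -!toasyM //;do ?apply: bddM => //;apply: bdd_adj.
 have bd: bdd (fun k => dd i - e k * dd i).
 have -> : (fun k => dd i - e k * dd i) = (fun k => (1 - e k) * dd i).
 by apply/funext => k;rewrite mulrBl mul1r.
 by apply: bddM => //;apply: bddC.
 have nul: nulseq (fun k => (dd i - e k * dd i) - f k).
 by apply/(toasy_eq (the_asy U) bd bf);rewrite (ad_Ef D) fE.
 have d4: 0 < nrm (dd i) / 4 by rewrite divr_gt0.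
 have [N1 H1]:=nul _ d4;have [N2 H2]:=inv_small 1 d4;exists (maxn N1 N2) => k.
 rewrite geq_max => /andP[/H1 h1 /H2 h2];rewrite subr0 in h1;rewrite div1r in h2.
 have h3: nrm (dd i) - k.+1%:R^-1 <= nrm (dd i - e k * dd i) by apply: (ds_eF D (dF i i2)).2.
 have h4: nrm (f k) <= 3 * nrm (u i k).
 have pu: nrm (adj (p i k) * u i k) <= nrm (u i k).
 rewrite -[leRHS]mul1r;apply: nrmM_le => //;rewrite nrm_adj;exact: (ds_p D i k).2.
 have one (z: U): nrm z <= 1 -> nrm (adj z * (adj (p i k) * u i k) * z) <= nrm (u i k).
 move=> z1;rewrite -[leRHS]mulr1;apply: nrmM_le => //.
 by rewrite -[leRHS]mul1r;apply: nrmM_le => //;rewrite nrm_adj.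
 apply: le_trans (nrm_sum _ _ _) _;rewrite mulr_natl -[X in _ *+ X]card_ord -sumr_const.
 by apply: ler_sum => j _;apply: one;exact: (ds_X D j k).2.
 have:=nrmD ((dd i - e k * dd i) - f k) (f k);rewrite subrK => h5.
 move: h2 h3;set q:=k.+1%:R^-1;lra.
have [N0 H0]:=large 0%N isT;have [N1 H1]:=large 1%N isT.
pose rho:=Num.min (nrm (dd 0%N)) (nrm (dd 1%N)) / 2 / 3.
have rho0: 0 < rho by rewrite !divr_gt0 // lt_min !dp.
exists (rho ^+ 2);first by rewrite exprn_gt0.
move=> eta eta0.
have nul: nulseq (fun k => a 0%N k * a 1%N k).
 by apply/toasy_eq0 => //;apply: bddM.
have [N2 H2]:=nul _ eta0;pose k:=maxn N0 (maxn N1 N2).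
have k0: (N0 <= k)%N by rewrite leq_maxl.
have k1: (N1 <= k)%N by rewrite /k;lia.
have k2: (N2 <= k)%N by rewrite /k;lia.
have big i: nrm (dd i) / 2 <= 3 * nrm (u i k) ->
 Num.min (nrm (dd 0%N)) (nrm (dd 1%N)) <= nrm (dd i) -> rho ^+ 2 <= nrm (a i k).
 move=> h hm;have h': rho <= nrm (u i k).
 by rewrite /rho ler_pdivrMr // [leRHS]mulrC;apply: le_trans h;rewrite ler_pM2r ?invr_gt0.
 rewrite /a -{1}[u i k]adjK nrm_cstar nrm_adj lerXn2r // nnegrE ?nrmge0 //;exact: ltW.
exists (fun i => a i k), (fun i => (1 - e k) * p i k * adj (u i k));split.
- by move=> i;split=> //;[exact: padjM2|rewrite /a /u !mulrA].
- by apply: big;[exact: H0|rewrite ge_min lexx].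
- by apply: big;[exact: H1|rewrite ge_min lexx orbT].
- by have:=H2 _ k2;rewrite subr0.
Qed.

Lemma orth_pair (d: U): H d -> adj d = d -> d != 0 ->
 exists d1 d2, [/\ H d1 /\ H d2, adj d1 = d1 /\ adj d2 = d2, d1 != 0, d2 != 0 &
 d1 * d2 = 0 /\ exists z1 z2, d1 = d * z1 /\ d2 = d * z2].
move=> Hd sd d0;have [r r0 h]:=aorth (fun=> Hd) (fun=> sd) (fun=> d0).
have [a [z [ha n0 n1 n2]]]:=h _ (exprn_gt0 2 r0).
have [H0 p0 e0]:=ha 0%N;have [H1 p1 e1]:=ha 1%N.
have [g1 [g2 [? ? ? ? [? hz]]]]:=orthogonal_parts H0 H1 p0 p1 r0 n0 n1 n2.
have [z1 [z2 [f1 f2]]]:=hz.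
exists g1, g2;split=> //;split=> //;exists ((z 0%N - z 1%N) * z1), ((z 0%N - z 1%N) * z2).
by rewrite f1 f2 e0 e1 -mulrBr !mulrA.
Qed.

(** Compressing [x] by [hcut w] for [w = adj x * x + x * adj x] changes it little and provides the
    local unit [lcut w], still orthogonal to [d]. Then [d] is split in two, because [nilp_approx]
    wants two orthogonal elements. *)
Lemma orth_approx (x d: U): H x -> H d -> adj d = d -> d != 0 ->
 x * d = 0 -> d * x = 0 -> GLnear H x.
move=> Hx Hd sd d0 xd dx.
apply: GLn_closed => eps eps0;pose dl:=eps ^+ 2 / 32.
have e2: 0 < eps ^+ 2 by rewrite exprn_gt0.
have dl0: 0 < dl by rewrite /dl;lra.
pose w:=adj x * x + x * adj x.
have Hsx:=her_adj hH Hx.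
have Hw: H w by apply: (herD hH);apply: (herM hH).
have pw: pos w by apply: posD;[exact: padjM|exact: padjM2].
have p1: pos (w - adj x * x) by rewrite /w addrC addKr;apply: padjM2.
have p2: pos (w - adj (adj x) * adj x) by rewrite adjK addrK;apply: padjM.
have c1:=hcut_close dl0 pw p1;have c2:=hcut_close dl0 pw p2.
have [[gs fs _] _ [fg gf _] _ _]:=cutP dl0 pw.
have [Hg Hf]:=her_cut hH dl0 pw Hw.
have wd: w * d = 0.
 have sxd: adj x * d = 0 by rewrite -{1}sd -adjM dx adj0.
 by rewrite /w mulrDl -!mulrA xd sxd !mulr0 addr0.
have [gd _]:=cut_mull0 dl0 pw wd;have [nf _]:=nrm_cut dl0 pw.
move: (hcut dl w) (lcut dl w) nf fg gf fs gs c1 c2 gd Hf Hg.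
move=> f g nf fg gf fs gs c1 c2 gd Hf Hg.
have [h1 [h2 [[Hd1 Hd2] [sd1 sd2] nz1 nz2 [d12 hz]]]]:=orth_pair Hd sd d0.
have [z1 [z2 [hz1 hz2]]]:=hz.
have gd1: g * h1 = 0 by rewrite hz1 mulrA gd mul0r.
have gd2: g * h2 = 0 by rewrite hz2 mulrA gd mul0r.
exists (f * x * f).
 apply: (@nilp_approx _ _ A_simple TD H hH _ g h1 h2) => //.
- by apply: (herM hH) => //;apply: (herM hH).
- by rewrite -(mulrA _ f) fg.
- by rewrite !mulrA gf.
have f1: nrm (x - f * x) ^+ 2 <= dl by rewrite -nrm_adj adjB adjM fs.
have -> : x - f * x * f = (x - x * f) + (x - f * x) * f by nc_ring.
have sm (z: U): nrm z ^+ 2 <= dl -> nrm z <= eps / 4.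
 move=> h;rewrite -(@ler_pXn2r _ 2) ?nnegrE ?nrmge0 //;last by lra.
 apply: le_trans h _;rewrite /dl expr_div_n;lra.
apply: le_lt_trans (nrmD _ _) _.
have:=nrmM_le (sm _ f1) nf;have:=sm _ c1;lra.
Qed.

End Orthogonal.

(** * Elements with annihilators, and finiteness of projections *)

Section Annihilators.
Variables (R: realType) (A: cstarAlgType R).
Local Notation U:=(unitz A).
Hypotheses (A_simple: simple A) (TD: tdiv A).
Variable H: set U.
Hypothesis hH: her H.

(** Otherwise [a] kills every sum of terms [u i * b * v i], and one of these is close to [a], while
    [a * a] is not small. *)
Lemma simple_prime (a b: U): inA a -> inA b -> adj a = a -> a != 0 -> b != 0 ->
 exists2 h, inA h & a * h * b != 0.
move=> aA bA sa a0 b0;apply: contrapT => no.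
have z h: inA h -> a * h * b = 0.
 by move=> hA;apply: contrapT => /eqP h0;apply: no;exists h.
have ap: 0 < nrm a by apply: nrm_gt0;apply/eqP.
have [k [u [v [uA vA uv]]]]:=simple_span A_simple bA b0 aA (divr_gt0 ap (ltr0n R 2)).
have e: a * (\sum_(i < k) u i * b * v i - a) = - (a * a).
 rewrite mulrBr mulr_sumr big1 ?sub0r // => i _.
 by rewrite !mulrA z ?mul0r.
have: nrm (a * a) <= nrm a * (nrm a / 2).
 by rewrite -nrmN -e;apply: nrmM_le => //;apply: ltW.
rewrite -{1}sa nrm_cstar expr2 ler_pM2l //;lra.
Qed.

Lemma GLher_unipotent n: H n -> n * n = 0 -> GLher H (1 + n).
move=> Hn nn;have [c1 cD cM cZ cL]:=her1C hH.
exists (1 - n);split.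
- by apply: cD => //;apply: her1_H.
- by apply: cD => //;apply: her1_H;apply: (herN hH).
- by rewrite mulrDl !mulrBr nn mul1r mulr1;nc_ring.
- by rewrite mulrBl !mulrDr nn mul1r mulr1;nc_ring.
Qed.

Lemma GLnear_scale x (r: R): 0 < r -> GLnear H (rc r *: x) -> GLnear H x.
move=> r0 h;apply: (@GLnear_mulr _ _ _ hH _ (rc r *: 1));last by rewrite -scalerAr mulr1.
exact: GLher_scal.
Qed.

Lemma GLher_adj x: GLher H x -> GLher H (adj x).
have adj1H y: her1 H y -> her1 H (adj y).
 move=> [h [k [Hh ->]]];exists (adj h), (Num.conj k).
 by rewrite adjD adjZ adj1;split=> //;apply: (her_adj hH).
move=> [y [h1 h2 h3 h4]];exists (adj y);split;try exact: adj1H.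
 by rewrite -adjM h4 adj1.
by rewrite -adjM h3 adj1.
Qed.

Lemma GLnear_adj x: GLnear H (adj x) -> GLnear H x.
move=> h eps /h[y hy xy];exists (adj y);first exact: GLher_adj.
by rewrite -nrm_adj adjB adjK.
Qed.

(* An invertible [W] turns the right annihilator [a] and the left annihilator [b]
   of [x] into a two-sided annihilator of [x W]. *)
Lemma orth_ann (x a b: U): H x -> H a -> H b -> adj a = a -> adj b = b ->
 a != 0 -> b != 0 -> x * a = 0 -> b * x = 0 -> a * b = 0 -> GLnear H x.
move=> Hx Ha Hb sa sb a0 b0 xa bx ab.
have ba: b * a = 0 by rewrite -sa -sb -adjM ab adj0.
have [h0 h0A n0]:=simple_prime (her_inA hH Ha) (her_inA hH Hb) sa a0 b0.
have p0: 0 < nrm (a * h0 * b) by apply: nrm_gt0;apply/eqP.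
pose h:=rc (nrm (a * h0 * b))^-1 *: h0.
have hA: inA h by apply: inAZ.
have [y yE]: exists y, y = a * h * b by eexists.
have y1: nrm y = 1.
 rewrite yE /h -scalerAr -scalerAl nrmR gtr0_norm ?invr_gt0 //.
 by rewrite mulVf // gt_eqF.
have Hy: H y by rewrite yE;apply: (her_mid hH).
have ysE: adj y = b * adj h * a by rewrite yE !adjM sa sb mulrA.
have Hys: H (adj y) by apply: (her_adj hH).
pose w:=adj y * y;have pw: pos w:=padjM y.
have nw: nrm w = 1 by rewrite nrm_cstar y1 expr1n.
have aw: a * w = 0 by rewrite /w ysE !mulrA ab !mul0r.
have wx: w * x = 0 by rewrite /w {2}yE -!mulrA bx !mulr0.
have Hw: H w by apply: (herM hH).
pose d: R:=1 / 4;have d0: 0 < d by rewrite /d;lra.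
have [_ Hk]:=her_cut hH d0 pw Hw;have [_ ak]:=cut_mulr0 d0 pw aw.
have [_ kx]:=cut_mull0 d0 pw wx;have [[_ sk _] _ [_ _ vk] _ _]:=cutP d0 pw.
have k0: hcut d w != 0 by apply: hcut_neq0;rewrite // nw /d;lra.
have [_ gc /(_ _ (her1C hH) (her1_H Hw)) H1g]:=high_inv d0 pw.
move: (hcut d w) Hk ak kx sk vk k0 gc H1g => k Hk ak kx sk vk k0 gc H1g.
pose c':=rc d^-1 *: (1 - k).
have sc': adj c' = c' by rewrite adjR adjB adj1 sk.
have ac': a * c' * b = 0 by rewrite -scalerAr mulrBr mulr1 ak subr0 -scalerAl ab scaler0.
pose z:=c' * adj y.
have zyk: z * y * k = k.
 by rewrite /z -(mulrA c') -/w -mulrA -scalerAl scalerAr scalerAl vk mulrA gc mul1r.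
have zk: z * k = 0 by rewrite /z ysE -!mulrA ak !mulr0.
have zz: z * z = 0.
 have -> : z * z = c' * b * adj h * (a * c' * b) * adj h * a by rewrite /z ysE !mulrA.
 by rewrite ac' !(mulr0, mul0r).
have yy: y * y = 0 by rewrite yE !mulrA -(mulrA _ b a) ba !(mulr0, mul0r).
have Hz: H z.
 rewrite -[z]adjK adjM sc' adjK;apply: (her_adj hH);apply: her1_mul => //.
 by have [_ _ _ cZ _]:=her1C hH;exact: cZ.
(* A rotation as a product of three elementary matrices: [z] undoes [y] on [k], so [W * k = y * k],
   and [x * y = 0] because [y] begins with [a]. *)
pose W:=(1 + y) * (1 - z) * (1 + y).
have GW: GLher H W.
 apply: GLherM => //;first apply: GLherM => //;apply: GLher_unipotent => //.
 by apply: (herN hH).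
 by rewrite mulrNN.
have Wk: W * k = y * k.
 have -> : W * k = (1 + y) * (k + y * k - z * k - z * y * k) by rewrite /W;nc_ring.
 rewrite zk zyk subr0 addrAC subrr add0r mulrDl mul1r mulrA yy mul0r addr0.
 by [].
apply: (GLnear_mulr hH GW);apply: (orth_approx A_simple TD hH (d:=k)) => //.
- by apply: her1_mul => //;case: GW => W' [].
- by rewrite -mulrA Wk yE !mulrA xa !mul0r.
- by rewrite mulrA kx mul0r.
Qed.

(** [aorth] replaces [a] and [b] by the nearly orthogonal [al] and [be]. Cutting [be] by [1 - f1]
    makes it exactly orthogonal to [f], but then it kills [x] only approximately; this is repaired
    by passing to [x - k1 * x], a small change. *)
Lemma annihilators (x a b: U): H x -> H a -> H b -> adj a = a -> adj b = b ->
 a != 0 -> b != 0 -> x * a = 0 -> b * x = 0 -> GLnear H x.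
move=> Hx Ha Hb sa sb a0 b0 xa bx;apply: GLn_closed => eps eps0.
pose dd i:=if i == 0%N then a else b.
have Hd i: H (dd i) by rewrite /dd;case: ifP.
have sd i: adj (dd i) = dd i by rewrite /dd;case: ifP.
have nd i: dd i != 0 by rewrite /dd;case: ifP.
have [r r0 AO]:=aorth TD hH Hd sd nd.
pose rho: R:=1 / 8;have rho0: 0 < rho by rewrite /rho;lra.
have X0: 0 < nrm x ^+ 2 + 1 by rewrite ltr_wpDl // sqr_ge0.
(* The first bound keeps [b1] larger than [rho]; the second makes [2 mu nrm x ^ 2 / rho], which
   bounds the square of the norm of [k1 * x], smaller than [eps ^ 2]. *)
pose mu:=Num.min (1 / 8) (rho * eps ^+ 2 / (4 * (nrm x ^+ 2 + 1))).
have mu0: 0 < mu.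
 rewrite lt_min;apply/andP;split;first lra.
 by rewrite divr_gt0 // mulr_gt0 // ?exprn_gt0 //;lra.
have mu1: mu <= 1 / 8 by rewrite ge_min lexx.
have mu2: mu * (4 * (nrm x ^+ 2 + 1)) <= rho * eps ^+ 2.
 by rewrite -ler_pdivlMr ?mulr_gt0 // ge_min lexx orbT.
have eta0: 0 < r ^+ 2 * (rho * mu ^+ 2) by rewrite !mulr_gt0 // exprn_gt0.
have [g [z [hg g0 g1 g01]]]:=AO _ eta0.
have [Hg0 pg0 e0]:=hg 0%N;have [Hg1 pg1 e1]:=hg 1%N.
have n0: 0 < nrm (g 0%N):=lt_le_trans r0 g0.
have n1: 0 < nrm (g 1%N):=lt_le_trans r0 g1.
pose al:=rc (nrm (g 0%N))^-1 *: g 0%N;pose be:=rc (nrm (g 1%N))^-1 *: g 1%N.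
have nal: nrm al = 1 by rewrite nrmR gtr0_norm ?invr_gt0 // mulVf // gt_eqF.
have nbe: nrm be = 1 by rewrite nrmR gtr0_norm ?invr_gt0 // mulVf // gt_eqF.
have pal: pos al by apply: posR => //;rewrite invr_ge0 ltW.
have pbe: pos be by apply: posR => //;rewrite invr_ge0 ltW.
have Hal: H al by apply: (herZ hH).
have Hbe: H be by apply: (herZ hH).
have xal: x * al = 0 by rewrite /al -scalerAr e0 mulrA xa mul0r scaler0.
have bex: be * x = 0.
 by rewrite -(pos_sa pbe) /be e1 adjR adjM sb -scalerAl -mulrA bx mulr0 scaler0.
have sbe:=pos_sa pbe.
have albe: nrm (al * be) <= rho * mu ^+ 2.
 rewrite /al /be -scalerAl -scalerAr !nrmR !gtr0_norm ?invr_gt0 //.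
 rewrite mulrA -invfM ler_pdivrMl ?mulr_gt0 //;apply: le_trans (ltW g01) _.
 rewrite ler_pM2r ?mulr_gt0 ?exprn_gt0 //;exact: ler_pM (ltW r0) (ltW r0) g0 g1.
pose f:=hcut rho al;pose f1:=lcut rho al.
have [[sf1 sf [pf1 pf1']] _ [ff1 _ _] _ _]:=cutP rho0 pal.
have [Hf1 Hf]:=her_cut hH rho0 pal Hal.
have nf1: nrm (1 - f1) <= 1 by apply: pos_nrm;rewrite // rc1 scale1r subKr.
have f1be: nrm (f1 * be) <= mu.
 rewrite -(@ler_pXn2r _ 2) ?nnegrE ?nrmge0 //;last exact: ltW.
 apply: le_trans (lcut_mul rho0 be pal) _;rewrite ler_pdivrMl //.
 rewrite sbe -mulrA -[leRHS]mul1r;apply: nrmM_le => //;rewrite nbe.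
 by [].
pose b1:=(1 - f1) * be * (1 - f1).
have s1f: adj (1 - f1) = 1 - f1 by rewrite adjB adj1 sf1.
have pb1: pos b1 by rewrite /b1 -{1}s1f;apply: pos_conj.
have bb1: nrm (be - b1) <= 2 * mu.
 have -> : be - b1 = f1 * be * (1 - f1) + be * f1 by rewrite /b1;nc_ring.
 apply: le_trans (nrmD _ _) _.
 have h1:=nrmM_le f1be nf1.
 have h2: nrm (be * f1) <= mu by rewrite -nrm_adj adjM sf1 sbe.
 lra.
have big: rho < nrm b1.
 have:=nrmD (be - b1) b1;rewrite subrK nbe /rho;lra.
pose k:=hcut rho b1;pose k1:=lcut rho b1.
have [[_ sk _] _ [kk1 _ _] _ _]:=cutP rho0 pb1.
have H1f: her1 H (1 - f1).
 exists (- f1), 1;rewrite scale1r addrC;split=> //;exact: (herN hH).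
have Hb1: H b1.
 rewrite /b1;apply: her1_mul => //;rewrite -[_ * be]adjK adjM s1f sbe.
 by apply: (her_adj hH);apply: her1_mul.
have [Hk1 Hk]:=her_cut hH rho0 pb1 Hb1;have [_ xf]:=cut_mulr0 rho0 pal xal.
exists (x - k1 * x);last first.
 rewrite subKr -(@ltr_pXn2r _ 2) ?nnegrE ?nrmge0 //;last exact: ltW.
 apply: le_lt_trans (lcut_mul rho0 x pb1) _;rewrite mulrC ltr_pdivrMr //.
 have h1: nrm (adj x * b1 * x) <= nrm x * (2 * mu * nrm x).
 rewrite -mulrA;apply: nrmM_le;first by rewrite nrm_adj.
 have -> : b1 * x = - ((be - b1) * x) by rewrite mulrBl bex sub0r opprK.
 by rewrite nrmN;apply: nrmM_le.
 apply: le_lt_trans h1 _.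
 have -> : nrm x * (2 * mu * nrm x) = 2 * (mu * nrm x ^+ 2) by rewrite expr2;ring.
 have h0: 0 <= mu * nrm x ^+ 2 by rewrite mulr_ge0 ?sqr_ge0 // ltW.
 move: mu2;rewrite (_: mu * _ = 4 * (mu * nrm x ^+ 2) + 4 * mu);last by ring.
 rewrite [rho * _]mulrC;lra.
have Hx1: H (x - k1 * x) by apply: (herB hH) => //;apply: (herM hH).
have nf: f != 0 by apply: hcut_neq0 => //;rewrite nal /rho;lra.
have nk: k != 0 by apply: hcut_neq0.
have xf1: (x - k1 * x) * f = 0 by rewrite mulrBl -mulrA xf mulr0 subrr.
have kx1: k * (x - k1 * x) = 0 by rewrite mulrBr mulrA kk1 subrr.
have fk: f * k = 0.
 have e: f * (1 - f1) = 0 by rewrite mulrBr mulr1 [f * f1]ff1 subrr.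
 by have []:=cut_mulr0 (y:=f) rho0 pb1 _;rewrite // /b1 !mulrA e !mul0r.
exact: (orth_ann Hx1 Hf Hk sf sk nf nk xf1 kx1 fk).
Qed.

(** No projection of [A] is infinite: a partial isometry [v] from [u] into [u] is onto. *)
Definition noinf:=forall u v: U, inA u -> inA v ->
 adj v * v = u -> u * u = u -> u * v = v -> v * adj v = u.

Hypothesis NI: noinf.

(** The cut [u] is then a unit of [H], so [x] is bounded below on it and [y = x + (1 - u)] is left
    invertible. [noinf] makes the isometry in its polar decomposition unitary, hence [y] is
    invertible. *)
Lemma linv_approx (x: U) (d: R): H x -> nrm x <= 1 -> 0 < d <= 1 ->
 (forall a, H a -> lcut d (adj x * x) * a = a) -> GLnear H x.
move=> Hx x1 /andP[d0 d1] hu;set h:=adj x * x in hu.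
have Hs:=her_adj hH;have ph: pos h:=padjM x.
have Hh: H h by apply: (herM hH) => //;apply: Hs.
have [[su _ _] [_ _ pv] _ _ _]:=cutP d0 ph;have [Hu _]:=her_cut hH d0 ph Hh.
have pu: pos (h - rc d *: lcut d h).
 by have:=posR (ltW d0) pv;rewrite scalerBr rcK //.
move: (lcut d h) hu pu Hu su => u hu pu Hu su.
have uu:=hu _ Hu.
have hu' a: H a -> a * u = a by move=> Ha;rewrite -[a]adjK -{1}su -adjM hu //;apply: Hs.
have [c1 cD cM cZ cL]:=her1C hH.
have [q qE]: exists q, q = 1 - u by eexists.
have uq: u + q = 1 by rewrite qE addrC subrK.
have H1u: her1 H q by rewrite qE;apply: cD => //;apply: her1_H;apply: (herN hH).
have comm a: her1 H a -> a * u = u * a.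
 by move=> [b [l [Hb ->]]];rewrite mulrDl mulrDr -scalerAl -scalerAr mul1r mulr1 hu // hu'.
have q1 a: H a -> q * a = 0 by move=> Ha;rewrite qE mulrBl mul1r hu // subrr.
have q2 a: H a -> a * q = 0 by move=> Ha;rewrite qE mulrBr mulr1 hu' // subrr.
have s1u: adj q = q by rewrite qE adjB adj1 su.
have qq: q * q = q by rewrite {2}qE mulrBr mulr1 q1 // subr0.
pose y:=x + q;have H1y: her1 H y by apply: cD => //;apply: her1_H.
have yy: adj y * y = h + q.
 by rewrite adjD s1u mulrDl !mulrDr q1 // (q2 _ (Hs _ Hx)) qq addr0 add0r.
have pyy: pos (adj y * y - rc d *: 1).
 have -> : adj y * y - rc d *: 1 = (h - rc d *: u) + rc (1 - d) *: q.
 by rewrite yy -uq rcD rcN rc1 scalerDl scale1r scaleNr scalerDr;nc_ring.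
 apply: posD => //;apply: posR;first by lra.
 by rewrite -qq;apply: pos_sqr.
have H1ys: her1 H (adj y).
 by rewrite adjD s1u;apply: cD => //;apply: her1_H;apply: Hs.
have [k [Hk _ kyy sk]]:=pinv_ (her1C hH) (cM _ _ H1ys H1y) (padjM y) d0 pyy.
have ly: k * adj y * y = 1 by rewrite -mulrA.
have [l [Hl sl iso [l' [ll' l'l]]]]:=linv_polar ly (her1C hH) (cM _ _ H1ys H1y).
have [w wdef]: exists w, w = y * l by eexists.
have H1w: her1 H w by rewrite wdef;apply: cM.
have ww: adj w * w = 1 by rewrite wdef.
have H1ws: her1 H (adj w) by rewrite wdef adjM sl;apply: cM.
have sv: adj (w * u) = u * adj w by rewrite adjM su.
have e1: adj (w * u) * (w * u) = u by rewrite sv -mulrA (mulrA (adj w)) ww mul1r.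
have e2: u * (w * u) = w * u by rewrite mulrA -(comm _ H1w) -mulrA uu.
have wuw:=NI (her_inA hH Hu) (inAMr w (her_inA hH Hu)) e1 uu e2.
rewrite sv -mulrA (mulrA u) uu mulrA in wuw.
(* [noinf] covers the corner of [u]; on [q] an element of [H + C 1] acts as a scalar. *)
have w1: w * adj w = 1.
 have [g [c [Hg wE]]]:=H1w.
 have wc: w * q = c *: q.
 by rewrite wE mulrDl q2 // add0r -scalerAl mul1r.
 have cw: q * w = c *: q by rewrite -wc qE mulrBl mulrBr mul1r mulr1 comm.
 have wc': adj w * q = (Num.conj c) *: q.
 by rewrite -{1}s1u -adjM cw adjZ s1u.
 have wc'': q * adj w = (Num.conj c) *: q by rewrite -{1}s1u -adjM wc adjZ s1u.
 have e: w * q * adj w = q.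
 have h1: c *: (Num.conj c *: q) = q by rewrite -wc' scalerAr -wc mulrA ww mul1r.
 by rewrite wc -scalerAl wc''.
 have -> : w * adj w = w * u * adj w + w * q * adj w by rewrite -mulrDl -mulrDr uq mulr1.
 by rewrite wuw e uq.
have yE: y = w * l' by rewrite wdef -mulrA ll' mulr1.
have Gy: GLher H y.
 exists (l * adj w);split=> //;first exact: cM.
- by rewrite mulrA -wdef.
- rewrite yE mulrA -(mulrA l) ww mulr1;exact: ll'.
apply: (GLn_closed) => eps eps0 /=;exists x;last by rewrite subrr nrm0.
move=> e e0;pose t:=e / 2;have t0: 0 < t by rewrite /t;lra.
(* On [u] this is [x]; on [q], where [x] vanishes, it is the small scalar [t]. *)
exists (y * (u + rc t *: q)).
 apply: GLherM => //;exists (u + rc t^-1 *: q).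
 have tt: rc t * rc t^-1 = 1 :> Cplx R by rewrite -rcM mulfV ?rc1 // gt_eqF.
 split;try by apply: cD;[exact: her1_H|exact: cZ].
- rewrite mulrDl !mulrDr uu -!scalerAl -!scalerAr q1 // q2 // qq !scaler0 addr0 add0r.
 by rewrite scalerA tt scale1r uq.
- rewrite mulrDl !mulrDr uu -!scalerAl -!scalerAr q1 // q2 // qq !scaler0 addr0 add0r.
 by rewrite scalerA mulrC tt scale1r uq.
have -> : x - y * (u + rc t *: q) = - (rc t *: q).
 rewrite /y mulrDr mulrDl hu' // q1 // addr0 -scalerAr mulrDl q2 // qq add0r.
 by rewrite opprD addNKr.
rewrite nrmN nrmR gtr0_norm //.
have u1:=proj_nrm s1u qq.
have:=ler_wpM2l (ltW t0) u1;rewrite mulr1 /t;lra.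
Qed.

(** Either a cut of [adj x * x] or of [x * adj x] is a unit of [H], and [linv_approx] applies to [x]
    or to its adjoint; or both cuts fail on some element, and the two defects give annihilators on
    both sides of the nearby [x * f]. *)
Lemma GLnear_all (x: U): H x -> GLnear H x.
move=> Hx0;pose r:=(nrm x + 1)^-1;have x0:=nrmge0 x.
have r0: 0 < r by rewrite invr_gt0;lra.
apply: (GLnear_scale r0);have x1: nrm (rc r *: x) <= 1.
 rewrite nrmR gtr0_norm // mulrC ler_pdivrMr;lra.
have: H (rc r *: x) by apply: (herZ hH).
move: (rc r *: x) x1 => {Hx0 r r0 x0} {}x x1 Hx.
apply: GLn_closed => eps eps0.
pose d:=Num.min 1 (eps ^+ 2 / 4);have e2: 0 < eps ^+ 2 by rewrite exprn_gt0.
have d0: 0 < d by rewrite lt_min ltr01;lra.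
have d1: d <= 1 by rewrite ge_min lexx.
have d2: d <= eps ^+ 2 / 4 by rewrite ge_min lexx orbT.
have Hs:=her_adj hH.
have xs1: nrm (adj x) <= 1 by rewrite nrm_adj.
have p1:=padjM x;have p2:=padjM2 x.
have dd: 0 < d <= 1 by rewrite d0.
case: (pselect (forall a, H a -> lcut d (adj x * x) * a = a)) => [h|].
 by exists x;[exact: linv_approx h|rewrite subrr nrm0].
move=> /existsNP[a /not_implyP[Ha na]].
case: (pselect (forall a, H a -> lcut d (x * adj x) * a = a)) => [h|].
 exists x;last by rewrite subrr nrm0.
 apply: GLnear_adj;apply: (linv_approx (Hs _ Hx) xs1 dd).
 by rewrite adjK.
move=> /existsNP[b /not_implyP[Hb nb]].
pose f:=hcut d (adj x * x);pose f':=hcut d (x * adj x).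
pose u:=lcut d (adj x * x);pose u':=lcut d (x * adj x).
have [[su _ _] _ [fu _ _] _ _]:=cutP d0 p1;have [[su' _ _] _ [_ uf' _] _ _]:=cutP d0 p2.
have hxx: H (adj x * x) by apply: (herM hH) => //;apply: Hs.
have hxx': H (x * adj x) by apply: (herM hH) => //;apply: Hs.
have ann (v c: U): H v -> adj v = v -> H c -> v * c <> c ->
 let s:=(1 - v) * (c * adj c) * (1 - v) in [/\ H s, adj s = s & s != 0].
 move=> Hv sv Hc nc s;have sv1: adj (1 - v) = 1 - v by rewrite adjB adj1 sv.
 have Hvc: H ((1 - v) * c) by rewrite mulrBl mul1r;apply: (herB hH) => //;apply: (herM hH).
 have sE: s = adj (adj ((1 - v) * c)) * adj ((1 - v) * c) by rewrite adjK adjM sv1 /s !mulrA.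
 split;rewrite sE.
- by apply: (herM hH);rewrite ?adjK //;apply: Hs.
- by rewrite adjM adjK.
- apply/eqP => /cstar0 /(congr1 adj);rewrite adjK adj0 mulrBl mul1r => /eqP.
 by rewrite subr_eq0 => /eqP /esym.
have [Hu Hf]:=her_cut hH d0 p1 hxx;have [Hu' _]:=her_cut hH d0 p2 hxx'.
have [H1 s1 n1]:=ann _ _ Hu su Ha na;have [H2 s2 n2]:=ann _ _ Hu' su' Hb nb.
have xf: f' * x = x * f by apply: high_inter => //;rewrite mulrA.
exists (x * f).
 apply: (annihilators _ H1 H2 s1 s2 n1 n2).
- exact: (herM hH).
- by rewrite !mulrA -(mulrA x) (mulrBr f) mulr1 fu subrr mulr0 !mul0r.
- by rewrite -xf !mulrA -(mulrA _ _ f') (mulrBl f') mul1r uf' subrr mulr0 mul0r.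
have p: pos (adj x * x - adj x * x) by rewrite subrr;apply: pos0.
have:=hcut_close d0 p1 p;rewrite -/f => h.
rewrite -(@ltr_pXn2r _ 2) ?nnegrE ?nrmge0 //;[lra|exact: ltW].
Qed.

End Annihilators.
Section DenseNorm.
Variables (R: realType) (A: cstarAlgType R).

Lemma dense_nA (S: set A) x (e: R): dense S -> 0 < e -> exists2 y, S y & nA (x - y) < e.
move=> dS e0;have e0': 0 < rc e :> Cplx R by rewrite -rc0 rc_lt.
have xb: (ball x (rc e))^° x by apply: nbhsx_ballx.
have [y [/interior_subset yb Sy]]:=dS _ (ex_intro _ x xb) (open_interior _).
by exists y => //;move: yb;rewrite -ball_normE /ball_ /= nAE rc_lt.
Qed.

Lemma nA_dense (S: set A): (forall x (e: R), 0 < e -> exists2 y, S y & nA (x - y) < e) -> dense S.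
move=> h O [x Ox] oO;have:=oO;rewrite openE => /(_ x Ox) /nbhs_ballP [e /= /cplx_pos[r r0 ->] H].
have [y Sy xy]:=h x r r0;exists y;split=> //;apply: H.
by rewrite -ball_normE /ball_ /= nAE rc_lt.
Qed.
End DenseNorm.

(** * A proper isometry makes the algebra purely infinite *)

Section Infinite.
Variables (R: realType) (A: cstarAlgType R).
Local Notation U:=(unitz A).
Hypotheses (A_simple: simple A) (TD: tdiv A).

Lemma inA_her: her (@inA R A).
split;split=> //;[exact: inA0| |exact: inA_adj|exact: inA_lim| |].
- by move=> k x y hx hy;apply: inAD => //;apply: inAZ.
- by move=> x y hx _;apply: inAMl.
- by move=> x a y _ _;apply: inAMr.
Qed.

Lemma corner_fac (u r: U): u * u = u -> nrm (u * (u - r) * u) < 1 ->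
 exists y, u = u * y * u * r * u.
move=> uu h1;set h:=u * (u - r) * u in h1.
have [y [_ _ y2]]:=neumann h1 (S:=setT) I I (fun _ _ _ _ => I) (fun _ _ _ _ => I) (fun _ _ _ _ => I).
exists y;have e: (1 - h) * u = u * r * u.
 by rewrite mulrBl mul1r /h -!(mulrA _ u u) uu mulrBr mulrBl uu uu subKr.
by rewrite -!mulrA [u * (r * u)]mulrA -e (mulrA y) y2 mul1r uu.
Qed.

Lemma exact_span (u d: U): inA u -> u * u = u -> inA d -> d != 0 ->
 exists k (a b: nat -> U), [/\ forall i, inA (a i), forall i, inA (b i) &
 u = \sum_(i < k) a i * d * b i].
move=> uA uu dA d0;pose e:=(nrm u ^+ 2 + 1)^-1.
have E0: 0 < nrm u ^+ 2 + 1 by rewrite ltr_wpDl // sqr_ge0.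
have e0: 0 < e by rewrite invr_gt0.
have [k [a [b [aA bA ab]]]]:=simple_span A_simple dA d0 uA e0.
set r :=\sum_(i < k) _ in ab;have h1: nrm (u * (u - r) * u) < 1.
 have h: nrm (u * (u - r) * u) <= nrm u * e * nrm u.
 by apply: nrmM_le => //;apply: nrmM_le => //;rewrite nrmC ltW.
 apply: le_lt_trans h _;rewrite mulrAC -expr2 /e ltr_pdivrMr //;lra.
have [y yE]:=corner_fac uu h1.
exists k, (fun i => u * y * u * a i), (fun i => b i * u);split=> [i|i|].
- exact: inAMr.
- exact: inAMl.
- by rewrite {1}yE /r mulr_sumr mulr_suml;apply: eq_bigr => i _;rewrite !mulrA.
Qed.

(** For [w = s * k], [s] the root of [d], the factorization [u = l * s * w] bounds [adj w * w] below
    in the corner of [u]. So [c = adj w * w + (1 - u)] is invertible, and its inverse root [t],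
    which commutes with [u], normalizes [k * u] to [x]. *)
Lemma adj_root (u d l k: U): inA u -> adj u = u -> u * u = u ->
 pos d -> u = l * d * k -> k * u = k -> exists2 x, inA x & adj x * d * x = u.
move=> uA su uu pd ulk ku;have [s [ss ps s2 _]]:=psqrt pd.
pose w:=s * k;have wu: w * u = w by rewrite /w -mulrA ku.
have ww: adj w * w = adj k * d * k by rewrite /w adjM ss -s2 !mulrA.
pose r:=nrm (l * s) + 1;have r0: 0 < r by rewrite /r ltr_wpDl // nrmge0.
have r1: 1 <= r by rewrite /r lerDr nrmge0.
have q0: 0 < (r ^+ 2)^-1 by rewrite invr_gt0 exprn_gt0.
have q1: (r ^+ 2)^-1 <= 1 by rewrite invf_le1 ?exprn_gt0 // expr_ge1 // ltW.
have pq: pos (adj w * w - rc (r ^+ 2)^-1 *: u).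
 have: pos (rc (r ^+ 2) *: 1 - adj (l * s) * (l * s)) by apply: adjM_le;rewrite /r lerDl.
 move=> /(pos_conj w)/(posR (ltW q0));congr pos.
 have lsw: l * s * w = u by rewrite ulk -s2 /w !mulrA.
 rewrite mulrBr mulrBl -scalerAr -scalerAl mulr1 scalerBr scalerA -rcM mulVf ?gt_eqF ?exprn_gt0 //.
 rewrite rc1 scale1r;congr (_ - _ *: _).
 have -> : adj w * (adj (l * s) * (l * s)) * w = adj (l * s * w) * (l * s * w).
 by rewrite (adjM (l * s)) !mulrA.
 by rewrite lsw su uu.
pose c:=adj w * w + (1 - u).
have p1u: pos (1 - u).
 have -> : 1 - u = (1 - u) * (1 - u) by rewrite mulrBr mulr1 mulrBl mul1r uu subrr subr0.
 by apply: pos_sqr;rewrite adjB adj1 su.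
have pc: pos c by apply: posD => //;apply: padjM.
have pcq: pos (c - rc (r ^+ 2)^-1 *: 1).
 have -> : c - rc (r ^+ 2)^-1 *: 1 = (adj w * w - rc (r ^+ 2)^-1 *: u) + rc (1 - (r ^+ 2)^-1) *: (1 - u).
 by rewrite /c rcD rcN rc1 scalerDl scale1r scaleNr scalerBr;nc_ring.
 by apply: posD => //;apply: posR => //;lra.
have cT: subalg (@setT U) by [].
have [g [_ cg gc sg]]:=pinv_ cT I pc q0 pcq.
have pg: pos g by rewrite -[g]mul1r -gc -[g in g * c]sg;apply: pos_conj.
have [t [st _ t2 lt]]:=psqrt pg.
have uw: u * (adj w * w) = adj w * w by rewrite mulrA -{1}su -adjM wu.
have wwu: adj w * w * u = adj w * w by rewrite -mulrA wu.
have uc: u * c = c * u by rewrite /c mulrDr mulrDl uw wwu mulrBr mulrBl mulr1 mul1r.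
have ug: u * g = g * u.
 by rewrite -[LHS]mul1r -gc -(mulrA g) (mulrA c) -uc -(mulrA u) cg mulr1.
have tu: t * u = u * t by apply: lp_comm lt.
exists (k * u * t);first by apply: inAMl;apply: inAMr.
have wwc: adj w * w = c * u by rewrite -uc /c mulrDr uw mulrBr mulr1 uu subrr addr0.
rewrite !adjM st su ku !mulrA -(mulrA (t * u)) -(mulrA (t * u)) -ww.
rewrite -(mulrA t) uw wwc -mulrA -(mulrA c) -tu.
have tc: t * c = c * t by apply: lp_comm lt;rewrite gc cg.
by rewrite mulrA tc -mulrA (mulrA t) t2 mulrA cg mul1r.
Qed.

Section Isometry.
Variables (u v: U).
Hypotheses (uA: inA u) (vA: inA v) (vv: adj v * v = u) (uu: u * u = u) (uv: u * v = v).
Let q:=u - v * adj v.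

Lemma iso_facts: [/\ adj u = u, v * u = v, q * v = 0 & adj v * q = 0] /\
 [/\ q * q = q, u * q = q, adj q = q & inA q].
have su: adj u = u by rewrite -vv adjM adjK.
have vu: v * u = v.
 apply/eqP;rewrite -subr_eq0;apply/eqP;apply: cstar0.
 have e1: u * adj v * (v * u) = u by rewrite mulrA -(mulrA u) vv !uu.
 have e2: u * adj v * v = u by rewrite -mulrA vv uu.
 have e3: adj v * (v * u) = u by rewrite mulrA vv uu.
 by rewrite adjB adjM su mulrBl !mulrBr e1 e2 e3 vv !subrr.
have qv: q * v = 0 by rewrite /q mulrBl uv -mulrA vv vu subrr.
have sq: adj q = q by rewrite /q adjB su adjM adjK.
have uq: u * q = q by rewrite /q mulrBr uu mulrA uv.
have vq: adj v * q = 0 by rewrite -sq -adjM qv adj0.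
split;split=> //;last by apply: inAD => //;apply: inAN;apply: inAMl.
by rewrite {1}/q mulrBl uq -mulrA vq mulr0 subr0.
Qed.

Lemma shift_orth i j: q * (adj v ^+ j * v ^+ i) * q = if i == j then q else 0.
have [[su vu qv vq] [qq uq sq qA]]:=iso_facts.
have uvq i': u * (v ^+ i' * q) = v ^+ i' * q.
 by case: i' => [|i'];rewrite ?expr0 ?mul1r // exprS -mulrA mulrA uv.
elim: i j => [|i IH] [|j].
- by rewrite !expr0 mulr1 mulr1 qq.
- by rewrite exprSr expr0 mulr1 !mulrA -mulrA vq mulr0.
- by rewrite expr0 mul1r exprS !mulrA qv !mul0r.
- rewrite eqSS -(IH j) exprSr exprS -(mulrA (adj v ^+ j)) (mulrA (adj v)) vv -!(mulrA q).
 by rewrite -!(mulrA (adj v ^+ j)) -(mulrA u) uvq.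
Qed.

(** [u] is a sum of [m] terms [a i * q * b i], and the translates [v ^+ j * q] are orthogonal. Copy
    [l] uses the translates with [j] from [m * l] to [m * l + m - 1]. *)
Lemma orthogonal_copies: q != 0 -> exists T T': nat -> U,
 [/\ forall l, inA (T l), forall l, inA (T' l) &
 forall l l', T' l * u * T l' = if l == l' then u else 0].
move=> q0;have [[su vu qv vq] [qq uq sq qA]]:=iso_facts.
have [m [a [b [aA bA ab]]]]:=exact_span uA uu qA q0.
exists (fun l => \sum_(i < m) v ^+ (m * l + i) * q * b i),
 (fun l => \sum_(i < m) a i * q * adj v ^+ (m * l + i));split.
- by move=> l;apply: (inA_sum (F:=fun i => v ^+ (m * l + i) * q * b i)) => i _;apply: inAMr.
- move=> l;apply: (inA_sum (F:=fun i => a i * q * adj v ^+ (m * l + i))) => i _.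
 by apply: inAMl;apply: inAMr.
move=> l l';have uvq i': u * (v ^+ i' * q) = v ^+ i' * q.
 by case: i' => [|i'];rewrite ?expr0 ?mul1r // exprS -mulrA mulrA uv.
have term (i j: 'I_m): a i * q * adj v ^+ (m * l + i) * u * (v ^+ (m * l' + j) * q * b j) =
 if (i == j) && (l == l') then a i * q * b i else 0.
 have -> : a i * q * adj v ^+ (m * l + i) * u * (v ^+ (m * l' + j) * q * b j) =
 a i * (q * (adj v ^+ (m * l + i) * v ^+ (m * l' + j)) * q) * b j.
 rewrite -!mulrA;congr (_ * (_ * (_ * _)));rewrite !mulrA -!(mulrA u).
 by rewrite mulrA uvq.
 rewrite shift_orth.
 have -> : (m * l' + j == m * l + i)%N = (i == j) && (l == l').
 apply/eqP/andP => [e|[/eqP -> /eqP ->] //].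
 have m0: (0 < m)%N by apply: leq_ltn_trans (ltn_ord i).
 have:=congr1 (modn^~ m) e;rewrite !(mulnC m) !modnMDl !modn_small // => ji.
 have:=congr1 (divn^~ m) e;rewrite !(mulnC m) !divnMDl // !divn_small // !addn0 => ->.
 by split;apply/eqP => //;apply/val_inj.
 have [->|_] /= := eqVneq i j;last by rewrite mulr0 mul0r.
 by case: ifP => _;rewrite ?mulr0 ?mul0r.
rewrite -mulrA mulr_suml;under eq_bigr do rewrite mulrA mulr_sumr.
under eq_bigr => i _ do under eq_bigr => j _ do rewrite term.
case: ifP => [_|ll];last by rewrite big1 // => i _;rewrite big1 // => j _;rewrite andbF.
rewrite [RHS]ab;apply: eq_bigr => i _;rewrite (bigD1 i) //= eqxx big1 ?addr0 // => j ji.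
by rewrite eq_sym (negPf ji).
Qed.
End Isometry.

(** Orthogonal copies turn sums into single products. The [p i] do so for
    [u = \sum a i * (d1 * d1) * b i], and the [T l] for the unity, which gives [E ^+ 6] times [u] as
    a product through [d1]. What remains of [u], namely [1 - E ^+ 6], factors through [t], hence
    through [d2]; both [d1] and [d2] are right multiples of [d]. *)
Lemma unity_fac (u v d: U): inA u -> inA v -> adj v * v = u -> u * u = u -> u * v = v ->
 u - v * adj v != 0 -> inA d -> pos d -> d != 0 -> exists l k: U, nrm (l * d * k - u) < 1 / 4.
move=> uA vA vv uu uv q0 dA pd d0.
have [[su _ _ _] _]:=iso_facts uA vA vv uu uv.
have [T [T' [TA T'A TT]]]:=orthogonal_copies uA vA vv uu uv q0.
have [d1 [d2 [[d1A d2A] [s1 s2] n1 n2 [d12 hz]]]]:=orth_pair TD inA_her dA (pos_sa pd) d0.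
have [z1 [z2 [d1z d2z]]]:=hz.
have dd0: d1 * d1 != 0 by apply: contra_neq n1 => h;apply: cstar0;rewrite s1.
have [k [a [b [aA bA ab]]]]:=exact_span uA uu (inAMl d1 d1A) dd0.
(* [N] counts the terms of the unity that belongs to [n] copies; each term gets its own [T l]. *)
pose n:=k.+1;have [N NE]: exists N, N = n.+1 by eexists.
have [|F [inF FA F_adj]]:=@adj_family _ _ [:: a;b;T;T';fun=> d1;fun=> u] N.
 by move=> [|[|[|[|[|[|j]]]]]] i //=;rewrite nth_nil;exact: inA0.
have N0: (0 < N)%N by rewrite NE.
have dF: d1 \in F:=inF 4%N 0%N isT N0;have uF: u \in F:=inF 5%N 0%N isT N0.
have aF i: (i < k)%N -> a i \in F by move/leqW/leqW;rewrite -NE;exact: (inF 0%N).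
have bF i: (i < k)%N -> b i \in F by move/leqW/leqW;rewrite -NE;exact: (inF 1%N).
have TF i: (i < N)%N -> T i \in F:=inF 2%N i isT.
have T'F i: (i < N)%N -> T' i \in F:=inF 3%N i isT.
have [e [t [p [X D]]]]:=div_ex TD FA d2A s2 n2 (ltn0Sn k).
have comm:=ad_comm D F_adj;have unity:=ad_unity D;have EF:=ad_EF D;have mulE:=ad_mul D.
have qp:=ad_qp D;have gX:=ad_gX D;have tbt:=adtbt D.
have tl:=ad_left D;have tbr a0:=@ad_right _ _ _ _ _ _ _ _ _ D a0 s2.
have [bt tz]:=ds_t D;have /choice[z zz]: forall j, exists z, t j = d2 * z.
 by move=> j;have [z _ ->]:=tz j;exists z.
have tE: adt t = toasy t by [].
clear D.
move: (adE e) (adt t) (adtb t) (adp p) (adq p) (adX X) (adZ X) tE comm unity EF mulE qp gX tbt tl tbr.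
move=> E s tb {}p q {}X Z tE comm unity EF mulE qp gX tbt tl tbr.
have [B BE]: exists B: U -> asyR U, forall f, B f = E * acst f by exists (fun f => E * acst f).
have commB f: f \in F -> bcent p q X Z (B f) by move=> fF;rewrite BE;apply: comm.
have BW f l: f \in F -> B f * Z l = Z l * B f by case/commB/(_ l).
have Bg f: f \in F -> B f * (q 0%N * p 0%N) = q 0%N * p 0%N * B f.
 by case/commB/(_ 0%N) => h1 h2 _ _;rewrite mulrA h2 -(mulrA (q 0%N)) h1 mulrA.
have Bpow m f g: f \in F -> B f * (E ^+ m * acst g) = E ^+ m.+1 * acst (f * g).
 by rewrite BE;exact: mulE.
have B1 f: B f = E ^+ 1 * acst f by rewrite BE expr1.
have BuX m: B u ^+ m.+1 = E ^+ m.+1 * acst u.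
 by elim: m => [|m IH];[rewrite !expr1 BE|rewrite exprS IH Bpow // uu].
pose Rr :=\sum_(i < k) B d1 * p i * B (b i).
pose Rl :=\sum_(i < k) B (a i) * q i * B d1.
have RR: Rl * Rr = E ^+ 4 * acst u * (q 0%N * p 0%N).
 rewrite /Rl /Rr mulr_suml ab.
 rewrite (acst_sum _ (fun i => a i * (d1 * d1) * b i)) mulr_sumr mulr_suml;apply: eq_bigr => i _.
 rewrite mulr_sumr (bigD1 i) //= big1 => [|j ji].
 have ik:=ltn_ord i;have in': (i < n)%N:=ltnW ik.
 have [h1 h2 _ _]:=commB _ dF i.
 have qpi:=qp i i in' in';rewrite eqxx in qpi.
 have -> : B (a i) * q i * B d1 * (B d1 * p i * B (b i)) = B (a i) * (B d1 * (B d1 * ((q i * p i) * B (b i)))).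
 have e': B d1 * (B d1 * (q i * p i * B (b i))) = q i * B d1 * (B d1 * p i * B (b i)).
 by rewrite -(mulrA (q i)) (mulrA (B d1) (q i)) h2 -(mulrA (q i)) (mulrA (B d1) (q i)) h2 !mulrA.
 by rewrite e' !mulrA.
 rewrite qpi -Bg ?bF // [B (b i)]B1 addr0.
 rewrite (mulrA (B d1) (E ^+ 1 * _)) Bpow // (mulrA (B d1)) Bpow // (mulrA (B (a i))) Bpow ?aF //.
 by rewrite !mulrA.
 have ik:=ltn_ord i;have jk:=ltn_ord j.
 have in': (i < n)%N:=ltnW ik;have jn: (j < n)%N:=ltnW jk.
 have [h1 h2 _ _]:=commB _ dF i;have [h3 h4 _ _]:=commB _ dF j.
 have:=qp i j in' jn;rewrite ifN;last by rewrite eq_sym.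
 move=> qpi.
 have -> : B (a i) * q i * B d1 * (B d1 * p j * B (b j)) = B (a i) * (q i * (B d1 * (B d1 * p j)) * B (b j)).
 by rewrite !mulrA.
 by rewrite h3 (mulrA (B d1)) h3 -(mulrA (p j)) (mulrA (q i)) qpi !(mul0r, mulr0).
pose M :=\sum_(l < N) B (T l) * X l;pose M' :=\sum_(l < N) Z l * B (T' l).
have MM: M' * (Rl * Rr) * M = E ^+ 6 * acst u.
 have WY: B u * (\sum_(l < N) Z l * X l) = B u by rewrite BE NE;apply: unity.
 have -> : E ^+ 6 * acst u = \sum_(l < N) Z l * (E ^+ 6 * acst u) * X l.
 have e6: B u ^+ 6 = B u ^+ 6 * (\sum_(l < N) Z l * X l) by rewrite exprSr -mulrA WY.
 rewrite -BuX {1}e6 mulr_sumr;apply: eq_bigr => l _.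
 rewrite mulrA;congr (_ * _);elim: (6%N) => [|m IH];first by rewrite mul1r mulr1.
 by rewrite exprSr -mulrA BW // mulrA IH -mulrA.
 have Bu m m' g: B u ^+ m.+1 * (E ^+ m' * acst g) = E ^+ (m.+1 + m') * acst (u * g).
 elim: m => [|m IH];first by rewrite expr1 Bpow.
 by rewrite exprS -mulrA IH Bpow // mulrA uu.
 have term (l j: 'I_N): Z l * B (T' l) * (E ^+ 4 * acst u * (q 0%N * p 0%N)) * (B (T j) * X j) =
 if l == j :> nat then Z l * (E ^+ 6 * acst u) * X j else 0.
 have -> : Z l * B (T' l) * (E ^+ 4 * acst u * (q 0%N * p 0%N)) * (B (T j) * X j) =
 Z l * (B (T' l) * (E ^+ 4 * acst u * (q 0%N * p 0%N * B (T j)))) * X j by rewrite !mulrA.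
 rewrite -Bg ?TF // -BuX [B (T j)]B1 (mulrA (B u ^+ 4)) Bu mulrA Bpow ?T'F // mulrA TT.
 case: ifP => _;last by rewrite acst0 mulr0 mul0r mulr0 mul0r.
 by rewrite -(mulrA (Z l)) -(mulrA (E ^+ _ * _)) gX mulrA.
 rewrite /M' /M RR mulr_suml mulr_suml;apply: eq_bigr => l _.
 rewrite mulr_sumr (bigD1 l) //= big1 => [|j jl];first by rewrite term eqxx addr0.
 by rewrite term ifN // eq_sym.
pose KK:=Rr * M + s * acst u;pose LL:=M' * Rl + (\sum_(i < 6) E ^+ i) * tb.
have d21: d2 * d1 = 0 by rewrite -s1 -s2 -adjM d12 adj0.
have Rs: Rl * s = 0.
 rewrite /Rl mulr_suml big1 // => i _;rewrite -!mulrA (BE d1) -(mulrA E) tl // !mulr0 //.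
have tR: tb * Rr = 0.
 by rewrite /Rr mulr_sumr big1 // => i _;rewrite BE EF // !mulrA tbr // !mul0r.
have key: LL * KK = acst u.
 rewrite /LL /KK mulrDl !mulrDr.
 have -> : M' * Rl * (Rr * M) = E ^+ 6 * acst u by rewrite -MM !mulrA.
 have -> : M' * Rl * (s * acst u) = 0 by rewrite -!mulrA (mulrA Rl) Rs mul0r mulr0.
 have -> : (\sum_(i < 6) E ^+ i) * tb * (Rr * M) = 0 by rewrite -!mulrA (mulrA tb) tR mul0r mulr0.
 have -> : (\sum_(i < 6) E ^+ i) * tb * (s * acst u) = (\sum_(i < 6) E ^+ i) * (tb * s) * acst u.
 by rewrite !mulrA.
 rewrite tbt addr0 add0r mulrBr mulr1 mulr_suml.
 under [X in _ - X]eq_bigr do rewrite -exprSr.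
 rewrite mulrBl -mulrBl -mulrDl.
 have -> : E ^+ 6 + (\sum_(i < 6) E ^+ i - \sum_(i < 6) E ^+ i.+1) = 1.
 rewrite big_ord_recl [X in _ - X]big_ord_recr /= expr0;nc_ring.
 by rewrite mul1r.
(* Pulling [d1] to the left of [E] in [KK] leaves representatives [d1 * rho j + t j * u], which
   start with [d]. *)
pose P:=E * (\sum_(i < k) p i * B (b i)) * M;pose rho:=ofasy P.
have brho: bdd rho:=ofasy_bdd P.
have bLL: bdd (ofasy LL):=ofasy_bdd LL.
have bk: bdd (fun j => d1 * rho j + t j * u).
 by apply: bddD;apply: bddM => //;apply: bddC.
have kE: toasy (fun j => d1 * rho j + t j * u) = KK.
 rewrite toasyD;[|apply: bddM => //;exact: bddC|apply: bddM => //;exact: bddC].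
 rewrite !toasyM //;try exact: bddC;rewrite -tE ofasyK /KK /P /Rr;congr (_ + _).
 rewrite -[toasy (fun=> d1)]/(acst d1);have -> : \sum_(i < k) B d1 * p i * B (b i) =
 acst d1 * E * (\sum_(i < k) p i * B (b i)).
 by rewrite -EF // mulr_sumr;apply: eq_bigr => i _;rewrite (BE d1) mulrA.
 by rewrite !mulrA.
have nul: nulseq (fun j => ofasy LL j * (d1 * rho j + t j * u) - u).
 apply/(toasy_eq (the_asy U));[exact: bddM|exact: bddC|].
 by rewrite toasyM // kE ofasyK key.
have r4: 0 < 1 / 4 :> R by lra.
have [j /(_ j (leqnn j)) hj]:=nul _ r4;rewrite subr0 in hj.
exists (ofasy LL j), (z1 * rho j + z2 * z j * u).
have e': d * (z1 * rho j + z2 * z j * u) = d1 * rho j + t j * u.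
 by rewrite mulrDr !mulrA -d1z -d2z -zz.
by rewrite -mulrA e'.
Qed.

(** A dense ideal contains some [y] near [p], and [corner_fac] factors [p] through [y]. *)
Lemma Ped_projection (p: A): p ** p = p -> Ped A p.
move=> pp I [[I0 ID] IM] dI;pose P:=ui p;have PP: P * P = P by rewrite -uiM pp.
pose e:=(nrm P ^+ 2 + 1)^-1;have E0: 0 < nrm P ^+ 2 + 1 by rewrite ltr_wpDl // sqr_ge0.
have e0: 0 < e by rewrite invr_gt0.
have [y Iy py]:=dense_nA p dI e0;rewrite -ui_nrm uiB -/P in py.
have h1: nrm (P * (P - ui y) * P) < 1.
 have h: nrm (P * (P - ui y) * P) <= nrm P * e * nrm P.
 by apply: nrmM_le => //;apply: nrmM_le => //;rewrite ltW.
 by apply: le_lt_trans h _;rewrite mulrAC -expr2 /e ltr_pdivrMr //;lra.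
have [z zE]:=corner_fac PP h1.
have -> : p = p ** (z.1 ** p + z.2 *: p) ** y ** p.
 apply: ui_inj;rewrite [LHS]zE (uiM _ p) (uiM _ y) -[P * z * P]mulrA.
 by rewrite (_: z * P = ui (z.1 ** p + z.2 *: p)) ?(uiM p) //;exact: ui_mull.
exact: (IM p _ (IM _ y Iy).1).2.
Qed.

(** The witnesses are [b = u - v * adj v] and [c = v * adj v]: [v] puts [b + c = u] below [c], and
    [x * adj v] with [adj x * a * x = u] puts [c] below [a]. *)
Lemma pinf_isom (u v: U): inA u -> inA v -> adj v * v = u -> u * u = u ->
 u * v = v -> v * adj v <> u -> purely_infinite A.
move=> uA vA vv uu uv ne a a0 Pa pa.
have [[su vu qv vq] [qq uq sq qA]]:=iso_facts uA vA vv uu uv.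
have q0: u - v * adj v != 0 by rewrite subr_eq0 eq_sym;apply/eqP.
have pa': pos (ui a) by case: pa => x ->;rewrite uiM ui_adj;apply: padjM.
have na: ui a != 0 by apply/eqP => /ui_inj;exact: a0.
have [l [k lk]]:=unity_fac uA vA vv uu uv q0 (inA_ui a) pa' na.
have nu:=proj_nrm su uu.
have h1: nrm (u * (u - l * ui a * k) * u) < 1.
 have h: nrm (u * (u - l * ui a * k) * u) <= 1 * (1 / 4) * 1.
 by apply: nrmM_le => //;apply: nrmM_le => //;rewrite nrmC ltW.
 by apply: le_lt_trans h _;lra.
have [y yE]:=corner_fac uu h1.
have fac: u = u * y * u * l * ui a * (k * u) by rewrite {1}yE !mulrA.
have kuu: k * u * u = k * u by rewrite -mulrA uu.
have [x xA xu]:=adj_root uA su uu pa' fac kuu.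
case: uA xA vA => [u0 _ u0E] [x0 _ x0E] [v0 _ v0E].
have cv: ui (v0 ** star v0) = v * adj v by rewrite uiM ui_adj v0E.
have cu: ui (u0 - v0 ** star v0) = u - v * adj v by rewrite uiB cv u0E.
have vvv: v * adj v * (v * adj v) = v * adj v by rewrite mulrA -(mulrA v) vv vu.
have posP (p: A): adj (ui p) = ui p -> ui p * ui p = ui p -> Ped A p /\ positive p.
 move=> sp pp;have pp': p ** p = p by apply: ui_inj;rewrite uiM.
 split;first exact: Ped_projection.
 by exists p;apply: ui_inj;rewrite uiM ui_adj sp.
exists (u0 - v0 ** star v0), (v0 ** star v0);split.
- by move=> /(congr1 ui);rewrite cu ui0;apply/eqP.
- move=> /(congr1 ui);rewrite cv ui0 => v0';have v00: adj v = 0.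
 by apply: cstar0;rewrite adjK.
 by move/eqP: q0;apply;rewrite -vv v00 !(mul0r, mulr0) subrr.
- by apply: posP;rewrite cu.
- by apply: posP;rewrite cv // adjM adjK.
- split.
+ by apply: ui_inj;rewrite uiM cu cv mulrA qv mul0r ui0.
+ by apply: ui_inj;rewrite uiM cu cv -mulrA vq mulr0 ui0.
+ exists (fun=> v0);rewrite subrK;suff -> : star v0 ** (v0 ** star v0) ** v0 = u0 by apply: cvg_cst.
 by apply: ui_inj;rewrite !uiM ui_adj v0E u0E mulrA vv -mulrA vv.
+ exists (fun=> x0 ** star v0).
 suff -> : star (x0 ** star v0) ** a ** (x0 ** star v0) = v0 ** star v0 by apply: cvg_cst.
 apply: ui_inj;rewrite !uiM !ui_adj uiM ui_adj v0E x0E adjM adjK.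
 by rewrite !mulrA -(mulrA v) -(mulrA v) xu vu.
Qed.

End Infinite.

(** * A C*-subalgebra as an algebra of its own *)

Section Subalgebra.
Variables (R: realType) (A: cstarAlgType R) (B: set A).
Hypothesis hB: is_cstar_subalgebra B.

(** The proof is an argument of the type so that the instances, which depend on it, can be inferred
    from the type. *)
Definition csub (_: is_cstar_subalgebra B): Type :={x: A | `[< B x >]}.
Local Notation D:=(csub hB).
HB.instance Definition _:=Choice.copy D {x: A | `[< B x >]}.

Definition csubv (x: D): A:=val x.
Local Notation v:=csubv.

Lemma csub_in (x: D): B (v x). Proof. exact/asboolP/(valP x). Qed.
Definition csub_mk x (Bx: B x): D:=exist _ x (asboolT Bx).
Lemma csub_inj (x y: D): v x = v y -> x = y. Proof. exact: val_inj. Qed.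

Let B0: B 0. Proof. by case: hB => [[]]. Qed.
Let BL k x y: B x -> B y -> B (k *: x + y). Proof. by case: hB => [[_ h] _ _ _];apply: h. Qed.
Let BD x y: B x -> B y -> B (x + y). Proof. by move=> hx hy;rewrite -[x]scale1r;apply: BL. Qed.
Let BZ k x: B x -> B (k *: x). Proof. by move=> hx;rewrite -[_ *: _]addr0;apply: BL. Qed.
Let BN x: B x -> B (- x). Proof. by rewrite -scaleN1r;apply: BZ. Qed.
Let BM x y: B x -> B y -> B (x ** y). Proof. by case: hB => [_ _ h _];apply: h. Qed.
Let BS x: B x -> B (star x). Proof. by case: hB => [_ _ _ h];apply: h. Qed.

Definition csub_add (x y: D):=csub_mk (BD (csub_in x) (csub_in y)).
Definition csub_opp (x: D):=csub_mk (BN (csub_in x)).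
Definition csubZ k (x: D):=csub_mk (BZ k (csub_in x)).
Definition csubM (x y: D):=csub_mk (BM (csub_in x) (csub_in y)).
Definition csubS (x: D):=csub_mk (BS (csub_in x)).

Fact csub_addA: associative csub_add. Proof. by move=> x y z;apply/csub_inj/addrA. Qed.
Fact csub_addC: commutative csub_add. Proof. by move=> x y;apply/csub_inj/addrC. Qed.
Fact csub_add0: left_id (csub_mk B0) csub_add. Proof. by move=> x;apply/csub_inj/add0r. Qed.
Fact csub_addN: left_inverse (csub_mk B0) csub_opp csub_add. Proof. by move=> x;apply/csub_inj/addNr. Qed.
HB.instance Definition _:=GRing.isZmodule.Build D csub_addA csub_addC csub_add0 csub_addN.

Fact csub_scaleA k l (x: D): csubZ k (csubZ l x) = csubZ (k * l) x.
exact/csub_inj/scalerA. Qed.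
Fact csub_scale1: left_id 1 csubZ. Proof. by move=> x;apply/csub_inj/scale1r. Qed.
Fact csub_scaleDr: right_distributive csubZ +%R.
by move=> k x y;apply/csub_inj/scalerDr. Qed.
Fact csub_scaleDl (x: D): {morph csubZ^~ x: k l / k + l}.
by move=> k l;apply/csub_inj/scalerDl. Qed.
HB.instance Definition _:=GRing.Zmodule_isLmodule.Build (Cplx R) D
 csub_scaleA csub_scale1 csub_scaleDr csub_scaleDl.

Definition csub_norm (x: D): Cplx R :=`|v x|.
Fact csub_normD (x y: D): csub_norm (x + y) <= csub_norm x + csub_norm y.
exact: ler_normD. Qed.
Fact csub_normZ k (x: D): csub_norm (k *: x) = `|k| * csub_norm x.
exact: normrZ. Qed.
Fact csub_norm0 (x: D): csub_norm x = 0 -> x = 0.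
by move=> /normr0_eq0 h;apply: csub_inj. Qed.
HB.instance Definition _:=Lmodule_isNormed.Build (Cplx R) D csub_normD csub_normZ csub_norm0.

Lemma csub_ball (x y: D) (e: Cplx R): ball x e y <-> ball (v x) e (v y).
by rewrite -!ball_normE. Qed.

Fact csub_complete (F: set_system D): ProperFilter F -> cauchy F -> cvg F.
move=> FF cF;have cv: cauchy (v @ F).
 apply/cauchy_ballP => e e0;have /cauchy_ballP/(_ e e0)[[P Q] /= [FP FQ] PQ]:=cF.
 exists (v @` P, v @` Q) => /=.
 by split;[apply: filterS FP|apply: filterS FQ] => x;exists x.
 move=> [_ _] /= [[x Px <-] [y Qy <-]];apply/csub_ball;exact: (PQ (x, y)).
have /cvg_ex[l vl]: cvg (v @ F) by apply: cauchy_cvg.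
have Bl: B l.
 have cB: closed B by case: hB.
 apply: (closed_cvg _ cB _ _ vl);apply: filterS filterT => x _;exact: csub_in.
apply/cvg_ex;exists (csub_mk Bl);apply/cvg_ballP => e e0.
have /cvg_ballP/(_ e e0):=vl;apply: filterS => x;exact: (csub_ball (csub_mk Bl) x e).2.
Qed.
HB.instance Definition _:=Uniform_isComplete.Build D csub_complete.

Fact csub_mulA (x y z: D): csubM x (csubM y z) = csubM (csubM x y) z.
exact/csub_inj/cmulA. Qed.
Fact csub_mul_linearl k (x y z: D): csubM (k *: x + y) z = k *: csubM x z + csubM y z.
exact/csub_inj/cmul_linearl. Qed.
Fact csub_mul_linearr k (x y z: D): csubM z (k *: x + y) = k *: csubM z x + csubM z y.
exact/csub_inj/cmul_linearr. Qed.
Fact csub_anti k (x y: D) :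
 csubS (k *: x + y) = Num.conj k *: csubS x + csubS y.
exact/csub_inj/star_antilinear. Qed.
Fact csub_starK (x: D): csubS (csubS x) = x.
exact/csub_inj/starK. Qed.
Fact csub_star_mul (x y: D): csubS (csubM x y) = csubM (csubS y) (csubS x).
exact/csub_inj/star_cmul. Qed.
Fact csub_norm_mul (x y: D): `|csubM x y| <= `|x| * `|y|.
exact: normr_cmul. Qed.
Fact csub_norm_cstar (x: D): `|csubM (csubS x) x| = `|x| ^+ 2.
exact: normr_cstar. Qed.
HB.instance Definition _:=@isCstarAlgebra.Build R D csubM csubS
 csub_mulA csub_mul_linearl csub_mul_linearr csub_anti csub_starK csub_star_mul
 csub_norm_mul csub_norm_cstar.

Definition csub_cstar: cstarAlgType R:=D.

Lemma subalgebra_in_csub (P: cstarAlgType R -> Prop): P csub_cstar -> subalgebra_in P B.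
move=> PD;split=> //;exists csub_cstar, csubv;split=> //.
by apply/seteqP;split=> [_ [x _ <-]|x Bx];[exact: csub_in|exists (csub_mk Bx)].
Qed.

End Subalgebra.

(** * Stable rank one from division *)

Section Conclusion.
Variables (R: realType) (A: cstarAlgType R).
Local Notation U:=(unitz A).
Hypotheses (A_simple: simple A) (TD: tdiv A) (A_npi: ~ purely_infinite A).

Lemma noinf1: noinf A.
move=> u v uA vA vv uu uv;apply: contrapT => ne;apply: A_npi.
exact: (pinf_isom A_simple TD uA vA vv uu uv ne).
Qed.

Section OnSubset.
Variable B: set A.
Hypothesis BH: her (@ui R A @` B).
Let NI:=noinf1.

(** If [B] has its own unit [u], multiplying by [u] turns an invertible [b + k 1] of the outer
    unitization into the invertible [b + k u] of [B], without increasing distances to elements of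
    [B]. *)
Lemma GLnear_unital (u: A): B u -> (forall x, B x -> u ** x = x /\ x ** u = x) ->
 forall x (e: R), B x -> 0 < e ->
 exists y z, [/\ B y, B z, y ** z = u, z ** y = u & nA (x - y) < e].
move=> Bu hu x e Bx e0;have Bx': (@ui R A @` B) (ui x) by exists x.
have [y [z [y1 z1 yz zy]] xy]:=GLnear_all A_simple TD BH NI Bx' e0.
pose s (w: U): A:=w.1 + w.2 *: u.
have fst w: her1 (@ui R A @` B) w -> B w.1.
 by move=> [_ [k [[b Bb <-] ->]]];rewrite /= scaler0 addr0.
have BM k b: B b -> B (b + k *: u).
 move=> Bb;have [c Bc cE]: (@ui R A @` B) (ui (b + k *: u)).
 by rewrite uiD uiZ;apply: (herD BH);[exists b|apply: (herZ BH);exists u].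
 by rewrite -(ui_inj cE).
have su w: her1 (@ui R A @` B) w -> w * ui u = ui (s w).
 by move=> /fst Bw;rewrite ui_mull (hu _ Bw).2.
have us w: her1 (@ui R A @` B) w -> ui u * w = ui (s w).
 by move=> /fst Bw;rewrite ui_mulr (hu _ Bw).1.
have sM w w': her1 (@ui R A @` B) w -> her1 (@ui R A @` B) w' -> w * w' = 1 -> s w ** s w' = u.
 move=> h h' ww';apply: ui_inj;rewrite uiM -(su _ h) -(us _ h').
 by rewrite mulrA -(mulrA w) -uiM (hu u Bu).1 (su _ h) -(us _ h) -mulrA ww' mulr1.
exists (s y), (s z);split;[exact/BM/fst|exact/BM/fst|exact: sM|exact: sM|].
rewrite -ui_nrm uiB -su // -(hu x Bx).2 uiM -mulrBl.
have nu: nrm (ui u) <= 1.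
 have [c Bc cE]: (@ui R A @` B) (adj (ui u)) by apply: (her_adj BH);exists u.
 have uu: star u = u.
 move: cE;rewrite -ui_adj => /ui_inj cE;rewrite cE in Bc.
 by rewrite -{2}[u]starK -{2}(hu _ Bc).2 star_cmul starK (hu _ Bc).2.
 by apply: proj_nrm;rewrite -?ui_adj ?uu // -uiM (hu u Bu).1.
apply: le_lt_trans (nrmM _ _) _;apply: le_lt_trans xy.
by rewrite ler_piMr // nrmge0.
Qed.
End OnSubset.

(** The root lies in [A] because the square of its scalar part is zero. *)
Lemma pos_positive (a: A): pos (ui a) -> positive a.
move=> /psqrt[s [ss _ s2 _]];have /inAE[t _ tE]: s.2 = 0.
 have: (s * s).2 = 0 by rewrite s2.
 by rewrite uz_mul_2 => /eqP;rewrite mulf_eq0 orbb => /eqP.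
by exists t;apply: ui_inj;rewrite uiM ui_adj tE ss s2.
Qed.

Variable B: set A.
Hypotheses (hB: is_cstar_subalgebra B) (B_her: hereditary B).

(** Polarization: [x ** z] with [z = a ** y] is a combination of squares of [z + k *: star x] and of
    [S]. These squares are below [S + S], and [S] lies in [B] because [star z ** z] is below a
    multiple of [star y ** y]. *)
Lemma hereditary_mid x a y: B x -> B y -> B (x ** a ** y).
case: (hB) => [[B0 BL] cB BM BS] Bx By.
have BD p q: B p -> B q -> B (p + q) by move=> hp hq;rewrite -[p]scale1r;apply: BL.
have BZ k p: B p -> B (k *: p) by move=> hp;rewrite -[_ *: _]addr0;apply: BL.
have [z zE]: exists z, z = a ** y by eexists.
have [S SE]: exists S, S = star z ** z + x ** star x by eexists.
pose i: Cplx R :='i.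
have dom p b: B b -> pos (ui b) -> pos (ui p) -> pos (ui (b - p)) -> B p.
 by move=> Bb pb pp pbp;apply: (B_her Bb);exact: pos_positive.
have pS (w: A): pos (ui (star w ** w)) by rewrite uiM ui_adj;exact: padjM.
have pS' (w: A): pos (ui (w ** star w)) by rewrite uiM ui_adj;exact: padjM2.
have Bxx: B (x ** star x) by apply: BM => //;exact: BS.
have Byy: B (star y ** y) by apply: BM => //;exact: BS.
have BSS: B S.
 rewrite SE;apply: BD => //;apply: (dom _ (rc (nA a ^+ 2) *: (star y ** y))) => //;first exact: BZ.
 by rewrite uiZ;apply: posR (pS _);rewrite sqr_ge0.
 have:=pos_conj (ui y) (adjM_le (lexx (nrm (ui a))));rewrite ui_nrm;congr pos.
 by rewrite zE uiB uiZ !uiM !ui_adj uiM adjM mulrBr mulrBl -scalerAr mulr1 -scalerAl !mulrA.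
pose T:=adj (ui z) * adj (ui x);pose V:=ui x * ui z.
have E k: Num.conj k * k = 1 -> ui (star (z + k *: star x) ** (z + k *: star x)) = ui S + (k *: T + Num.conj k *: V).
 move=> kk;rewrite uiM ui_adj uiD uiZ ui_adj adjD adjZ adjK mulrDl !mulrDr -!scalerAl -!scalerAr scalerA kk scale1r.
 by rewrite [X in _ + X]addrC addrACA SE uiD !uiM !ui_adj.
have Bw k: Num.conj k * k = 1 -> B (star (z + k *: star x) ** (z + k *: star x)).
 move=> kk;apply: (dom _ (S + S)) => //;first exact: BD.
 by rewrite SE !uiD;do !apply: posD.
 have:=pS (z + (- k) *: star x);rewrite E;last by rewrite rmorphN mulrNN.
 by rewrite uiB uiD E // rmorphN !scaleNr;congr pos;nc_ring.
have ii: i * i = -1 by rewrite -[i * i]expr2 [i ^+ 2]sqrCi.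
have ci: Num.conj i * i = 1 by rewrite [Num.conj i]conjCi mulNr ii opprK.
have c1: Num.conj (1: Cplx R) * 1 = 1 by rewrite rmorph1 mulr1.
have -> : x ** a ** y = rc 2^-1 *: ((star (z + 1 *: star x) ** (z + 1 *: star x) - S) +
 i *: (star (z + i *: star x) ** (z + i *: star x) - S)).
 apply: ui_inj;rewrite uiZ uiD uiZ !uiB !E // !(addrC (ui S)) !addrK.
 have -> : i *: (i *: T + Num.conj i *: V) = V - T.
 by rewrite scalerDr !scalerA ii [i * _]mulrC ci scaleN1r scale1r addrC.
 rewrite rmorph1 !scale1r (_: T + V + (V - T) = V + V) ?half2 -?cmulA -?zE ?uiM //.
 by nc_ring.
have BN w: B w -> B (- w) by rewrite -scaleN1r;exact: BZ.
by apply/BZ/BD;[|apply: BZ];apply: BD;[exact: Bw|exact: BN|exact: Bw|exact: BN].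
Qed.

Lemma hereditary_her: her (@ui R A @` B).
case: (hB) => [[B0 BL] cB BM BS];split;split.
- by move=> _ [b _ <-];apply: inA_ui.
- by exists 0 => //;rewrite ui0.
- by move=> k _ _ [a Ba <-] [b Bb <-];exists (k *: a + b);rewrite ?uiD ?uiZ //;apply: BL.
- by move=> _ [b Bb <-];exists (star b);rewrite ?ui_adj //;apply: BS.
- move=> w x hw wx;have [a _ aE]: inA x.
 by apply: inA_lim wx => n;have [b _ <-]:=hw n;apply: inA_ui.
 have /choice[b hb] n: exists b, B b /\ ui b = w n by have [b ? ?]:=hw n;exists b.
 exists a => //;have ba: b @ \oo --> a.
 apply/cvg_nAP => e /wx[N H];exists N => n /H.
 by rewrite -aE -(hb n).2 -uiB ui_nrm.
 by apply: (closed_cvg _ cB _ _ ba);apply: nearW => n;case: (hb n).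
- by move=> _ _ [a Ba <-] [b Bb <-];exists (a ** b);rewrite ?uiM //;apply: BM.
- move=> _ _ _ [a Ba <-] [c _ <-] [b Bb <-];exists (a ** c ** b);rewrite ?uiM //.
 exact: hereditary_mid.
Qed.

End Conclusion.

Section Divisible.
Variables (R: realType) (A: cstarAlgType R).
Local Notation U:=(unitz A).
Hypotheses (A_simple: simple A) (TD: tdiv A) (A_npi: ~ purely_infinite A).

Lemma sr1_div :
 (unital A -> stable_rank_one A) /\ (~ unital A -> almost_stable_rank_one A).
split=> [[u hu]|_ B hB B_her].
 exists u => //;apply: nA_dense => x e e0.
 have sT: her (@ui R A @` setT) by exact: inA_her.
 have [y [z [_ _ yz zy xy]]]:=GLnear_unital A_simple TD A_npi sT (I: setT u) (fun x _ => hu x) (I: setT x) e0.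
 by exists y => //;exists z.
apply: (@subalgebra_in_csub R A B hB (@in_closure_GL_unitization R));set D:=csub_cstar hB.
have BH:=hereditary_her hB B_her.
have nD (d: D): nA d = nA (csubv d) by [].
split=> [u hu|_ d e e0].
 apply: nA_dense => x e e0.
 have hu' b: B b -> csubv u ** b = b /\ b ** csubv u = b.
 move=> Bb;have [h1 h2]:=hu (csub_mk hB Bb).
 by split;[have:=congr1 (@csubv _ _ _ _) h1|have:=congr1 (@csubv _ _ _ _) h2].
 have [y [z [By Bz yz zy xy]]] :=
 GLnear_unital A_simple TD A_npi BH (csub_in u) hu' (csub_in x) e0.
 exists (csub_mk hB By) => //;exists (csub_mk hB Bz).
 by split;apply: csub_inj.
have Bd: (@ui R A @` B) (ui (csubv d)) by exists (csubv d) => //;exact: csub_in.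
have [y [z [y1 z1 yz zy]] xy]:=GLnear_all A_simple TD BH (noinf1 A_simple TD A_npi) Bd e0.
have [_ [k [[b Bb <-] yE]]]:=y1;have [_ [l [[c Bc <-] zE]]]:=z1.
have E1 w (m: Cplx R): ui w + m *: 1 = (w, m) :> U.
 by apply: uz_eq => /=;rewrite ?scaler0 ?addr0 // add0r;exact: mulr1.
rewrite E1 in yE;rewrite E1 in zE.
exists (csub_mk hB Bb, k);split.
 exists (csub_mk hB Bc, l);split.
 move: yz;rewrite yE zE => -[e1 e2];congr pair => //;exact: csub_inj.
 by move: zy;rewrite yE zE => -[e1 e2];congr pair => //;exact: csub_inj.
(* The norm on the unitization of [B] is a supremum over the unit ball of [B] only, hence at most
   the operator norm on [A]. *)
apply: le_lt_trans xy;rewrite /unitization_norm;apply: ge_sup.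
 by eexists;exists 0 => //=;rewrite normr0.
move=> _ [f /= f1 <-].
have -> : complex.Re (`|(d - csub_mk hB Bb) ** f + - k *: f| : R[i]) =
 nA (uz_act (ui (csubv d) - y) (csubv f)).
 by rewrite yE /uz_act /= sub0r.
apply: le_trans (opn_ub _ _) _;last by change (opn (ui (csubv d) - y) <= uz_nrm (ui (csubv d) - y));rewrite le_max lexx orbT.
by rewrite -nD -rc_le -nAE.
Qed.

End Divisible.

Notation "M ^h" := (map_mx Num.conj (M^T)) (at level 8, format "M ^h"): ring_scope.

(** * Norm bounds, spectral calculus and paths of matrices *)

Section MatrixNorm.
Variable R: realType.
Local Notation C:=(Cplx R).

Lemma hmK m n (M: 'M[C]_(m, n)): M^h^h = M.
by apply/matrixP => i j;rewrite !mxE conjCK. Qed.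
Lemma hmM m n p (M: 'M[C]_(m, n)) (N: 'M[C]_(n, p)): (M *m N)^h = N^h *m M^h.
by rewrite trmx_mul map_mxM. Qed.
Lemma hmD m n (M N: 'M[C]_(m, n)): (M + N)^h = M^h + N^h.
by apply/matrixP => i j;rewrite !mxE rmorphD. Qed.
Lemma hmN m n (M: 'M[C]_(m, n)): (- M)^h = - M^h.
by apply/matrixP => i j;rewrite !mxE rmorphN. Qed.
Lemma hmB m n (M N: 'M[C]_(m, n)): (M - N)^h = M^h - N^h.
by rewrite hmD hmN. Qed.
Lemma hmZ m n k (M: 'M[C]_(m, n)): (k *: M)^h = Num.conj k *: M^h.
by apply/matrixP => i j;rewrite !mxE rmorphM. Qed.
Lemma hm0 m n: (0: 'M[C]_(m, n))^h = 0.
by apply/matrixP => i j;rewrite !mxE rmorph0. Qed.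
Lemma hm1 n: (1%:M: 'M[C]_n)^h = 1%:M.
by apply/matrixP => i j;rewrite !mxE eq_sym rmorph_nat. Qed.
Lemma hm_sum (I: Type) (s: seq I) (P: pred I) m n (F: I -> 'M[C]_(m, n)) :
 (\sum_(i <- s | P i) F i)^h = \sum_(i <- s | P i) (F i)^h.
exact: (big_morph (fun M: 'M[C]_(m, n) => M^h) (@hmD m n) (@hm0 m n)). Qed.

Definition sqn n (v: 'rV[C]_n): R :=\sum_j absC (v 0 j) ^+ 2.

Lemma sqnE n (v: 'rV[C]_n): rc (sqn v) = (v *m v^h) 0 0.
by rewrite rc_sum mxE;apply: eq_bigr => j _;rewrite absC_sqr !mxE. Qed.
Lemma sqn_ge0 n (v: 'rV[C]_n): 0 <= sqn v.
by apply: sumr_ge0 => j _;rewrite sqr_ge0. Qed.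
Lemma sqn_eq0 n (v: 'rV[C]_n): sqn v = 0 -> v = 0.
move=> h;apply/rowP => j;rewrite mxE;apply: absC_eq0;apply/eqP.
rewrite -sqrf_eq0;apply/eqP;apply: (psumr_eq0P _ h) => // i _;exact: sqr_ge0.
Qed.
Lemma sqnZ n k (v: 'rV[C]_n): sqn (k *: v) = absC k ^+ 2 * sqn v.
by rewrite mulr_sumr;apply: eq_bigr => j _;rewrite mxE absCM exprMn. Qed.
Lemma sqn0 n: sqn (0: 'rV[C]_n) = 0.
by rewrite /sqn big1 // => j _;rewrite mxE absC0 expr0n. Qed.

(** The weight [s] is left free: with [s = b / a] the sum over the entries becomes the triangle
    inequality [opbD]. *)
Lemma absC_sqrD (k l: C) (s: R): 0 < s ->
 absC (k + l) ^+ 2 <= (1 + s) * absC k ^+ 2 + (1 + s^-1) * absC l ^+ 2.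
move=> s0;have h: absC (k + l) ^+ 2 <= (absC k + absC l) ^+ 2.
 by rewrite lerXn2r ?nnegrE ?addr_ge0 ?abs0 // absCD.
apply: le_trans h _;rewrite -subr_ge0.
have -> : (1 + s) * absC k ^+ 2 + (1 + s^-1) * absC l ^+ 2 - (absC k + absC l) ^+ 2 =
 s^-1 * (s * absC k - absC l) ^+ 2 by field;rewrite gt_eqF.
by rewrite mulr_ge0 ?sqr_ge0 // invr_ge0 ltW.
Qed.
Lemma sqnD n (u v: 'rV[C]_n) (s: R): 0 < s -> sqn (u + v) <= (1 + s) * sqn u + (1 + s^-1) * sqn v.
by move=> s0;rewrite /sqn !mulr_sumr -big_split;apply: ler_sum => j _;rewrite mxE absC_sqrD.
Qed.

(* Matrices act on row vectors from the right. *)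
Definition opb n (c: R) (M: 'M[C]_n):=forall v, sqn (v *m M) <= c ^+ 2 * sqn v.

Lemma opb_le n c d (M: 'M[C]_n): 0 <= c -> c <= d -> opb c M -> opb d M.
move=> c0 cd h v;apply: le_trans (h v) _;rewrite ler_wpM2r ?sqn_ge0 //.
by rewrite lerXn2r // nnegrE // (le_trans c0).
Qed.
Lemma opb0 n (M: 'M[C]_n): opb 0 M -> M = 0.
move=> h;apply/row_matrixP => i;rewrite row0 rowE;apply: sqn_eq0;apply/le_anti.
by rewrite sqn_ge0 andbT;apply: le_trans (h _) _;rewrite expr0n mul0r.
Qed.
Lemma opb00 n c: opb c (0: 'M[C]_n).
by move=> v;rewrite mulmx0 sqn0 mulr_ge0 ?sqr_ge0 ?sqn_ge0. Qed.
Lemma opb1 n: opb 1 (1%:M: 'M[C]_n).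
by move=> v;rewrite mulmx1 expr1n mul1r. Qed.
Lemma opbD n a b (M N: 'M[C]_n): 0 <= a -> 0 <= b -> opb a M -> opb b N -> opb (a + b) (M + N).
rewrite le_eqVlt => /orP[/eqP <- _ /opb0 -> hN|a0];first by rewrite !add0r.
rewrite le_eqVlt => /orP[/eqP <- hM /opb0 ->|b0 hM hN v];first by rewrite !addr0.
have s0: 0 < b / a by rewrite divr_gt0.
rewrite mulmxDr;apply: le_trans (sqnD _ _ s0) _.
have h1:=ler_wpM2l (ltW (addr_gt0 ltr01 s0)) (hM v).
have s1: 0 <= 1 + (b / a)^-1 by rewrite addr_ge0 // invr_ge0 ltW.
have h2:=ler_wpM2l s1 (hN v);apply: le_trans (lerD h1 h2) _.
by rewrite !mulrA -mulrDl ler_wpM2r ?sqn_ge0 // le_eqVlt;apply/orP;left;apply/eqP;field;rewrite !gt_eqF.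
Qed.
Lemma opbM n a b (M N: 'M[C]_n): opb a M -> opb b N -> opb (a * b) (M *m N).
move=> hM hN v;rewrite mulmxA;apply: le_trans (hN _) _.
by have:=ler_wpM2l (sqr_ge0 b) (hM v);rewrite mulrA -exprMn [b * a]mulrC.
Qed.
Lemma opbZ n c k (M: 'M[C]_n): opb c M -> opb (absC k * c) (k *: M).
move=> h v;rewrite -scalemxAr sqnZ exprMn -[leRHS]mulrA ler_wpM2l ?sqr_ge0 //;exact: h.
Qed.
Lemma opbN n c (M: 'M[C]_n): opb c M -> opb c (- M).
by rewrite -scaleN1r => /(opbZ (-1));rewrite absCN absC1 mul1r. Qed.
Lemma opbB n a b (M N: 'M[C]_n): 0 <= a -> 0 <= b -> opb a M -> opb b N -> opb (a + b) (M - N).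
by move=> a0 b0 hM hN;apply: opbD => //;apply: opbN. Qed.
Lemma opb_sum n c (I: Type) (s: seq I) (F: I -> 'M[C]_n): 0 <= c -> (forall i, opb c (F i)) ->
 opb ((size s)%:R * c) (\sum_(i <- s) F i).
move=> c0 h;elim: s => [|i s IH];first by rewrite big_nil mul0r;apply: opb00.
by rewrite big_cons -nat1r mulrDl mul1r;apply: opbD => //;rewrite mulr_ge0.
Qed.

(** Cauchy-Schwarz: the component of [u] orthogonal to [v] has a nonnegative square. *)
Lemma dot_bound n (u v: 'rV[C]_n): absC ((u *m v^h) 0 0) ^+ 2 <= sqn u * sqn v.
pose z:=(u *m v^h) 0 0;have [v0|v0]:=eqVneq (sqn v) 0.
 by rewrite (sqn_eq0 v0) hm0 mulmx0 mxE absC0 expr0n sqn0 mulr0.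
have vp: 0 < sqn v by rewrite lt_neqAle sqn_ge0 eq_sym v0.
have zc: (v *m u^h) 0 0 = Num.conj z.
 by rewrite /z -[v *m u^h]hmK hmM hmK !mxE.
pose l :=- z / rc (sqn v).
have r0: rc (sqn v) != 0 :> C by apply: contra_neq v0 => /rc_inj.
have mD (M N: 'M[C]_1): (M + N) 0 0 = M 0 0 + N 0 0 by rewrite mxE.
have mZ k (M: 'M[C]_1): (k *: M) 0 0 = k * M 0 0 by rewrite mxE.
have lc: Num.conj l = - Num.conj z / rc (sqn v) by rewrite /l rmorphM rmorphN fmorphV;congr (_ * _^-1);exact: rc_conj.
have e: rc (sqn (u + l *: v)) = rc (sqn u - absC z ^+ 2 / sqn v).
 rewrite sqnE hmD hmZ mulmxDl !mulmxDr -!scalemxAl -!scalemxAr !mD !mZ -!sqnE -/z zc lc.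
 by rewrite rcB rcM rcV absC_sqr /l;field.
have:=sqn_ge0 (u + l *: v);rewrite (rc_inj e) subr_ge0 ler_pdivrMr //.
Qed.

Lemma opb_dot n c (M: 'M[C]_n) u v: 0 <= c -> opb c M ->
 absC ((u *m M *m v^h) 0 0) ^+ 2 <= c ^+ 2 * (sqn u * sqn v).
move=> c0 hM;apply: le_trans (dot_bound _ _) _;rewrite mulrA ler_wpM2r ?sqn_ge0 //;exact: hM.
Qed.

Lemma opb_of_dot n c (M: 'M[C]_n): (forall u v, absC ((u *m M *m v^h) 0 0) ^+ 2 <= c ^+ 2 * (sqn u * sqn v)) ->
 opb c M.
move=> h v;have:=h v (v *m M);rewrite -sqnE absC_rc ger0_norm ?sqn_ge0 // expr2 mulrA.
have [->|]:=eqVneq (sqn (v *m M)) 0;first by rewrite mulr_ge0 ?sqr_ge0 ?sqn_ge0.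
by move=> h0;rewrite ler_pM2r // lt_neqAle sqn_ge0 eq_sym h0.
Qed.

Lemma opb_adj n c (M: 'M[C]_n): 0 <= c -> opb c M -> opb c M^h.
move=> c0 hM;apply: opb_of_dot => u v.
have -> : (u *m M^h *m v^h) 0 0 = Num.conj ((v *m M *m u^h) 0 0).
 by rewrite -[u in LHS]hmK -!hmM mulmxA !mxE.
by rewrite absC_conj [sqn u * _]mulrC;apply: opb_dot.
Qed.

Lemma opb_cstar n c (M: 'M[C]_n): 0 <= c -> opb (c ^+ 2) (M *m M^h) -> opb c M.
move=> c0 hM v;have h:=dot_bound (v *m (M *m M^h)) v.
have e: (v *m (M *m M^h) *m v^h) 0 0 = rc (sqn (v *m M)) by rewrite sqnE hmM !mulmxA.
rewrite e absC_rc ger0_norm ?sqn_ge0 // in h.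
rewrite -(@ler_pXn2r _ 2) ?nnegrE ?sqn_ge0 //;last by rewrite mulr_ge0 ?sqr_ge0 ?sqn_ge0.
apply: le_trans h _;rewrite exprMn [in leRHS]expr2 mulrA ler_wpM2r ?sqn_ge0 //;exact: hM.
Qed.

Lemma opb_entry n c (M: 'M[C]_n) i j: 0 <= c -> opb c M -> absC (M i j) <= c.
move=> c0 /(_ (delta_mx 0 i));rewrite -rowE => h.
have s1: sqn (delta_mx 0 i: 'rV[C]_n) = 1.
 rewrite /sqn (bigD1 i) //= mxE !eqxx absC1 expr1n big1 ?addr0 // => k ki.
 by rewrite mxE eqxx (negPf ki) absC0 expr0n.
rewrite s1 mulr1 in h;rewrite -(@ler_pXn2r _ 2) ?nnegrE ?abs0 //;apply: le_trans h.
rewrite /sqn (bigD1 j) //= mxE lerDl;apply: sumr_ge0 => k _;exact: sqr_ge0.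
Qed.

Lemma opb_entries n c (M: 'M[C]_n): 0 <= c -> (forall i j, absC (M i j) <= c) ->
 opb ((n * n)%:R * c) M.
move=> c0 h;rewrite [M]matrix_sum_delta pair_big /=.
have -> : (n * n)%N = size (index_enum ('I_n * 'I_n)%type).
 by rewrite [index_enum _]unlock -enumT -cardE card_prod card_ord.
apply: opb_sum => // -[i j] /=.
have hd: opb 1 (delta_mx i j: 'M[C]_n).
 move=> v;rewrite expr1n mul1r.
 have -> : v *m delta_mx i j = v 0 i *: delta_mx 0 j.
 apply/rowP => k;rewrite !mxE (bigD1 i) //= big1 ?addr0 => [|l li];first by rewrite !mxE eqxx.
 by rewrite mxE (negPf li) mulr0.
 rewrite sqnZ;have -> : sqn (delta_mx 0 j: 'rV[C]_n) = 1.
 rewrite /sqn (bigD1 j) //= mxE !eqxx absC1 expr1n big1 ?addr0 // => k kj.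
 by rewrite mxE eqxx (negPf kj) absC0 expr0n.
 by rewrite mulr1 /sqn (bigD1 i) //= lerDl;apply: sumr_ge0 => k _;exact: sqr_ge0.
by have:=opbZ (M i j) hd;rewrite mulr1;apply: opb_le;rewrite ?abs0.
Qed.

Section Calculus.
Variables (n: nat) (M: 'M[C]_n).
Hypothesis M_normal: M *m M^h = M^h *m M.
Let P:=spectralmx M.
Let d:=spectral_diag M.

Definition nfun (f: C -> C): 'M[C]_n:=P^h *m diag_mx (map_mx f d) *m P.

Lemma spec1: P *m P^h = 1%:M /\ P^h *m P = 1%:M.
have h: P *m P^h = 1%:M by apply/unitarymxP/spectral_unitarymx.
by split=> //;apply: mulmx1C.
Qed.
Lemma nfun_id: nfun id = M.
have /orthomx_spectralP -> : M \is normalmx by apply/normalmxP.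
rewrite invmx_unitary ?spectral_unitarymx // /nfun;congr (_ *m diag_mx _ *m _).
by apply/rowP => j;rewrite mxE.
Qed.
Lemma nfunM f g: nfun (fun z => f z * g z) = nfun f *m nfun g.
have [h _]:=spec1;rewrite /nfun !mulmxA -(mulmxA _ P) h mulmx1 -!mulmxA.
congr (_ *m _);rewrite mulmxA mulmx_diag;congr (diag_mx _ *m _).
by apply/rowP => j;rewrite !mxE.
Qed.
Lemma nfunD f g: nfun (fun z => f z + g z) = nfun f + nfun g.
rewrite /nfun -mulmxDl -mulmxDr;congr (_ *m _ *m _).
by rewrite -linearD;congr diag_mx;apply/rowP => j;rewrite !mxE.
Qed.
Lemma nfun_cst k: nfun (fun=> k) = k%:M.
have [_ h]:=spec1;rewrite /nfun (_: diag_mx _ = k%:M) ?mul_mx_scalar -?scalemxAl ?h ?scalemx1 //.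
by apply/matrixP => i j;rewrite !mxE.
Qed.
Lemma nfun_adj f: (nfun f)^h = nfun (fun z => Num.conj (f z)).
rewrite /nfun !hmM hmK mulmxA;congr (_ *m _ *m _);apply/matrixP => i j.
by rewrite !mxE rmorphMn eq_sym;case: eqP => [->|];rewrite ?mulr0n.
Qed.
Lemma srow j: row j P *m M = d 0 j *: row j P.
have [h _]:=spec1;rewrite -[M in LHS]nfun_id /nfun !mulmxA -row_mul h row1 -rowE.
by rewrite row_diag_mx -scalemxAl -rowE mxE.
Qed.
Lemma srow_sqn j: sqn (row j P) = 1.
have [h _]:=spec1;apply: rc_inj;rewrite sqnE.
have e: (P *m P^h) j j = 1 by rewrite h mxE eqxx.
by rewrite rc1 -e !mxE;apply: eq_bigr => k _;rewrite !mxE.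
Qed.
(** In the eigenbasis of [M] a commuting [X] has nonzero entries only between equal eigenvalues. *)
Lemma nfun_comm f X: X *m M = M *m X -> X *m nfun f = nfun f *m X.
have [h h']:=spec1;move=> XM;have [Y YE]: exists Y, Y = P *m X *m P^h by eexists.
have XY: X = P^h *m Y *m P by rewrite YE !mulmxA h' mul1mx -mulmxA h' mulmx1.
have YD: Y *m diag_mx d = diag_mx d *m Y.
 have ME: diag_mx d = P *m M *m P^h.
 rewrite -{1}nfun_id /nfun !mulmxA h mul1mx -mulmxA h mulmx1;congr diag_mx.
 by apply/rowP => j;rewrite mxE.
 rewrite ME YE !mulmxA -(mulmxA _ P^h) h' mulmx1 -(mulmxA P) XM mulmxA.
 by rewrite -(mulmxA _ P^h P) h' mulmx1.
have YF: Y *m diag_mx (map_mx f d) = diag_mx (map_mx f d) *m Y.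
 apply/matrixP => i j;have:=congr1 (fun N: 'M[C]_n => N i j) YD.
 rewrite !mul_mx_diag !mul_diag_mx !mxE;have [->|/eqP ne]:=eqVneq (Y i j) 0;first by rewrite !(mul0r, mulr0).
 by rewrite mulrC => /(mulIf (introN eqP ne)) ->;rewrite mulrC.
rewrite XY /nfun !mulmxA -(mulmxA _ P) h mulmx1 -(mulmxA _ P) h mulmx1.
by rewrite -(mulmxA P^h) YF mulmxA.
Qed.
Lemma nfun_opb f c: (forall j, absC (f (d 0 j)) <= c) -> opb c (nfun f).
have [h h']:=spec1;move=> hf v;pose u:=v *m P^h.
have uv: sqn u = sqn v.
 by apply: rc_inj;rewrite !sqnE /u hmM hmK mulmxA -(mulmxA v) h' mulmx1.
have -> : sqn (v *m nfun f) = sqn (u *m diag_mx (map_mx f d)).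
 by apply: rc_inj;rewrite !sqnE /nfun /u !hmM hmK !mulmxA -(mulmxA _ P P^h) h mulmx1.
rewrite -uv mulr_sumr;apply: ler_sum => j _;rewrite mul_mx_diag !mxE absCM exprMn mulrC.
rewrite ler_wpM2r ?sqr_ge0 // lerXn2r ?nnegrE ?abs0 //.
exact: le_trans (abs0 _) (hf j).
Qed.
Lemma spectral_near c k: 0 <= c -> opb c (M - k%:M) -> forall j, absC (d 0 j - k) <= c.
move=> c0 hM j;have:=hM (row j P);rewrite mulmxBr srow mul_mx_scalar -scalerBl sqnZ srow_sqn.
by rewrite !mulr1 ler_pXn2r // nnegrE abs0.
Qed.
End Calculus.

(** Continuity on the whole line spares the subspace topology; functions on the unit interval are
    extended by [clamp]. *)
Definition rcont (f: R -> C):=forall s (e: R), 0 < e -> exists2 d: R, 0 < d &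
 forall s', `|s' - s| < d -> absC (f s' - f s) < e.
Definition mcont m n (G: R -> 'M[C]_(m, n)):=forall i j, rcont (fun s => G s i j).

Lemma rcontC k: rcont (fun=> k).
by move=> s e e0;exists 1 => // s' _;rewrite subrr absC0. Qed.
Lemma rcontD f g: rcont f -> rcont g -> rcont (fun s => f s + g s).
move=> hf hg s e e0;have e2: 0 < e / 2 by lra.
have [a a0 ha]:=hf s _ e2;have [b b0 hb]:=hg s _ e2.
exists (Num.min a b) => [|s'];rewrite ?lt_min ?a0 // => /andP[/ha h1 /hb h2].
rewrite opprD addrACA;apply: le_lt_trans (absCD _ _) _;lra.
Qed.
Lemma rcontM f g: rcont f -> rcont g -> rcont (fun s => f s * g s).
move=> hf hg s e e0;set F:=absC (f s);set G:=absC (g s).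
have F0: 0 <= F:=abs0 _;have G0: 0 <= G:=abs0 _.
pose t:=Num.min 1 (e / (F + G + 2)).
have S0: 0 < F + G + 2 by lra.
have t0: 0 < t by rewrite lt_min ltr01 divr_gt0.
have t1: t <= 1 by rewrite ge_min lexx.
have tS: t * (F + G + 2) <= e by rewrite -ler_pdivlMr // ge_min lexx orbT.
have [a a0 ha]:=hf s _ t0;have [b b0 hb]:=hg s _ t0.
exists (Num.min a b) => [|s'];rewrite ?lt_min ?a0 // => /andP[/ha h1 /hb h2].
have -> : f s' * g s' - f s * g s =
 (f s' - f s) * (g s' - g s) + (f s' - f s) * g s + f s * (g s' - g s) by ring.
apply: le_lt_trans (absCD _ _) _;rewrite absCM.
apply: le_lt_trans (lerD (absCD _ _) (lexx _)) _;rewrite !absCM -/F -/G.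
have p1:=abs0 (f s' - f s);have p2:=abs0 (g s' - g s);nra.
Qed.
Lemma rcont_conj f: rcont f -> rcont (fun s => Num.conj (f s)).
by move=> h s e /(h s)[d d0 hd];exists d => // s' /hd;rewrite -rmorphB absC_conj.
Qed.
Lemma rcont_sum (I: Type) (r: seq I) (F: I -> R -> C): (forall i, rcont (F i)) ->
 rcont (fun s => \sum_(i <- r) F i s).
move=> h;elim: r => [|i r IH];first by under eq_fun do rewrite big_nil;apply: rcontC.
by under eq_fun do rewrite big_cons;apply: rcontD.
Qed.
Lemma rcont_real (f: R -> R): (forall s (e: R), 0 < e -> exists2 d: R, 0 < d &
 forall s', `|s' - s| < d -> `|f s' - f s| < e) -> rcont (fun s => rc (f s)).
by move=> h s e /(h s)[d d0 hd];exists d => // s' /hd;rewrite -rcB absC_rc.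
Qed.
Lemma rcont_comp (f: R -> C) (h: R -> R): rcont f -> rcont (fun s => rc (h s)) ->
 rcont (fun s => f (h s)).
move=> hf hh s e /(hf (h s))[d d0 hd];have [c c0 hc]:=hh s _ d0.
by exists c => // s' /hc;rewrite -rcB absC_rc => /hd.
Qed.

Definition clamp (x: R): R:=Num.max 0 (Num.min 1 x).

Lemma clampP x: 0 <= clamp x <= 1.
by rewrite /clamp le_max lexx ge_max ler01 ge_min lexx. Qed.
Lemma clamp0 x: x <= 0 -> clamp x = 0.
by move=> h;apply/max_idPl;rewrite ge_min h orbT. Qed.
Lemma clamp1 x: 1 <= x -> clamp x = 1.
by move=> h;rewrite /clamp (min_idPl h);apply/max_idPr/ler01. Qed.
Lemma clamp_id x: 0 <= x <= 1 -> clamp x = x.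
by move=> /andP[a b];rewrite /clamp (min_idPr b);apply/max_idPr. Qed.
Lemma clamp_lip x y: `|clamp x - clamp y| <= `|x - y|.
have E (z: R): clamp z = if z <= 0 then 0 else if 1 <= z then 1 else z.
 have [z0|z0]:=leP z 0;first exact: clamp0.
 by have [z1|z1]:=leP 1 z;[exact: clamp1|rewrite clamp_id // !ltW].
wlog xy: x y / x <= y.
 by move=> h;case: (leP x y) => [|/ltW] /h //;rewrite distrC [X in _ <= X]distrC.
rewrite distrC [X in _ <= X]distrC [X in _ <= X]ger0_norm ?subr_ge0 // ler_norml !E.
by case: (leP x 0) => ?;case: (leP y 0) => ?;case: (leP 1 x) => ?;case: (leP 1 y) => ?;lra.
Qed.
Lemma rcont_lip (f: R -> R) (k: R): (forall s s', `|f s' - f s| <= k * `|s' - s|) -> rcont (fun s => rc (f s)).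
move=> h;apply: rcont_real => s e e0;have k1: 0 < `|k| + 1 by rewrite ltr_wpDl.
exists (e / (`|k| + 1)) => [|s'];first exact: divr_gt0.
rewrite ltr_pdivlMr // => hs;apply: le_lt_trans (h _ _) _;apply: le_lt_trans hs.
by rewrite mulrC ler_wpM2l // (le_trans (ler_norm _)) // lerDl.
Qed.

Lemma mcontC m n (M: 'M[C]_(m, n)): mcont (fun=> M).
by move=> i j;apply: rcontC. Qed.
Lemma mcontD m n (F G: R -> 'M[C]_(m, n)): mcont F -> mcont G -> mcont (fun s => F s + G s).
by move=> hF hG i j;under eq_fun do rewrite mxE;apply: rcontD. Qed.
Lemma mcontM m n p (F: R -> 'M[C]_(m, n)) (G: R -> 'M[C]_(n, p)): mcont F -> mcont G ->
 mcont (fun s => F s *m G s).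
by move=> hF hG i j;under eq_fun do rewrite mxE;apply: rcont_sum => k;apply: rcontM.
Qed.
Lemma mcontZ m n f (G: R -> 'M[C]_(m, n)): rcont f -> mcont G -> mcont (fun s => f s *: G s).
by move=> hf hG i j;under eq_fun do rewrite mxE;apply: rcontM. Qed.
Lemma mcont_adj m n (G: R -> 'M[C]_(m, n)): mcont G -> mcont (fun s => (G s)^h).
by move=> hG i j;under eq_fun do rewrite 2!mxE;apply: rcont_conj. Qed.

Lemma mcont_opb n (G: R -> 'M[C]_n) s (e: R): mcont G -> 0 < e -> exists2 d: R, 0 < d &
 forall s', `|s' - s| < d -> opb e (G s' - G s).
move=> hG e0;pose c:=e / ((n * n)%:R + 1).
have N0: 0 < (n * n)%:R + 1 :> R by rewrite ltr_wpDl.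
have c0: 0 < c by rewrite divr_gt0.
have /choice[D hD]: forall ij: 'I_n * 'I_n, exists d: R, 0 < d /\
 forall s', `|s' - s| < d -> absC (G s' ij.1 ij.2 - G s ij.1 ij.2) < c.
 by move=> ij;have [d d0 hd]:=hG ij.1 ij.2 s _ c0;exists d.
exists (\big[Num.min/1]_ij D ij).
 by apply: (big_ind (fun x: R => 0 < x)) => [//|x y x0 y0|ij _];rewrite ?lt_min ?x0 //;case: (hD ij).
move=> s' hs;apply: (@opb_le _ ((n * n)%:R * c));first by rewrite mulr_ge0 // ltW.
 by rewrite /c mulrCA ler_piMr ?(ltW e0) // ler_pdivrMr // mul1r lerDl.
apply: opb_entries;first exact: ltW.
move=> i j;have:=(hD (i, j)).2 s' _;rewrite !mxE => /(_ _)/ltW;apply.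
apply: lt_le_trans hs _;exact: bigmin_le_cond.
Qed.

Lemma rcont_sqrt (f: R -> R): rcont (fun s => rc (f s)) -> rcont (fun s => rc (Num.sqrt (f s))).
apply: (@rcont_comp (fun x => rc (Num.sqrt x)));apply: rcont_real => s e e0.
have /cvgrPdist_lt/(_ e e0)/nbhs_ballP[r r0 hr]:=@sqrt_continuous R s.
by exists r => // s' hs;rewrite distrC;apply: hr;rewrite -ball_normE /= distrC.
Qed.

(* A path on the unit circle from [1] to the points of real part [2 b - 1], for [0 <= b <= 1]. *)
Definition cosp b s: R:=1 - 2 * clamp s * (1 - clamp b).
Definition sinp b s: R:=Num.sqrt (1 - cosp b s ^+ 2).
(** Continuity is wanted in [s] alone, since the path is applied to the eigenvalues of one fixed
    unitary. The half circle is chosen by the sign of the imaginary part. *)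
Definition cpath (s: R) (z: C): C:=let b:=(complex.Re z + 1) / 2 in
 Complex (cosp b s) (if 0 <= complex.Im z then sinp b s else - sinp b s).

Lemma cosp2 b s: cosp b s ^+ 2 + sinp b s ^+ 2 = 1.
rewrite /sinp sqr_sqrtr;first by rewrite addrC subrK.
rewrite subr_ge0 /cosp;move: (clamp s) (clamp b) (clampP s) (clampP b) => x y /andP[s0 s1] /andP[b0 b1].
have t0: 0 <= x * (1 - y) by rewrite mulr_ge0 ?subr_ge0.
have t1: x * (1 - y) <= 1 by nra.
by rewrite -mulrA;move: (x * _) t0 t1 => t t0 t1;nra.
Qed.
Lemma cosp0 b: cosp b 0 = 1 /\ sinp b 0 = 0.
by rewrite /sinp /cosp clamp0 // mulr0 mul0r subr0 expr1n subrr sqrtr0. Qed.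
Lemma cosp_half s: cosp 2^-1 s = 1 - clamp s.
by rewrite /cosp (@clamp_id 2^-1);[field|lra]. Qed.
Lemma cosp1: cosp 2^-1 1 = 0 /\ sinp 2^-1 1 = 1.
by rewrite /sinp cosp_half clamp1 // subrr expr0n subr0 sqrtr1. Qed.
Lemma rcont_cosp b: rcont (fun s => rc (cosp b s)).
apply: (@rcont_lip _ 2) => s s';rewrite /cosp.
rewrite (_: _ - _ = 2 * ((1 - clamp b) * (clamp s - clamp s')));last by ring.
rewrite normrM ger0_norm // ler_wpM2l // normrM [`|s' - s|]distrC -[leRHS]mul1r ler_pM ?clamp_lip //.
by rewrite ger0_norm;have:=clampP b;lra.
Qed.
Lemma rcont_sinp b: rcont (fun s => rc (sinp b s)).
apply: rcont_sqrt;under eq_fun do rewrite rcB rcX expr2 -mulN1r;apply: rcontD;first exact: rcontC.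
by apply: rcontM;[exact: rcontC|apply: rcontM;exact: rcont_cosp].
Qed.

Lemma absCE (a b: R): absC (Complex a b) ^+ 2 = a ^+ 2 + b ^+ 2.
by rewrite /absC normc_def /= sqr_sqrtr // addr_ge0 ?sqr_ge0. Qed.

Lemma cpath0 z: cpath 0 z = 1.
by rewrite /cpath;have [-> ->]:=cosp0 ((complex.Re z + 1) / 2);rewrite oppr0 if_same. Qed.
Lemma cpath_norm s z: absC (cpath s z) = 1.
apply/eqP;rewrite -(@eqrXn2 _ 2) ?abs0 ?ler01 //;apply/eqP.
by rewrite absCE;case: ifP => _;rewrite ?sqrrN cosp2 expr1n.
Qed.
Lemma cpath1 z: absC z = 1 -> cpath 1 z = z.
case: z => x y z1;have:=absCE x y;rewrite z1 expr1n => h.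
have c: cosp ((x + 1) / 2) 1 = x.
 by rewrite /cosp clamp1 // clamp_id;[field|apply/andP;split;nra].
have e: 1 - x ^+ 2 = y ^+ 2 by lra.
rewrite /cpath /sinp /= c e sqrtr_sqr;case: ifP => [y0|/negbT];first by rewrite ger0_norm.
by rewrite -ltNge => y0;rewrite ltr0_norm // opprK.
Qed.
Lemma cpath_near s z: absC z = 1 -> absC (cpath s z - 1) <= absC (z - 1).
move=> z1;set b:=(complex.Re z + 1) / 2.
have dist t: absC (cpath t z - 1) ^+ 2 = 2 - 2 * cosp b t.
 have -> : cpath t z - 1 = Complex (cosp b t - 1) (if 0 <= complex.Im z then sinp b t else - sinp b t).
 by apply/eqP;rewrite eq_complex /= subr0 !eqxx.
 by rewrite absCE;have:=cosp2 b t;case: ifP => _;rewrite ?sqrrN;lra.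
rewrite -(@ler_pXn2r _ 2) ?nnegrE ?abs0 // dist -{1}(cpath1 z1) dist /cosp [clamp 1]clamp1 //.
by have:=clampP s;have:=clampP b;nra.
Qed.
Lemma cpath_cont z: rcont (fun s => cpath s z).
set b:=(complex.Re z + 1) / 2.
have -> : (fun s => cpath s z) = fun s => rc (cosp b s) + Complex 0 (if 0 <= complex.Im z then 1 else -1) * rc (sinp b s).
 apply/funext => s;apply/eqP;rewrite eq_complex /=;case: ifP => _;
 by rewrite !(mul0r, mul1r, mulN1r, mulr0, add0r, addr0, subr0, oppr0) !eqxx.
apply: rcontD;first exact: rcont_cosp.
by apply: rcontM;[exact: rcontC|exact: rcont_sinp].
Qed.

Section UnitaryPath.
Variables (n: nat) (U: 'M[C]_n).
Hypotheses (U1: U *m U^h = 1%:M) (U2: U^h *m U = 1%:M).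

Definition upath s:=nfun U (cpath s).

Let U_normal: U *m U^h = U^h *m U. Proof. by rewrite U1 U2. Qed.
Let U_spec j: absC (spectral_diag U 0 j) = 1.
have:=srow U_normal j => h;have s1:=srow_sqn U j.
have: sqn (row j (spectralmx U) *m U) = sqn (row j (spectralmx U)).
 by apply: rc_inj;rewrite !sqnE hmM mulmxA -(mulmxA _ U) U1 mulmx1.
rewrite h sqnZ s1 mulr1 => /eqP;rewrite sqrp_eq1 ?abs0 // => /eqP //.
Qed.

Lemma upath0: upath 0 = 1%:M.
by rewrite -(nfun_cst U 1) /upath;congr (_ *m diag_mx _ *m _);apply/rowP => j;rewrite !mxE cpath0.
Qed.
Lemma upath1: upath 1 = U.
rewrite -[RHS](nfun_id U_normal) /upath;congr (_ *m diag_mx _ *m _);apply/rowP => j.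
by rewrite !mxE cpath1.
Qed.
Lemma upath_u s: upath s *m (upath s)^h = 1%:M /\ (upath s)^h *m upath s = 1%:M.
have h z: cpath s z * Num.conj (cpath s z) = 1.
 by rewrite -absC_sqr cpath_norm expr1n rc1.
rewrite nfun_adj -!nfunM;split;rewrite -(nfun_cst U 1);congr nfun;apply/funext => z;rewrite ?h //.
by rewrite mulrC h.
Qed.
Lemma upath_comm s X: X *m U = U *m X -> X *m upath s = upath s *m X.
exact: nfun_comm. Qed.
Lemma upath_near s c: 0 <= c -> opb c (U - 1%:M) -> opb c (upath s - 1%:M).
move=> c0 hU;rewrite -(nfun_cst U 1) -scaleN1r.
have -> : upath s + -1 *: nfun U (fun=> 1) = nfun U (fun z => cpath s z - 1).
 rewrite nfunD (nfun_cst U 1) (nfun_cst U (-1)) scale_scalar_mx mulr1 //.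
apply: nfun_opb => j;apply: le_trans (cpath_near _ (U_spec j)) _.
exact: spectral_near.
Qed.
Lemma upath_cont: mcont upath.
apply: mcontM;last exact: mcontC.
apply: mcontM;first exact: mcontC.
move=> i j;under eq_fun do rewrite mxE mxE.
by case: eqP => _;[apply: cpath_cont|apply: rcontC].
Qed.
End UnitaryPath.

(* The unitary part of an almost unitary matrix, close to [1] and in the commutant of
   whatever commutes with [Z^* Z]. *)
Lemma polar_near n (Z: 'M[C]_n) (c: R): 0 <= c <= 1 / 8 -> opb c (Z - 1%:M) ->
 exists K: 'M[C]_n, [/\ (Z *m K) *m (Z *m K)^h = 1%:M, (Z *m K)^h *m (Z *m K) = 1%:M,
 opb (8 * c) (Z *m K - 1%:M) & forall X, X *m (Z^h *m Z) = (Z^h *m Z) *m X -> X *m K = K *m X].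
move=> /andP[c0 c1] hZ;have [Y YE]: exists Y, Y = Z^h *m Z by eexists.
have Yh: Y^h = Y by rewrite YE hmM hmK.
have Yn: Y *m Y^h = Y^h *m Y by rewrite Yh.
have Z1: opb (1 + c) Z by rewrite -[Z](subrK 1%:M) addrC;apply: opbD => //;exact: opb1.
have hY: opb (3 * c) (Y - 1%:M).
 have -> : Y - 1%:M = Z^h *m (Z - 1%:M) + (Z - 1%:M)^h.
 by rewrite YE mulmxBr mulmx1 hmB hm1 addrA subrK.
 apply: (@opb_le _ ((1 + c) * c + c));[nra|nra|].
 by apply: opbD;[nra|lra|apply: opbM => //;apply: opb_adj => //;lra|apply: opb_adj].
have c3: 0 <= 3 * c by lra.
have spec:=spectral_near Yn c3 hY.
have real j: Num.conj (spectral_diag Y 0 j) = spectral_diag Y 0 j.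
 have h:=srow Yn j;have s1:=srow_sqn Y j.
 have e: (row j (spectralmx Y) *m Y *m (row j (spectralmx Y))^h) 0 0 = spectral_diag Y 0 j.
 by rewrite h -scalemxAl mxE -sqnE s1 mulr1.
 rewrite -[in LHS]e -[X in Num.conj X]/(_ 0 0).
 have -> : forall M: 'M[C]_1, Num.conj (M 0 0) = M^h 0 0 by move=> M;rewrite !mxE.
 by rewrite !hmM hmK Yh mulmxA e.
pose g (z: C): C:=rc (Num.sqrt (complex.Re z))^-1.
have sp j: let x:=complex.Re (spectral_diag Y 0 j) in spectral_diag Y 0 j = rc x /\ `|x - 1| <= 3 * c.
 have e: spectral_diag Y 0 j = rc (complex.Re (spectral_diag Y 0 j)).
 by rewrite -[LHS]RRe_real //;apply/CrealP/real.
 split=> //;have:=spec j;rewrite {1}e -rc1 -rcB absC_rc //.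
have sqr j: g (spectral_diag Y 0 j) * g (spectral_diag Y 0 j) * spectral_diag Y 0 j = 1.
 have [e h]:=sp j;rewrite {3}e /g -!rcM -expr2 exprVn sqr_sqrtr;last by have:=ler_distl (complex.Re (spectral_diag Y 0 j)) 1 (3 * c);rewrite h => /esym /andP[];lra.
 rewrite mulVf ?rc1 //;apply/eqP => x0;move: h;rewrite x0 sub0r normrN normr1;lra.
pose K:=nfun Y g;exists K.
have Kh: K^h = K by rewrite nfun_adj;congr nfun;apply/funext => z;apply: rc_conj.
have YK X: X *m Y = Y *m X -> X *m K = K *m X by move=> h;apply: nfun_comm.
have KKY: K *m K *m Y = 1%:M.
 rewrite -[X in _ *m X](nfun_id Yn) /K -!nfunM -(nfun_cst Y 1);congr (_ *m diag_mx _ *m _).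
 by apply/rowP => j;rewrite !mxE sqr.
have u2: (Z *m K)^h *m (Z *m K) = 1%:M.
 by rewrite hmM Kh mulmxA -(mulmxA K) -YE -mulmxA (YK Y) // mulmxA KKY.
rewrite -YE;split=> //;first exact: mulmx1C.
have hK: opb (3 * c) (K - 1%:M).
 have -> : K - 1%:M = nfun Y (fun z => g z - 1) by rewrite nfunD (nfun_cst Y (-1)) -[in LHS]scaleN1r scale_scalar_mx mulr1.
 apply: nfun_opb => j;have [e h]:=sp j.
 rewrite /g -rc1 -rcB absC_rc;move: h;set x:=complex.Re _ => h.
 have x0: 5 / 8 <= x by move: h;rewrite ler_norml => /andP[];lra.
 set r:=Num.sqrt x;have r0: 0 < r by rewrite sqrtr_gt0;lra.
 have r2: r * r = x by rewrite -expr2 sqr_sqrtr //;lra.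
 have r1: 5 / 8 <= r by nra.
 have -> : r^-1 - 1 = (1 - x) / (r * (1 + r)) by rewrite -r2;field;rewrite !gt_eqF //;lra.
 rewrite normrM normfV distrC [`|r * _|]ger0_norm;last by nra.
 rewrite ler_pdivrMr;last by nra.
 apply: le_trans h _;rewrite ler_peMr //;nra.
have K1: opb (1 + 3 * c) K by rewrite -[K](subrK 1%:M) addrC;apply: opbD => //;exact: opb1.
have -> : Z *m K - 1%:M = (Z - 1%:M) *m K + (K - 1%:M) by rewrite mulmxBl mul1mx addrA subrK.
apply: (@opb_le _ (c * (1 + 3 * c) + 3 * c));[nra|nra|].
by apply: opbD => //;[nra|apply: opbM].
Qed.

End MatrixNorm.

(** * Comparison of projections in the commutant of matrix units *)

Section Factors.
Variables (R: realType) (D: nat).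
Local Notation C:=(Cplx R).
Local Notation M :='M[C]_D.
Implicit Types (e f q z: M) (A: M -> Prop).

Definition proj e:=e^h = e /\ e *m e = e.

(** The rows of [W] are an orthonormal basis of the row space of [e], so the trace is the rank. *)
Lemma proj_fac e: proj e -> exists r (W: 'M[C]_(r, D)),
 [/\ W *m W^h = 1%:M, W^h *m W = e & \tr e = r%:R].
move=> [eh ee];have [W [W1 We [Y YE]]]: exists W: 'M[C]_(\rank e, D),
 [/\ W *m W^h = 1%:M, W *m e = W & exists Y, e = Y *m W].
 pose W:=schmidt (row_base e);exists W.
 have WE: (W :=: e)%MS by apply: eqmx_trans (eqmx_schmidt_free (row_base_free e)) (eq_row_base e).
 split;first by apply/unitarymxP/schmidt_unitarymx/rank_leq_col.
 by have /submxP[X ->]: (W <= e)%MS;rewrite ?WE // -mulmxA ee.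
 by apply/submxP;rewrite WE.
move: (\rank e) W W1 We Y YE => r W W1 We Y YE;exists r, W.
have Wh: e *m W^h = W^h by rewrite -[in RHS]We hmM eh.
have h: W^h *m W = e by rewrite -Wh {1}YE -(mulmxA Y) W1 mulmx1 -YE.
by split=> //;rewrite -h mxtrace_mulC W1 mxtrace1.
Qed.

Lemma proj_trace0 e: proj e -> \tr e = 0 -> e = 0.
move=> /proj_fac[r [W [_ <- ->]]] /eqP;rewrite pnatr_eq0 => /eqP r0.
by move: W;rewrite r0 => W;rewrite (flatmx0 W) mulmx0.
Qed.

Lemma projB e f: proj e -> proj f -> e *m f = f -> proj (e - f).
move=> [eh ee] [fh ff] ef;have fe: f *m e = f by rewrite -[RHS]fh -[in RHS]ef hmM eh fh.
split;first by rewrite hmB eh fh.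
by rewrite mulmxBl !mulmxBr ee ef fe ff subrr subr0.
Qed.
Lemma projD e f: proj e -> proj f -> e *m f = 0 -> proj (e + f).
move=> [eh ee] [fh ff] ef;have fe: f *m e = 0 by rewrite -[LHS]hmK hmM eh fh ef hm0.
split;first by rewrite hmD eh fh.
by rewrite mulmxDl !mulmxDr ee ef fe ff addr0 add0r.
Qed.

(* Models the commutant of the matrix algebra of size [d], cut down by [q]. *)
Record fac (d: nat) q A: Prop:=Fac {
 fac_unit: A q;
 fac_proj: proj q;
 facD: forall y z, A y -> A z -> A (y + z);
 facM: forall y z, A y -> A z -> A (y *m z);
 facZ: forall k z, A z -> A (k *: z);
 fac_adj: forall z, A z -> A z^h;
 fac_l: forall z, A z -> q *m z = z;
 fac_le: forall e f, A e -> proj e -> A f -> proj f -> \tr e <= \tr f ->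
 exists2 z, A z & z^h *m z = e /\ f *m z = z;
 fac_sub: forall e k, A e -> proj e -> (d * k)%:R <= \tr e ->
 exists f, [/\ A f, proj f, e *m f = f & \tr f = (d * k)%:R];
 fac_nat: forall e, A e -> proj e -> exists k, \tr e = (d * k)%:R;
 fac_bicommutant: forall y z, A y -> q *m z = z ->
 (forall X, X *m y = y *m X -> X *m q = q *m X -> X *m z = z *m X) -> A z }.

Definition mxunits d (p: nat -> nat -> M) :=[/\ (0 < d)%N,
 forall j k, (j < d)%N -> (k < d)%N -> (p j k)^h = p k j &
 forall j k j' k', (j < d)%N -> (k < d)%N -> (j' < d)%N -> (k' < d)%N ->
 p j k *m p j' k' = if k == j' then p j k' else 0].

Definition ucomm d (p: nat -> nat -> M) z:=let q :=\sum_(j < d) p j j in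
 [/\ q *m z = z, z *m q = z &
 forall j k, (j < d)%N -> (k < d)%N -> z *m p j k = p j k *m z].

Section Units.
Variables (d: nat) (p: nat -> nat -> M).
Hypothesis pu: mxunits d p.
Let d0: (0 < d)%N. Proof. by case: pu. Qed.
Let pM j k k': (j < d)%N -> (k < d)%N -> (k' < d)%N -> p j k *m p k k' = p j k'.
by case: pu => _ _ h jd kd kd';rewrite h // eqxx. Qed.
Let pM0 j k j' k': (j < d)%N -> (k < d)%N -> (j' < d)%N -> (k' < d)%N -> k != j' ->
 p j k *m p j' k' = 0.
by case: pu => _ _ h a b c e /negPf kj;rewrite h // kj. Qed.
Let ph j k: (j < d)%N -> (k < d)%N -> (p j k)^h = p k j. Proof. by case: pu => _ h _;apply: h. Qed.
Let q :=\sum_(j < d) p j j.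

Lemma mxu_proj: proj q.
split;first by rewrite hm_sum;apply: eq_bigr => j _;rewrite ph.
rewrite mulmx_suml;apply: eq_bigr => j _;rewrite mulmx_sumr (bigD1 j) //= pM // big1 ?addr0 // => k kj.
by rewrite pM0 // eq_sym.
Qed.

Lemma mxunits_l j k: (j < d)%N -> (k < d)%N -> q *m p j k = p j k.
move=> jd kd;rewrite mulmx_suml (bigD1 (Ordinal jd)) //= pM // big1 ?addr0 // => i ij.
by rewrite pM0.
Qed.
Lemma mxunits_r j k: (j < d)%N -> (k < d)%N -> p j k *m q = p j k.
by move=> jd kd;rewrite -(ph kd jd) -{1}mxu_proj.1 -hmM mxunits_l.
Qed.

(** Carries the corner at [p 0 0] to the commutant of the units; the inverse cuts by [p 0 0]. *)
Definition amp z :=\sum_(j < d) p j 0%N *m z *m p 0%N j.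

Lemma amplify_comm z: ucomm d p (amp z).
split.
- by rewrite mulmx_sumr;apply: eq_bigr => j _;rewrite !mulmxA mxunits_l.
- by rewrite mulmx_suml;apply: eq_bigr => j _;rewrite -!mulmxA mxunits_r.
move=> j k jd kd;rewrite mulmx_suml mulmx_sumr (bigD1 (Ordinal jd)) //= [RHS](bigD1 (Ordinal kd)) //=.
rewrite -[X in X + _ = _]mulmxA pM // [X in _ = X + _](_: _ = p j 0%N *m z *m p 0%N k);last first.
 by rewrite !mulmxA pM.
rewrite !big1 // => i ij.
 by rewrite !mulmxA pM0 ?mul0mx // eq_sym.
by rewrite -mulmxA pM0 ?mulmx0.
Qed.
Lemma amplifyM y z: p 0%N 0%N *m z = z -> amp y *m amp z = amp (y *m z).
move=> pz;rewrite mulmx_suml;apply: eq_bigr => j _;rewrite mulmx_sumr (bigD1 j) //=.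
rewrite big1 => [|k kj];last by rewrite !mulmxA -(mulmxA _ (p _ _) (p _ _)) pM0 ?mulmx0 ?mul0mx // eq_sym.
by rewrite addr0 !mulmxA -(mulmxA (p j 0%N *m y) (p 0%N j)) pM // -(mulmxA _ (p 0%N 0%N) z) pz.
Qed.
Lemma amplify_adj z: (amp z)^h = amp z^h.
by rewrite hm_sum;apply: eq_bigr => j _;rewrite !hmM !ph // mulmxA. Qed.
Lemma amp_corner z: ucomm d p z -> amp (p 0%N 0%N *m z) = z.
move=> [qz _ zp];rewrite -[RHS]qz mulmx_suml;apply: eq_bigr => j _.
by rewrite !mulmxA pM // -mulmxA zp // mulmxA pM.
Qed.
Lemma amplify_trace z: p 0%N 0%N *m z = z -> \tr (amp z) = d%:R * \tr z.
move=> pz;rewrite raddf_sum /= (eq_bigr (fun=> \tr z)).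
 by rewrite sumr_const card_ord mulr_natl.
by move=> j _;rewrite mxtrace_mulC mulmxA pM // pz.
Qed.
Lemma corner_proj e: ucomm d p e -> proj e ->
 proj (p 0%N 0%N *m e) /\ \tr e = d%:R * \tr (p 0%N 0%N *m e).
move=> ue [eh ee];have [qe _ ep]:=ue;split;last first.
 by rewrite -{1}(amp_corner ue) amplify_trace // mulmxA pM.
by split;[rewrite hmM eh ph // ep|rewrite mulmxA -(mulmxA (p _ _)) ep // mulmxA pM // -mulmxA ee].
Qed.

(** Through [amp] the commutant is the corner at [p 0 0] repeated [d] times. In the corner
    projections compare by rank, and [amp] multiplies traces by [d]. *)
Lemma mxunits_fac: fac d q (ucomm d p).
have [qh qq]:=mxu_proj;split;[ | | | | | | | | | |].
- by split=> // j k jd kd;rewrite mxunits_l ?mxunits_r.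
- exact: mxu_proj.
- move=> y z [a b c] [a' b' c'];split=> [||j k jd kd];first by rewrite mulmxDr a a'.
 by rewrite mulmxDl b b'.
 by rewrite mulmxDl mulmxDr c ?c'.
- move=> y z [a b c] [a' b' c'];split=> [||j k jd kd];first by rewrite mulmxA a.
 by rewrite -mulmxA b'.
 by rewrite -mulmxA c' // mulmxA c // mulmxA.
- move=> k z [a b c];split=> [||j l jd ld];first by rewrite -scalemxAr a.
 by rewrite -scalemxAl b.
 by rewrite -scalemxAl -scalemxAr c.
- rewrite /ucomm -/q => z [a b c];split=> [||j k jd kd];first by rewrite -{1}qh -hmM b.
 by rewrite -{1}qh -hmM a.
 by rewrite -(ph kd jd) -!hmM c.
- by move=> z [].
- move=> e f ue pe uf pf;have [pe0 ->]:=corner_proj ue pe;have [pf0 ->]:=corner_proj uf pf.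
 have [r [W [W1 We te]]]:=proj_fac pe0;have [r' [W' [W1' We' tf]]]:=proj_fac pf0.
 rewrite te tf ler_pM2l ?ltr0n // ler_nat => rr.
 have [z zE]: exists z, z = W'^h *m pid_mx r *m W by eexists.
 have z0: p 0%N 0%N *m z = z.
 have h: p 0%N 0%N *m W'^h = W'^h.
 rewrite -[W'^h in LHS]mulmx1 -(hm1 _ r') -W1' hmM hmK !mulmxA -(mulmxA _ W'^h) We' mulmxA pM //.
 by rewrite -We' -!mulmxA W1' mulmx1.
 by rewrite zE !mulmxA h.
 have zz: z^h *m z = p 0%N 0%N *m e.
 rewrite zE !hmM hmK tr_pid_mx map_pid_mx !mulmxA -(mulmxA _ W') W1' mulmx1.
 rewrite -(mulmxA _ (pid_mx r) (pid_mx r)) mul_pid_mx !minnn (minn_idPr rr) pid_mx_1 mulmx1 //.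
 exists (amp z);first exact: amplify_comm.
 split;first by rewrite amplify_adj amplifyM // zz amp_corner.
 rewrite -{1}(amp_corner uf) amplifyM //;congr amp.
 by rewrite -We' zE !mulmxA -(mulmxA _ W') W1' mulmx1.
- move=> e k ue pe;have [pe0 ->]:=corner_proj ue pe;have [r [W [W1 We te]]]:=proj_fac pe0.
 rewrite te -natrM ler_nat leq_pmul2l // => kr.
 have [V V1 Vp]: exists2 V: 'M[C]_(k, D), V *m V^h = 1%:M & V *m (p 0%N 0%N *m e) = V.
 exists (pid_mx k *m W);last by rewrite -We !mulmxA -(mulmxA _ W) W1 mulmx1.
 by rewrite hmM !mulmxA -(mulmxA _ W) W1 mulmx1 tr_pid_mx map_pid_mx mul_pid_mx minnn (minn_idPr kr) pid_mx_1.
 have [z zE]: exists z, z = V^h *m V by eexists.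
 have zh: z^h = z by rewrite zE hmM hmK.
 have zz: z *m z = z by rewrite zE mulmxA -(mulmxA _ V) V1 mulmx1.
 have Vh: p 0%N 0%N *m e *m V^h = V^h by rewrite -[in RHS]Vp [RHS]hmM pe0.1.
 have pz: p 0%N 0%N *m e *m z = z by rewrite zE mulmxA Vh.
 have z0: p 0%N 0%N *m z = z by rewrite -pz !mulmxA pM.
 exists (amp z);split.
+ exact: amplify_comm.
+ by split;[rewrite amplify_adj zh|rewrite amplifyM ?zz].
+ by rewrite -{1}(amp_corner ue) amplifyM ?pz.
+ by rewrite amplify_trace // natrM zE mxtrace_mulC V1 mxtrace1.
- move=> e ue pe;have [pe0 ->]:=corner_proj ue pe;have [r [W [_ _ ->]]]:=proj_fac pe0.
 by exists r;rewrite natrM.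
- move=> y z [qy yq yp] qz hz;have zq: z *m q = q *m z by rewrite (hz q) // qy yq.
 split=> [//||j k jd kd];first by rewrite zq.
 by rewrite -(hz (p j k)) ?mxunits_l ?mxunits_r // -yp.
Qed.
End Units.

(** One nonzero row from each [G x] gives [K] orthogonal vectors in the row space of [q]. *)
Lemma orth_count K (G: 'I_K -> M) q: proj q -> (forall x, G x *m q = G x) ->
 (forall x, G x <> 0) -> (forall x y, x != y -> G x *m (G y)^h = 0) -> K%:R <= \tr q.
move=> pq Gq G0 GG;have [r [W [W1 Wq ->]]]:=proj_fac pq;rewrite ler_nat.
have /choice[i hi] x: exists i, row i (G x) != 0.
 apply/existsP;rewrite -[X in is_true X]negbK;apply/negP => /existsPn h;apply: (G0 x).
 by apply/row_matrixP => i;rewrite row0;have:=h i;rewrite negbK => /eqP.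
pose V :=\matrix_x row (i x) (G x);pose s: 'rV[C]_K :=\row_x rc (sqn (row (i x) (G x))).
have VV: V *m V^h = diag_mx s.
 apply/matrixP => x y;rewrite mxE [RHS]mxE;have [->|ne]:=eqVneq x y.
 by rewrite mulr1n mxE sqnE mxE;apply: eq_bigr => k _;rewrite !mxE.
 rewrite mulr0n;have:=congr1 (fun N: M => N (i x) (i y)) (GG _ _ ne).
 rewrite [X in X = _ -> _]mxE [X in _ = X -> _]mxE => h;apply: etrans h.
 by apply: eq_bigr => k _;rewrite !mxE.
have sP x: s 0 x != 0.
 by rewrite mxE;apply: contra_neq (hi x) => h;apply: sqn_eq0;apply: rc_inj.
have VW: V = V *m W^h *m W.
 by apply/row_matrixP => x;rewrite -mulmxA Wq row_mul rowK -row_mul Gq.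
have [t tE]: exists t: 'rV[C]_K, diag_mx s *m diag_mx t = 1%:M.
 exists (\row_x (s 0 x)^-1);rewrite mulmx_diag;apply/matrixP => x y;rewrite !mxE.
 by rewrite mulfV //;have:=sP x;rewrite mxE.
have h: V *m W^h *m (W *m V^h *m diag_mx t) = 1%:M by rewrite !mulmxA -VW VV tE.
have:=mxrankM_maxl (V *m W^h) (W *m V^h *m diag_mx t);rewrite h mxrank1.
by move/leq_trans;apply;apply: rank_leq_col.
Qed.
End Factors.

(** * Division tuples in one commutant and paths between them *)

Section Tuples.
Variables (R: realType) (D n: nat).
Local Notation C:=(Cplx R).
Local Notation M :='M[C]_D.
Local Notation tup:=(bool -> nat -> M).
Implicit Types (q e f z: M) (T G: tup) (Q: tup -> Prop).
Hypothesis n0: (0 < n)%N.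
Local Opaque mulmx map_mx trmx opb mxtrace.

Lemma hcancel z: z *m z^h = 0 -> z = 0.
move=> zz;apply/row_matrixP => i;rewrite row0 rowE;apply: sqn_eq0;apply: (@rc_inj R).
by rewrite sqnE hmM mulmxA -(mulmxA _ z) zz mulmx0 mul0mx mxE rc0.
Qed.
Lemma hcancelV z: z^h *m z = 0 -> z = 0.
by move=> h;rewrite -[z]hmK (hcancel (z:=z^h)) ?hmK // hm0. Qed.

Lemma proj_compl q: proj q -> proj (1%:M - q).
move=> [qh qq];split;first by rewrite hmB hm1 qh.
by rewrite mulmxBr mulmx1 mulmxBl mul1mx qq subrr subr0.
Qed.
Lemma sqn_proj q v: proj q -> rc (sqn (v *m q)) = (v *m q *m v^h) 0 0.
by move=> [qh qq];rewrite sqnE hmM qh mulmxA -(mulmxA v) qq. Qed.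
Lemma piso_r z e: proj e -> z^h *m z = e -> z *m e = z.
move=> [eh ee] zz;apply/subr0_eq/hcancelV.
by rewrite hmB hmM eh mulmxBr !mulmxBl !mulmxA -!(mulmxA _ z^h z) zz !ee !subrr.
Qed.
Lemma opb_proj q: proj q -> opb 1 q.
move=> pq v;rewrite expr1n mul1r.
have e: rc (sqn v) = rc (sqn (v *m q) + sqn (v *m (1%:M - q))).
 rewrite rcD !sqn_proj //;last exact: proj_compl.
 by rewrite mulmxBr mulmx1 mulmxBl sqnE [X in _ = _ + X]mxE [X in _ = _ + (_ + X)]mxE addrC subrK.
by rewrite (rc_inj e) lerDl sqn_ge0.
Qed.

Lemma opb_sum_adj q (I: finType) (F: I -> M) i: proj q ->
 \sum_i (F i)^h *m F i = q -> opb 1 (F i).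
move=> pq FF;rewrite -[F i]hmK;apply: opb_adj => //.
move=> v;apply: le_trans (opb_proj pq v);rewrite -lecR -[_%:C%C]/(rc _) -[(sqn (v *m q))%:C%C]/(rc _).
rewrite !sqnE !hmM hmK pq.1 !mulmxA -(mulmxA v q) pq.2 -FF mulmx_sumr mulmx_suml.
rewrite summxE (bigD1 i) //= !mulmxA lerDl sumr_ge0 // => j _.
have -> : v *m ((F j)^h *m F j) *m v^h = (v *m (F j)^h) *m (v *m (F j)^h)^h by rewrite hmM hmK !mulmxA.
by rewrite -sqnE -[0](rc0 R) rc_le sqn_ge0.
Qed.

(** Matrix form of the relations of [tdiv]: [T true] holds the [p] and [T false] the [X]. *)
Definition divt q T :=
 [/\ forall a b, (a < n)%N -> (b < n)%N ->
 (T true a)^h *m T true b = if a == b then (T true 0%N)^h *m T true 0%N else 0,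
 forall a, (a <= n)%N -> (T true 0%N)^h *m T true 0%N *m T false a = T false a,
 forall a b, (a < n)%N -> (b < n)%N -> a != b -> T false a *m T true b = 0,
 \sum_(a < n.+1) (T false a)^h *m T false a = q &
 forall c a, opb 1 (T c a)].

(** Rigid solutions, with [p a] the adjoint of [X a] for [a < n] and [X 0] a projection. They are
    easy to construct and to compare, but a path of them cannot change the trace of [X 0]; paths
    therefore pass through tuples that are only [divt]. *)
Definition std q T :=
 [/\ proj (T false 0%N) /\ T false 0%N *m T false n = T false n,
 forall a, T true a = (if (a < n)%N then T false a else 0)^h /\ ((n < a)%N -> T false a = 0),
 forall a b, (a < n)%N -> (b < n)%N ->
 T false a *m (T false b)^h = if a == b then T false 0%N else 0,
 forall a, (a < n)%N -> T false a *m (T false n)^h = 0 &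
 \sum_(a < n.+1) (T false a)^h *m T false a = q].

Lemma std_l q T a: std q T -> (a <= n)%N -> T false 0%N *m T false a = T false a.
move=> [[[eh ee] ew] _ vv vw _];rewrite leq_eqVlt => /orP[/eqP ->//|an].
apply/subr0_eq/hcancel;rewrite hmB hmM eh mulmxBl !mulmxBr !mulmxA -!(mulmxA _ (T false a)) vv // eqxx.
by rewrite -(mulmxA _ (T false 0%N)) !ee !subrr.
Qed.

Lemma std_div q T: proj q -> std q T -> divt q T.
move=> pq sT;have [[[eh ee] ew] Tt vv vw sq]:=sT.
have te a: (a < n)%N -> T true a = (T false a)^h by move=> an;have [-> _]:=Tt a;rewrite an.
have g: (T true 0%N)^h *m T true 0%N = T false 0%N by rewrite te // hmK vv.
have cf a: opb 1 (T false a).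
 have [an|an]:=leqP a n;last by have [_ ->]:=Tt a => //;exact: opb00.
 have an': (a < n.+1)%N by [].
 exact: (@opb_sum_adj q _ (fun a: 'I_n.+1 => T false a) (Ordinal an')).
split;[move=> a b an bn|move=> a an|move=> a b an bn ab|exact: sq|case=> a].
- by rewrite g !te // hmK vv.
- by rewrite g (std_l sT).
- by rewrite te // vv // (negPf ab).
- by have [-> _]:=Tt a;case: ifP => _;[apply: opb_adj|rewrite hm0;exact: opb00].
- exact: cf.
Qed.

(** Paths are constant outside the unit interval, so they are joined by adding them and subtracting
    the common value, with no case distinction in the proof of continuity. *)
Definition conn Q T T':=exists G: R -> tup,
 [/\ forall c a, mcont (fun s => G s c a), forall s, s <= 0 -> G s = T,
 forall s, 1 <= s -> G s = T' & forall s, Q (G s)].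

Lemma mcont_comp m p (F: R -> 'M[C]_(m, p)) (f: R -> R) k :
 (forall s s', `|f s' - f s| <= k * `|s' - s|) -> mcont F -> mcont (fun s => F (f s)).
by move=> h hF i j;apply: rcont_comp (hF i j) _;apply: rcont_lip h. Qed.
Lemma mcont_sum m p (I: Type) (r: seq I) (P: pred I) (F: I -> R -> 'M[C]_(m, p)) :
 (forall i, mcont (F i)) -> mcont (fun s => \sum_(i <- r | P i) F i s).
move=> h;elim: r => [|i r IH];first by under eq_fun do rewrite big_nil;apply: mcontC.
by under eq_fun do rewrite big_cons;case: (P i) => //;apply: mcontD.
Qed.

Lemma conn_path Q (G: R -> tup) T T': (forall c a, mcont (fun s => G s c a)) -> G 0 = T -> G 1 = T' ->
 (forall s, 0 <= s <= 1 -> Q (G s)) -> conn Q T T'.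
move=> hG G0 G1 hQ;exists (fun s => G (clamp s));split=> [c a|s s0|s s1|s].
- apply: (@mcont_comp _ _ (fun s => G s c a) (@clamp R) 1 _ (hG c a)) => s s'.
 by rewrite mul1r clamp_lip.
- by rewrite clamp0.
- by rewrite clamp1.
- exact/hQ/clampP.
Qed.
Lemma conn_sym Q T T': conn Q T T' -> conn Q T' T.
move=> [G [hG G0 G1 hQ]];exists (fun s => G (1 - s));split=> [c a|s s0|s s1|s //].
- apply: (@mcont_comp _ _ (fun s => G s c a) (fun s => 1 - s) 1 _ (hG c a)) => s s'.
 by rewrite mul1r distrC;have -> : 1 - s - (1 - s') = s' - s by ring.
- by apply: G1;lra.
- by apply: G0;lra.
Qed.
Lemma conn_trans Q T1 T2 T3: conn Q T1 T2 -> conn Q T2 T3 -> conn Q T1 T3.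
move=> [G [hG G0 G1 GQ]] [H [hH H0 H1 HQ]].
pose F s c a:=G (2 * s) c a + H (2 * s - 1) c a - T2 c a.
have F1 s: s <= 1 / 2 -> F s = G (2 * s).
 move=> h;have e: H (2 * s - 1) = T2 by apply: H0;lra.
 by apply/funext => c;apply/funext => a;rewrite /F e addrK.
have F2 s: 1 / 2 <= s -> F s = H (2 * s - 1).
 move=> h;have e: G (2 * s) = T2 by apply: G1;lra.
 by apply/funext => c;apply/funext => a;rewrite /F e addrAC subrr add0r.
exists F;split=> [c a|s s0|s s1|s].
- apply: mcontD;last exact: mcontC.
 apply: mcontD.
 apply: (@mcont_comp _ _ (fun s => G s c a) (fun s => 2 * s) 2 _ (hG c a)) => s s'.
 by rewrite -mulrBr normrM [`|2|]ger0_norm.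
 apply: (@mcont_comp _ _ (fun s => H s c a) (fun s => 2 * s - 1) 2 _ (hH c a)) => s s'.
 have -> : 2 * s' - 1 - (2 * s - 1) = 2 * (s' - s) by ring.
 by rewrite normrM [`|2|]ger0_norm.
- rewrite F1;[apply: G0|];lra.
- rewrite F2;[apply: H1|];lra.
- by have [h|h]:=leP s (1 / 2);[rewrite F1|rewrite F2 // ltW].
Qed.
Lemma conn_mono Q Q' T T': (forall T, Q T -> Q' T) -> conn Q T T' -> conn Q' T T'.
by move=> h [G [a b c d]];exists G;split=> // s;apply: h. Qed.
Lemma conn_sum K (Q: nat -> tup -> Prop) (T T': nat -> tup) :
 (forall i, (i < K)%N -> conn (Q i) (T i) (T' i)) ->
 conn (fun S => exists Si, (forall i, (i < K)%N -> Q i (Si i)) /\ S = fun c a => \sum_(i < K) Si i c a)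
 (fun c a => \sum_(i < K) T i c a) (fun c a => \sum_(i < K) T' i c a).
move=> h;have /choice[G hG] i: exists G: R -> tup, (i < K)%N ->
 [/\ forall c a, mcont (fun s => G s c a), forall s, s <= 0 -> G s = T i,
 forall s, 1 <= s -> G s = T' i & forall s, Q i (G s)].
 by have [iK|_]:=ltnP i K;[have [G ?]:=h _ iK;exists G|exists (fun=> T i)].
exists (fun s c a => \sum_(i < K) G i s c a);split=> [c a|s s0|s s1|s].
- apply: mcont_sum => i;by have [hc _ _ _]:=hG i (ltn_ord i).
- by apply/funext => c;apply/funext => a;apply: eq_bigr => i _;have [_ -> //]:=hG i (ltn_ord i).
- by apply/funext => c;apply/funext => a;apply: eq_bigr => i _;have [_ _ -> //]:=hG i (ltn_ord i).
- by exists (fun i => G i s);split=> // i iK;have [_ _ _ ]:=hG i iK.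
Qed.

Lemma div_conj W q q' T: W^h *m W = q -> W *m W^h = q' -> q *m q = q ->
 (forall c a, q *m T c a = T c a /\ T c a *m q = T c a) ->
 divt q T -> divt q' (fun c a => W *m T c a *m W^h).
move=> WW WW' qq qT [h1 h2 h3 h4 h5].
have cM (x: M) c a: W *m x *m W^h *m (W *m T c a *m W^h) = W *m (x *m T c a) *m W^h.
 by rewrite !mulmxA -(mulmxA _ W^h) WW -(mulmxA _ q) (qT c a).1.
have ca (x: M): (W *m x *m W^h)^h = W *m x^h *m W^h by rewrite !hmM hmK mulmxA.
have E c a c' b: (W *m T c a *m W^h)^h *m (W *m T c' b *m W^h) = W *m ((T c a)^h *m T c' b) *m W^h.
 by rewrite ca cM.
have qh: q^h = q by rewrite -WW hmM hmK.
have Wq: W *m q = W.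
 by apply/subr0_eq/hcancelV;rewrite hmB hmM qh mulmxBl !mulmxBr !mulmxA -!(mulmxA _ W^h W) WW !qq !subrr.
have W1: opb 1 W.
 rewrite -[W]hmK;apply: opb_adj => //;apply: opb_cstar => //;rewrite expr1n hmK WW.
 exact: opb_proj.
split=> [a b an bn|a an|a b an bn ab||c a].
- apply: (etrans (E true a true b));rewrite (h1 a b an bn).
 by case: (a == b);[exact: esym (E true 0%N true 0%N)|rewrite mulmx0 mul0mx].
- by rewrite /= E cM (h2 a an).
- by rewrite /= cM (h3 a b an bn ab) mulmx0 mul0mx.
- under eq_bigr => a _ do rewrite /= E.
 by rewrite -mulmx_suml -mulmx_sumr h4 Wq.
- rewrite /= -[1]mulr1;apply: opbM;last exact: opb_adj.
 by rewrite -[1]mulr1;apply: opbM.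
Qed.

Definition mk_std (v: nat -> M) w: bool -> nat -> M:=fun c a =>
 if (a < n)%N then (if c then (v a)^h else v a) else if ~~ c && (a == n) then w else 0.

Lemma mk_stdP q (v: nat -> M) f w: proj (v 0%N) -> proj f ->
 (forall a b, (a < n)%N -> (b < n)%N -> v a *m (v b)^h = if a == b then v 0%N else 0) ->
 (forall a, (a < n)%N -> v a *m f = 0) -> \sum_(a < n) (v a)^h *m v a + f = q ->
 w^h *m w = f -> v 0%N *m w = w -> std q (mk_std v w).
move=> pv pf vv vf sq ww vw.
have vE a: (a < n)%N -> mk_std v w false a = v a by rewrite /mk_std => ->.
have wE: mk_std v w false n = w by rewrite /mk_std ltnn eqxx.
split;rewrite ?(vE 0%N n0) ?wE //.
- move=> a;rewrite /mk_std;split;first by case: ifP => _ //=;rewrite hm0.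
 by move=> an;rewrite ltnNge ltnW //= gtn_eqF.
- by move=> a b an bn;rewrite !vE //;apply: vv.
- by move=> a an;rewrite vE // -(piso_r pf ww) hmM pf.1 mulmxA vf // mul0mx.
by rewrite big_ord_recr /= wE ww -sq;congr (_ + _);apply: eq_bigr => a _;rewrite vE.
Qed.

Section Factor.
Variables (d: nat) (q: M) (A: M -> Prop).
Hypothesis fA: fac d q A.

Definition stdA T:=std q T /\ forall c a, A (T c a).
Definition divA T:=divt q T /\ forall c a, A (T c a).

Lemma fac_qh: q^h = q. Proof. exact: (fac_proj fA).1. Qed.
Lemma fac_r z: A z -> z *m q = z.
by move=> Az;rewrite -[z in LHS]hmK -{1}fac_qh -hmM (fac_l fA) ?hmK //;apply: fac_adj fA _ Az. Qed.
Lemma fac0: A 0.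
by rewrite -(scale0r q);apply: (facZ fA);apply: fac_unit fA. Qed.
Lemma facN z: A z -> A (- z).
by rewrite -scaleN1r;exact: (facZ fA). Qed.
Lemma facB y z: A y -> A z -> A (y - z).
by move=> hy hz;apply: (facD fA) => //;apply: facN. Qed.
Lemma fac_sum (I: Type) (r: seq I) (P: pred I) (F: I -> M): (forall i, P i -> A (F i)) ->
 A (\sum_(i <- r | P i) F i).
by move=> h;apply: big_ind => //;[exact: fac0|exact: (facD fA)]. Qed.

Lemma fac_eq e f: A e -> proj e -> A f -> proj f -> \tr e = \tr f ->
 exists z, [/\ A z, z^h *m z = e, z *m z^h = f, z *m e = z & f *m z = z].
move=> Ae pe Af pf ef;have [|z Az [ze fz]]:=fac_le fA Ae pe Af pf;first by rewrite ef.
have zz: z *m e = z by apply: piso_r.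
exists z;split=> //.
have pz: proj (z *m z^h) by split;[rewrite hmM hmK|rewrite !mulmxA -(mulmxA z) ze zz].
apply/esym/subr0_eq/proj_trace0;first by apply: projB => //;rewrite mulmxA fz.
by rewrite linearB /= mxtrace_mulC ze ef subrr.
Qed.

Section Std.
Variable T: bool -> nat -> M.
Hypothesis sT: stdA T.
Let v a:=T false a.
Let e:=T false 0%N.
Definition std_rem:=v n *m (v n)^h.
Let r:=std_rem.

Lemma std_Av a: A (v a). Proof. by have [_]:=sT;apply. Qed.
Lemma std_p: proj e. Proof. by have [[[]]]:=sT. Qed.
Lemma std_vq a: v a *m q = v a. Proof. exact/fac_r/std_Av. Qed.
Lemma std_vw a: (a < n)%N -> v a *m (v n)^h = 0. Proof. by move=> an;have [[_ _ _ h _] _]:=sT;apply: h. Qed.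
Lemma std_wv a: (a < n)%N -> v n *m (v a)^h = 0.
by move=> an;rewrite -[LHS]hmK hmM hmK std_vw // hm0. Qed.
Lemma std_sum: \sum_(a < n.+1) (v a)^h *m v a = q. Proof. by have [[]]:=sT. Qed.
Definition std_g a:=if (a < n)%N then e else r.
Lemma std_wwh: r *m v n = v n.
rewrite -[RHS]std_vq -std_sum mulmx_sumr big_ord_recr /= big1 ?add0r ?mulmxA // => a _.
by rewrite mulmxA std_wv // mul0mx.
Qed.
Lemma std_rp: proj r.
by split;[rewrite /r /std_rem hmM hmK|rewrite {2}/r /std_rem mulmxA std_wwh]. Qed.
Lemma std_er: e *m r = r.
by rewrite /r /std_rem mulmxA;have [[[_ ->]]]:=sT. Qed.
Lemma std_gv a: (a <= n)%N -> std_g a *m v a = v a.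
rewrite /std_g leq_eqVlt => /orP[/eqP ->|an];first by rewrite ltnn std_wwh.
by rewrite an;have [h _]:=sT;apply: (std_l h);apply: ltnW.
Qed.
Lemma std_ev a: (a <= n)%N -> e *m v a = v a.
by have [h _]:=sT;apply: (std_l h). Qed.
Lemma std_vv a b: (a <= n)%N -> (b <= n)%N -> v a *m (v b)^h = if a == b then std_g a else 0.
rewrite /std_g leq_eqVlt => /orP[/eqP ->|an];rewrite leq_eqVlt => /orP[/eqP ->|bn].
- by rewrite eqxx ltnn.
- by rewrite gtn_eqF // std_wv.
- by rewrite ltn_eqF // std_vw.
- by rewrite an;have [[_ _ h _ _] _]:=sT;apply: h.
Qed.
Lemma std_trace: \tr q = n%:R * \tr e + \tr r.
rewrite -std_sum raddf_sum /= big_ord_recr /= [in X in _ + X]mxtrace_mulC;congr (_ + _).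
rewrite (eq_bigr (fun=> \tr e)) ?sumr_const ?card_ord ?mulr_natl // => a _.
by rewrite mxtrace_mulC std_vv ?(ltnW (ltn_ord a)) // eqxx /std_g ltn_ord.
Qed.
Lemma std_Ae: A e. Proof. exact: std_Av. Qed.
Lemma std_Ar: A r. Proof. by apply: (facM fA);[|apply: (fac_adj fA)];apply: std_Av. Qed.
(** The range of the remainder lies below [e], so [q] is worth at most [n.+1] copies of [e]. *)
Lemma std_bound m k: (0 < d)%N -> \tr e = (d * m)%:R -> \tr q = (d * k)%:R -> (k <= n.+1 * m)%N.
move=> d0 em qk;have pb: proj (e - r):=projB std_p std_rp std_er.
have [j tj]:=fac_nat fA (facB std_Ae std_Ar) pb.
have e1: (d * (k + j))%:R = (d * (n.+1 * m))%:R :> C.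
 rewrite mulnDr natrD -qk -tj std_trace linearB /= -/e -/r.
 by rewrite addrA addrAC addrK em mulnCA mulSn natrD !natrM addrC.
move/eqP: e1;rewrite eqr_nat eqn_pmul2l // => /eqP <-;exact: leq_addr.
Qed.
End Std.
Local Opaque std_rem.

(* Both tuples are standard, so the unitary carrying one to the other is built from partial
   isometries between the projections [v a *m (v a)^h]. *)
Lemma conn_std_eq T T': stdA T -> stdA T' -> \tr (T false 0%N) = \tr (T' false 0%N) ->
 conn divA T T'.
move=> sT sT' te.
have tr_r: \tr (std_rem T) = \tr (std_rem T').
 by have:=std_trace sT;rewrite (std_trace sT') te => /addrI ->.
have [z1 [Az1 z1z z1z' z1r z1r']] :=
 fac_eq (std_Ar sT) (std_rp sT) (std_Ar sT') (std_rp sT') tr_r.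
have [z2 [Az2 z2z z2z' z2r z2r']]: exists z, [/\ A z, z^h *m z = T false 0%N - std_rem T,
 z *m z^h = T' false 0%N - std_rem T', z *m (T false 0%N - std_rem T) = z &
 (T' false 0%N - std_rem T') *m z = z].
 apply: fac_eq;[| | | |by rewrite !linearB /= te tr_r].
- by apply: facB;[exact: std_Ae|exact: std_Ar].
- by apply: projB;[exact: std_p|exact: std_rp|exact: std_er].
- by apply: facB;[exact: std_Ae|exact: std_Ar].
- by apply: projB;[exact: std_p|exact: std_rp|exact: std_er].
have rd S: stdA S -> std_rem S *m (S false 0%N - std_rem S) = 0.
 move=> sS;have [rh rr]:=std_rp sS;have [eh _]:=std_p sS;have er:=std_er sS.
 by have:=congr1 (fun N: M => N^h) er;rewrite hmM rh eh mulmxBr rr => ->;apply: subrr.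
have z12: z1^h *m z2 = 0.
 rewrite -z2r' -z1r' hmM (std_rp sT').1 -mulmxA (mulmxA (std_rem T')) rd //.
 by rewrite mul0mx mulmx0.
have z12': z1 *m z2^h = 0.
 rewrite -z1r -z2r hmM hmB (std_rp sT).1 (std_p sT).1 -mulmxA (mulmxA (std_rem T)) rd //.
 by rewrite mul0mx mulmx0.
have [z zE]: exists z, z = z1 + z2 by eexists.
have Az: A z by rewrite zE;apply: (facD fA).
have zz: z^h *m z = T false 0%N.
 rewrite zE hmD mulmxDl !mulmxDr z1z z2z z12 -[z2^h *m z1]hmK hmM hmK z12 hm0 addr0 add0r.
 by rewrite addrC subrK.
have zz': z *m z^h = T' false 0%N.
 rewrite zE hmD mulmxDl !mulmxDr z1z' z2z' z12' -[z2 *m z1^h]hmK hmM hmK z12' hm0 addr0 add0r.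
 by rewrite addrC subrK.
have zr: z *m std_rem T = std_rem T' *m z.
 have h2: z2 *m std_rem T = 0.
 by rewrite -z2r -mulmxA -[_ *m std_rem T]hmK hmM hmB (std_rp sT).1 (std_p sT).1 rd // hm0 mulmx0.
 have h3: std_rem T' *m z2 = 0 by rewrite -z2r' mulmxA rd // mul0mx.
 by rewrite zE mulmxDl mulmxDr z1r z1r' h2 h3.
have ze: z *m T false 0%N = z:=piso_r (std_p sT) zz.
have e'z: T' false 0%N *m z = z by rewrite -zz' -mulmxA zz ze.
have zg b: z *m std_g T b = std_g T' b *m z by rewrite /std_g;case: ifP => _;rewrite ?zr ?ze ?e'z.
have vg b: (b <= n)%N -> (T' false b)^h *m std_g T' b = (T' false b)^h.
 move=> bn;have h:=std_gv sT' bn;rewrite -[in RHS]h hmM;congr (_ *m _).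
 by rewrite /std_g;case: ifP => _;[rewrite (std_p sT').1|rewrite (std_rp sT').1].
have [U UE]: exists U, U = \sum_(a < n.+1) (T' false a)^h *m z *m T false a by eexists.
have Uv b: (b <= n)%N -> U *m (T false b)^h = (T' false b)^h *m z.
 move=> bn;have bn': (b < n.+1)%N by [].
 rewrite UE mulmx_suml (bigD1 (Ordinal bn')) //= big1 => [|a ab].
 by rewrite addr0 -(mulmxA _ (T false b)) std_vv // eqxx -mulmxA zg mulmxA vg.
 by rewrite -(mulmxA _ (T false a)) std_vv ?leq_ord //= (negPf (ab: (a: nat) != b)) mulmx0.
have vU b: (b <= n)%N -> T' false b *m U = z *m T false b.
 move=> bn;have bn': (b < n.+1)%N by [].
 rewrite UE mulmx_sumr (bigD1 (Ordinal bn')) //= big1 => [|a ab].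
 by rewrite addr0 !mulmxA std_vv // eqxx -zg -mulmxA std_gv.
 by rewrite !mulmxA std_vv ?leq_ord // eq_sym (negPf (ab: (a: nat) != b)) !mul0mx.
have UU': U *m U^h = q.
 rewrite {2}UE hm_sum mulmx_sumr -(std_sum sT');apply: eq_bigr => a _.
 by rewrite !hmM hmK !mulmxA Uv ?leq_ord // -(mulmxA _ z) zz' -mulmxA std_ev ?leq_ord.
have U'U: U^h *m U = q.
 rewrite {1}UE hm_sum mulmx_suml -(std_sum sT);apply: eq_bigr => a _.
 by rewrite !hmM hmK -!mulmxA vU ?leq_ord // (mulmxA z^h) zz std_ev ?leq_ord.
have AU: A U.
 rewrite UE;apply: fac_sum => a _;apply: (facM fA);last exact: std_Av.
 by apply: (facM fA) => //;apply: (fac_adj fA);apply: std_Av.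
have [qh qq]:=fac_proj fA.
have qU: q *m U = U by apply: (fac_l fA).
have Uq: U *m q = U by apply: fac_r.
have [h0 _ _ _ _]:=sT.1;have [h0' _ _ _ _]:=sT'.1.
have UvU b: (b <= n)%N -> U *m T false b *m U^h = T' false b.
 move=> bn;rewrite -(std_ev sT bn) mulmxA -[in X in U *m X](std_p sT).1 Uv // (std_p sT').1 e'z.
 by rewrite -vU // -mulmxA UU' std_vq.
have TE c a: U *m T c a *m U^h = T' c a.
 have f b: U *m T false b *m U^h = T' false b.
 have [bn|bn]:=leqP b n;first exact: UvU.
 have [[_ t _ _ _] _]:=sT;have [[_ t' _ _ _] _]:=sT'.
 by rewrite (t b).2 // (t' b).2 // mulmx0 mul0mx.
 case: c;last exact: f.
 have [[_ t _ _ _] _]:=sT;have [[_ t' _ _ _] _]:=sT'.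
 rewrite (t a).1 (t' a).1;case: ifP => _;last by rewrite hm0 mulmx0 mul0mx.
 by rewrite -f !hmM hmK mulmxA.
have [Y YE]: exists Y, Y = U + (1%:M - q) by eexists.
have Yh: Y^h = U^h + (1%:M - q) by rewrite YE hmD hmB hm1 qh.
have Uhq: U^h *m q = U^h by rewrite -[LHS]hmK hmM hmK qh qU.
have qUh: q *m U^h = U^h by rewrite -[LHS]hmK hmM hmK qh Uq.
have Y1: Y *m Y^h = 1%:M.
 have Uc: U *m (1%:M - q) = 0 by rewrite mulmxBr mulmx1 Uq subrr.
 have cU: (1%:M - q) *m U^h = 0 by rewrite mulmxBl mul1mx qUh subrr.
 rewrite Yh YE mulmxDl [U *m _]mulmxDr [(1%:M - q) *m _]mulmxDr Uc cU UU' addr0 add0r.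
 by rewrite (proj_compl (fac_proj fA)).2 addrC subrK.
have Y2: Y^h *m Y = 1%:M by apply: mulmx1C.
have Yq: q *m Y = U by rewrite YE mulmxDr mulmxBr mulmx1 qq subrr addr0.
have qY: q *m Y = Y *m q by rewrite Yq YE mulmxDl mulmxBl mul1mx qq subrr addr0.
pose W s:=q *m upath Y s.
have qu s: q *m upath Y s = upath Y s *m q by apply: upath_comm.
have WW s: (W s)^h *m W s = q.
 by rewrite /W hmM qh mulmxA -(mulmxA (upath Y s)^h q q) qq -mulmxA qu mulmxA (upath_u Y s).2 mul1mx.
have WW' s: W s *m (W s)^h = q.
 by rewrite /W hmM qh mulmxA -(mulmxA q (upath Y s)) (upath_u Y s).1 mulmx1 qq.
have qT S: stdA S -> forall c a, q *m S c a = S c a /\ S c a *m q = S c a.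
 by move=> sS c a;split;[apply: (fac_l fA)|apply: fac_r];apply: sS.2.
apply: (@conn_path _ (fun s c a => W s *m T c a *m (W s)^h)).
- have cW: mcont W by apply: mcontM;[exact: mcontC|exact: upath_cont].
 by move=> c a;apply: mcontM;[apply: mcontM => //;exact: mcontC|exact: mcont_adj].
- apply/funext => c;apply/funext => a;rewrite /W upath0 mulmx1 qh.
 by rewrite (qT _ sT c a).1 (qT _ sT c a).2.
- by apply/funext => c;apply/funext => a;rewrite /W upath1 // Yq TE.
move=> s _;split.
 by apply: (@div_conj _ q) => //;[exact: qT|apply: std_div => //;exact: sT.1].
have AW: A (W s).
 apply: (fac_bicommutant fA AU) => [|X XU Xq];first by rewrite mulmxA qq.
 have XY: X *m Y = Y *m X by rewrite YE mulmxDr mulmxDl mulmxBr mulmxBl mulmx1 mul1mx XU Xq.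
 have h: X *m upath Y s = upath Y s *m X by apply: upath_comm.
 by rewrite /W mulmxA Xq -mulmxA h mulmxA.
by move=> c a;apply: (facM fA);[apply: (facM fA) => //;apply: sT.2|apply: (fac_adj fA)].
Qed.

Section Lower.
Variable T: bool -> nat -> M.
Hypothesis sT: stdA T.
Let v a:=T false a.
Let e:=T false 0%N.
Variables (e' z: M).
Hypotheses (Ae': A e') (pe': proj e') (ee': e *m e' = e') (e'w: e' *m v n = v n).
Hypotheses (Az: A z) (e'z: e' *m z = z) (zw: z^h *m v n = 0)
 (zz: z^h *m z = \sum_(a < n) (v a)^h *m (e - e') *m v a).

(** On [e - e'] the [X a] are scaled by [x] and the [p a] by [c], while [s] adds to the remainder
    the [z] that makes up for the loss. The relation that [g] fixes each [X a] needs [x = 0] or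
    [c = 1]. *)
Definition lowered (x c s: R): bool -> nat -> M:=fun b a =>
 if b then (if (a < n)%N then (v a)^h *m (e' + rc c *: (e - e')) else 0)
 else if (a < n)%N then (e' + rc x *: (e - e')) *m v a
 else if a == n then v n + rc s *: z else 0.

Let pe: proj e. Proof. exact: std_p sT. Qed.
Let e'e: e' *m e = e'.
by rewrite -[RHS]pe'.1 -[in RHS]ee' hmM pe.1 pe'.1. Qed.
Let pd: proj (e - e'). Proof. exact: projB pe pe' ee'. Qed.
Let e'd: e' *m (e - e') = 0. Proof. by rewrite mulmxBr e'e pe'.2 subrr. Qed.
Let de': (e - e') *m e' = 0. Proof. by rewrite mulmxBl ee' pe'.2 subrr. Qed.
Let mix_mul x c: (e' + rc x *: (e - e')) *m (e' + rc c *: (e - e')) = e' + rc (x * c) *: (e - e').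
rewrite mulmxDl !mulmxDr -!scalemxAl -!scalemxAr e'd de' pe'.2 pd.2 !scaler0 add0r addr0.
by rewrite scalerA rcM.
Qed.
Let mix_adj c: (e' + rc c *: (e - e'))^h = e' + rc c *: (e - e').
by rewrite hmD hmZ rc_conj pe'.1 pd.1. Qed.
Let mix1: e' + rc 1 *: (e - e') = e.
by rewrite rc1 scale1r addrC subrK. Qed.
Let mix_e x: (e' + rc x *: (e - e')) *m e = e' + rc x *: (e - e').
by rewrite -{2}mix1 mix_mul mulr1. Qed.
Let mix_e' x: (e' + rc x *: (e - e')) *m e' = e'.
by rewrite mulmxDl pe'.2 -scalemxAl de' scaler0 addr0. Qed.
Let vv a b: (a < n)%N -> (b < n)%N -> v a *m (v b)^h = if a == b then e else 0.
by move=> an bn;rewrite /v (std_vv sT (ltnW an) (ltnW bn)) /std_g an. Qed.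

Lemma lowered_div x c s: 0 <= x <= 1 -> 0 <= c <= 1 -> s ^+ 2 = 1 - x ^+ 2 -> (x = 0 \/ c = 1) ->
 divA (lowered x c s).
move=> x01 c01 sx xc.
have g a: (a < n)%N -> (lowered x c s true a)^h *m lowered x c s true a = e' + rc (c * c) *: (e - e').
 by move=> an;rewrite /lowered an hmM hmK mix_adj !mulmxA -(mulmxA _ (v a)) vv // eqxx mix_e mix_mul.
have cx: c * c * x = x by case: xc => ->;rewrite ?mulr0 ?mulr1 ?mul1r.
have AL b a: A (lowered x c s b a).
 have Am t: A (e' + rc t *: (e - e')).
 by apply: (facD fA) => //;apply: (facZ fA);apply: facB => //;apply: std_Ae sT.
 case: b;rewrite /lowered;case: ifP => _;try exact: fac0.
- by apply: (facM fA) => //;apply: (fac_adj fA);apply: (std_Av sT).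
- by apply: (facM fA) => //;apply: (std_Av sT).
- case: ifP => _;last exact: fac0.
 by apply: (facD fA);[apply: (std_Av sT)|apply: (facZ fA)].
have sumE: \sum_(a < n.+1) (lowered x c s false a)^h *m lowered x c s false a = q.
 rewrite -(std_sum sT) !big_ord_recr /= /lowered ltnn eqxx.
 have -> : (v n + rc s *: z)^h *m (v n + rc s *: z) = (v n)^h *m v n + rc (1 - x ^+ 2) *: (z^h *m z).
 have wz: (v n)^h *m z = 0 by rewrite -[LHS]hmK hmM hmK zw hm0.
 rewrite hmD hmZ rc_conj mulmxDl !mulmxDr -!scalemxAl -!scalemxAr wz zw !scaler0 add0r addr0.
 by rewrite scalerA -rcM -expr2 sx.
 rewrite zz addrCA [RHS]addrC scaler_sumr -big_split /=;congr (_ + _);apply: eq_bigr => a _.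
 rewrite ltn_ord hmM mix_adj mulmxA -(mulmxA (v a)^h) mix_mul.
 rewrite mulmxDr mulmxDl -scalemxAr -scalemxAl -addrA -scalerDl -rcD -expr2 addrCA subrr addr0 rc1 scale1r.
 by rewrite -mulmxDl -mulmxDr [e' + _]addrC subrK -mulmxA (std_ev sT) // ltnW.
split;last exact: AL.
split=> [a b an bn|a an|a b an bn ab|//|b a].
- case: (eqVneq a b) => [<-|ab];first by rewrite (g a an) (g 0%N n0).
 by rewrite /lowered an bn hmM hmK mix_adj !mulmxA -(mulmxA _ (v a)) vv // (negPf ab) mulmx0 mul0mx.
- rewrite (g 0%N n0) /lowered;case: ifP => an'.
 by rewrite mulmxA;congr (_ *m _);rewrite -[in RHS]cx;exact: mix_mul.
 case: (a == n);last by rewrite mulmx0.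
 rewrite mulmxDr -scalemxAr -{1}e'w -{1}e'z;congr (_ + _ *: _);rewrite mulmxA mix_e' //.
- by rewrite /lowered an bn mulmxA -(mulmxA _ (v a)) vv // (negPf ab) mulmx0 mul0mx.
have o t: 0 <= t <= 1 -> opb 1 (e' + rc t *: (e - e')).
 move=> /andP[t0 t1].
 have -> : e' + rc t *: (e - e') = rc t *: e + rc (1 - t) *: e'.
 rewrite scalerBr rcB scalerBl rc1 scale1r addrCA;by [].
 have [h1 h2]: opb t (rc t *: e) /\ opb (1 - t) (rc (1 - t) *: e').
 split;first by have:=opbZ (rc t) (opb_proj pe);rewrite absC_rc ger0_norm // mulr1.
 by have:=opbZ (rc (1 - t)) (opb_proj pe');rewrite absC_rc ger0_norm ?subr_ge0 // mulr1.
 by have:=opbD t0 _ h1 h2;rewrite subr_ge0 [t + _]addrC subrK;apply.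
have ov i: opb 1 (v i) by have [_ _ _ _ h]:=std_div (fac_proj fA) sT.1;apply: h.
case: b.
 rewrite /lowered;case: ifP => _;last exact: opb00.
 by rewrite -[1]mulr1;apply: opbM;[apply: opb_adj|apply: o].
have [an|an]:=leqP a n;last by rewrite /lowered ltnNge (ltnW an) /= gtn_eqF //;apply: opb00.
have an': (a < n.+1)%N by [].
exact: (@opb_sum_adj q _ (fun a: 'I_n.+1 => lowered x c s false a) (Ordinal an') (fac_proj fA) sumE).
Qed.
End Lower.

(* Shrinking the range projection keeps the relations if [X] is cut down before [p]. *)
Lemma conn_std_lower T m k m': (0 < d)%N -> stdA T -> \tr (T false 0%N) = (d * m)%:R ->
 \tr q = (d * k)%:R -> (m' <= m)%N -> (k <= n.+1 * m')%N ->
 exists T', [/\ stdA T', \tr (T' false 0%N) = (d * m')%:R & conn divA T T'].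
move=> d0 sT em qk mm km.
have nk: (n * m <= k)%N.
 have [j tj]:=fac_nat fA (std_Ar sT) (std_rp sT).
 have:=std_trace sT;rewrite qk em tj -natrM -natrD mulnCA -mulnDr => /eqP.
 by rewrite eqr_nat eqn_pmul2l // => /eqP ->;apply: leq_addr.
have trr: \tr (std_rem T) = (d * (k - n * m))%:R.
 apply: (@addrI _ (n%:R * \tr (T false 0%N)));rewrite -(std_trace sT) qk em -natrM -natrD.
 by rewrite mulnCA -mulnDr subnKC.
set e:=T false 0%N in em *;set r:=std_rem T in trr *.
have per: proj (e - r):=projB (std_p sT) (std_rp sT) (std_er sT).
have Aer: A (e - r) by apply: facB;[exact: std_Ae|exact: std_Ar].
have kk: (k - n * m <= m')%N.
 rewrite leq_subLR;apply: leq_trans km _;rewrite mulSn addnC leq_add2r leq_mul2l mm orbT //.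
have ter: \tr (e - r) = (d * (m - (k - n * m)))%:R.
 by rewrite linearB /= em trr -natrB -?mulnBr // leq_pmul2l // (leq_trans kk).
have [g [Ag pg erg tg]]: exists f, [/\ A f, proj f, (e - r) *m f = f & \tr f = (d * (m' - (k - n * m)))%:R].
 by apply: (fac_sub fA) => //;rewrite ter ler_nat leq_mul2l leq_sub2r ?orbT.
have [eh ee]:=std_p sT;have [rh rr]:=std_rp sT;have er:=std_er sT.
have re: r *m e = r by rewrite -[RHS]rh -[in RHS]er hmM rh eh.
have eg: e *m g = g by rewrite -erg mulmxA mulmxBr ee er.
have rg: r *m g = 0 by rewrite -erg mulmxA mulmxBr re rr subrr mul0mx.
(* [e'] has to contain the range [r] of the old remainder; the part [g] receives what is cut off. *)
have [e' e'E]: exists e', e' = r + g by eexists.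
have Ae': A e' by rewrite e'E;apply: (facD fA) => //;exact: std_Ar.
have pe': proj e' by rewrite e'E;apply: projD => //;exact: std_rp.
have ee': e *m e' = e' by rewrite e'E mulmxDr er eg.
have te': \tr e' = (d * m')%:R by rewrite e'E linearD /= trr tg -natrD -mulnDr subnKC.
have rw: r *m T false n = T false n:=std_wwh sT.
have gr: g *m r = 0 by rewrite -[LHS]hmK hmM rh pg.1 rg hm0.
have e'w: e' *m T false n = T false n.
 by rewrite e'E mulmxDl rw -[in X in _ + X]rw mulmxA gr mul0mx addr0.
have pd: proj (e - e'):=projB (std_p sT) pe' ee'.
have [f fE]: exists f, f = \sum_(a < n) (T false a)^h *m (e - e') *m T false a by eexists.
have vv a b: (a < n)%N -> (b < n)%N -> T false a *m (T false b)^h = if a == b then e else 0.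
 by move=> an bn;rewrite (std_vv sT (ltnW an) (ltnW bn)) /std_g an.
have ed: e *m (e - e') = e - e' by rewrite mulmxBr ee ee'.
have Af: A f.
 rewrite fE;apply: fac_sum => a _;apply: (facM fA);last exact: std_Av.
 by apply: (facM fA);[apply: (fac_adj fA);exact: std_Av|apply: facB => //;exact: std_Ae].
have pf: proj f.
 split;first by rewrite fE hm_sum;apply: eq_bigr => a _;rewrite !hmM hmK pd.1 mulmxA.
 rewrite {1}fE mulmx_suml fE;apply: eq_bigr => a _;rewrite mulmx_sumr (bigD1 a) //= big1 => [|b ba].
 by rewrite addr0 -!mulmxA (mulmxA (T false a) (T false a)^h) vv // eqxx (mulmxA e) ed (mulmxA (e - e')) pd.2.
 by rewrite !mulmxA -(mulmxA _ (T false a)) vv // eq_sym (negPf (ba: (b: nat) != a)) mulmx0 !mul0mx.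
have tf: \tr f = (d * (n * (m - m')))%:R.
 rewrite fE raddf_sum /= (eq_bigr (fun=> \tr (e - e'))) ?sumr_const ?card_ord.
 by rewrite linearB /= em te' -natrB ?leq_mul2l ?mm ?orbT // -mulnBr -mulrnA;congr (_ *+ _);lia.
 move=> a _;rewrite -mulmxA mxtrace_mulC -mulmxA vv // eqxx.
 by rewrite -[RHS](congr1 (fun N => \tr N) ed) mxtrace_mulC.
(* Here [k <= n.+1 * m'] enters: the [n] pieces cut off, each of size [m - m'], must fit into [g],
   of size [m' - (k - n * m)]. *)
have [|z Az [zz gz]]:=fac_le fA Af pf Ag pg.
 by move: km nk kk;rewrite tf tg ler_nat leq_mul2l mulnBr mulSn => h1 h2 h3;apply/orP;right;lia.
have e'z: e' *m z = z by rewrite -gz e'E mulmxDl !mulmxA rg pg.2 mul0mx add0r.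
have zw: z^h *m T false n = 0.
 by rewrite -gz hmM pg.1 -mulmxA -rw (mulmxA g) gr mul0mx mulmx0.
have zf: z^h *m z = \sum_(a < n) (T false a)^h *m (e - e') *m T false a by rewrite zz fE.
have L:=lowered_div sT Ae' pe' ee' e'w Az e'z zw zf.
have itv0: 0 <= (0: R) <= 1 by rewrite lexx ler01.
have sx0: (1: R) ^+ 2 = 1 - 0 ^+ 2 by rewrite expr0n subr0 expr1n.
have L0:=L 0 0 1 itv0 itv0 sx0 (or_introl erefl).
pose T':=lowered T e' z 0 0 1.
have e'v: e' *m e = e' by rewrite -[RHS]pe'.1 -[in RHS]ee' hmM eh pe'.1.
have nn: (n == n) = true by exact: eqxx.
have vE a: (a < n)%N -> T' false a = e' *m T false a.
 by move=> an;rewrite /T' /lowered an rc0 scale0r addr0.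
have wE: T' false n = T false n + z by rewrite /T' /lowered ltnn eqxx rc1 scale1r.
have v0E: T' false 0%N = e' by rewrite vE.
have T1: stdA T'.
 have [dT' AT']: divA T':=L0.
 split=> //;split.
- by rewrite v0E wE mulmxDr e'w e'z.
- move=> a;split;last by move=> an;rewrite /T' /lowered ltnNge (ltnW an) /= gtn_eqF.
 case: ifP => an;last by rewrite /T' /lowered an hm0.
 by rewrite vE // hmM pe'.1 /T' /lowered an rc0 scale0r addr0.
- move=> a b an bn;rewrite v0E !vE // hmM pe'.1 mulmxA -(mulmxA e') vv //.
 by case: (a == b);rewrite ?mulmx0 ?mul0mx // e'v pe'.2.
- move=> a an;rewrite vE // wE hmD mulmxDr -!mulmxA (std_vw sT an) mulmx0 add0r.
 have zhE: z^h = f *m z^h by rewrite -{1}(piso_r pf zz) hmM pf.1.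
 have vf: T false a *m f = (e - e') *m T false a.
 rewrite fE mulmx_sumr (bigD1 (Ordinal an)) //= big1 => [|b ba].
 by rewrite addr0 !mulmxA vv // eqxx ed.
 by rewrite !mulmxA vv // eq_sym (negPf (ba: (b: nat) != a)) !mul0mx.
 by rewrite zhE (mulmxA _ f) vf !mulmxA mulmxBr e'v pe'.2 subrr !mul0mx.
- by have [_ _ _ h _]:=dT'.
exists T';split=> //;first by rewrite v0E.
apply: (@conn_trans _ _ (lowered T e' z 0 1 1)).
 apply: (@conn_path _ (fun s => lowered T e' z (cosp 2^-1 s) 1 (sinp 2^-1 s))).
- move=> [] a;rewrite /lowered;case: (a < n)%N;try exact: mcontC.
 apply: mcontM;last exact: mcontC;apply: mcontD;first exact: mcontC.
 by apply: mcontZ;[exact: rcont_cosp|exact: mcontC].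
 case: (a == n);last exact: mcontC.
 by apply: mcontD;[exact: mcontC|apply: mcontZ;[exact: rcont_sinp|exact: mcontC]].
- have [-> ->]:=cosp0 (2^-1: R);apply/funext => b;apply/funext => a;rewrite /lowered rc1 rc0 !scale1r scale0r addr0.
 rewrite addrC subrK;have [[_ t _ _ _] _]:=sT;case: b.
 by rewrite (t a).1;case: ifP => an;rewrite ?hm0 // -[in RHS](std_ev sT (ltnW an)) hmM eh.
 case: (ltngtP a n) => an;[exact: std_ev (ltnW an)|by rewrite (t a).2|by rewrite an].
- by have [-> ->]:=cosp1 R.
- move=> s s01;apply: L;rewrite ?lexx ?ler01 //;last by right.
 by rewrite cosp_half;have:=clampP s;lra.
 by have:=cosp2 2^-1 s;lra.
apply: (@conn_path _ (fun s => lowered T e' z 0 (1 - s) 1)).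
- move=> [] a;rewrite /lowered;case: (a < n)%N;try exact: mcontC.
 apply: mcontM;first exact: mcontC;apply: mcontD;first exact: mcontC.
 apply: mcontZ;last exact: mcontC;apply: (@rcont_lip _ _ 1) => s s';rewrite mul1r distrC.
 by have -> : 1 - s - (1 - s') = s' - s by ring.
- by rewrite subr0.
- by rewrite subrr.
by move=> s /andP[s0 s1];apply: L => //;[apply/andP;split;lra|left].
Qed.

Lemma conn_std T T': (0 < d)%N -> stdA T -> stdA T' -> conn divA T T'.
move=> d0;have [k qk]:=fac_nat fA (fac_unit fA) (fac_proj fA).
suff H S S' m m': stdA S -> stdA S' -> \tr (S false 0%N) = (d * m)%:R -> \tr (S' false 0%N) = (d * m')%:R ->
 (m' <= m)%N -> conn divA S S'.
 move=> sT sT';have [m tm]:=fac_nat fA (std_Ae sT) (std_p sT).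
 have [m' tm']:=fac_nat fA (std_Ae sT') (std_p sT').
 by case: (leqP m' m) => [|/ltnW] h;[|apply: conn_sym];[apply: H h|apply: H h].
move=> sS sS' tm tm' mm.
have [S2 [sS2 t2 c2]]:=conn_std_lower d0 sS tm qk mm (std_bound sS' d0 tm' qk).
by apply: conn_trans c2 (conn_std_eq sS2 sS' _);rewrite t2 tm'.
Qed.

(* Without the condition [r <= m] the remainder [f] need not embed in [v 0]. *)
Lemma fac_divide q0 m r: A q0 -> proj q0 -> \tr q0 = (d * (n * m + r))%:R ->
 exists (v: nat -> M) f, [/\ [/\ forall a, A (v a), A f, proj f & \tr f = (d * r)%:R],
 proj (v 0%N) /\ \tr (v 0%N) = (d * m)%:R,
 forall a b, (a < n)%N -> (b < n)%N -> v a *m (v b)^h = if a == b then v 0%N else 0,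
 forall a, (a < n)%N -> v a *m f = 0 &
 \sum_(a < n) (v a)^h *m v a + f = q0].
move=> Aq pq tq.
have [e [Ae pe qe te]]: exists f, [/\ A f, proj f, q0 *m f = f & \tr f = (d * m)%:R].
 by apply: (fac_sub fA) => //;rewrite tq ler_nat leq_mul2l (leq_trans _ (leq_addr _ _)) ?leq_pmull ?orbT.
suff H j: (0 < j)%N -> (j <= n)%N -> exists (v: nat -> M) f,
 [/\ [/\ forall a, A (v a), A f, proj f & \tr f = (d * ((n - j) * m + r))%:R], v 0%N = e,
 forall a b, (a < j)%N -> (b < j)%N -> v a *m (v b)^h = if a == b then e else 0,
 forall a, (a < j)%N -> v a *m f = 0 & \sum_(a < j) (v a)^h *m v a + f = q0].
 have [v [f [[h1 h2 h3 h4] h5 h6 h7 h8]]]:=H n n0 (leqnn n).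
 by exists v, f;split=> //;[split=> //;rewrite h4 subnn|rewrite h5|move=> a b an bn;rewrite h5;apply: h6].
elim: j => // -[_ _ _|j IH _ jn].
 exists (fun=> e), (q0 - e);split=> //.
- split=> //;[exact: facB|exact: projB|rewrite linearB /= tq te -natrB ?leq_mul2l -?mulnBr].
 by congr ((d * _)%:R);case: (n) n0 => // n' _;rewrite subn1 mulSn;lia.
 by rewrite (leq_trans _ (leq_addr _ _)) ?leq_pmull ?orbT.
- by move=> [|a] [|b] //;rewrite pe.1 pe.2.
- have eq: e *m q0 = e by rewrite -[LHS]hmK hmM pe.1 pq.1 qe pe.1.
 by move=> [|a] // _;rewrite mulmxBr eq pe.2 subrr.
- by rewrite big_ord1 pe.1 pe.2 addrC subrK.
have [v [f [[Av Af pf tf] v0 vv vf sq]]]:=IH isT (ltnW jn).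
have [g [Ag pg fg tg]]: exists g, [/\ A g, proj g, f *m g = g & \tr g = (d * m)%:R].
 apply: (fac_sub fA) => //;rewrite tf ler_nat leq_mul2l;apply/orP;right;nia.
have [z [Az zz zz' zg ez]]: exists z, [/\ A z, z^h *m z = g, z *m z^h = e, z *m g = z & e *m z = z].
 by apply: fac_eq => //;rewrite tg te.
have zh: z^h = f *m z^h by rewrite -zg hmM pg.1 mulmxA fg.
exists (fun a => if (a < j.+1)%N then v a else z), (f - g);split=> //.
- split=> [a|||];[by case: ifP|exact: facB|exact: projB|].
 by rewrite linearB /= tf tg -natrB -?mulnBr;[congr ((_ * _)%:R);nia|rewrite leq_mul2l;apply/orP;right;nia].
- move=> a b a2 b2;case: (ltnP a j.+1) => ha;case: (ltnP b j.+1) => hb.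
+ exact: vv.
+ by rewrite ltn_eqF ?(leq_trans ha) // zh mulmxA vf // mul0mx.
+ by rewrite gtn_eqF ?(leq_trans hb) // -[LHS]hmK hmM hmK zh mulmxA vf // mul0mx hm0.
+ by rewrite zz' (_: a = b) ?eqxx //;lia.
- move=> a a2;case: (ltnP a j.+1) => ha.
 by rewrite mulmxBr vf // -fg mulmxA vf // mul0mx subr0.
 have zf: z *m f = z by rewrite -[LHS]hmK hmM pf.1 -zh hmK.
 by rewrite mulmxBr zg zf subrr.
- rewrite big_ord_recr /= ltnn zz -sq -!addrA [g + _]addrC subrK;congr (_ + _).
 by apply: eq_bigr => a _;rewrite ltn_ord.
Qed.
End Factor.
End Tuples.

(** * Dimension drop algebras and their representations *)

Record emb_t (R: realType) (N: nat):=Embedding {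
 edim: nat;
 efun :> 'M[Cplx R]_edim -> 'M[Cplx R]_N;
 edim_gt0: (0 < edim)%N;
 embL: forall k x y, efun (k *: x + y) = k *: efun x + efun y;
 embM: forall x y, efun (x *m y) = efun x *m efun y;
 emb_adj: forall x, efun x^h = (efun x)^h;
 emb1: efun 1%:M = 1%:M }.

Section MxUnits.
Variables (R: realType) (n: nat).
Definition dmx j k: 'M[Cplx R]_n :=\matrix_(a, b) ((a == j :> nat) && (b == k :> nat))%:R.
Lemma dmxM j k j' k': (k < n)%N -> dmx j k *m dmx j' k' = if k == j' then dmx j k' else 0.
move=> kn;apply/matrixP => a b;rewrite mxE (bigD1 (Ordinal kn)) //= big1 => [|c ck].
 by rewrite !mxE eqxx andbT addr0;case: (k == j');rewrite !mxE /= ?mulr0 // ?mulr1 ?andbT -?natrM ?mulnb.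
by rewrite !mxE (negPf (ck: (c: nat) != k)) andbF mul0r.
Qed.
Lemma dmx_adj j k: (dmx j k)^h = dmx k j.
by apply/matrixP => a b;rewrite !mxE rmorph_nat andbC. Qed.
Lemma dmx_sum (x: 'M[Cplx R]_n): x = \sum_(jk: 'I_n * 'I_n) x jk.1 jk.2 *: dmx jk.1 jk.2.
apply/matrixP => a b;rewrite summxE (bigD1 (a, b)) //= big1 => [|[j k] ne].
 by rewrite !mxE !eqxx mulr1 addr0.
rewrite !mxE [(a: nat) == _]eq_sym [(b: nat) == _]eq_sym -[_ && _]/((j, k) == (a, b)).
by rewrite (negPf ne) mulr0.
Qed.
Lemma dmx1: \sum_(j < n) dmx j j = 1%:M.
apply/matrixP => a b;rewrite summxE (bigD1 a) //= big1 => [|j ja].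
 by rewrite !mxE eqxx addr0 eq_sym.
by rewrite !mxE eq_sym (negPf (ja: (j: nat) != a)).
Qed.
End MxUnits.

Section EmbTheory.
Variables (R: realType) (N: nat) (e: emb_t R N).
Lemma emb0: e 0 = 0.
by rewrite -[X in e X](subrr (1%:M)) addrC -scaleN1r embL scaleN1r addrC subrr. Qed.
Lemma embZ k x: e (k *: x) = k *: e x.
by rewrite -[X in e X]addr0 embL emb0 addr0. Qed.
End EmbTheory.

Section Embeddings.
Variables (R: realType) (p q: nat).
Hypotheses (p0: (0 < p)%N) (q0: (0 < q)%N).
Local Notation C:=(Cplx R).

Lemma tens_adj a b (x: 'M[C]_a) (y: 'M[C]_b): (x *t y)^h = x^h *t y^h.
apply/matrixP => i j;case: (mxtens_indexP i) => i1 i2;case: (mxtens_indexP j) => j1 j2.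
by rewrite tensmxE mxE mxE tensmxE !mxE rmorphM.
Qed.
Lemma tens11 a b: (1%:M: 'M[C]_a) *t (1%:M: 'M[C]_b) = 1%:M.
apply/matrixP => i j;case: (mxtens_indexP i) => i1 i2;case: (mxtens_indexP j) => j1 j2.
rewrite tensmxE !mxE (can_eq (@mxtens_indexK _ _)) xpair_eqE.
by case: (i1 == j1);case: (i2 == j2);rewrite ?mulr1 ?mulr0.
Qed.

Fact emb_lL k (x y: 'M[C]_p): (k *: x + y) *t (1%:M: 'M[C]_q) = k *: (x *t 1%:M) + y *t 1%:M.
by apply/matrixP => i j;rewrite !mxE mulrDl mulrA. Qed.
Fact emb_rL k (x y: 'M[C]_q): (1%:M: 'M[C]_p) *t (k *: x + y) = k *: (1%:M *t x) + 1%:M *t y.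
by apply/matrixP => i j;rewrite !mxE mulrDr mulrCA. Qed.
Fact emb_lM (x y: 'M[C]_p): (x *m y) *t (1%:M: 'M[C]_q) = x *t 1%:M *m (y *t 1%:M).
by rewrite tensmx_mul mulmx1. Qed.
Fact emb_rM (x y: 'M[C]_q): (1%:M: 'M[C]_p) *t (x *m y) = 1%:M *t x *m (1%:M *t y).
by rewrite tensmx_mul mulmx1. Qed.
Fact emb_l_adj (x: 'M[C]_p): x^h *t (1%:M: 'M[C]_q) = (x *t 1%:M)^h.
by rewrite tens_adj hm1. Qed.
Fact emb_r_adj (x: 'M[C]_q): (1%:M: 'M[C]_p) *t x^h = (1%:M *t x)^h.
by rewrite tens_adj hm1. Qed.
(** [emb_l] and [emb_r] hold the values allowed at 0 and at 1, [emb_id] those at interior points. *)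
Definition emb_l: emb_t R (p * q):=Embedding p0 emb_lL emb_lM emb_l_adj (tens11 p q).
Definition emb_r: emb_t R (p * q):=Embedding q0 emb_rL emb_rM emb_r_adj (tens11 p q).
Fact pq_gt0: (0 < p * q)%N. Proof. by rewrite muln_gt0 p0. Qed.
Definition emb_id: emb_t R (p * q):=@Embedding R (p * q) (p * q) id pq_gt0
 (fun _ _ _ => erefl) (fun _ _ => erefl) (fun _ => erefl) erefl.

(** The dimension drop algebra with continuity on the whole line; by [clamp_ddrop] every element of
    [dimdrop] has such a form. *)
Definition ddrop (f: R -> 'M[C]_(p * q)) :=
 [/\ mcont f, exists x, f 0 = emb_l x & exists x, f 1 = emb_r x].

Lemma ddropL k f g: ddrop f -> ddrop g -> ddrop (fun s => k *: f s + g s).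
move=> [cf [x fx] [y fy]] [cg [x' gx] [y' gy]];split.
- by apply: mcontD => //;apply: mcontZ => //;exact: rcontC.
- by exists (k *: x + x');rewrite fx gx -embL.
- by exists (k *: y + y');rewrite fy gy -embL.
Qed.
Lemma ddropM f g: ddrop f -> ddrop g -> ddrop (fun s => f s *m g s).
move=> [cf [x fx] [y fy]] [cg [x' gx] [y' gy]];split;first exact: mcontM.
- by exists (x *m x');rewrite fx gx -embM.
- by exists (y *m y');rewrite fy gy -embM.
Qed.
Lemma ddrop_adj f: ddrop f -> ddrop (fun s => (f s)^h).
move=> [cf [x fx] [y fy]];split;first exact: mcont_adj.
- by exists x^h;rewrite fx emb_adj.
- by exists y^h;rewrite fy emb_adj.
Qed.

Definition elt (h: R -> R) (x: 'M[C]_(p * q)):=fun s => rc (h s) *: x.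
Definition rcontR (h: R -> R):=rcont (fun s => rc (h s)).

Lemma rcontRB h g: rcontR h -> rcontR g -> rcontR (fun s => h s - g s).
move=> ch cg;have -> : (fun s => h s - g s) = (fun s => h s + -1 * g s) by apply/funext => s;rewrite mulN1r.
rewrite /rcontR;under eq_fun do rewrite rcD rcM.
by apply: rcontD => //;apply: rcontM => //;exact: rcontC.
Qed.
Lemma ddrop_elt h x: rcontR h -> (h 0 <> 0 -> exists y, x = emb_l y) ->
 (h 1 <> 0 -> exists y, x = emb_r y) -> ddrop (elt h x).
move=> ch h0 h1;split;first by apply: mcontZ => //;exact: mcontC.
- rewrite /elt;have [->|/eqP /h0[y ->]]:=eqVneq (h 0) 0;last by exists (rc (h 0) *: y);rewrite embZ.
 by exists 0;rewrite emb0 rc0 scale0r.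
- rewrite /elt;have [->|/eqP /h1[y ->]]:=eqVneq (h 1) 0;last by exists (rc (h 1) *: y);rewrite embZ.
 by exists 0;rewrite emb0 rc0 scale0r.
Qed.
Lemma ddropS h: rcontR h -> ddrop (elt h 1%:M).
by move=> ch;apply: ddrop_elt => // _;exists 1%:M;rewrite emb1. Qed.

Definition adm (h: R -> R) (e: emb_t R (p * q)):=rcontR h /\ forall x, ddrop (elt h (e x)).

(** Purely algebraic; the norm estimate it satisfies is [small_rep]. *)
Record rep D (f: (R -> 'M[C]_(p * q)) -> 'M[C]_D): Prop:=Rep {
 rep_ext: forall g h, ddrop g -> ddrop h -> (forall s, 0 <= s <= 1 -> g s = h s) -> f g = f h;
 repL: forall k g h, ddrop g -> ddrop h -> f (fun s => k *: g s + h s) = k *: f g + f h;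
 repM: forall g h, ddrop g -> ddrop h -> f (fun s => g s *m h s) = f g *m f h;
 rep_adj: forall g, ddrop g -> f (fun s => (g s)^h) = (f g)^h;
 rep1: f (fun=> 1%:M) = 1%:M }.
End Embeddings.

(** * Cutting a representation into cells *)

Section Blocks.
Variables (R: realType) (D n: nat).
Local Notation M :='M[Cplx R]_D.
Local Opaque mulmx map_mx trmx opb mxtrace.

Lemma orth_sum (I: finType) (X Y: I -> M): (forall i j, i != j -> X i *m Y j = 0) ->
 (\sum_i X i) *m (\sum_i Y i) = \sum_i X i *m Y i.
move=> h;rewrite mulmx_suml;apply: eq_bigr => i _;rewrite mulmx_sumr (bigD1 i) //= big1 ?addr0 // => j ji.
by rewrite h // eq_sym.
Qed.

Lemma std_cut q (S: bool -> nat -> M): proj q -> (forall c a, S c a *m q = q *m S c a) ->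
 std n 1%:M S -> std n q (fun c a => q *m S c a).
move=> [qh qq] Sq [[[eh ee] ew] t vv vw sq].
have Sqh c a: (S c a)^h *m q = q *m (S c a)^h.
 by have:=congr1 (fun N: M => N^h) (Sq c a);rewrite !hmM qh.
have qa c a: (q *m S c a)^h = q *m (S c a)^h by rewrite hmM qh Sqh.
have qm x y: x *m q = q *m x -> q *m x *m (q *m y) = q *m (x *m y).
 by move=> xq;rewrite mulmxA -(mulmxA q) xq mulmxA qq !mulmxA.
split.
- split;first by split;[rewrite qa eh|rewrite qm // ee].
 by rewrite qm // ew.
- move=> a;have [ta na]:=t a;split;last by move=> /na ->;rewrite mulmx0.
 by rewrite ta;case: (a < n)%N;rewrite ?qa // hm0 mulmx0.
- by move=> a b an bn;rewrite qa qm // vv //;case: (a == b);rewrite ?mulmx0.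
- by move=> a an;rewrite qa qm // vw // mulmx0.
- under eq_bigr => a _ do rewrite qa qm //.
 by rewrite -mulmx_sumr sq mulmx1.
Qed.

Variables (K: nat) (Q: 'I_K -> M) (S: 'I_K -> bool -> nat -> M).
Hypotheses (QQ: forall i j, Q i *m Q j = if i == j then Q i else 0) (Qh: forall i, (Q i)^h = Q i)
 (Q1: \sum_i Q i = 1%:M).

Lemma div_sum: (forall i, divt n (Q i) (S i)) ->
 (forall i c a, Q i *m S i c a = S i c a /\ S i c a *m Q i = S i c a) ->
 divt n 1%:M (fun c a => \sum_i S i c a).
move=> dS SQ.
have SS i j c a d b: i != j -> S i c a *m S j d b = 0.
 by move=> ij;rewrite -(SQ i c a).2 -(SQ j d b).1 -mulmxA (mulmxA (Q i)) QQ (negPf ij) mul0mx mulmx0.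
have SSh i j c a d b: i != j -> (S i c a)^h *m S j d b = 0.
 move=> ij;rewrite -(SQ i c a).1 -(SQ j d b).1 hmM Qh -mulmxA (mulmxA (Q i)) QQ.
 by rewrite (negPf ij) mul0mx mulmx0.
have hS c a d b: (\sum_i S i c a)^h *m (\sum_i S i d b) = \sum_i (S i c a)^h *m S i d b.
 by rewrite hm_sum orth_sum // => i j;apply: SSh.
split=> [a b an bn|a an|a b an bn ab||c a].
- rewrite !hS;case: (eqVneq a b) => [<-|ab].
 by apply: eq_bigr => i _;have [h _ _ _ _]:=dS i;rewrite (h a a an an) eqxx.
 by apply: big1 => i _;have [h _ _ _ _]:=dS i;rewrite (h a b an bn) (negPf ab).
- rewrite hS orth_sum => [|i j ij];last by rewrite -mulmxA SS // mulmx0.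
 by apply: eq_bigr => i _;have [_ -> // _ _ _]:=dS i.
- rewrite orth_sum => [|i j];last exact: SS.
 by apply: big1 => i _;have [_ _ -> // _ _]:=dS i.
- under eq_bigr do rewrite hS.
 by rewrite exchange_big -[RHS]Q1;apply: eq_bigr => i _;have [_ _ _ -> _]:=dS i.
move=> v;rewrite expr1n mul1r -(rc_le (sqn _)) !sqnE hmM -mulmxA (mulmxA _ _ v^h) hm_sum.
rewrite orth_sum => [|i j ij];last first.
 rewrite -(SQ i c a).2 -[S j c a](SQ j c a).2 hmM Qh -mulmxA (mulmxA (Q i)) QQ.
 by rewrite (negPf ij) mul0mx mulmx0.
rewrite -[v in X in _ <= (X *m _) _ _]mulmx1 -Q1 -mulmxA !mulmx_suml !mulmx_sumr !summxE;apply: ler_sum => i _.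
have [_ _ _ _ h]:=dS i.
have -> : v *m ((S i c a *m (S i c a)^h) *m v^h) = (v *m Q i *m S i c a) *m (v *m Q i *m S i c a)^h.
 by rewrite -(mulmxA v) (SQ i c a).1 !hmM !mulmxA.
have -> : v *m (Q i *m v^h) = (v *m Q i) *m (v *m Q i)^h.
 by rewrite hmM Qh !mulmxA -(mulmxA v (Q i) (Q i)) QQ eqxx.
by rewrite -!sqnE rc_le;have:=h c a (v *m Q i);rewrite expr1n mul1r.
Qed.
End Blocks.

Section Cell.
Variables (R: realType) (p q D: nat) (p0: (0 < p)%N) (q0: (0 < q)%N).
Variable f: (R -> 'M[Cplx R]_(p * q)) -> 'M[Cplx R]_D.
Local Notation C:=(Cplx R).
Local Notation ddrop:=(ddrop p0 q0).
Local Notation adm:=(adm p0 q0).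
Hypothesis rf: rep p0 q0 f.
Local Opaque mulmx map_mx trmx mxtrace.
Implicit Types (h g: R -> R) (e: emb_t R (p * q)).

Definition cel h x:=f (elt h x).
Local Notation P:=cel.
Local Notation "''1'" := (1%:M: 'M[C]_(p * q)).

Lemma celM h (k: R -> R) x y: ddrop (elt h x) -> ddrop (elt k y) -> P h x *m P k y = P (fun s => h s * k s) (x *m y).
move=> dx dy;rewrite -(repM rf dx dy);congr f;apply/funext => s.
by rewrite /elt -scalemxAl -scalemxAr scalerA rcM.
Qed.
Lemma cel_adj h x: ddrop (elt h x) -> (P h x)^h = P h x^h.
by move=> dx;rewrite -(rep_adj rf dx);congr f;apply/funext => s;rewrite /elt hmZ rc_conj. Qed.
Lemma celL h c x y: ddrop (elt h x) -> ddrop (elt h y) -> P h (c *: x + y) = c *: P h x + P h y.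
move=> dx dy;rewrite -(repL rf c dx dy);congr f;apply/funext => s.
by rewrite /elt scalerDr !scalerA mulrC.
Qed.
Lemma celB h (k: R -> R) x: ddrop (elt h x) -> ddrop (elt k x) -> P (fun s => h s - k s) x = P h x - P k x.
move=> dx dy;have:=repL rf (-1) dy dx;rewrite scaleN1r addrC => <-;congr f;apply/funext => s.
by rewrite /elt scaleN1r rcB scalerBl addrC.
Qed.
Lemma cel_h h: rcontR h -> (P h '1)^h = P h '1.
by move=> ch;rewrite cel_adj ?hm1 //;exact: ddropS. Qed.
Lemma cel_comm h (k: R -> R) x: rcontR h -> ddrop (elt k x) -> P h '1 *m P k x = P k x *m P h '1.
move=> ch dx;have d1:=ddropS p0 q0 ch;rewrite !celM // mulmx1 mul1mx;congr f.
by apply/funext => s;rewrite /elt mulrC.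
Qed.

(* [y = P h x] satisfies [y^h y = e y'], so [y] vanishes on the complement of [e]. *)
Lemma cel_idem h e x: adm h e -> P h '1 *m P h '1 = P h '1 -> P h '1 *m P h (e x) = P h (e x).
move=> [ch he] ee;rewrite cel_comm //;apply/subr0_eq/hcancelV.
have dx:=he x;have d1:=ddropS p0 q0 ch;have eh:=cel_h ch.
set y:=P h (e x);set E:=P h '1 in ee eh *.
have yy: E *m (y^h *m y) = y^h *m y.
 rewrite /y cel_adj // celM -?emb_adj // -embM.
 have -> : P (fun s => h s * h s) (e (x^h *m x)) = E *m P h (e (x^h *m x)) by rewrite celM // mul1mx.
 by rewrite mulmxA ee.
have yy': y^h *m y *m E = y^h *m y by have:=congr1 (fun N: 'M[C]_D => N^h) yy;rewrite !hmM hmK eh.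
by rewrite hmB hmM eh mulmxBl !mulmxBr -!mulmxA !(mulmxA y^h y E) yy' yy !subrr.
Qed.

(** The commutant of the matrix units that the copy [e] has on the part [h], cut down to that
    part. *)
Definition cell h e (z: 'M[C]_D) :=[/\ P h '1 *m z = z, z *m P h '1 = z &
 forall x, z *m P h (e x) = P h (e x) *m z].

Lemma cel0 h e: adm h e -> P h 0 = 0.
move=> [ch he];have d0: ddrop (elt h 0) by rewrite -(emb0 e).
by have:=celL (-1) d0 d0;rewrite scaler0 addr0 => {1}->;rewrite scaleN1r addrC subrr.
Qed.
Lemma cel_sum h e (I: Type) (r: seq I) (c: I -> C) (F: I -> 'M[C]_(edim e)): adm h e ->
 P h (e (\sum_(i <- r) c i *: F i)) = \sum_(i <- r) c i *: P h (e (F i)).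
move=> [ch he];elim: r => [|i r IH];last by rewrite !big_cons embL celL // IH.
by rewrite !big_nil emb0 (cel0 (conj ch he)).
Qed.
Lemma cel_dmx h e x: adm h e ->
 P h (e x) = \sum_(i: 'I_(edim e) * 'I_(edim e)) x i.1 i.2 *: P h (e (dmx _ _ i.1 i.2)).
by move=> he;rewrite {1}(dmx_sum x) cel_sum. Qed.
Lemma cell_units h e: adm h e -> P h '1 *m P h '1 = P h '1 ->
 mxunits (edim e) (fun j k => P h (e (dmx _ _ j k))) /\ \sum_(j < edim e) P h (e (dmx _ _ j j)) = P h '1.
move=> he ee;have [ch dh]:=he;split;last first.
 rewrite -(emb1 e) -dmx1;have:=cel_sum (index_enum 'I_(edim e)) (fun=> 1) (fun j => dmx _ _ j j) he.
 by under eq_bigr do rewrite scale1r;move=> ->;apply: eq_bigr => j _;rewrite scale1r.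
split=> [|j k _ _|j k j' k' jd kd jd' kd'];first exact: edim_gt0.
 by rewrite cel_adj // -emb_adj dmx_adj.
rewrite celM // -embM dmxM //.
have -> : P (fun s => h s * h s) (e (if k == j' then dmx R _ j k' else 0)) =
 P h '1 *m P h (e (if k == j' then dmx R _ j k' else 0)).
 by rewrite celM ?mul1mx //;apply: ddropS.
by rewrite cel_idem //;case: eqP => // _;rewrite emb0 (cel0 he).
Qed.

Lemma cell_fac h e: adm h e -> P h '1 *m P h '1 = P h '1 -> fac (edim e) (P h '1) (cell h e).
move=> he ee;have [uu us]:=cell_units he ee.
have -> : cell h e = ucomm (edim e) (fun j k => P h (e (dmx _ _ j k))).
 apply/funext => z;apply/propext;rewrite /ucomm us;split=> -[a b c];split=> // x.
 by rewrite cel_dmx // mulmx_sumr mulmx_suml;apply: eq_bigr => i _;rewrite -scalemxAr -scalemxAl c.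
by rewrite -us;exact: mxunits_fac uu.
Qed.

(* Passing to a smaller part of the interval and to more matrices enlarges the units. *)
Lemma cell_sub h e g e' z: adm h e -> adm g e' -> P h '1 *m P g '1 = P g '1 -> P g '1 *m P h '1 = P g '1 ->
 (forall x, exists y, e x = e' y) -> cell g e' z -> cell h e z.
move=> [ch dh] [cg dg] hg gh ee [gz zg zc];have hz: P h '1 *m z = z by rewrite -gz mulmxA hg.
have zh: z *m P h '1 = z by rewrite -zg -mulmxA gh.
split=> // x;have [y xy]:=ee x;have dx:=dg y;rewrite -xy in dx.
have s1:=ddropS p0 q0 cg;have s2:=ddropS p0 q0 ch.
have e1: P g '1 *m P h (e x) = P g (e x) *m P h '1 by rewrite !celM // mul1mx mulmx1.
have e2: P h (e x) *m P g '1 = P h '1 *m P g (e x).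
 by rewrite !celM // mul1mx mulmx1.
rewrite -{1}zg -mulmxA e1 -{2}gz (mulmxA (P h (e x))) e2 xy mulmxA zc -mulmxA zh.
by rewrite -!mulmxA -zc mulmxA hz.
Qed.

(* [F] is a decreasing family of cut-off functions, [m] the cell where [F m - F m.+1] lives. *)
Variables (L: nat) (F: nat -> R -> R) (E: nat -> emb_t R (p * q)).
Definition part m s:=F m s - F m.+1 s.
Record cuts: Prop:=Cuts {
 cuts0: forall s, F 0%N s = 1;
 cutsL: forall m s, (L <= m)%N -> F m s = 0;
 cuts_le: forall m m', (m <= m')%N -> P (F m) '1 *m P (F m') '1 = P (F m') '1;
 cuts_adm: forall m, rcontR (F m) /\ adm (part m) (E m) }.
Hypothesis FC: cuts.
Definition pq m:=P (part m) '1.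

Lemma pqE m: pq m = P (F m) '1 - P (F m.+1) '1.
by rewrite /pq /part celB //;apply: ddropS;have []:=cuts_adm FC m;have []:=cuts_adm FC m.+1.
Qed.
Lemma cuts_ge m m': (m <= m')%N -> P (F m') '1 *m P (F m) '1 = P (F m') '1.
move=> mm;have h k:=cel_h (cuts_adm FC k).1.
by have:=congr1 (fun N: 'M[C]_D => N^h) (cuts_le FC mm);rewrite hmM !h.
Qed.
Lemma pqM m m': pq m *m pq m' = if m == m' then pq m else 0.
have c k l (kl: (k <= l)%N):=cuts_le FC kl;have g k l (kl: (k <= l)%N):=cuts_ge kl.
rewrite !pqE mulmxBl !mulmxBr;case: ltngtP => [mm|mm|<-].
- by rewrite !c ?subrr //;lia.
- by rewrite !g ?subrr //;lia.
- by rewrite (c m m) // (c m m.+1) // (c m.+1 m.+1) // (g m m.+1) // subrr subr0.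
Qed.
Lemma pq_proj m: proj (pq m).
by split;[apply: cel_h;have [_ []]:=cuts_adm FC m|rewrite pqM eqxx]. Qed.
Lemma pq_sum: \sum_(m < L) pq m = 1%:M.
have F1 m: rcontR (F m) by case: (cuts_adm FC m).
have e0: P (F 0%N) '1 = 1%:M.
 by rewrite -(rep1 rf);congr f;apply/funext => s;rewrite /elt (cuts0 FC) rc1 scale1r.
have eL: P (F L) '1 = 0.
 have -> : F L = fun s => F L s - F L s by apply/funext => s;rewrite (cutsL FC) ?leqnn ?subrr.
 by rewrite celB ?subrr //;apply: ddropS.
suff H l: \sum_(m < l) pq m = 1%:M - P (F l) '1 by rewrite H eL subr0.
by elim: l => [|l IH];[rewrite big_ord0 e0 subrr|rewrite big_ord_recr /= IH pqE addrA subrK].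
Qed.
Lemma pq_fac m: fac (edim (E m)) (pq m) (cell (part m) (E m)).
by apply: cell_fac;[case: (cuts_adm FC m)|have []:=pq_proj m]. Qed.

Definition cmt z:=forall m x, (m < L)%N -> z *m P (part m) (E m x) = P (part m) (E m x) *m z.

Lemma part_q m x: pq m *m P (part m) (E m x) = P (part m) (E m x) /\
 P (part m) (E m x) *m pq m = P (part m) (E m x).
have [_ am]:=cuts_adm FC m;have [_ ii]:=pq_proj m.
by split;[exact: cel_idem|rewrite -cel_comm ?cel_idem //;case: am].
Qed.
Lemma cell_cmt m z: cell (part m) (E m) z -> cmt z.
move=> [qz zq zc] m' x mL;have [e0|ne]:=eqVneq m' m;first by move: x;rewrite e0 => x;exact: zc.
have [<- _]:=@part_q m' x;rewrite -{1}zq -!mulmxA (mulmxA (pq m) (pq m')) pqM eq_sym (negPf ne) mul0mx mulmx0.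
by have [_ <-]:=@part_q m' x;rewrite -qz -!mulmxA (mulmxA (pq m') (pq m)) pqM (negPf ne) mul0mx !mulmx0.
Qed.
Lemma commutes_q z m: cmt z -> (m < L)%N -> z *m pq m = pq m *m z.
by move=> zc mL;have:=zc m 1%:M mL;rewrite emb1. Qed.
Lemma commutes_cell z m: cmt z -> (m < L)%N -> cell (part m) (E m) (pq m *m z).
move=> zc mL;have qq:=(pq_proj m).2;split.
- by rewrite mulmxA qq.
- by rewrite -mulmxA commutes_q // mulmxA qq.
- move=> x;have [a b]:=@part_q m x.
 by rewrite -mulmxA (zc m x mL) !mulmxA a b.
Qed.

Lemma cmtL c y z: cmt y -> cmt z -> cmt (c *: y + z).
by move=> cy cz m x mL;rewrite mulmxDl mulmxDr -scalemxAl -scalemxAr cy // cz. Qed.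
Lemma cmt0: cmt 0.
by move=> m x _;rewrite mul0mx mulmx0. Qed.
Lemma cmt_sum (I: Type) (r: seq I) (Q: pred I) (G: I -> 'M[C]_D) :
 (forall i, Q i -> cmt (G i)) -> cmt (\sum_(i <- r | Q i) G i).
move=> h;apply: big_ind => //;first exact: cmt0.
by move=> y z cy cz;rewrite -[y]scale1r;apply: cmtL.
Qed.
Lemma commutes_split z: cmt z -> z = \sum_(m < L) pq m *m z.
by move=> _;rewrite -mulmx_suml pq_sum mul1mx. Qed.

(** [conn_std] in the commutant of each cell; the paths are summed over the orthogonal projections
    [pq m]. *)
Lemma conn_commuting n T T': (0 < n)%N ->
 std n 1%:M T -> std n 1%:M T' -> (forall c a, cmt (T c a)) -> (forall c a, cmt (T' c a)) ->
 conn (fun S => divt n 1%:M S /\ forall c a, cmt (S c a)) T T'.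
move=> n0 sT sT' cT cT'.
have cut S m: std n 1%:M S -> (forall c a, cmt (S c a)) -> (m < L)%N ->
 stdA n (pq m) (cell (part m) (E m)) (fun c a => pq m *m S c a).
 move=> sS cS mL;split;last by move=> c a;apply: commutes_cell.
 by apply: std_cut => // [|c a];[exact: pq_proj|exact: commutes_q].
have:=conn_sum (fun m mL => conn_std n0 (pq_fac m) (edim_gt0 _) (cut T m sT cT mL) (cut T' m sT' cT' mL)).
have E1 S: (forall c a, cmt (S c a)) -> (fun c a => \sum_(m < L) pq m *m S c a) = S.
 by move=> cS;apply/funext => c;apply/funext => a;rewrite -commutes_split.
rewrite !E1 //;apply: conn_mono => _ [S [hS ->]].
have sq (i: 'I_L) c a: pq i *m S i c a = S i c a /\ S i c a *m pq i = S i c a.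
 by have [_ /(_ c a)[]]:=hS i (ltn_ord i).
split;last by move=> c a;apply: cmt_sum => i _;apply: cell_cmt;apply: (hS i (ltn_ord i)).2.
apply: (@div_sum _ _ _ _ (fun i: 'I_L => pq i) (fun i: 'I_L => S i)) => [i j|i||i|i c a].
- by rewrite pqM.
- by have []:=pq_proj i.
- exact: pq_sum.
- by have []:=hS i (ltn_ord i).
- exact: sq.
Qed.
End Cell.

Section Ranges.
Variables (R: realType) (D: nat) (x y z: 'M[Cplx R]_D) (c s: R).
(** The elements [y] and [z] have the same source and orthogonal ranges, so rotating one into the
    other keeps the source. *)
Hypotheses (xy: x^h *m y = 0) (xz: x^h *m z = 0) (yz: y^h *m z = 0) (zy: z^h *m z = y^h *m y).
Lemma rotate_adj: c ^+ 2 + s ^+ 2 = 1 ->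
 (x + (rc c *: y + rc s *: z))^h *m (x + (rc c *: y + rc s *: z)) = x^h *m x + y^h *m y.
move=> cs;have v (a b: 'M[Cplx R]_D): a^h *m b = 0 -> b^h *m a = 0 by move=> h;rewrite -[LHS]hmK hmM hmK h hm0.
have [u uE]: exists u, u = rc c *: y + rc s *: z by eexists.
have xw: x^h *m u = 0 by rewrite uE mulmxDr -!scalemxAr xy xz !scaler0 addr0.
rewrite -uE hmD mulmxDl !mulmxDr xw (v _ _ xw) addr0 add0r;congr (_ + _).
rewrite uE hmD !hmZ !rc_conj mulmxDl !mulmxDr -!scalemxAl -!scalemxAr yz (v _ _ yz) !scaler0 addr0 add0r zy !scalerA.
by rewrite -scalerDl -!rcM -rcD -!expr2 cs rc1 scale1r.
Qed.
End Ranges.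

(** * Passing from one system of cuts to the next *)

Section Step.
Variables (R: realType) (p q D: nat) (p0: (0 < p)%N) (q0: (0 < q)%N).
Variable f: (R -> 'M[Cplx R]_(p * q)) -> 'M[Cplx R]_D.
Local Notation C:=(Cplx R).
Local Notation M :='M[C]_D.
Hypothesis rf: rep p0 q0 f.
Local Opaque mulmx map_mx trmx mxtrace opb cel.
Variables (n K: nat) (F: nat -> R -> R) (tau: nat -> emb_t R (p * q)).
Hypothesis n0: (0 < n)%N.
(** Odd parts lie in the same cell of both systems and keep its type. Even parts lie between the two
    positions of a cut and change cells; there all matrices are used, so that the commutant serves
    cells of either type. *)
Definition alternate m:=if odd m then tau m./2 else emb_id R p0 q0.
Local Notation E:=alternate.
Hypothesis FC: cuts p0 q0 f K.*2 F E.
Hypothesis F1: forall s, F 1%N s = 1.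
Local Notation P:=(pq f F).
(** [coarse 0] joins the even part [i.*2] to the odd part after it, [coarse 1] joins [i.*2.+2] to
    the odd part before it. *)
Definition coarse b i:=F (i.*2 + b)%N.

Let P0: P 0%N = 0.
have -> : F = fun m => F m by [];rewrite (pqE rf FC).
by have -> : F 0%N = F 1%N by [apply/funext => s;rewrite (cuts0 FC) F1];rewrite subrr.
Qed.
Let PL: P K.*2 = 0.
rewrite (pqE rf FC);have -> : F K.*2 = F K.*2.+1 by apply/funext => s;rewrite !(cutsL FC).
by rewrite subrr.
Qed.

Lemma coarse_part b i: part (coarse b) i = fun s => part F (i.*2 + b) s + part F (i.*2 + b).+1 s.
by apply/funext => s;rewrite /part /coarse doubleS !addSn addrA subrK. Qed.

Lemma adm_alt b i m x: (b <= 1)%N -> (m = i.*2 + b \/ m = (i.*2 + b).+1)%N -> exists y, tau i x = E m y.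
move=> b1 mi;rewrite /E;case: ifP => om;last by exists (tau i x).
have -> : m./2 = i by lia.
by exists x.
Qed.

Lemma coarse_cuts b: (b <= 1)%N -> cuts p0 q0 f K (coarse b) tau.
move=> b1;split=> [s|m s Lm|m m' mm|m].
- by rewrite /coarse add0n;case: b b1 => [|[]] // _;exact: (cuts0 FC s).
- by apply: (cutsL FC);lia.
- by apply: (cuts_le FC);lia.
have rF m': rcontR (F m') by case: (cuts_adm FC m').
split;first exact: rF.
split;first by apply: (rcontRB (h:=coarse b m));exact: rF.
move=> x;rewrite coarse_part.
have [y1 e1]:=adm_alt x b1 (or_introl erefl: (m.*2 + b = m.*2 + b \/ m.*2 + b = (m.*2 + b).+1)%N).
have [y2 e2]:=adm_alt x b1 (or_intror erefl: ((m.*2 + b).+1 = m.*2 + b \/ (m.*2 + b).+1 = (m.*2 + b).+1)%N).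
have [_ [_ /(_ y1) d1]]:=cuts_adm FC (m.*2 + b)%N;have [_ [_ /(_ y2) d2]]:=cuts_adm FC (m.*2 + b).+1.
rewrite -e1 in d1;rewrite -e2 in d2;have:=ddropL 1 d1 d2;congr (ddrop _ _ _);apply/funext => s.
by rewrite /elt scale1r rcD scalerDl.
Qed.

Lemma cell_coarse b i m z: (b <= 1)%N -> (m = i.*2 + b \/ m = (i.*2 + b).+1)%N ->
 cell f (part F m) (E m) z -> cell f (part (coarse b) i) (tau i) z.
move=> b1 mi;have CC:=coarse_cuts b1.
have e: pq f (coarse b) i = P (i.*2 + b)%N + P (i.*2 + b).+1.
 by rewrite !(pqE rf FC) (pqE rf CC) /coarse doubleS !addSn addrA subrK.
have [_ am]:=cuts_adm CC i;have [_ am']:=cuts_adm FC m.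
apply: (cell_sub rf am am') => [||x];last exact: adm_alt mi.
- rewrite -!/(pq _ _ _) e mulmxDl !(pqM rf FC);case: mi => ->;rewrite eqxx.
 by rewrite gtn_eqF ?addr0.
 by rewrite ltn_eqF ?add0r.
- rewrite -!/(pq _ _ _) e mulmxDr !(pqM rf FC);case: mi => ->;rewrite eqxx.
 by rewrite ltn_eqF ?addr0.
 by rewrite gtn_eqF ?add0r.
Qed.

Lemma cell_ccomm b m z: (b <= 1)%N -> cell f (part F m) (E m) z ->
 cmt f K (coarse b) tau z.
move=> b1 cz;have [m0|m0]:=leqP b m.
 have mi: (m = (m - b)./2.*2 + b \/ m = ((m - b)./2.*2 + b).+1)%N by lia.
 exact: (cell_cmt rf (coarse_cuts b1) (cell_coarse b1 mi cz)).
have m00: m = 0%N by lia.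
suff -> : z = 0 by exact: cmt0.
by case: cz => [<- _ _];rewrite -/(pq f F m) m00 P0 mul0mx.
Qed.

Lemma commutes_adj b z: (b <= 1)%N -> cmt f K (coarse b) tau z -> cmt f K (coarse b) tau z^h.
move=> b1 cz m x mK;have [_ [_ /(_ (x^h)) d]]:=cuts_adm (coarse_cuts b1) m.
have:=congr1 (fun N: M => N^h) (cz m x^h mK);rewrite !hmM (cel_adj rf d) -emb_adj hmK //.
Qed.

Hypothesis big: forall i, (i < K)%N ->
 (edim (tau i) * (n * (3 * (p * q * n))))%:R <= \tr (P i.*2.+1).

Let ff m: fac (edim (E m)) (P m) (cell f (part F m) (E m)). Proof. exact: (pq_fac rf FC). Qed.

Record division m (v: nat -> M) (r: M) k: Prop:=Division {
 dv_cell: forall a, cell f (part F m) (E m) (v a);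
 dr_cell: cell f (part F m) (E m) r;
 dr_proj: proj r;
 dr_tr: exists2 l, \tr r = (edim (E m) * l)%:R & (l <= n)%N;
 dv_proj: proj (v 0%N) /\ \tr (v 0%N) = (edim (E m) * (k %/ n))%:R;
 dv_v: forall a b, (a < n)%N -> (b < n)%N -> v a *m (v b)^h = if a == b then v 0%N else 0;
 dv_r: forall a, (a < n)%N -> v a *m r = 0;
 dv_sum: \sum_(a < n) (v a)^h *m v a + r = P m;
 dv_tr: \tr (P m) = (edim (E m) * k)%:R }.

Lemma exists_division m: exists v r k, division m v r k.
have Fm:=ff m;have [k tk]:=fac_nat Fm (fac_unit Fm) (fac_proj Fm).
have tk': \tr (P m) = (edim (E m) * (n * (k %/ n) + k %% n))%:R by rewrite tk {1}(divn_eq k n) [(n * _)%N]mulnC.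
have [v [r [[Av Ar pr tr] [pv tv] vv vr vs]]]:=fac_divide n0 Fm (fac_unit Fm) (fac_proj Fm) tk'.
by exists v, r, k;split=> //;exists (k %% n)%N => //;apply/ltnW;rewrite ltn_mod.
Qed.

(* [g 0] receives the remainder of the cell itself, [g 1] and [g 2] those of its neighbours. *)
Lemma exists_slots i v r k: (i < K)%N -> division i.*2.+1 v r k ->
 exists g: nat -> M, [/\ forall t, cell f (part F i.*2.+1) (E i.*2.+1) (g t),
 forall t, (t < 3)%N -> proj (g t) /\ v 0%N *m g t = g t,
 forall t u, (t < 3)%N -> (u < 3)%N -> t != u -> g t *m g u = 0 &
 forall t, (t < 3)%N -> exists2 l, \tr (g t) = (edim (tau i) * l)%:R & (p * q * n <= l)%N].
move=> iK [Av _ _ _ [pv tv] _ _ _ tk].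
have Ei: E i.*2.+1 = tau i by rewrite /E /= odd_double /= uphalf_double.
have Fm:=ff i.*2.+1;have e0:=edim_gt0 (tau i).
have kb: (n * (3 * (p * q * n)) <= k)%N.
 by have:=big iK;rewrite tk Ei ler_nat leq_pmul2l.
set m:=(k %/ n)%N in tv;have mb: (3 * (p * q * n) <= m)%N by rewrite leq_divRL // mulnC.
have tv': \tr (v 0%N) = (edim (E i.*2.+1) * (3 * (m %/ 3) + m %% 3))%:R.
 by rewrite tv {1}(divn_eq m 3) [(3 * _)%N]mulnC.
have [w [r' [[Aw Ar' pr' tr'] [pw tw] ww wr ws]]]:=fac_divide (isT: (0 < 3)%N) Fm (Av 0%N) pv tv'.
have wi t: (t < 3)%N -> w t *m (w t)^h = w 0%N by move=> t3;rewrite ww // eqxx.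
have wwE t: (t < 3)%N -> proj ((w t)^h *m w t).
 move=> t3;have e1: w 0%N *m w t = w t.
 apply/subr0_eq/hcancel;rewrite hmB hmM pw.1 mulmxBl !mulmxBr !mulmxA -!(mulmxA _ (w t)) wi //.
 by rewrite -(mulmxA _ (w 0%N)) !pw.2 !subrr.
 by split;[rewrite hmM hmK|rewrite mulmxA -(mulmxA _ (w t)) wi // -mulmxA e1].
have wo t u: (t < 3)%N -> (u < 3)%N -> t != u -> (w t)^h *m w t *m ((w u)^h *m w u) = 0.
 by move=> t3 u3 tu;rewrite mulmxA -(mulmxA _ (w t)) ww // (negPf tu) mulmx0 mul0mx.
exists (fun t => (w t)^h *m w t);split=> //.
- by move=> t;apply: (facM Fm) => //;apply: (fac_adj Fm).
- move=> t t3;split;first exact: wwE.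
 rewrite -ws mulmxDl mulmx_suml (bigD1 (Ordinal t3)) //= big1 => [|u ut].
 have -> : r' *m ((w t)^h *m w t) = 0 by rewrite mulmxA -[r']pr'.1 -hmM wr // hm0 mul0mx.
 by rewrite !addr0 (wwE t t3).2.
 by rewrite wo //;exact: ltn_ord.
- move=> t t3;exists (m %/ 3)%N;last by rewrite leq_divRL // mulnC.
 by rewrite mxtrace_mulC wi // tw Ei.
Qed.

Let I :='I_K.*2.
Let cell_q m z: cell f (part F m) (E m) z -> P m *m z = z /\ z *m P m = z.
by case. Qed.
Let cell_orth m m' y z: cell f (part F m) (E m) y -> cell f (part F m') (E m') z -> m != m' -> y *m z = 0.
move=> /cell_q[_ yq] /cell_q[zq _] ne.
by rewrite -yq -zq -mulmxA (mulmxA (P m)) (pqM rf FC) (negPf ne) mul0mx mulmx0.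
Qed.

Lemma sum_even_odd (X: nat -> M) l :
 \sum_(m < l.*2) X m = \sum_(i < l) X i.*2 + \sum_(i < l) X i.*2.+1.
elim: l => [|l IH];first by rewrite !big_ord0 addr0.
by rewrite doubleS !big_ord_recr /= IH -!addrA;congr (_ + _);rewrite addrCA.
Qed.

(* Between the two systems of cuts only the images of the remainders of the even
   parts move, from the upper to the lower neighbour. *)
Lemma connected_cuts: exists T T', [/\ std n 1%:M T, std n 1%:M T',
 forall c a, cmt f K (coarse 0) tau (T c a), forall c a, cmt f K (coarse 1) tau (T' c a) &
 conn (fun S => divt n 1%:M S /\ forall c a, exists x y,
 [/\ cmt f K (coarse 0) tau x, cmt f K (coarse 1) tau y, opb 2 x, opb 2 y & S c a = x + y]) T T'].
have /choice[v /choice[r /choice[k dv]]]:=exists_division.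
have /choice[g hg] i: exists g: nat -> M, (i < K)%N -> [/\ forall t, cell f (part F i.*2.+1) (E i.*2.+1) (g t),
 forall t, (t < 3)%N -> proj (g t) /\ v i.*2.+1 0%N *m g t = g t,
 forall t u, (t < 3)%N -> (u < 3)%N -> t != u -> g t *m g u = 0 &
 forall t, (t < 3)%N -> exists2 l, \tr (g t) = (edim (tau i) * l)%:R & (p * q * n <= l)%N].
 by have [iK|_]:=ltnP i K;[have [g h]:=exists_slots iK (dv i.*2.+1);exists g|exists (fun=> 0)].
have eid m: ~~ odd m -> edim (E m) = (p * q)%N by rewrite /E => /negPf ->.
have Ei i: E i.*2.+1 = tau i by rewrite /E /= odd_double /= uphalf_double.
pose N:=(p * q)%N;have N0: (0 < N)%N by rewrite muln_gt0 p0.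
(* Slot 0 of the odd part [i.*2.+1] takes its own remainder, slots 1 and 2 those of the even parts
   before and after it. Each even remainder thus has two possible places, one in each system of
   cuts. *)
pose host t i:=nth i.*2.+1 [:: i.*2.+1;i.*2;i.*2.+2] t.
have /choice[w hw] (ti: nat * nat): exists z: M, (ti.1 < 3)%N -> (ti.2 < K)%N ->
 [/\ z^h *m z = r (host ti.1 ti.2), g ti.2 ti.1 *m z = z,
 (ti.1 < 2)%N -> cmt f K (coarse 0) tau z & ti.1 != 1%N -> cmt f K (coarse 1) tau z].
 case: ti => t i /=;have [t3|]:=ltnP t 3;last by exists 0.
 have [iK|]:=ltnP i K;last by exists 0.
 have [gc gp go gt]:=hg i iK;have [l gl lb]:=gt t t3;have e0:=edim_gt0 (tau i).
 have [l' rl' lb']:=dr_tr (dv (host t i)).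
 have rg: \tr (r (host t i)) <= \tr (g i t).
 rewrite rl' gl ler_nat;case: t {gl} t3 l' lb' rl' => [|[|[|]]] // _ l' lb' _;rewrite /host /=.
- rewrite Ei leq_pmul2l // (leq_trans lb') // (leq_trans _ lb) // leq_pmull //.
- rewrite eid;last by lia.
 by rewrite -/N (leq_trans _ (leq_pmull _ e0)) // (leq_trans _ lb) // leq_pmul2l.
- rewrite eid;last by lia.
 by rewrite -/N (leq_trans _ (leq_pmull _ e0)) // (leq_trans _ lb) // leq_pmul2l.
 have pr:=dr_proj (dv (host t i));have pg:=(gp t t3).1.
 have cr:=dr_cell (dv (host t i));have cg:=gc t.
 have sub b: (b <= 1)%N -> (host t i = i.*2 + b \/ host t i = (i.*2 + b).+1)%N ->
 exists2 z, z^h *m z = r (host t i) /\ g i t *m z = z & cmt f K (coarse b) tau z.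
 move=> b1 hb;have CC:=coarse_cuts b1;have Fb:=pq_fac rf CC i.
 have hm: (i.*2.+1 = i.*2 + b \/ i.*2.+1 = (i.*2 + b).+1)%N by lia.
 have [z cz zz]:=fac_le Fb (cell_coarse b1 hb cr) pr (cell_coarse b1 hm cg) pg rg.
 by exists z => //;exact: (cell_cmt rf CC cz).
 have own: host t i = i.*2.+1 -> exists2 z, z^h *m z = r (host t i) /\ g i t *m z = z &
 cell f (part F i.*2.+1) (E i.*2.+1) z.
 move=> ht;rewrite ht in cr pr rg *;have [z cz zz]:=fac_le (ff _) cr pr cg pg rg;by exists z.
 case: t {gl rl' rg pr cr pg cg} t3 sub own => [|[|[|]]] // _ sub own;rewrite /host /= in sub own *.
- have [z [zz gz] cz]:=own erefl.
 by exists z;split=> // _;exact: (cell_ccomm _ cz).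
- by have [z [zz gz] cz]:=sub 0%N isT (or_introl (esym (addn0 _)));exists z.
- by have [|z [zz gz] cz]:=sub 1%N isT;[right;rewrite addn1|exists z].
have /= hw1 t i t3 iK:=hw (t, i) t3 iK.
pose V a :=\sum_(m < K.*2) v m a;pose W t :=\sum_(i < K) w (t, (i: nat)).
have gO t u i j: (t < 3)%N -> (u < 3)%N -> (i < K)%N -> (j < K)%N -> (t, i) != (u, j) -> g i t *m g j u = 0.
 move=> t3 u3 iK jK ne;have [gi _ go _]:=hg i iK;have [gj _ _ _]:=hg j jK.
 have [ij|ij]:=eqVneq i j;last by apply: cell_orth (gi t) (gj u) _;rewrite eqSS -!addnn;apply: contra ij;lia.
 by rewrite -ij;apply: go => //;apply: contra ne => /eqP ->;rewrite ij.
have ww t u i j: (t < 3)%N -> (u < 3)%N -> (i < K)%N -> (j < K)%N -> (t, i) != (u, j) ->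
 (w (t, i))^h *m w (u, j) = 0.
 move=> t3 u3 iK jK ne;have [_ gi _ _]:=hw1 t i t3 iK;have [_ gj _ _]:=hw1 u j u3 jK.
 have [_ gp _ _]:=hg i iK;have [[gh _] _]:=gp t t3.
 by rewrite -gi -gj hmM gh -mulmxA (mulmxA (g i t)) gO // mul0mx mulmx0.
have WW t u: (t < 3)%N -> (u < 3)%N -> t != u -> (W t)^h *m W u = 0.
 move=> t3 u3 tu;rewrite hm_sum mulmx_suml big1 // => i _;rewrite mulmx_sumr big1 // => j _.
 by rewrite ww //;apply: contra tu => /eqP[->].
have WW1 t: (t < 3)%N -> (W t)^h *m W t = \sum_(i < K) r (host t i).
 move=> t3;rewrite hm_sum orth_sum => [|i j ij];last by rewrite ww //;apply: contra ij => /eqP[/val_inj ->].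
 by apply: eq_bigr => i _;have []:=hw1 t i t3 (ltn_ord i).
have r00 m: P m = 0 -> r m = 0 by move=> Pm;have [<- _]:=cell_q (dr_cell (dv m));rewrite Pm mul0mx.
(* Both are sums of the even remainders, with the index shifted by one; the end parts 0 and [K.*2]
   are zero. *)
have W21: (W 2)^h *m W 2 = (W 1)^h *m W 1.
 rewrite !WW1 // /host /=;have: \sum_(i < K.+1) r i.*2 = \sum_(i < K.+1) r i.*2 by [].
 by rewrite {1}big_ord_recr big_ord_recl /= (r00 _ PL) (r00 0%N P0) addr0 add0r => ->.
have rp m:=dr_proj (dv m).
pose rr :=\sum_(m < K.*2) r m.
have rrE: rr = (W 0)^h *m W 0 + (W 1)^h *m W 1 by rewrite /rr sum_even_odd !WW1 // addrC.
have sumproj (J: finType) (X: J -> M): (forall j, proj (X j)) -> (forall i j, i != j -> X i *m X j = 0) -> proj (\sum_j X j).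
 move=> pX oX;split;first by rewrite hm_sum;apply: eq_bigr => j _;rewrite (pX j).1.
 by rewrite orth_sum //;apply: eq_bigr => j _;rewrite (pX j).2.
have rO m m': m != m' -> r m *m r m' = 0 by apply: cell_orth (dr_cell (dv m)) (dr_cell (dv m')).
have vO m m' a b: m != m' -> v m a *m (v m' b)^h = 0.
 by apply: cell_orth (dv_cell (dv m) a) (fac_adj (ff m') (dv_cell (dv m') b)).
have vhO m m' a b: m != m' -> (v m a)^h *m v m' b = 0.
 by apply: cell_orth (fac_adj (ff m) (dv_cell (dv m) a)) (dv_cell (dv m') b).
have VV a b: (a < n)%N -> (b < n)%N -> V a *m (V b)^h = if a == b then V 0%N else 0.
 move=> an bn;rewrite hm_sum orth_sum => [|i j ij];last exact: vO.
 case: (eqVneq a b) => [<-|ab].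
 by apply: eq_bigr => m _;rewrite (dv_v (dv m)) // eqxx.
 by apply: big1 => m _;rewrite (dv_v (dv m)) // (negPf ab).
have pV: proj (V 0%N) by apply: sumproj => [j|i j ij];[case: (dv_proj (dv j))|apply: cell_orth ij;apply: dv_cell].
have VW t: (t < 3)%N -> V 0%N *m W t = W t.
 move=> t3;rewrite mulmx_sumr;apply: eq_bigr => i _;have [_ gi _ _]:=hw1 t i t3 (ltn_ord i).
 have [gc gp _ _]:=hg i (ltn_ord i);have iK2: (i.*2.+1 < K.*2)%N by have:=ltn_ord i;lia.
 rewrite -gi mulmxA;congr (_ *m _);rewrite mulmx_suml (bigD1 (Ordinal iK2)) //= big1 => [|m mi].
 by rewrite addr0;case: (gp t t3).
 by apply: cell_orth (dv_cell (dv m) 0%N) (gc t) _;apply: contra mi => /eqP e;apply/eqP/val_inj.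
have Vr a: (a < n)%N -> V a *m rr = 0.
 move=> an;rewrite orth_sum => [|i j ij];last by apply: cell_orth (dv_cell (dv i) a) (dr_cell (dv j)) ij.
 by apply: big1 => m _;rewrite (dv_r (dv m)).
have Vs: \sum_(a < n) (V a)^h *m V a + rr = 1%:M.
 rewrite -(pq_sum rf FC) (eq_bigr (fun a: 'I_n => \sum_(m < K.*2) (v m a)^h *m v m a)) => [|a _].
 by rewrite exchange_big -big_split;apply: eq_bigr => m _;rewrite -(dv_sum (dv m)).
 by rewrite hm_sum orth_sum // => i j;apply: vhO.
pose S c s:=mk_std n V (W 0 + (rc c *: W 1 + rc s *: W 2)).
have Sstd c s: c ^+ 2 + s ^+ 2 = 1 -> std n 1%:M (S c s).
 move=> cs;apply: (mk_stdP n0 pV _ VV Vr Vs);first by apply: sumproj => // i j;apply: rO.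
 by rewrite (rotate_adj (WW 0%N 1%N isT isT isT) (WW 0%N 2%N isT isT isT) (WW 1%N 2%N isT isT isT) W21 cs) rrE.
 by rewrite !mulmxDr -!scalemxAr !VW.
have pW t: (t < 3)%N -> opb 1 (W t).
 move=> t3;rewrite -[W t]hmK;apply: opb_adj => //;apply: opb_cstar => //;rewrite hmK expr1n WW1 //.
 apply: opb_proj;apply: sumproj => // i j ij;apply: rO.
 case: t {WW1} t3 => [|[|[|]]] // _;rewrite /host /=;apply: contra ij => /eqP e;apply/eqP/val_inj => /=;lia.
have cV b a: (b <= 1)%N -> cmt f K (coarse b) tau (V a).
 by move=> b1;apply: cmt_sum => m _;apply: (cell_ccomm b1 (dv_cell (dv m) a)).
have cW b t: (b <= 1)%N -> (t < 3)%N -> t != (2 - b)%N -> cmt f K (coarse b) tau (W t).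
 move=> b1 t3 tb;apply: cmt_sum => i _;have [_ _ h0 h1]:=hw1 t i t3 (ltn_ord i).
 have [b0|b0]: (b = 0 \/ b = 1)%N by lia.
 by rewrite b0;apply: h0;lia.
 by rewrite b0;apply: h1;lia.
have cS b c s a d: (b <= 1)%N -> (if b == 0%N then s else c) = 0 -> cmt f K (coarse b) tau (S c s d a).
 move=> b1 cs;rewrite /S /mk_std;case: (a < n)%N;first by case: d;[apply: commutes_adj => //|];exact: cV.
 case: (~~ d && _);last exact: cmt0.
 rewrite -[W 0]scale1r;have [b0|b0]: (b = 0 \/ b = 1)%N by lia.
 rewrite b0 /= in cs *;rewrite cs rc0 scale0r addr0.
 apply: cmtL;[exact: cW|];rewrite -[_ *: _]addr0;apply: cmtL;[exact: cW|exact: cmt0].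
 rewrite b0 /= in cs *;rewrite cs rc0 scale0r add0r.
 apply: cmtL;[exact: cW|];rewrite -[_ *: _]addr0;apply: cmtL;[exact: cW|exact: cmt0].
exists (S 1 0), (S 0 1);split=> [||d a|d a|].
- by apply: Sstd;rewrite expr1n expr0n addr0.
- by apply: Sstd;rewrite expr1n expr0n add0r.
- by apply: cS.
- by apply: cS.
apply: (@conn_path _ _ _ (fun s => S (cosp 2^-1 s) (sinp 2^-1 s))).
- move=> d a;rewrite /S /mk_std;case: (a < n)%N;first exact: mcontC.
 case: (~~ d && _);last exact: mcontC.
 apply: mcontD;first exact: mcontC.
 by apply: mcontD;apply: mcontZ;[exact: rcont_cosp|exact: mcontC|exact: rcont_sinp|exact: mcontC].
- by have [-> ->]:=cosp0 (2^-1: R).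
- by have [-> ->]:=cosp1 R.
move=> s _;set c:=cosp _ _;set d:=sinp _ _;have cd: c ^+ 2 + d ^+ 2 = 1:=cosp2 _ _.
have p1: proj (1%:M: M) by split;rewrite ?hm1 ?mulmx1.
have dS:=std_div n0 p1 (Sstd _ _ cd);have [_ _ _ _ oS]:=dS;split=> //.
move=> b a;have o12:=opb_le (ler01: 0 <= (1: R)) (ler1n R 2).
have [an|an]:=ltnP a n.
 exists (S c d b a), 0;rewrite addr0;split=> //;[|exact: cmt0|exact: o12 (oS b a)|exact: opb00].
 by rewrite /S /mk_std an;case: b;[apply: commutes_adj => //|];exact: cV.
case E2: (~~ b && (a == n));last first.
 exists 0, 0;rewrite /S /mk_std ltnNge an /= E2 addr0.
 by split=> //;[exact: cmt0|exact: cmt0|exact: opb00|exact: opb00].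
have ob t x: (t < 3)%N -> -1 <= x <= 1 -> opb 1 (rc x *: W t).
 move=> t3 x1;apply: (@opb_le _ _ (absC (rc x) * 1));last exact/opbZ/pW;first by rewrite mulr1 abs0.
 by rewrite mulr1 absC_rc ler_norml.
have c11: -1 <= c <= 1 by apply/andP;split;nra.
have d11: -1 <= d <= 1 by apply/andP;split;nra.
exists (W 0 + rc c *: W 1), (rc d *: W 2);split.
- rewrite -[W 0]scale1r;apply: cmtL;[exact: cW|];rewrite -[_ *: _]addr0.
 by apply: cmtL;[exact: cW|exact: cmt0].
- by rewrite -[_ *: _]addr0;apply: cmtL;[exact: cW|exact: cmt0].
- by have -> : 2 = 1 + 1 :> R by [];apply: opbD => //;[exact: pW|exact: ob].
- exact/o12/ob.
- by rewrite /S /mk_std ltnNge an /= E2 addrA.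
Qed.
End Step.

(** * Ramps, positions of cuts, and cores *)

Section Ramps.
Variables (R: realType) (K: nat).
Implicit Types (h k s: R).

Definition ramp h k s: R:=clamp (h * (K%:R * s) - k).
(** Equal to 1 wherever the ramp at [k] is strictly between 0 and 1: a representation that kills it
    maps that ramp to an idempotent. *)
Definition bump h k s:=ramp h (k - 1) s - ramp h (k + 1) s.

Lemma ramp_nest h k h' k' s: 0 < h -> 0 < h' -> (k + 1) * h' <= k' * h -> ramp h k s * ramp h' k' s = ramp h' k' s.
move=> h0 h0' le;have [x|x]:=leP (h' * (K%:R * s) - k') 0;first by rewrite [ramp h' _ _]clamp0 ?mulr0.
rewrite [ramp h k s]clamp1 ?mul1r // lerBrDr [1 + k]addrC -(ler_pM2r h0') (le_trans le) //.
by rewrite -mulrA mulrC ler_pM2l // mulrC;lra.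
Qed.
Lemma rcont_ramp h k: rcontR (ramp h k).
apply: (@rcont_lip _ _ `|h * K%:R|) => s s';apply: le_trans (clamp_lip _ _) _.
by rewrite opprB addrA subrK !mulrA -mulrBr normrM.
Qed.
Lemma rcont_bump h k: rcontR (bump h k). Proof. by apply: rcontRB;apply: rcont_ramp. Qed.
Lemma ramp0 h k: 0 <= k -> ramp h k 0 = 0.
by move=> k0;rewrite /ramp clamp0 // !mulr0 sub0r oppr_le0. Qed.
Lemma ramp1 h k: k + 1 <= h * K%:R -> ramp h k 1 = 1.
by move=> hk;rewrite /ramp clamp1 // mulr1;lra. Qed.
Lemma bump_orth h k k' s: 0 < h -> k + 3 <= k' -> bump h k s * bump h k' s = 0.
move=> h0 kk;have N a b: a + 1 <= b -> ramp h a s * ramp h b s = ramp h b s.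
 by move=> ab;apply: ramp_nest => //;rewrite ler_pM2r.
by rewrite /bump mulrBl !mulrBr !N ?subrr //;lra.
Qed.
Lemma ramp_bump h k s: 0 < h -> let r:=ramp h k s in (r - r * r) * bump h k s = r - r * r.
move=> h0 r;have N a b: a + 1 <= b -> ramp h a s * ramp h b s = ramp h b s.
 by move=> ab;apply: ramp_nest => //;rewrite ler_pM2r.
have e1: r * ramp h (k - 1) s = r by rewrite mulrC N //;lra.
have e2: r * ramp h (k + 1) s = ramp h (k + 1) s by rewrite N //;lra.
by rewrite /bump mulrBl mulrBr e1 e2 -mulrA mulrBr e1 e2 mulrBr e2;ring.
Qed.

Variables (rr: nat) (r0: (0 < rr)%N).
(** In units of [1 / (6 * rr)] on the scale [K * s]: the [rr] candidates for the cut [i] lie in the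
    first half of the cell [i], three units apart so that their bumps are orthogonal. The second
    half is reserved for the cores. *)
Definition cutpos i c:=(6 * rr * i + 3 * c + 1)%N.
Definition cutf (c: nat -> nat) i s: R :=
 if i == 0%N then 1 else if (i < K)%N then ramp (6 * rr)%:R (cutpos i (c i))%:R s else 0.

Let hr: 0 < (6 * rr)%:R :> R. Proof. by rewrite ltr0n;lia. Qed.

Lemma rcont_cutf c i: rcontR (cutf c i).
by rewrite /cutf /rcontR;case: (i == 0%N);[exact: rcontC|case: (i < K)%N;[exact: rcont_ramp|exact: rcontC]]. Qed.
Lemma cutf_nest c c' i j s: (forall m, c m < rr)%N -> (i < j \/ i = j /\ c i < c' j)%N ->
 cutf c i s * cutf c' j s = cutf c' j s.
move=> cr ij;rewrite /cutf;case: eqP => [_|/eqP i0];first by rewrite mul1r.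
have -> : (j == 0%N) = false by lia.
case: (ltnP j K) => jK;last by rewrite mulr0.
have -> : (i < K)%N by lia.
apply: ramp_nest => //;rewrite ler_pM2r // natr1 ler_nat /cutpos.
by have:=cr i;case: ij => [ij|[<- ij]];nia.
Qed.
Lemma cutf0 c i: cutf c i 0 = (i == 0%N)%:R.
by rewrite /cutf;case: eqP => // _;case: ifP => // _;rewrite ramp0. Qed.
Lemma cutf1 c i: (forall m, c m < rr)%N -> cutf c i 1 = ((i == 0%N) || (i < K)%N)%:R.
move=> cr;rewrite /cutf;case: eqP => // _;case: ltnP => //= iK;rewrite ramp1 // natr1 -natrM.
by rewrite ler_nat /cutpos;have:=cr i;nia.
Qed.
End Ramps.

Section Connect.
Variables (R: realType) (p q D n K rr: nat) (p0: (0 < p)%N) (q0: (0 < q)%N).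
Hypotheses (n0: (0 < n)%N) (K1: (1 < K)%N) (r0: (0 < rr)%N).
Local Notation C:=(Cplx R).
Local Notation M :='M[C]_D.
Variable f: (R -> 'M[C]_(p * q)) -> M.
Hypothesis rf: rep p0 q0 f.
Local Opaque mulmx map_mx trmx mxtrace opb cel.
Local Notation P h:=(cel f h 1%:M).
Implicit Types c: nat -> nat.

(** Only the first and the last cell contain an end of the interval, where the values are
    restricted. *)
Definition ctype i:=if i == 0%N then @emb_l R p q p0 else if i == K.-1 then @emb_r R p q q0 else emb_id R p0 q0.
(** Three slots are needed, each for a remainder of size up to [p * q * n]. The further [n] accounts
    for the division by [n], and [p * q] bounds the size of the matrix units. *)
Definition cores:=(p * q * (n * (3 * (p * q * n))))%N.
Definition core i x: R -> R:=bump K (6 * cores)%:R (6 * cores * i + 3 * cores + 3 * x + 1)%:R.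
Definition alive:=forall i x, (i < K)%N -> (x < cores)%N -> P (core i x) <> 0.
Definition cutok c:=forall i, (c i < rr)%N.
(** Each cut-off is mapped to a projection; [killed_of] gets this from bumps that the representation
    kills. *)
Definition killed c:=forall i, P (cutf K rr c i) *m P (cutf K rr c i) = P (cutf K rr c i).
(** The cuts of [c] and [c'] interlaced, for [c <= c']: the even parts are where the two systems
    disagree. *)
Definition refined c c' m:=cutf (R:=R) K rr (if odd m then c' else c) m./2.

Lemma celM1 h g: rcontR h -> rcontR g -> P h *m P g = P (fun s => h s * g s).
by move=> ch cg;rewrite (celM rf) ?mulmx1 //;apply: ddropS. Qed.
Lemma cel_nest h g: rcontR h -> rcontR g -> (forall s, h s * g s = g s) -> P h *m P g = P g.
by move=> ch cg e;rewrite celM1 //;congr (cel f _ _);apply/funext. Qed.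

Lemma refined_cuts c c': cutok c -> cutok c' -> (forall i, (c i <= c' i)%N) -> killed c -> killed c' ->
 cuts p0 q0 f K.*2 (refined c c') (alternate p0 q0 ctype).
move=> hc hc' cc kc kc';split=> [s|m s Km|m m' mm|m].
- by rewrite /refined /cutf.
- rewrite /refined /cutf;have -> : (m./2 == 0)%N = false by lia.
 by rewrite ltnNge;have -> : (K <= m./2)%N by lia.
- have rc m1: rcontR (refined c c' m1) by apply: rcont_cutf.
 have ok m1: cutok (if odd m1 then c' else c) by case: (odd m1).
 have [e|ne]:=boolP ((m./2 == m'./2) && ((odd m == odd m') || (c m./2 == c' m./2))).
 have -> : refined c c' m' = refined c c' m.
 case/andP: e => /eqP e1 e2;apply/funext => s;rewrite /refined /cutf e1.
 by case: (odd m) e2 mm;case: (odd m') => //=;rewrite e1 => /eqP ->.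
 by rewrite /refined;case: (odd m);[apply: kc'|apply: kc].
 apply: cel_nest => // s;apply: cutf_nest => //;first exact: ok.
 case: (ltngtP m./2 m'./2) => [|h|h];[by left|lia|right;split=> //].
 move: ne;rewrite h eqxx /= negb_or => /andP[ne1 ne2].
 have [m1 m2]: odd m = false /\ odd m' = true by lia.
 by rewrite m1 m2 ltn_neqAle ne2 cc.
split;first exact: rcont_cutf.
split;first by apply: rcontRB;apply: rcont_cutf.
have o: (m.+1)./2 = (odd m + m./2)%N by lia.
move=> x;apply: ddrop_elt => [|h|h];first by apply: rcontRB;apply: rcont_cutf.
 move: h;rewrite /part /refined !cutf0 o /= => h.
 have om: odd m /\ m./2 = 0%N.
 by case: (odd m) h => /=;case: (m./2) => [|m2] //=;rewrite ?subrr.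
 rewrite /alternate in x *;move: x;rewrite om.1 om.2 /ctype /= => x;by exists x.
have ok b: cutok (if b then c' else c) by case: b.
move: h;rewrite /part /refined (@cutf1 R K rr r0 _ _ (ok (odd m))) (@cutf1 R K rr r0 _ _ (ok (odd m.+1))) o => h.
have [m1 mK]: odd m /\ m./2 = K.-1.
 case E: (odd m && (m./2 == K.-1));first by case/andP: E => -> /eqP.
 case: h;suff -> : ((m./2 == 0) || (m./2 < K) = (odd m + m./2 == 0) || (odd m + m./2 < K))%N by rewrite subrr.
 lia.
rewrite /alternate in x *;move: x;rewrite m1 mK /ctype.
have -> : (K.-1 == 0%N) = false by lia.
by rewrite eqxx => x;exists x.
Qed.

Lemma coarse_refined c c' b: (b <= 1)%N -> coarse (refined c c') b = cutf K rr (if b == 0%N then c else c').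
move=> b1;apply/funext => i;rewrite /coarse /refined.
have [->|->]: (b = 0 \/ b = 1)%N by lia.
 by rewrite addn0 odd_double doubleK.
by rewrite addn1 /= odd_double uphalf_double.
Qed.
Lemma cutf_cuts c: cutok c -> killed c -> cuts p0 q0 f K (cutf K rr c) ctype.
move=> hc kc;have:=coarse_cuts n0 (refined_cuts hc hc (fun=> leqnn _) kc kc) (fun=> erefl) (leq0n 1).
by rewrite coarse_refined.
Qed.

Lemma core_sub c c' i x s: cutok c -> cutok c' -> (i < K)%N -> (x < cores)%N ->
 part (refined c c') i.*2.+1 s * core i x s = core i x s.
move=> hc hc' iK xc;have c0: (0 < cores)%N by lia.
have h0: 0 < (6 * cores)%:R :> R by rewrite ltr0n;lia.
have hr: 0 < (6 * rr)%:R :> R by rewrite ltr0n;lia.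
rewrite /part /refined /= odd_double doubleK uphalf_double /= /core /bump.
set k:=(6 * cores * i + 3 * cores + 3 * x + 1)%N.
have -> : k%:R - 1 = (6 * cores * i + 3 * cores + 3 * x)%:R :> R by rewrite /k natrD addrK.
have -> : k%:R + 1 = (6 * cores * i + 3 * cores + 3 * x + 2)%:R :> R by rewrite natr1 /k addn1 addn2.
have lo a: (6 * cores * i + 3 * cores <= a)%N -> cutf K rr c' i s * ramp K (6 * cores)%:R a%:R s = ramp K (6 * cores)%:R a%:R s.
 move=> ha;rewrite /cutf;case: eqP => _;first by rewrite mul1r.
 rewrite iK;apply: ramp_nest => //;rewrite natr1 -!natrM ler_nat /cutpos.
 have:=hc' i;have:=leq_mul2r (6 * rr) (6 * cores * i + 3 * cores)%N a;rewrite ha orbT => h1 h2.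
 by apply: leq_trans h1;have:=leq_mul2l cores (c' i).+1 rr;rewrite h2 orbT;nia.
have hi a: (a < 6 * cores * i.+1)%N -> ramp K (6 * cores)%:R a%:R s * cutf K rr c i.+1 s = cutf K rr c i.+1 s.
 move=> ha;rewrite /cutf /=;case: ifP => _;last by rewrite mulr0.
 apply: ramp_nest => //;rewrite natr1 -!natrM ler_nat /cutpos.
 have:=leq_mul2r (6 * rr) a.+1 (6 * cores * i.+1)%N;rewrite ha orbT => h1.
 by apply: leq_trans h1 _;nia.
have l1:=lo (6 * cores * i + 3 * cores + 3 * x)%N _;have l2:=lo (6 * cores * i + 3 * cores + 3 * x + 2)%N _.
have h1:=hi (6 * cores * i + 3 * cores + 3 * x)%N _;have h2:=hi (6 * cores * i + 3 * cores + 3 * x + 2)%N _.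
rewrite mulrBl !mulrBr l1 ?l2 ?[cutf _ _ _ _ _ * _]mulrC ?h1 ?h2;[|lia|lia|lia|lia].
by rewrite subrr subr0.
Qed.

Lemma refined_big c c' i: cutok c -> cutok c' -> (forall m, (c m <= c' m)%N) -> killed c -> killed c' -> alive -> (i < K)%N ->
 (edim (ctype i) * (n * (3 * (p * q * n))))%:R <= \tr (pq f (refined c c') i.*2.+1).
move=> hc hc' cc kc kc' al iK;have FC:=refined_cuts hc hc' cc kc kc'.
apply: (@le_trans _ _ cores%:R).
 rewrite ler_nat leq_mul2r;apply/orP;right;rewrite /ctype.
 by case: eqP => _ /=;[rewrite leq_pmulr|case: eqP => _ /=;rewrite ?leq_pmull].
have rg x: rcontR (core i x) by exact: rcont_bump.
have rp: rcontR (part (refined c c') i.*2.+1) by apply: rcontRB;apply: rcont_cutf.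
apply: (@orth_count _ _ cores (fun x: 'I_cores => P (core i x))) => [|x|x|x y xy].
- exact: (pq_proj rf FC).
- rewrite celM1 //;congr (cel f _ _);apply/funext => s;rewrite mulrC;exact: core_sub.
- exact: al.
have h0: 0 < (6 * cores)%:R :> R by rewrite ltr0n;have:=ltn_ord x;lia.
rewrite (cel_h rf) // celM1 //.
have -> : (fun s => core i x s * core i y s) = (fun s => core i x s - core i x s).
 apply/funext => s;rewrite subrr /core.
 have [h|h]: (x < y \/ y < x)%N by move: xy;rewrite -val_eqE /=;lia.
 by apply: bump_orth => //;rewrite -natrD ler_nat;lia.
 by rewrite mulrC;apply: bump_orth => //;rewrite -natrD ler_nat;lia.
by rewrite (celB rf) ?subrr //;apply: ddropS.
Qed.
End Connect.

(** * Approximate commutation with a finite family *)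

Section Vanishing.
Variables (R: realType) (p q: nat) (p0: (0 < p)%N) (q0: (0 < q)%N).
Local Notation C:=(Cplx R).
Local Notation ddrop:=(ddrop p0 q0).
Variables (g: R -> 'M[C]_(p * q)) (d: R).
Hypotheses (dg: ddrop g) (g0: g 0 = 0) (g1: g 1 = 0) (d0: 0 <= d).
Hypothesis gd: forall s j k, 0 <= s <= 1 -> absC (g s j k) <= d.

Definition entry (jk: 'I_(p * q) * 'I_(p * q)) s:=g s jk.1 jk.2 *: dmx R (p * q) jk.1 jk.2.
Lemma ddrop_vanish (G: R -> 'M[C]_(p * q)): mcont G -> G 0 = 0 -> G 1 = 0 -> ddrop G.
by move=> cG G0 G1;split=> //;exists 0;rewrite emb0. Qed.
Lemma ddrop_entry jk: ddrop (entry jk).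
apply: ddrop_vanish;rewrite /entry ?g0 ?g1 ?mxE ?scale0r //;apply: mcontZ;last exact: mcontC.
by have [cg _ _]:=dg;apply: cg.
Qed.
Lemma entry_sum s: g s = \sum_jk entry jk s.
exact: dmx_sum. Qed.

Lemma entry_root (jk: 'I_(p * q) * 'I_(p * q)): exists T, [/\ ddrop T, forall s, (T s)^h = T s &
 forall s, 0 <= s <= 1 -> 1 *: ((entry jk s)^h *m entry jk s) + T s *m T s = elt (fun=> d * d) 1%:M s].
case: jk => j k;pose u s:=Num.sqrt (d ^+ 2 - absC (g s j k) ^+ 2).
have [cg _ _]:=dg.
have cu: rcontR u.
 apply: rcont_sqrt.
 under eq_fun do rewrite rcB absC_sqr;apply: rcontD;first exact: rcontC.
 under eq_fun do rewrite -mulN1r;apply: rcontM;first exact: rcontC.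
 by apply: rcontM;[exact: cg|apply: rcont_conj;exact: cg].
have u0 s: g s = 0 -> u s = d by move=> gs;rewrite /u gs mxE absC0 expr0n subr0 sqrtr_sqr ger0_norm.
pose V s:=rc (d - u s) *: dmx R (p * q) k k;pose T s:=rc (-1) *: V s + elt (fun=> d) 1%:M s.
have dV: ddrop V.
 apply: ddrop_vanish;rewrite /V ?u0 // ?subrr ?rc0 ?scale0r //.
 by apply: mcontZ;[apply: rcontRB => //;exact: rcontC|exact: mcontC].
have dE: ddrop (elt (fun=> d) 1%:M) by apply: ddropS;exact: rcontC.
exists T;split=> [|s|s s01];first exact: ddropL.
 have H (x y: R) (a b: 'M[C]_(p * q)): a^h = a -> b^h = b -> (rc x *: a + rc y *: b)^h = rc x *: a + rc y *: b.
 by move=> ha hb;rewrite hmD !hmZ !rc_conj ha hb.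
 apply: H;last exact: hm1.
 by rewrite /V hmZ rc_conj dmx_adj.
suff TT: T s *m T s = (rc d * rc d)%:M - (entry (j, k) s)^h *m entry (j, k) s.
 by rewrite TT scale1r addrC subrK /elt rcM scalemx1.
have uu: u s * u s = d ^+ 2 - absC (g s j k) ^+ 2.
 by rewrite -expr2 sqr_sqrtr // subr_ge0 lerXn2r ?nnegrE ?abs0 // gd.
set a:=dmx R (p * q) j k;have sq t: (t *: a)^h *m (t *: a) = rc (absC t ^+ 2) *: (a^h *m a).
 by rewrite hmZ -scalemxAl -scalemxAr scalerA absC_sqr mulrC.
rewrite /entry /= sq dmx_adj dmxM // eqxx.
have -> : absC (g s j k) ^+ 2 = d * d - u s * u s by rewrite uu -expr2;ring.
have -> : T s = (rc d)%:M - rc (d - u s) *: dmx R (p * q) k k by rewrite /T /V /elt rcN rc1 scaleN1r addrC scalemx1.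
set x:=rc (d - u s);set e:=dmx R (p * q) k k;have ee: e *m e = e by rewrite dmxM // eqxx.
have -> : (rc d)%:M - x *: e = rc d *: 1%:M - x *: e by rewrite scalemx1.
rewrite mulmxBl !mulmxBr -!scalemxAl -!scalemxAr ee !mulmx1 !mul1mx !scalerA -[in RHS]scalemx1 -addrA;congr (_ + _).
rewrite -scalerBl -opprD -scalerDl;congr (- (_ *: _)).
by rewrite /x -!rcM -rcB -rcD;congr rc;ring.
Qed.
End Vanishing.

Lemma opb_of_sum (R: realType) n (a b: 'M[Cplx R]_n) (d: R): 0 <= d ->
 a^h *m a + b^h *m b = (rc (d * d))%:M -> opb d a.
move=> d0 ab;rewrite -[a]hmK;apply: opb_adj => // v.
have e: sqn (v *m a^h) + sqn (v *m b^h) = d * d * sqn v.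
 apply: (@rc_inj R);rewrite rcD rcM !sqnE !hmM !hmK.
 have -> : v *m a^h *m (a *m v^h) = v *m (a^h *m a) *m v^h by rewrite !mulmxA.
 have -> : v *m b^h *m (b *m v^h) = v *m (b^h *m b) *m v^h by rewrite !mulmxA.
 have mD (x y: 'M[Cplx R]_1): x 0 0 + y 0 0 = (x + y) 0 0 by rewrite mxE.
 by rewrite mD -mulmxDl -mulmxDr ab mul_mx_scalar -scalemxAl mxE.
by have:=sqn_ge0 (v *m b^h);rewrite expr2;lra.
Qed.

Section SmallRep.
Variables (R: realType) (p q D: nat) (p0: (0 < p)%N) (q0: (0 < q)%N).
Local Notation C:=(Cplx R).
Variable f: (R -> 'M[C]_(p * q)) -> 'M[C]_D.
Hypothesis rf: rep p0 q0 f.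

Lemma ddrop1: ddrop p0 q0 (fun=> 1%:M: 'M[C]_(p * q)).
by split;[exact: mcontC|exists 1%:M;rewrite emb1|exists 1%:M;rewrite emb1]. Qed.
Lemma rep_cst c: f (elt (fun=> c) 1%:M) = (rc c)%:M.
have:=repL rf (rc c - 1) ddrop1 ddrop1;rewrite (rep1 rf).
have -> : (rc c - 1) *: 1%:M + 1%:M = rc c *: 1%:M :> 'M[C]_D by rewrite scalerBl scale1r subrK.
move=> h;apply: etrans (scalemx1 _ _);rewrite -h;congr f;apply/funext => s;by rewrite /elt scalerBl scale1r subrK.
Qed.
Lemma rep_sum (I: finType) (G: I -> R -> 'M[C]_(p * q)): (forall i, ddrop p0 q0 (G i)) ->
 ddrop p0 q0 (fun s => \sum_i G i s) /\ f (fun s => \sum_i G i s) = \sum_i f (G i).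
move=> dG;elim: (index_enum I) => [|i r [d IH]].
 have z: (fun=> -1 *: 1%:M + 1%:M) = (fun=> 0) :> (R -> 'M[C]_(p * q)).
 by apply/funext => s;rewrite scaleN1r addrC subrr.
 have:=ddropL (-1) ddrop1 ddrop1;have:=repL rf (-1) ddrop1 ddrop1.
 rewrite z (rep1 rf) scaleN1r [- _ + _]addrC subrr => f0 d0;under eq_fun do rewrite big_nil.
 by split;rewrite ?big_nil.
have z: (fun s => \sum_(j <- i :: r) G j s) = fun s => 1 *: G i s + \sum_(j <- r) G j s.
 by apply/funext => s;rewrite big_cons scale1r.
by rewrite z (repL rf) // big_cons IH scale1r;split=> //;apply: ddropL.
Qed.

(** For one entry [a] of [g], [d * d - a^h * a] has an explicit root in the algebra, which any
    representation preserves; so the image of [a] is bounded by [d]. Vanishing at both ends keeps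
    single entries in the algebra, and their number is the factor. *)
Lemma small_rep g d: ddrop p0 q0 g -> g 0 = 0 -> g 1 = 0 ->
 0 <= d -> (forall s j k, 0 <= s <= 1 -> absC (g s j k) <= d) -> opb (((p * q) * (p * q))%:R * d) (f g).
move=> dg g0 g1 d0 gd;have de jk:=ddrop_entry dg g0 g1 jk.
have -> : f g = \sum_jk f (entry g jk) by rewrite -(rep_sum de).2;congr f;apply/funext => s;exact: entry_sum.
have -> : ((p * q) * (p * q))%N = size (index_enum ('I_(p * q) * 'I_(p * q))%type).
 by rewrite [index_enum _]unlock -enumT -cardE card_prod card_ord.
apply: opb_sum => // jk;have [T [dT Th TT]]:=entry_root dg g0 g1 d0 gd jk.
apply: (@opb_of_sum _ _ _ (f T)) => //;rewrite -!(rep_adj rf) // -!(repM rf) //;try exact: ddrop_adj.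
have -> : (fun s => (T s)^h *m T s) = fun s => T s *m T s by apply/funext => s;rewrite Th.
have dd:=ddropM (ddrop_adj (de jk)) (de jk);have tt:=ddropM dT dT.
rewrite -rep_cst -[X in X + _]scale1r -(repL rf) //;apply: (rep_ext rf);first exact: ddropL.
 by apply: ddropS;exact: rcontC.
exact: TT.
Qed.
End SmallRep.

Section Approximation.
Variables (R: realType) (p q n K rr: nat) (p0: (0 < p)%N) (q0: (0 < q)%N).
Hypotheses (n0: (0 < n)%N) (K1: (1 < K)%N) (r0: (0 < rr)%N).
Local Notation C:=(Cplx R).
Variables (I: finType) (fam: I -> R -> 'M[C]_(p * q)) (d: R).
Hypotheses (dfam: forall i, ddrop p0 q0 (fam i)) (d0: 0 <= d).
Hypothesis osc: forall i s s' j k, 0 <= s <= 1 -> 0 <= s' <= 1 -> K%:R * `|s - s'| <= 2 ->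
 absC (fam i s j k - fam i s' j k) <= d.
Local Opaque mulmx map_mx trmx mxtrace opb cel.
Local Notation ctype:=(@ctype R p q K p0 q0).
Local Notation N2:=(((p * q) * (p * q))%:R: R).

(** Sample points, with the last cell sampled at the end 1, so that each value of [fam] fits the
    type of its cell. *)
Definition node i: R:=if i == K.-1 then 1 else i%:R / K%:R.
Lemma node_itv i: (i < K)%N -> 0 <= node i <= 1.
move=> iK;rewrite /node;case: eqP => _;rewrite ?lexx ?ler01 // divr_ge0 ?ler0n //=.
by rewrite ler_pdivrMr ?ltr0n ?mul1r ?ler_nat;lia.
Qed.
Lemma node_value i j: (i < K)%N -> exists x, fam j (node i) = ctype i x.
move=> iK;rewrite /node /ctype;have [_ h0 h1]:=dfam j;case: (eqVneq i K.-1) => [->|_].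
 by have -> : (K.-1 == 0%N) = false by lia.
case: eqP => [->|_];last by exists (fam j (i%:R / K%:R)).
by rewrite mul0r;case: h0 => x ->;exists x.
Qed.
Lemma part_near c i s: (forall m, c m < rr)%N -> (i < K)%N -> 0 <= s <= 1 -> 0 <= part (cutf K rr c) i s /\
 (part (cutf K rr c) i s != 0 -> K%:R * `|s - node i| <= 2).
move=> hc iK /andP[s0 s1];have K0: 0 < K%:R :> R by rewrite ltr0n;lia.
have b01 m: 0 <= cutf K rr c m s <= 1.
 by rewrite /cutf;case: eqP => _;[rewrite ler01 lexx|case: ifP => _;[exact: clampP|rewrite lexx ler01]].
have nest: cutf K rr c i s * cutf K rr c i.+1 s = cutf K rr c i.+1 s.
 by apply: cutf_nest => //;left.
have:=b01 i;have:=b01 i.+1;rewrite /part;set x:=cutf K rr c i s in nest *.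
set y:=cutf K rr c i.+1 s in nest * => /andP[y0 y1] /andP[x0 x1].
split;first by rewrite subr_ge0;nra.
move=> ne;have hr: 0 < (6 * rr)%:R :> R by rewrite ltr0n;lia.
have xn: x <> 0 by move=> e;move: ne;rewrite e -nest e mul0r subrr eqxx.
have yn: y <> 1 by move=> e;move: ne;rewrite e -[x]mulr1 -{1}e nest e subrr eqxx.
have lo: i%:R <= K%:R * s.
 rewrite leNgt;apply/negP => lt;apply: xn;rewrite /x /cutf;case: eqP lt => [->|_ lt];first by move: (mulr_ge0 (ltW K0) s0);lra.
 case: ifP => // _;rewrite /ramp clamp0 // subr_le0 (le_trans (_: _ <= (6 * rr)%:R * i%:R)) //.
 by rewrite ler_pM2l // ltW.
 by rewrite -natrM ler_nat /cutpos -addnA leq_addr.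
have hi: (i.+1 < K)%N -> K%:R * s <= i%:R + 2.
 move=> iK1;rewrite leNgt;apply/negP => lt;apply: yn;rewrite /y /cutf /= iK1 /ramp clamp1 //.
 rewrite lerBrDr [1 + _]addrC (le_trans (_: _ <= (6 * rr)%:R * (i%:R + 2))) //;last by rewrite ler_pM2l // ltW.
 by rewrite natr1 -natrD -natrM ler_nat /cutpos;move: (hc i.+1);clear;nia.
rewrite -[K%:R in leLHS]ger0_norm ?(ltW K0) // -normrM mulrBr /node;case: eqP => [e|ne'].
 rewrite mulr1 ler_norml;have h: K%:R * s <= K%:R by rewrite ger_pMr.
 have e2: i%:R + 1 = K%:R :> R by rewrite natr1 e prednK // (ltn_trans _ K1).
 apply/andP;split;lra.
rewrite mulrCA mulfV ?mulr1 ?gt_eqF // ler_norml.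
have iK1: (i.+1 < K)%N by move: iK ne';clear;lia.
by have:=hi iK1;lra.
Qed.

Variables (D: nat) (f: (R -> 'M[C]_(p * q)) -> 'M[C]_D).
Hypothesis rf: rep p0 q0 f.

(* [z] commutes with the image of the step function with value [fam j (node i)] on part [i]. *)
Lemma cmt_near c z b j: (forall m, c m < rr)%N -> killed K rr f c -> 0 <= b -> opb b z ->
 cmt f K (cutf K rr c) ctype z -> opb (2 * b * (N2 * d)) (z *m f (fam j) - f (fam j) *m z).
move=> hc kc b0 zb cz;have FC:=cutf_cuts n0 K1 r0 rf hc kc.
pose X (i: 'I_K):=cid (node_value j (ltn_ord i));pose x i:=sval (X i);have hx (i: 'I_K): fam j (node i) = ctype i (x i):=svalP (X i).
pose G (i: 'I_K):=elt (part (cutf K rr c) i) (ctype i (x i)).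
have dG i: ddrop p0 q0 (G i) by have [_ [_ h]]:=cuts_adm FC i;apply: h.
have [dS fS]:=rep_sum rf dG.
have part1 (s: R): \sum_(i < K) part (cutf K rr c) i s = 1.
 suff H l: \sum_(i < l) part (cutf K rr c) i s = 1 - cutf K rr c l s by rewrite H (cutsL FC) ?subr0.
 by elim: l => [|l IH];[rewrite big_ord0 (cuts0 FC) subrr|rewrite big_ord_recr /= IH addrA subrK].
have XS: z *m f (fun s => \sum_i G i s) = f (fun s => \sum_i G i s) *m z.
 rewrite fS mulmx_sumr mulmx_suml;apply: eq_bigr => i _;exact: cz.
pose g (s: R) :=-1 *: (\sum_i G i s) + fam j s.
have dg: ddrop p0 q0 g by apply: ddropL.
have fg: f g = f (fam j) - f (fun s => \sum_i G i s) by rewrite (repL rf) // scaleN1r addrC.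
have gE (s: R) k l: g s k l = \sum_(i < K) rc (part (cutf K rr c) i s) * (fam j s k l - fam j (node i) k l).
 rewrite /g /G mxE mxE summxE mulN1r addrC -[fam j s k l]mul1r -[1 in X in X - _](rc1 R) -(part1 s) rc_sum mulr_suml -sumrB.
 by apply: eq_bigr => i _;rewrite /elt mxE mul1r mulrBr -hx.
have gd (s: R) k l: 0 <= s <= 1 -> absC (g s k l) <= d.
 move=> s01;rewrite gE;apply: (@le_trans _ _ (\sum_(i < K) part (cutf K rr c) i s * d));last by rewrite -mulr_suml part1 mul1r.
 elim/big_ind2: _ => [|u u' v v' h1 h2|i _];first by rewrite absC0.
 by apply: le_trans (absCD _ _) _;apply: lerD.
 have [p0' pn]:=part_near hc (ltn_ord i) s01;rewrite absCM absC_rc ger0_norm //.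
 have [->|ne]:=eqVneq (part (cutf K rr c) i s) 0;first by rewrite !mul0r.
 by rewrite ler_wpM2l //;apply: osc => //;[apply: node_itv|apply: pn].
have end0 (s: R) i0: (i0 < K)%N -> node i0 = s -> (forall i, (i < K)%N -> i != i0 -> part (cutf K rr c) i s = 0) -> g s = 0.
 move=> iK ns h;apply/matrixP => k l;rewrite gE mxE big1 // => i _.
 have [e|ne]:=eqVneq (i: nat) i0;first by rewrite e ns subrr mulr0.
 by rewrite h // rc0 mul0r.
have g0: g 0 = 0.
 apply: (end0 0 0%N) => [||i iK i0];first by lia.
 by rewrite /node;case: eqP => [|_];[lia|rewrite mul0r].
 by rewrite /part !cutf0 (negPf i0) subrr.
have g1: g 1 = 0.
 apply: (end0 1 K.-1) => [||i iK i0];first by lia.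
 by rewrite /node eqxx.
 rewrite /part !cutf1 // iK orbT (_: (i.+1 < K)%N) ?subrr //;lia.
have sm:=small_rep rf dg g0 g1 d0 gd.
have -> : z *m f (fam j) - f (fam j) *m z = z *m f g - f g *m z.
 by rewrite fg mulmxBr mulmxBl XS opprB addrA subrK.
have n2: 0 <= N2 * d by rewrite mulr_ge0 ?ler0n.
have -> : 2 * b * (N2 * d) = b * (N2 * d) + (N2 * d) * b by ring.
by apply: opbB;rewrite ?mulr_ge0 //;apply: opbM.
Qed.

Definition almost eta S:=divt n 1%:M S /\ forall j c a, opb eta (S c a *m f (fam j) - f (fam j) *m S c a).
Definition stdcut c T:=std n 1%:M T /\ forall b a, cmt f K (cutf K rr c) ctype (T b a).
Variable eta: R.
Hypothesis d_eta: 8 * (N2 * d) <= eta.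
Let n2: 0 <= N2 * d. Proof. by rewrite mulr_ge0 ?ler0n. Qed.

Lemma conn_same c T T': (forall m, c m < rr)%N -> killed K rr f c -> stdcut c T -> stdcut c T' -> conn (almost eta) T T'.
move=> hc kc [sT cT] [sT' cT'];have:=conn_commuting rf (cutf_cuts n0 K1 r0 rf hc kc) n0 sT sT' cT cT'.
apply: conn_mono => S [dS cS];split=> // j b a;have [_ _ _ _ oS]:=dS.
apply: opb_le (cmt_near j hc kc ler01 (oS b a) (cS b a));first by rewrite mulr1 mulr_ge0.
by apply: le_trans d_eta;rewrite mulr1 ler_wpM2r // ler_nat.
Qed.

Hypothesis al: alive n K f.
Lemma conn_le c c': (forall m, c m < rr)%N -> (forall m, c' m < rr)%N -> killed K rr f c -> killed K rr f c' ->
 (forall m, c m <= c' m)%N -> exists T T', [/\ stdcut c T, stdcut c' T' & conn (almost eta) T T'].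
move=> hc hc' kc kc' cc;have FC:=refined_cuts n0 K1 r0 rf hc hc' cc kc kc'.
have [T [T' [sT sT' cT cT' h]]]:=connected_cuts rf n0 FC (fun=> erefl)
 (fun i iK => refined_big n0 K1 r0 rf hc hc' cc kc kc' al iK).
have e:=@coarse_refined R _ _ _ _ _ p0 q0 n0 K1 r0 c c';rewrite (e 0%N isT) in cT h;rewrite (e 1%N isT) in cT' h;exists T, T';split=> //.
apply: conn_mono h => S [dS cS];split=> // j b a;have [x [y [cx cy ox oy ->]]]:=cS b a.
have -> : (x + y) *m f (fam j) - f (fam j) *m (x + y) =
 (x *m f (fam j) - f (fam j) *m x) + (y *m f (fam j) - f (fam j) *m y).
 by rewrite mulmxDl mulmxDr opprD addrACA.
(* Each of [x] and [y] has norm at most 2 and contributes [4 * (N2 * d)]; this is the 8 in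
   [d_eta]. *)
have h1:=cmt_near j hc kc (ler0n _ 2) ox cx;have h2:=cmt_near j hc' kc' (ler0n _ 2) oy cy.
apply: opb_le (opbD _ _ h1 h2);rewrite ?addr_ge0 ?mulr_ge0 //.
by apply: le_trans d_eta;rewrite -mulrDl ler_wpM2r //;lra.
Qed.

(** Both systems are moved to their maximum, which dominates each of them as [conn_le] requires; it
    is [killed] because each of its cuts belongs to [c] or to [c']. *)
Lemma conn_cuts c c' T T': (forall m, c m < rr)%N -> (forall m, c' m < rr)%N -> killed K rr f c -> killed K rr f c' ->
 stdcut c T -> stdcut c' T' -> conn (almost eta) T T'.
move=> hc hc' kc kc' sT sT';pose m i:=maxn (c i) (c' i).
have hm i: (m i < rr)%N by rewrite gtn_max hc hc'.
have km: killed K rr f m.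
 by move=> i;rewrite /cutf /m;case: (leqP (c i) (c' i)) => _;[apply: kc'|apply: kc].
have [T1 [M1 [s1 m1 c1]]]:=conn_le hc hm kc km (fun i => leq_maxl (c i) (c' i)).
have [T2 [M2 [s2 m2 c2]]]:=conn_le hc' hm kc' km (fun i => leq_maxr (c i) (c' i)).
apply: conn_trans (conn_same hc kc sT s1) (conn_trans c1 _).
apply: conn_trans (conn_same hm km m1 m2) (conn_trans (conn_sym c2) _).
exact: conn_same hc' kc' s2 sT'.
Qed.
End Approximation.

(** * Choosing cuts and following them along a path of representations *)

Section Killing.
Variables (R: realType) (p q n K: nat) (p0: (0 < p)%N) (q0: (0 < q)%N).
Hypotheses (n0: (0 < n)%N) (K1: (1 < K)%N).
Local Notation C:=(Cplx R).
Local Opaque mulmx map_mx trmx mxtrace opb cel.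
Variable rr: nat.
Hypothesis r0: (0 < rr)%N.

(** The candidate bumps for one cut are orthogonal, and only [D] of them can survive in dimension
    [D]. *)
Lemma killed_count D (f: (R -> 'M[C]_(p * q)) -> 'M[C]_D) i: rep p0 q0 f ->
 (#|[pred r: 'I_rr | cel f (bump K (6 * rr)%:R (cutpos rr i r)%:R) 1%:M != 0%R]| <= D)%N.
move=> rf;set S :=[pred r | _];pose B (r: 'I_rr): R -> R:=bump K (6 * rr)%:R (cutpos rr i r)%:R.
have cB r: rcontR (B r) by exact: rcont_bump.
rewrite -(ler_nat C) -(mxtrace1 C D).
apply: (@orth_count _ _ _ (fun x: 'I_#|S| => cel f (B (enum_val x)) 1%:M)) => [|x|x|x y xy].
- by rewrite /proj mulmx1 hm1.
- by rewrite mulmx1.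
- by have:=enum_valP x;rewrite inE => /eqP.
have h0: 0 < (6 * rr)%:R :> R by rewrite ltr0n;lia.
have ne: val (enum_val x) != val (enum_val y) by apply: contraNneq xy => /val_inj/enum_val_inj ->.
rewrite (cel_h rf) // (celM1 rf) //.
have -> : (fun s => B (enum_val x) s * B (enum_val y) s) = fun s => B (enum_val x) s - B (enum_val x) s.
 apply/funext => s;rewrite subrr /B;set a:=enum_val x in ne *;set b:=enum_val y in ne *.
 have /orP[h|h]: (a < b)%N || (b < a)%N by rewrite -neq_ltn.
 by apply: bump_orth => //;rewrite -natrD ler_nat /cutpos;lia.
 by rewrite mulrC;apply: bump_orth => //;rewrite -natrD ler_nat /cutpos;lia.
by rewrite (celB rf) ?subrr //;apply: ddropS.
Qed.

Lemma killed_of D (f: (R -> 'M[C]_(p * q)) -> 'M[C]_D) c: rep p0 q0 f ->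
 (forall i, cel f (bump K (6 * rr)%:R (cutpos rr i (c i))%:R) 1%:M = 0) -> killed K rr f c.
move=> rf h i;have rc1: rcontR (cutf (R:=R) K rr c i) by exact: rcont_cutf.
rewrite (celM1 rf) //;have c2: rcontR (fun s => cutf (R:=R) K rr c i s * cutf K rr c i s).
 by rewrite /rcontR;under eq_fun do rewrite rcM;apply: rcontM.
apply/esym/subr0_eq;rewrite -(celB rf);[|exact: ddropS|exact: ddropS].
have cd: rcontR (fun s => cutf (R:=R) K rr c i s - cutf K rr c i s * cutf K rr c i s) by exact: rcontRB.
have h0: 0 < (6 * rr)%:R :> R by rewrite ltr0n;lia.
have <- : (fun s => (cutf K rr c i s - cutf K rr c i s * cutf K rr c i s) * bump K (6 * rr)%:R (cutpos rr i (c i))%:R s) =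
 (fun s => cutf K rr c i s - cutf K rr c i s * cutf K rr c i s) :> (R -> R).
 apply/funext => s;rewrite /cutf;case: eqP => _;first by rewrite mulr1 subrr mul0r.
 by case: ifP => _;[exact: ramp_bump|rewrite mulr0 subrr mul0r].
by rewrite -(celM1 rf) //;[rewrite h mulmx0|exact: rcont_bump].
Qed.

(** With more than [2 * D] candidates for each cut, some candidate is killed by both
    representations. *)
Lemma killed_both D (f g: (R -> 'M[C]_(p * q)) -> 'M[C]_D): (2 * D < rr)%N -> rep p0 q0 f -> rep p0 q0 g ->
 exists c: nat -> nat, [/\ forall m, (c m < rr)%N, killed K rr f c & killed K rr g c].
move=> Dr rf rg;suff /choice[c hc]: forall i, exists r: 'I_rr,
 cel f (bump K (6 * rr)%:R (cutpos rr i r)%:R) 1%:M = 0 /\ cel g (bump K (6 * rr)%:R (cutpos rr i r)%:R) 1%:M = 0.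
 by exists c;split=> [m||];[|apply: killed_of => // i;have []:=hc i|apply: killed_of => // i;have []:=hc i].
move=> i;have:=killed_count i rf;have:=killed_count i rg.
set A :=[pred r | _];set B :=[pred r | _] => hA hB.
have [r|h]:=pickP [predC [predU A & B]].
 by rewrite !inE negb_or !negbK => /andP[/eqP a /eqP b];exists r.
have: (#|'I_rr| <= #|[predU A & B]|)%N by apply/subset_leq_card/fintype.subsetP => r _;have /= /negbFE:=h r.
have:=leq_addr #|[predI A & B]| #|[predU A & B]|;rewrite cardUI card_ord => h1 h2.
by have:=leq_trans h2 (leq_trans h1 (leq_add hA hB));rewrite addnn -mul2n leqNgt Dr.
Qed.
End Killing.

Section Transfer.
Variables (R: realType) (p q D K: nat) (p0: (0 < p)%N) (q0: (0 < q)%N).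
Local Notation C:=(Cplx R).
Local Opaque mulmx map_mx trmx mxtrace opb cel.
Variables (F: nat -> R -> R) (E: nat -> emb_t R (p * q)).
Local Notation units f i j k:=(cel f (part F i) (E i (dmx R (edim (E i)) j k))).

Lemma units_sum (f: (R -> 'M[C]_(p * q)) -> 'M[C]_D): rep p0 q0 f -> cuts p0 q0 f K F E ->
 \sum_(i < K) \sum_(j < edim (E i)) units f i j j = 1%:M.
move=> rf FC;rewrite -(pq_sum rf FC);apply: eq_bigr => i _;have [_ ai]:=cuts_adm FC i.
by have [_ ->]:=cell_units rf ai (pq_proj rf FC i).2.
Qed.
Lemma unitsM (f: (R -> 'M[C]_(p * q)) -> 'M[C]_D) i i' j k j' k': rep p0 q0 f -> cuts p0 q0 f K F E ->
 (j < edim (E i))%N -> (k < edim (E i))%N -> (j' < edim (E i'))%N -> (k' < edim (E i'))%N ->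
 units f i j k *m units f i' j' k' = if (i == i') && (k == j') then units f i j k' else 0.
move=> rf FC;have [e|ne]:=eqVneq i i' => h1 h2 h3 h4;last first.
 have [_ <-]:=part_q (m:=i) rf FC (dmx R _ j k);have [<- _]:=part_q (m:=i') rf FC (dmx R _ j' k').
 by rewrite -!mulmxA (mulmxA (pq f F i)) (pqM rf FC) (negPf ne) mul0mx mulmx0.
move: h3 h4;rewrite -{}e => h3 h4;have [_ ai]:=cuts_adm FC i.
by have [[_ _ M] _]:=cell_units rf ai (pq_proj rf FC i).2;exact: M.
Qed.

(** The sum [Z] of products of units of [g] with units of [f] intertwines the two systems of matrix
    units and is close to 1 when they are close; its unitary part [U] then carries one commutant
    into the other. *)
Lemma cuts_transfer (f g: (R -> 'M[C]_(p * q)) -> 'M[C]_D) (k c: R): rep p0 q0 f -> rep p0 q0 g ->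
 cuts p0 q0 f K F E -> cuts p0 q0 g K F E -> 0 <= k -> K%:R * ((p * q)%:R * k) <= c -> c <= 1 / 8 ->
 (forall i, (i < K)%N -> (edim (E i) <= p * q)%N) ->
 (forall i a, (i < K)%N -> (a < edim (E i))%N -> opb k (units g i a 0%N - units f i a 0%N)) ->
 exists U, [/\ U *m U^h = 1%:M, U^h *m U = 1%:M, opb (8 * c) (U - 1%:M) &
 forall z, cmt f K F E z -> cmt g K F E (U *m z *m U^h)].
move=> rf rg Ff Fg k0 kc c1 Ed near;have e0 i: (0 < edim (E i))%N:=edim_gt0 (E i).
pose Z :=\sum_(i < K) \sum_(j < edim (E i)) units g i j 0%N *m units f i 0%N j.
have ZU i a b: (i < K)%N -> (a < edim (E i))%N -> (b < edim (E i))%N -> Z *m units f i a b = units g i a 0%N *m units f i 0%N b.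
 move=> iK ha hb;rewrite /Z mulmx_suml (bigD1 (Ordinal iK)) //= [X in _ + X]big1 ?addr0 => [|i' ne].
 rewrite mulmx_suml (bigD1 (Ordinal ha)) //= [X in _ + X]big1 ?addr0 => [|j ne].
 by rewrite -mulmxA (unitsM rf Ff) // !eqxx.
 by rewrite -mulmxA (unitsM rf Ff) // eqxx /= (negPf (ne: (j: nat) != a)) mulmx0.
 rewrite mulmx_suml big1 // => j _.
 by rewrite -mulmxA (unitsM rf Ff) // (negPf (ne: (i': nat) != i)) mulmx0.
have UZ i a b: (i < K)%N -> (a < edim (E i))%N -> (b < edim (E i))%N -> units g i a b *m Z = units g i a 0%N *m units f i 0%N b.
 move=> iK ha hb;rewrite /Z mulmx_sumr (bigD1 (Ordinal iK)) //= [X in _ + X]big1 ?addr0 => [|i' ne].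
 rewrite mulmx_sumr (bigD1 (Ordinal hb)) //= [X in _ + X]big1 ?addr0 => [|j ne].
 by rewrite mulmxA (unitsM rg Fg) // !eqxx.
 by rewrite mulmxA (unitsM rg Fg) // eqxx /= eq_sym (negPf (ne: (j: nat) != b)) mul0mx.
 rewrite mulmx_sumr big1 // => j _.
 by rewrite mulmxA (unitsM rg Fg) // eq_sym (negPf (ne: (i': nat) != i)) mul0mx.
have uh (h: (R -> 'M[C]_(p * q)) -> 'M[C]_D) i a b: rep p0 q0 h -> cuts p0 q0 h K F E -> (units h i a b)^h = units h i b a.
 by move=> rh Fh;have [_ [_ di]]:=cuts_adm Fh i;rewrite (cel_adj rh) // -emb_adj dmx_adj.
have u1 i a b: (i < K)%N -> opb 1 (units f i a b).
 move=> iK;have [_ ai]:=cuts_adm Ff i.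
 have [ha|ha]:=ltnP a (edim (E i));last first.
 have -> : dmx R (edim (E i)) a b = 0 by apply/matrixP => x y;rewrite !mxE;case: eqP => // xa;have:=ltn_ord x;rewrite xa ltnNge ha.
 by rewrite emb0 (cel0 rf ai);exact: opb00.
 have [hb|hb]:=ltnP b (edim (E i));last first.
 have -> : dmx R (edim (E i)) a b = 0 by apply/matrixP => x y;rewrite !mxE;case: eqP => //= _;case: eqP => // xa;have:=ltn_ord y;rewrite xa ltnNge hb.
 by rewrite emb0 (cel0 rf ai);exact: opb00.
 apply: opb_cstar => //;rewrite expr1n uh // (unitsM rf Ff) // !eqxx;apply: opb_proj;split;first by rewrite uh.
 by rewrite (unitsM rf Ff) // !eqxx.
have kk: 0 <= (p * q)%:R * k by rewrite mulr_ge0.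
have Z1: opb c (Z - 1%:M).
 apply: opb_le kc _;first by rewrite mulr_ge0.
 rewrite -(units_sum rf Ff) /Z -sumrB.
 have Sb m x (G: 'I_m -> 'M[C]_D): 0 <= x -> (forall i, opb x (G i)) -> opb (m%:R * x) (\sum_i G i).
 by move=> x0 h;have:=opb_sum (index_enum 'I_m) x0 h;rewrite [X in size X]unlock -enumT -cardE card_ord.
 apply: (Sb _ _ _ kk) => i;rewrite -sumrB;apply: (@opb_le _ _ ((edim (E i))%:R * k)).
- by rewrite mulr_ge0.
- by rewrite ler_wpM2r // ler_nat Ed.
 apply: (Sb _ _ _ k0) => j.
 have -> : units f i j j = units f i j 0%N *m units f i 0%N j by rewrite (unitsM rf Ff) // !eqxx.
 by rewrite -mulmxBl -[k]mulr1;apply: opbM;[apply: near|apply: u1].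
have c0: 0 <= c by apply: le_trans kc;rewrite mulr_ge0.
have [|W [U1 U2 UW WX]]:=@polar_near _ _ Z c _ Z1;first by rewrite c0.
exists (Z *m W);split=> // z cz i x iK;have [_ ai]:=cuts_adm Fg i;have [_ af]:=cuts_adm Ff i.
have Uu a b: (a < edim (E i))%N -> (b < edim (E i))%N -> Z *m W *m units f i a b = units g i a b *m (Z *m W).
 move=> ha hb;have zz: units f i a b *m (Z^h *m Z) = Z^h *m Z *m units f i a b.
 have:=congr1 (fun N: 'M[C]_D => N^h) (etrans (ZU i b a iK hb ha) (esym (UZ i b a iK hb ha))).
 by rewrite !hmM !uh // => e1;rewrite mulmxA e1 -!mulmxA (etrans (ZU i a b iK ha hb) (esym (UZ i a b iK ha hb))).
 by rewrite -mulmxA -(WX _ zz) !mulmxA (etrans (ZU i a b iK ha hb) (esym (UZ i a b iK ha hb))).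
move: (Z *m W) U1 U2 UW Uu => U U1 U2 UW Uu.
rewrite (cel_dmx rg x ai) mulmx_sumr mulmx_suml;apply: eq_bigr => -[a b] _ /=.
rewrite -scalemxAr -scalemxAl;congr (_ *: _).
have -> : units g i a b = U *m units f i a b *m U^h by rewrite Uu // -mulmxA U1 mulmx1.
have cab:=cz i (dmx R _ a b) iK.
transitivity (U *m (z *m units f i a b) *m U^h);first by rewrite !mulmxA -(mulmxA _ U^h) U2 mulmx1.
by rewrite cab !mulmxA -(mulmxA _ U^h U) U2 mulmx1.
Qed.
End Transfer.

Section Uniform.
Variable R: realType.
Local Notation C:=(Cplx R).

Lemma rcont_unif (f: R -> C) (e: R): rcont f -> 0 < e -> \forall N \near \oo,
 forall s s', 0 <= s <= 1 -> 0 <= s' <= 1 -> N%:R * `|s - s'| <= 2 -> absC (f s - f s') <= e.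
move=> cf e0;have /compact_near_coveringP/(_ _ _ (fun N s => forall s', N%:R * `|s - s'| <= 2 -> absC (f s - f s') <= e)):=@segment_compact R 0 1.
move=> /(_ _ eventually_filter)[x _|N _ hN];last first.
 by exists N => // M /hN h s s' s01 _;apply: h;rewrite /= in_itv.
have [d d0 hd]:=cf x (e / 2) (divr_gt0 e0 (ltr0n _ 2)).
have d4: 0 < d / 2 by rewrite divr_gt0.
near=> s N => s' hs.
have sx: `|s - x| < d / 2 by near: s;apply/nbhs_ballP;exists (d / 2) => // y;rewrite -ball_normE /= distrC.
have N0: 4 / d < N%:R by near: N;exact: nbhs_infty_gtr.
have N1: 0 < N%:R :> R by apply: lt_trans N0;rewrite divr_gt0.
have s's: `|s' - s| < d / 2.
 rewrite distrC -(ltr_pM2l N1);apply: le_lt_trans hs _;rewrite ltr_pdivrMr // in N0;lra.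
have -> : f s - f s' = (f s - f x) - (f s' - f x) by rewrite opprB addrA subrK.
apply: le_trans (absCD _ _) _;rewrite absCN;have:=hd s;have:=hd s'.
have:=ler_normD (s' - s) (s - x);rewrite addrA subrK => h h1 h2.
have a1: `|s' - x| < d by lra.
have a2: `|s - x| < d by lra.
by have:=h1 a1;have:=h2 a2;lra.
Unshelve. all: by end_near.
Qed.
Lemma mcont_unif n (I: finType) (F: I -> R -> 'M[C]_n) (e: R): (forall i, mcont (F i)) -> 0 < e -> \forall N \near \oo,
 forall i s s', 0 <= s <= 1 -> 0 <= s' <= 1 -> N%:R * `|s - s'| <= 2 ->
 (forall j k, absC (F i s j k - F i s' j k) <= e) /\ opb ((n * n)%:R * e) (F i s - F i s').
move=> cF e0;pose P (x: I * ('I_n * 'I_n)) :=[set N | forall s s', 0 <= s <= 1 -> 0 <= s' <= 1 -> N%:R * `|s - s'| <= 2 ->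
 absC (F x.1 s x.2.1 x.2.2 - F x.1 s' x.2.1 x.2.2) <= e].
have:=@filter_forall _ _ P _ eventually_filter (fun x => rcont_unif (cF x.1 x.2.1 x.2.2) e0).
apply: filterS => N h i s s' s0 s1 hs;have hj j k:=h (i, (j, k)) s s' s0 s1 hs;split=> //.
by apply: opb_entries => [|j k];[exact: ltW|rewrite !mxE;apply: hj].
Qed.
Lemma mcont_bound n (I: finType) (F: I -> R -> 'M[C]_n): (forall i, mcont (F i)) ->
 exists2 b: R, 0 <= b & forall i s, 0 <= s <= 1 -> opb b (F i s).
move=> cF;have [N _ /(_ N.+1 (leqnSn N)) h]:=mcont_unif cF ltr01.
have [b b0 hb]: exists2 b: R, 0 <= b & forall i, opb b (F i 0).
 exists (\sum_i ((n * n)%:R * \sum_j \sum_k absC (F i 0 j k))) => [|i].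
 by apply: sumr_ge0 => i _;rewrite mulr_ge0 ?sumr_ge0 // => j _;apply: sumr_ge0 => k _;exact: abs0.
 have g (i': I): 0 <= \sum_j \sum_k absC (F i' 0 j k) by apply: sumr_ge0 => j _;apply: sumr_ge0 => k _;exact: abs0.
 apply: opb_le (opb_entries (g i) _) => [||j k];first by rewrite mulr_ge0.
 by rewrite (bigD1 i) //= lerDl sumr_ge0 // => i' _;rewrite mulr_ge0.
 rewrite (bigD1 j) //= (bigD1 k) //= -addrA lerDl addr_ge0 // sumr_ge0 // => *;rewrite ?abs0 //.
 by apply: sumr_ge0 => *;exact: abs0.
have n0: 0 <= (n * n)%:R * 1 :> R by rewrite mulr1.
exists (N.+1%:R * ((n * n)%:R * 1) + b) => [|i s /andP[s0 s1]];first by rewrite addr_ge0 ?mulr_ge0.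
have u l: (l <= N.+1)%N -> 0 <= l%:R / N.+1%:R * s <= 1.
 move=> lN;have l1: l%:R / N.+1%:R <= 1 :> R by rewrite ler_pdivrMr // mul1r ler_nat.
 by rewrite mulr_ge0 ?divr_ge0 //= -[leRHS]mul1r ler_pM ?divr_ge0.
suff H l: (l <= N.+1)%N -> opb (l%:R * ((n * n)%:R * 1) + b) (F i (l%:R / N.+1%:R * s)).
 by have:=H N.+1 (leqnn _);rewrite mulfV ?mul1r.
elim: l => [|l IH] lN;first by rewrite !mul0r add0r.
have l':=ltnW lN;rewrite -[F i _](subrK (F i (l%:R / N.+1%:R * s))) -natr1 mulrDl mul1r -addrA addrCA.
apply: opbD;[by []|by rewrite addr_ge0 ?mulr_ge0| |exact: IH].
rewrite natr1;have [|_ hh]:=h i _ _ (u _ lN) (u _ l');last by apply: hh.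
have -> : l.+1%:R / N.+1%:R * s - l%:R / N.+1%:R * s = s / N.+1%:R by ring.
by rewrite ger0_norm ?divr_ge0 // mulrC divfK //;lra.
Qed.
End Uniform.

Section Chain.
Variables (R: realType) (D n: nat).
Local Notation tup:=(bool -> nat -> 'M[Cplx R]_D).

Lemma conn_chain (Q: nat -> tup -> Prop) (T: nat -> tup) m :
 (forall l, (l < m)%N -> conn (Q l) (T l) (T l.+1)) -> exists G: R -> tup,
 [/\ forall c a, mcont (fun s => G s c a), forall s, s <= 0 -> G s = T 0%N, forall s, m%:R <= s -> G s = T m &
 forall l s, (l < m)%N -> l%:R <= s -> s <= l%:R + 1 -> Q l (G s)].
elim: m => [|m IH] h;first by exists (fun=> T 0%N);split=> // c a;exact: mcontC.
have [|G [cG G0 G1 GQ]]:=IH;first by move=> l lm;apply: h;lia.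
have [H [cH H0 H1 HQ]]:=h m (ltnSn m).
pose F s c a:=G s c a + H (s - m%:R) c a - T m c a.
have F1 s: s <= m%:R -> F s = G s.
 move=> sm;have e: H (s - m%:R) = T m by apply: H0;rewrite subr_le0.
 by apply/funext => c;apply/funext => a;rewrite /F e addrK.
have F2 s: m%:R <= s -> F s = H (s - m%:R).
 by move=> /G1 e;apply/funext => c;apply/funext => a;rewrite /F e addrAC subrr add0r.
have m0: 0 <= m%:R :> R by rewrite ler0n.
exists F;split=> [c a|s s0|s s1|l s lm s0 s1].
- apply: mcontD;last exact: mcontC.
 apply: mcontD (cG c a) _;apply: (@mcont_comp _ _ _ (fun s => H s c a) (fun s => s - m%:R) 1 _ (cH c a)) => s s'.
 by rewrite mul1r opprB addrA subrK.
- by rewrite F1 ?G0 //;lra.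
- by move: s1;rewrite -natr1 => s1;rewrite F2 ?H1 //;lra.
- move: lm;rewrite ltnS leq_eqVlt => /orP[/eqP e|lm];first by rewrite e in s0 *;rewrite F2.
 have:=lm;rewrite -(ler_nat R) -natr1 => le;rewrite F1;last lra.
 exact: GQ.
Qed.

Lemma std_conj (U: 'M[Cplx R]_D) (T: tup): U *m U^h = 1%:M -> U^h *m U = 1%:M -> std n 1%:M T ->
 std n 1%:M (fun c a => U *m T c a *m U^h).
move=> U1 U2 [[[eh ee] ew] Tt vv vw sq].
have M x y: U *m x *m U^h *m (U *m y *m U^h) = U *m (x *m y) *m U^h.
 by rewrite !mulmxA -(mulmxA _ U^h U) U2 mulmx1.
have A x: (U *m x *m U^h)^h = U *m x^h *m U^h by rewrite !hmM hmK mulmxA.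
split=> [|a|a b an bn|a an|];rewrite ?A ?M.
- by rewrite /proj A M eh ee ew.
- by have [-> z]:=Tt a;split=> [|/z ->];[case: ifP;rewrite ?A ?hm0 ?mulmx0 ?mul0mx|rewrite mulmx0 mul0mx].
- by rewrite vv //;case: eqP;rewrite ?mulmx0 ?mul0mx.
- by rewrite vw // mulmx0 mul0mx.
- under eq_bigr do rewrite A M;by rewrite -mulmx_suml -mulmx_sumr sq mulmx1.
Qed.
End Chain.

Section Path.
Variables (R: realType) (p q n K rr D: nat) (p0: (0 < p)%N) (q0: (0 < q)%N).
Hypotheses (n0: (0 < n)%N) (K1: (1 < K)%N) (Drr: (2 * D < rr)%N).
Local Notation C:=(Cplx R).
Local Notation map:=((R -> 'M[C]_(p * q)) -> 'M[C]_D).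
Variables (I: finType) (fam: I -> R -> 'M[C]_(p * q)) (d eta: R).
Hypotheses (dfam: forall i, ddrop p0 q0 (fam i)) (d0: 0 <= d).
Hypothesis osc: forall i s s' j k, 0 <= s <= 1 -> 0 <= s' <= 1 -> K%:R * `|s - s'| <= 2 ->
 absC (fam i s j k - fam i s' j k) <= d.
Local Opaque mulmx map_mx trmx mxtrace opb cel.
Local Notation ctype:=(@ctype R p q K p0 q0).
Local Notation N2:=(((p * q) * (p * q))%:R: R).
Hypotheses (d_eta: 8 * (N2 * d) <= eta) (eta0: 0 < eta).
Let r0: (0 < rr)%N. Proof. by apply: leq_ltn_trans Drr. Qed.
Let eta0':=ltW eta0.
Implicit Types (f g: map) (c: nat -> nat).

Definition cut_at f c T :=[/\ forall m, (c m < rr)%N, killed K rr f c & stdcut n K rr p0 q0 f c T].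

Lemma cut_exists f c: rep p0 q0 f -> alive n K f -> (forall m, (c m < rr)%N) -> killed K rr f c -> exists T, cut_at f c T.
move=> rf al hc kc;have [T [_ [sT _ _]]]:=conn_le n0 K1 r0 dfam d0 osc rf d_eta al hc hc kc kc (fun=> leqnn _).
by exists T;split.
Qed.

Lemma opb_comm b x z w: 0 <= b -> 0 <= x -> opb b z -> opb x w -> opb (2 * (b * x)) (z *m w - w *m z: 'M[C]_D).
move=> b0 x0 hz hw;have -> : 2 * (b * x) = b * x + x * b by ring.
by apply: opbB;rewrite ?mulr_ge0 //;apply: opbM.
Qed.
Lemma sub_split (V: zmodType) (x y z w: V): x - y = (z - w) + ((x - z) - (y - w)).
by rewrite opprB addrACA [z + _]addrC subrK addKr. Qed.
Lemma almost_near f g x k T: 0 <= x -> 0 <= k -> (forall j, opb k (f (fam j) - g (fam j))) ->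
 almost n fam g x T -> almost n fam f (x + 2 * k) T.
move=> x0 k0 fg [dT cT];split=> // j b a;have [_ _ _ _ oT]:=dT.
have -> : T b a *m f (fam j) - f (fam j) *m T b a = (T b a *m g (fam j) - g (fam j) *m T b a) +
 (T b a *m (f (fam j) - g (fam j)) - (f (fam j) - g (fam j)) *m T b a).
 by rewrite mulmxBr mulmxBl;exact: sub_split.
apply: opbD;rewrite ?mulr_ge0 //;rewrite -[k]mul1r;exact: opb_comm.
Qed.

(** The unitary of [cuts_transfer] is joined to 1 by unitaries within [8 * e] of 1. Conjugation by
    them moves a tuple by at most [16 * e], and its commutators with elements bounded by [b] by
    [32 * e * b]. *)
Lemma cut_transfer f g c T (k e b: R): rep p0 q0 f -> rep p0 q0 g -> cut_at f c T -> killed K rr g c ->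
 0 <= k -> K%:R * ((p * q)%:R * k) <= e -> e <= 1 / 8 -> 0 <= b -> (forall j, opb b (f (fam j))) ->
 (forall i a, (i < K)%N -> (a < edim (ctype i))%N ->
 opb k (cel g (part (cutf K rr c) i) (ctype i (dmx R _ a 0%N)) - cel f (part (cutf K rr c) i) (ctype i (dmx R _ a 0%N)))) ->
 exists T', cut_at g c T' /\ conn (almost n fam f (eta + 32 * e * b)) T T'.
move=> rf rg [hc kf [sT cT]] kg k0 ke e1 b0 fb near.
have Ff:=cutf_cuts n0 K1 r0 rf hc kf;have Fg:=cutf_cuts n0 K1 r0 rg hc kg.
have [|U [U1 U2 Ue cU]]:=cuts_transfer rf rg Ff Fg k0 ke e1 _ near.
 by move=> i _;rewrite /ctype;case: eqP => _ /=;[rewrite leq_pmulr|case: eqP => _ //=;rewrite leq_pmull].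
exists (fun b a => U *m T b a *m U^h);split.
 by split=> //;split;[exact: std_conj|move=> b' a;apply: cU].
pose u:=upath U;have e0: 0 <= e by apply: le_trans ke;rewrite !mulr_ge0.
apply: (@conn_path _ _ _ (fun s b' a => u s *m T b' a *m (u s)^h)) => [b' a|||s s01].
- have cu: mcont u by exact: upath_cont.
 by apply: mcontM (mcont_adj cu);apply: mcontM cu (mcontC _).
- by apply/funext => b';apply/funext => a;rewrite /u upath0 // hm1 mulmx1 mul1mx.
- by apply/funext => b';apply/funext => a;rewrite /u upath1.
have [u1 u2]:=upath_u U s.
have us: opb (8 * e) (u s - 1%:M) by apply: (upath_near U1 U2);rewrite ?mulr_ge0.
have p1: proj (1%:M: 'M[C]_D) by split;rewrite ?hm1 ?mulmx1.
have dT:=std_div n0 p1 sT;split=> [|j b' a].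
 by apply: (div_conj u2 u1) dT => [|b' a];rewrite ?mulmx1 ?mul1mx.
have [_ _ _ _ oT]:=dT;set S:=_ *m (u s)^h.
have ST: opb (8 * e + 8 * e) (S - T b' a).
 have -> : S - T b' a = (u s - 1%:M) *m T b' a *m (u s)^h + T b' a *m (u s - 1%:M)^h.
 by rewrite hmB hm1 mulmxBl mul1mx mulmxBl mulmxBr mulmx1 addrA subrK.
 have o1: opb 1 (u s)^h by apply: opb_adj => //;apply: opb_cstar => //;rewrite expr1n u1;exact: opb1.
 have e8: 0 <= 8 * e by rewrite mulr_ge0.
 apply: (opbD e8 e8);first by have:=opbM (opbM us (oT b' a)) o1;rewrite !mulr1.
 by have:=opbM (oT b' a) (opb_adj e8 us);rewrite mul1r.
have -> : S *m f (fam j) - f (fam j) *m S = (T b' a *m f (fam j) - f (fam j) *m T b' a) +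
 ((S - T b' a) *m f (fam j) - f (fam j) *m (S - T b' a)).
 by rewrite mulmxBr mulmxBl;exact: sub_split.
have -> : 32 * e * b = 2 * ((8 * e + 8 * e) * b) by ring.
apply: opbD => //;rewrite ?mulr_ge0 ?addr_ge0 ?mulr_ge0 //;last by apply: opb_comm;rewrite ?addr_ge0 ?mulr_ge0.
have:=cmt_near n0 K1 r0 dfam d0 osc rf j hc kf ler01 (oT b' a) (cT b' a).
apply: opb_le;first by rewrite !mulr_ge0.
by apply: le_trans d_eta;rewrite mulr1 ler_wpM2r ?mulr_ge0 // ler_nat.
Qed.

(** A third system of cuts serves both representations: the cuts are changed under [f], the tuple is
    carried to [g], and the cuts are changed again under [g]. *)
Lemma cut_step f g c c' T T' (k k' e b: R): rep p0 q0 f -> rep p0 q0 g -> alive n K f -> alive n K g ->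
 cut_at f c T -> cut_at g c' T' ->
 0 <= k -> K%:R * ((p * q)%:R * k) <= e -> e <= 1 / 8 -> 0 <= b -> (forall j, opb b (f (fam j))) ->
 0 <= k' -> (forall j, opb k' (f (fam j) - g (fam j))) ->
 (forall c i a, (forall m, c m < rr)%N -> killed K rr f c -> (i < K)%N -> (a < edim (ctype i))%N ->
 opb k (cel g (part (cutf K rr c) i) (ctype i (dmx R _ a 0%N)) - cel f (part (cutf K rr c) i) (ctype i (dmx R _ a 0%N)))) ->
 conn (almost n fam f (eta + 32 * e * b + 2 * k')) T T'.
move=> rf rg af ag [hc kf sT] [hc' kg sT'] k0 ke e1 b0 fb k0' fg near.
have [m [hm mf mg]]:=killed_both n0 K1 r0 Drr rf rg;have [S [_ _ sS]]:=cut_exists rf af hm mf.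
have e0: 0 <= e by apply: le_trans ke;rewrite !mulr_ge0.
have eb: 0 <= 32 * e * b by rewrite mulr_ge0 // mulr_ge0.
have [S' [[_ _ sS'] SS']]:=@cut_transfer _ _ _ _ k e b rf rg (And3 hm mf sS) mg k0 ke e1 b0 fb (fun i a => @near m i a hm mf).
have le x y Q: x <= y -> almost n fam f x Q -> 0 <= x -> almost n fam f y Q.
 by move=> xy [dQ cQ] x0;split=> // j c1 a;apply: opb_le (cQ j c1 a).
apply: (@conn_trans _ _ _ _ S);last apply: (@conn_trans _ _ _ _ S').
- apply: conn_mono (conn_cuts n0 K1 r0 dfam d0 osc rf d_eta af hc hm kf mf sT sS) => Q hQ.
 by apply: le hQ _ => //;rewrite -addrA lerDl addr_ge0 ?mulr_ge0.
- by apply: conn_mono SS' => Q hQ;apply: le hQ _;rewrite ?addr_ge0 // lerDl mulr_ge0.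
apply: conn_mono (conn_cuts n0 K1 r0 dfam d0 osc rg d_eta ag hm hc' mg kg sS' sT') => Q hQ.
by apply: le (almost_near eta0' k0' fg hQ) _;rewrite ?addr_ge0 ?mulr_ge0 // lerD2r lerDl.
Qed.

Variable pi: R -> map.
Hypotheses (rpi: forall t, 0 <= t <= 1 -> rep p0 q0 (pi t)) (api: forall t, 0 <= t <= 1 -> alive n K (pi t)).
Hypothesis cpi: forall h: R -> 'M[C]_(p * q), ddrop p0 q0 h -> mcont (pi^~ h).

Lemma unit_itv m (x: R): (0 < m)%N -> 0 <= x <= m%:R -> exists2 l, (l < m)%N & l%:R <= x <= l%:R + 1.
elim: m => // m IH _ /andP[x0];have [h _|h x1]:=leP x m%:R;last first.
 by exists m => //;rewrite ltW //= natr1.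
case: m h IH => [h _|m h IH];first by exists 0%N;rewrite // x0 add0r (le_trans h).
by have [|l lm hl]:=IH isT;[rewrite x0|exists l => //;apply: ltnW].
Qed.

Lemma cut_path c c' T T': cut_at (pi 0) c T -> cut_at (pi 1) c' T' -> exists G: R -> bool -> nat -> 'M[C]_D,
 [/\ forall b a, mcont (fun s => G s b a), G 0 = T, G 1 = T' &
 forall s, 0 <= s <= 1 -> almost n fam (pi s) (2 * eta) (G s)].
move=> hT hT';have [b b0 hb]:=mcont_bound (fun j => cpi (dfam j)).
(* Beyond the first [eta], [32 * e * b] takes [eta / 2], and the comparisons of nearby
   representations take [2 * k'] twice; the total is [2 * eta]. *)
pose k':=eta / 8;pose e:=Num.min (1 / 8) (eta / (64 * (b + 1)));have k0': 0 < k' by rewrite divr_gt0.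
have b1: 0 < b + 1 by rewrite ltr_wpDl.
have e0: 0 < e by rewrite lt_min !divr_gt0 ?mulr_gt0.
have eb: 32 * e * b <= eta / 2.
 have: e <= eta / (64 * (b + 1)) by rewrite ge_min lexx orbT.
 by rewrite ler_pdivlMr ?mulr_gt0 // => h;nra.
pose kd: R:=K%:R * (p * q)%:R;have kd0: 0 < kd by rewrite mulr_gt0 // ltr0n ?muln_gt0 ?p0 ?q0 // ltnW.
pose k:=e / kd;have k0: 0 < k by rewrite divr_gt0.
have D1: 0 < (D * D)%:R + 1 :> R by rewrite ltr_wpDl.
(* Part [i] involves only the cuts [i] and [i.+1], so all systems of cuts together give finitely
   many test functions, and one step size serves them all. *)
pose gx (x: 'I_rr * 'I_rr * 'I_K * 'I_(p * q)):=let: (r1, r2, i, a):=x in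
 elt (part (cutf K rr (fun m => if m == i then r1 else r2)) i) (ctype i (dmx R _ a 0%N)).
pose Gx x t:=if `[< ddrop p0 q0 (gx x) >] then pi t (gx x) else 0.
have cGx x: mcont (Gx x).
 by rewrite /Gx;case: asboolP => h;[exact: cpi|exact: mcontC].
have D0 (x: R): 0 < x -> 0 < x / ((D * D)%:R + 1) by move=> x0;rewrite divr_gt0.
have [N _ hN]:=filterI (mcont_unif (fun j => cpi (dfam j)) (D0 _ k0')) (mcont_unif cGx (D0 _ k0)).
have {hN}[h1 h2]:=hN N.+1 (leqnSn N);set m:=N.+1 in h1 h2.
have Dle (x: R) (A: 'M[C]_D): 0 < x -> opb ((D * D)%:R * (x / ((D * D)%:R + 1))) A -> opb x A.
 move=> x0;apply: opb_le;first by rewrite mulr_ge0 // ltW // D0.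
 by rewrite mulrCA ger_pMr // ler_pdivrMr // mul1r lerDl.
have m0: 0 < m%:R :> R by [].
have itv l: (l <= m)%N -> 0 <= (l%:R / m%:R: R) <= 1.
 by move=> lm;rewrite divr_ge0 //= ler_pdivrMr // mul1r ler_nat.
have /choice[S hS] l: exists S, [/\ (l <= m)%N -> exists c, cut_at (pi (l%:R / m%:R)) c S, l = 0%N -> S = T & l = m -> S = T'].
 have [l0|l0]:=eqVneq l 0%N;first by exists T;split=> [_||e1];[exists c;rewrite l0 mul0r|by []|move: e1;rewrite l0].
 have [lm|lm]:=eqVneq l m;first by exists T';split=> // [_|/eqP];[exists c';rewrite lm divff ?gt_eqF|rewrite (negPf l0)].
 have [h|h]:=leqP l m;last by exists T;split=> [h'||e1];[move: h h';clear;lia|by []|rewrite e1 eqxx in lm].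
 have [c1 [hc k1 _]]:=killed_both n0 K1 r0 Drr (rpi (itv _ h)) (rpi (itv _ h)).
 have [S hS]:=cut_exists (rpi (itv _ h)) (api (itv _ h)) hc k1.
 by exists S;split=> // [_|/eqP|/eqP];[exists c1|rewrite (negPf l0)|rewrite (negPf lm)].
have close l (s t: R): (l < m)%N -> l%:R <= s * m%:R <= l%:R + 1 -> l%:R <= t * m%:R <= l%:R + 1 -> m%:R * `|s - t| <= 2.
 move=> lm /andP[s1 s2] /andP[t1 t2];rewrite -{1}[m%:R]ger0_norm // -normrM mulrC mulrBl ler_norml;apply/andP;split;lra.
have em l: l%:R / m%:R * m%:R = l%:R :> R by rewrite divfK // gt_eqF.
have [|G [cG G0 G1 GQ]]:=@conn_chain _ _ (fun l => almost n fam (pi (l%:R / m%:R)) (eta + 32 * e * b + 2 * k')) S m.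
 move=> l lm;have [/(_ (ltnW lm))[cl hl] _ _]:=hS l;have [/(_ lm)[cl' hl'] _ _]:=hS l.+1.
 have t1:=itv _ (ltnW lm);have t2:=itv _ lm.
 have cl12: m%:R * `|l%:R / m%:R - l.+1%:R / m%:R| <= (2: R).
 by apply: (close l) => //;rewrite em -?natr1 ?lerDl lexx ?ler01.
 apply: (cut_step (rpi t1) (rpi t2) (api t1) (api t2) hl hl' (ltW k0) _ _ b0 _ (ltW k0')) => [||j|j|c1 i a hc kc iK ae].
- by rewrite mulrA /k -/kd mulrCA divff ?mulr1 ?gt_eqF.
- by rewrite ge_min lexx.
- exact: hb.
- by have [_]:=h1 j _ _ t1 t2 cl12;apply: Dle.
 have pq: (edim (ctype i) <= p * q)%N.
 by rewrite /ctype;case: eqP => _ /=;[rewrite leq_pmulr|case: eqP => _ //=;rewrite leq_pmull].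
 pose x:=(Ordinal (hc i), Ordinal (hc i.+1), Ordinal iK, Ordinal (leq_trans ae pq)): 'I_rr * 'I_rr * 'I_K * 'I_(p * q).
 have gE: gx x = elt (part (cutf K rr c1) i) (ctype i (dmx R _ a 0%N)).
 by rewrite /gx /x /=;congr elt;apply/funext => s;rewrite /part /cutf eqxx (gtn_eqF (ltnSn i)).
 have [_ [_ ad]]:=cuts_adm (cutf_cuts n0 K1 r0 (rpi t1) hc kc) i.
 have GE t: Gx x t = cel (pi t) (part (cutf K rr c1) i) (ctype i (dmx R _ a 0%N)).
 by rewrite /Gx gE;case: asboolP => // /(_ (ad _)).
 have [_]:=h2 x _ _ t1 t2 cl12;rewrite !GE -opprB => /opbN;rewrite opprK;exact: Dle.
exists (fun s => G (m%:R * s));split=> [b' a|||s s01].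
- apply: (@mcont_comp _ _ _ (fun s => G s b' a) (fun s => m%:R * s) m%:R _ (cG b' a)) => s s'.
 by rewrite -mulrBr normrM ger0_norm.
- by have [_ e1 _]:=hS 0%N;rewrite mulr0 G0 // e1.
- by have [_ _ e1]:=hS m;rewrite mulr1 G1 // e1.
have [|l lm hl]:=@unit_itv m (m%:R * s) (ltn0Sn N).
 by case/andP: s01 => s0 s1;rewrite mulr_ge0 //= ger_pMr.
have [dS cS]:=GQ l _ lm (andP hl).1 (andP hl).2.
have t1:=itv _ (ltnW lm).
have fg j: opb k' (pi s (fam j) - pi (l%:R / m%:R) (fam j)).
 have [|_]:=h1 j _ _ s01 t1;last exact: Dle.
 by apply: (close l) => //;[rewrite mulrC|rewrite em lexx lerDl ler01].
have x0: 0 <= eta + 32 * e * b + 2 * k' by rewrite !addr_ge0 ?mulr_ge0 // ltW.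
have [d1 c1]:=almost_near x0 (ltW k0') fg (conj dS cS).
split=> // j b' a;apply: opb_le (c1 j b' a);first by rewrite (addr_ge0 x0) ?(mulr_ge0 (ler0n _ 2) (ltW k0')).
by rewrite /k';move: eb;lra.
Qed.
End Path.

(** * Dimension drop algebras inside a C*-algebra *)

Section Injectivity.
Variables (R: realType) (N: nat) (e: emb_t R N).
Hypothesis N0: (0 < N)%N.

(** Full matrix algebras are simple: matrix units around a nonzero entry of [z] rebuild 1, so
    [e z = 0] would give [1 = 0]. *)
Lemma emb_inj x y: e x = e y -> x = y.
suff H z: e z = 0 -> z = 0.
 move=> xy;apply/subr0_eq/H;rewrite addrC -scaleN1r embL scaleN1r xy addNr //.
move=> ez;apply/matrixP => i j;rewrite mxE;apply/eqP;apply: contraT => zij.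
have: e 1%:M = 0.
 rewrite -dmx1;have -> : \sum_(k < edim e) dmx R _ k k = \sum_(k < edim e) ((z i j)^-1 *: dmx R _ k i *m z *m dmx R _ j k).
 apply: eq_bigr => k _;apply/matrixP => a b;rewrite -!scalemxAl mxE [RHS]mxE [X in _ * X]mxE.
 rewrite (bigD1 j) //= big1 ?addr0 => [|l lj];last by rewrite [dmx _ _ j k l b]mxE (negPf (lj: (l: nat) != j)) mulr0.
 rewrite mxE (bigD1 i) //= big1 ?addr0 => [|l li];last by rewrite [dmx _ _ k i a l]mxE andbC (negPf (li: (l: nat) != i)) mul0r.
 by rewrite !mxE !eqxx andbT [_ * z i j]mulrC -mulrA mulKf // -natrM mulnb.
 elim: (index_enum _) => [|k r IH];first by rewrite big_nil emb0.
 by rewrite big_cons -[X in X + _]scale1r embL IH addr0 !embM ez mulmx0 mul0mx scaler0.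
rewrite emb1 => /matrixP/(_ (Ordinal N0) (Ordinal N0));rewrite !mxE eqxx => /eqP;by rewrite oner_eq0.
Qed.
Lemma emb_unit y: e y \in unitmx -> exists z, invmx (e y) = e z.
move=> uy;exists (invmx y);have ky: y \in unitmx.
 rewrite -row_free_unit;apply: inj_row_free => v vy.
 have: (const_mx 1: 'cV_(edim e)) *m v = 0.
 apply: emb_inj;rewrite emb0 -[LHS]mulmx1 -(mulmxV uy) mulmxA -embM -mulmxA vy mulmx0 emb0 mul0mx //.
 by move=> /matrixP h;apply/matrixP => i j;have:=h (Ordinal (edim_gt0 e)) j;rewrite !mxE big_ord1 mxE mul1r (ord1 i).
by rewrite -[RHS]mul1mx -(mulVmx uy) -mulmxA -embM mulmxV // emb1 mulmx1.
Qed.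
End Injectivity.

Section Inverse.
Variables (R: realType) (p q: nat) (p0: (0 < p)%N) (q0: (0 < q)%N).
Local Notation C:=(Cplx R).

Lemma ddrop_inv (A: R -> 'M[C]_(p * q)) (b: R): ddrop p0 q0 A -> 0 < b -> (forall s v, b ^+ 2 * sqn v <= sqn (v *m A s)) ->
 exists2 k, ddrop p0 q0 k & forall s, A s *m k s = 1%:M /\ k s *m A s = 1%:M.
move=> [cA [x Ax] [y Ay]] b0 low;have uA s: A s \in unitmx.
 rewrite -row_free_unit;apply: inj_row_free => v vA;have:=low s v;rewrite vA.
 by rewrite sqn0 => h;apply: sqn_eq0;apply/eqP;rewrite eq_le sqn_ge0 andbT -(ler_pM2l (exprn_gt0 2 b0)) mulr0.
exists (fun s => invmx (A s)) => [|s];last by rewrite mulmxV ?mulVmx.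
have N0: (0 < p * q)%N by rewrite muln_gt0 p0.
split;[|by rewrite Ax;apply: emb_unit;rewrite // -Ax|by rewrite Ay;apply: emb_unit;rewrite // -Ay].
have ib: 0 <= b^-1 by rewrite invr_ge0 ltW.
have ok s: opb b^-1 (invmx (A s)).
 move=> v;have:=low s (v *m invmx (A s));rewrite mulmxKV // exprVn => h.
 by rewrite mulrC ler_pdivlMr ?exprn_gt0 // mulrC.
move=> i j s r r0;have r1: 0 < r / 2 * b ^+ 2 by rewrite mulr_gt0 ?exprn_gt0 // divr_gt0.
have [d d0 hd]:=mcont_opb s cA r1;exists d => // s' /hd h.
have -> : invmx (A s') i j - invmx (A s) i j = (invmx (A s') *m (- (A s' - A s)) *m invmx (A s)) i j.
 by rewrite opprB mulmxBr mulVmx // mulmxBl mul1mx -mulmxA mulmxV // mulmx1 !mxE.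
have:=opbM (opbM (ok s') (opbN h)) (ok s);have -> : b^-1 * (r / 2 * b ^+ 2) * b^-1 = r / 2 by field;rewrite gt_eqF.
move=> h2;apply: le_lt_trans (opb_entry i j _ h2) _;lra.
Qed.
End Inverse.

Section Chart.
Variables (R: realType) (Z: cstarAlgType R) (u: Z) (p q: nat) (p0: (0 < p)%N) (q0: (0 < q)%N).
Local Notation C:=(Cplx R).
Local Notation ddrop:=(ddrop p0 q0).
Local Notation dimdrop:=(@dimdrop R p q).
Hypothesis uu: unit_of u.
Variable phi: (R -> 'M[C]_(p * q)) -> Z.
Hypothesis hphi: dimdrop_embedding u phi.

Lemma rcontP (f: R -> C): (forall x, 0 <= x <= 1 -> forall e: R, 0 < e -> exists2 d: R, 0 < d &
 forall y, 0 <= y <= 1 -> `|y - x| < d -> absC (f y - f x) < e) <-> {within `[0%R, 1%R], continuous f}.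
split=> [h|/subspace_continuousP h x x01 e e0].
 apply/subspace_continuousP => x;rewrite /= in_itv /= => x01;apply/(@cvgrPdist_lt C C) => e /cplx_pos[r r0 ->].
 have [d d0 hd]:=h x x01 r r0;rewrite near_withinE;apply/nbhs_ballP;exists d => //= y.
 rewrite -ball_normE /= in_itv /= distrC => yd y01;rewrite distrC rcE rc_lt;exact: hd.
have /h/(@cvgrPdist_lt C C)/(_ (rc e)): `[0%R, 1%R]%classic x by rewrite /= in_itv.
by rewrite -[0](rc0 R) rc_lt => /(_ e0);rewrite near_withinE => /nbhs_ballP[d /= d0 hd];exists d => // y y01 yx;
 have:=hd y;rewrite -ball_normE /= in_itv distrC => /(_ yx y01);rewrite distrC rcE rc_lt.
Qed.
Lemma ddrop_of f: ddrop f -> dimdrop f.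
move=> [cf [x fx] [y fy]];split=> [i j||];[|by exists x;rewrite fx|by exists y;rewrite fy].
by apply/rcontP => t _ e /(cf i j t)[d d0 hd];exists d => // z _ /hd.
Qed.
Lemma clamp_ddrop f: dimdrop f -> ddrop (fun s => f (clamp s)).
move=> [cf [x fx] [y fy]];split=> [i j s e e0||].
- have /rcontP/(_ (clamp s) (clampP s) e e0)[d d0 hd]:=cf i j;exists d => // s' hs.
 by apply: hd (clampP s') _;apply: le_lt_trans hs;exact: clamp_lip.
- by exists x;rewrite clamp0 //;apply/matrixP => i j;rewrite fx.
- by exists y;rewrite clamp1 //;apply/matrixP => i j;rewrite fy.
Qed.

Lemma chart_ext f g: ddrop f -> ddrop g -> phi f = phi g <-> forall s, 0 <= s <= 1 -> f s = g s.
move=> df dg;have [h _ _ _ _]:=hphi;rewrite (h f g (ddrop_of df) (ddrop_of dg)).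
by split=> H s s01;apply: H;move: s01;rewrite in_itv.
Qed.
Lemma chartL k f g: ddrop f -> ddrop g -> phi (fun s => k *: f s + g s) = k *: phi f + phi g.
by move=> /ddrop_of df /ddrop_of dg;have [_ h _ _ _]:=hphi;apply: h. Qed.
Lemma chartM f g: ddrop f -> ddrop g -> phi (fun s => f s *m g s) = phi f ** phi g.
by move=> /ddrop_of df /ddrop_of dg;have [_ _ h _ _]:=hphi;apply: h. Qed.
Lemma chart_adj f: ddrop f -> phi (fun s => (f s)^h) = star (phi f).
by move=> /ddrop_of df;have [_ _ _ h _]:=hphi;apply: h. Qed.
Lemma chart1: phi (fun=> 1%:M) = u. Proof. by have [_ _ _ _ h]:=hphi. Qed.
Lemma chart0: phi (fun=> 0) = 0.
rewrite -[RHS](addNr u) -scaleN1r -chart1 -chartL;[|exact: ddrop1|exact: ddrop1].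
by congr phi;apply/funext => s;rewrite scaleN1r addNr.
Qed.
Lemma ddrop0: ddrop (fun=> 0: 'M[C]_(p * q)).
by split;[exact: mcontC|exists 0;rewrite emb0|exists 0;rewrite emb0]. Qed.

Lemma chart_scal c: phi (elt (fun=> c) 1%:M) = rc c *: u.
rewrite -[RHS]addr0 -chart0 -chart1 -chartL;[|exact: ddrop1|exact: ddrop0].
by congr phi;apply/funext => s;rewrite addr0.
Qed.

(* If the norm r of phi (g^* g) exceeds c^2 then r^2 - (g^* g)^2 is pointwise invertible. *)
Lemma chart_le g c: ddrop g -> 0 <= c -> (forall s, 0 <= s <= 1 -> opb c (g s)) -> nA (phi g) <= c.
move=> dg c0 gc;wlog {gc} gc: g dg / forall s, opb c (g s).
 move=> H;have dg':=clamp_ddrop (ddrop_of dg);have -> : phi g = phi (fun s => g (clamp s)).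
 by apply/(chart_ext dg dg') => s s01;rewrite clamp_id.
 by apply: H => // s;apply/gc/clampP.
rewrite leNgt;apply/negP => lt;pose h s:=(g s)^h *m g s;have dh: ddrop h by apply/ddropM => //;exact: ddrop_adj.
have e: phi h = star (phi g) ** phi g by rewrite chartM ?chart_adj //;exact: ddrop_adj.
pose b:=ui (phi h);have bn: nrm b = nA (phi g) ^+ 2 by rewrite ui_nrm e nA_cstar.
have b0: 0 < nrm b by rewrite bn exprn_gt0 // (le_lt_trans c0).
have bs: adj b = b by rewrite /b -ui_adj e star_cmul starK.
have gt: c ^+ 4 < nrm b ^+ 2 by rewrite bn -exprM ltrXn2r // nnegrE // ltW // (le_lt_trans c0).
case: (nrm_not_invertible bs b0);set r:=nrm b ^+ 2 in gt *.
pose A s:=rc (- 1) *: (h s *m h s) + elt (fun=> r) 1%:M s.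
have dr: ddrop (elt (fun=> r) 1%:M) by apply: ddropS;exact: rcontC.
have dA: ddrop A by apply: ddropL => //;exact: ddropM.
have AE s: A s = (rc r)%:M - h s *m h s by rewrite /A rcN rc1 scaleN1r addrC /elt scalemx1.
pose a:=(c ^+ 4 + r) / 2;have ca: c ^+ 4 < a by rewrite /a;lra.
have ar: a < r by rewrite /a;lra.
have a0: 0 < a by apply: le_lt_trans ca;rewrite exprn_ge0.
have low s v: (r - a) ^+ 2 * sqn v <= sqn (v *m A s).
 have hh: opb a (h s *m h s).
 apply: (@opb_le _ _ (c ^+ 4));[by rewrite exprn_ge0|exact: ltW|].
 have -> : c ^+ 4 = c * c * (c * c) by ring.
 by have o:=opbM (opb_adj c0 (gc s)) (gc s);apply: opbM.
 have ra: 0 < r - a by rewrite subr_gt0.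
 have:=sqnD (v *m A s) (v *m (h s *m h s)) (divr_gt0 a0 ra).
 rewrite -mulmxDr AE subrK mul_mx_scalar sqnZ absC_rc real_normK ?num_real // => h1.
 have:=hh v => h2;have r1: 0 < r by apply: lt_trans ar.
 have e1: 1 + a / (r - a) = r / (r - a) by field;rewrite gt_eqF.
 have e2: 1 + (a / (r - a))^-1 = r / a by field;rewrite !gt_eqF.
 have h3: r / a * sqn (v *m (h s *m h s)) <= r * a * sqn v.
 have -> : r * a * sqn v = r / a * (a ^+ 2 * sqn v) by field;rewrite gt_eqF.
 by rewrite ler_wpM2l // divr_ge0 // ltW.
 rewrite e1 e2 in h1;have:=le_trans h1 (lerD (lexx _) h3).
 have -> : r ^+ 2 * sqn v = r / (r - a) * ((r - a) ^+ 2 * sqn v) + r * a * sqn v by field;rewrite gt_eqF.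
 by rewrite lerD2r ler_pM2l // divr_gt0.
have ra: 0 < r - a by rewrite subr_gt0.
have [k dk hk]:=ddrop_inv dA ra low.
have r0: rc r != 0 by rewrite -[0](rc0 R) (inj_eq (@rc_inj R)) gt_eqF // (le_lt_trans _ gt) // exprn_ge0.
have phA: ui (phi A) = rc r *: ui u - b * b.
 rewrite /A chartL //;last exact: ddropM.
 rewrite chartM // rcN rc1 scaleN1r addrC uiD uiN uiM;congr (_ - _);rewrite -uiZ;congr ui;exact: chart_scal.
have Ak: ui (phi A) * ui (phi k) = ui u /\ ui (phi k) * ui (phi A) = ui u.
 rewrite -!uiM -!chartM //;split;congr ui;rewrite -chart1;congr phi;apply/funext => s;by have []:=hk s.
have ul x: ui u * ui x = ui x by rewrite -uiM (uu x).1.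
have ur x: ui x * ui u = ui x by rewrite -uiM (uu x).2.
exists (ui (phi k) + (rc r)^-1 *: (1 - ui u)).
have E: rc r *: 1 - b * b = ui (phi A) + rc r *: (1 - ui u).
 by rewrite phA scalerBr [RHS]addrC addrA subrK.
rewrite E !mulrDl !mulrDr Ak.1 Ak.2 -!scalerAl -!scalerAr !scalerA !mulrBl !mulrBr !mulr1 !mul1r !ul !ur !subrr !scaler0 addr0 add0r mulfV // mulVf // scale1r subr0 add0r addrC subrK.
by split.
Qed.

(** Take a bump [b1] at [t] so narrow that [G] is small near its support. Then [b1] is
    [b1 ** (u - phi G)] plus a small multiple of [b1]; a distance below 1 would force [b1 = 0],
    though [b1] is the image of a function equal to 1 at [t]. *)
Lemma chart_unit_far G t: ddrop G -> 0 <= t <= 1 -> G t = 0 -> 1 <= nA (u - phi G).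
move=> dG t01 Gt;rewrite leNgt;apply/negP => lt;set x:=nA (u - phi G) in lt.
have [cG _ _]:=dG;have c0: 0 < (1 - x) / 2 by rewrite divr_gt0 // subr_gt0.
have [d d0 hd]:=mcont_opb t cG c0;pose B (k: R) s:=clamp (k - 2 / d * `|s - t|).
have d2: 0 < 2 / d by rewrite divr_gt0.
have cB k: rcontR (B k).
 apply: (@rcont_lip _ _ (2 / d)) => s s';apply: le_trans (clamp_lip _ _) _.
 have -> : k - 2 / d * `|s' - t| - (k - 2 / d * `|s - t|) = 2 / d * (`|s - t| - `|s' - t|) by ring.
 rewrite normrM gtr0_norm // ler_pM2l //;apply: le_trans (ler_dist_dist _ _) _.
 by rewrite opprB addrA subrK distrC.
have dB k: ddrop (elt (B k) 1%:M) by apply: ddropS.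
pose b1:=phi (elt (B 1) 1%:M).
have BB s: B 1 s * B 2 s = B 1 s.
 rewrite /B;have [h|h]:=leP (1 - 2 / d * `|s - t|) 0;first by rewrite clamp0 // mul0r.
 by rewrite [X in _ * X]clamp1 ?mulr1 //;lra.
have small: nA (phi (fun s => elt (B 2) 1%:M s *m G s)) <= (1 - x) / 2.
 apply: chart_le => [||s s01];[exact: ddropM|exact: ltW|].
 have [h|h]:=leP d `|s - t|.
 rewrite /elt /B clamp0 ?rc0 ?scale0r ?mul0mx;first exact: opb00.
 by rewrite subr_le0 mulrAC ler_pdivlMr // ler_wpM2l.
 have:=hd s h;rewrite Gt subr0 => o;rewrite /elt -scalemxAl mul1mx.
 have /andP[B0 B1]:=clampP (2 - 2 / d * `|s - t|).
 have:=opbZ (rc (B 2 s)) o;apply: opb_le;first by rewrite mulr_ge0 ?abs0 // ltW.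
 by rewrite absC_rc ger0_norm // ger_pMl.
have e: b1 = b1 ** (u - phi G) + b1 ** phi (fun s => elt (B 2) 1%:M s *m G s).
 have -> : b1 ** phi (fun s => elt (B 2) 1%:M s *m G s) = b1 ** phi G.
 rewrite /b1 -!chartM //;last exact: ddropM.
 congr phi;apply/funext => s;rewrite mulmxA;congr (_ *m _).
 by rewrite /elt -scalemxAl mul1mx scalerA -rcM BB.
 by rewrite cmulDr cmulNr (uu b1).2 subrK.
have b0: nA b1 = 0.
 apply/eqP;rewrite eq_le nAge0 andbT leNgt;apply/negP => b0.
 have:=nAD (b1 ** (u - phi G)) (b1 ** phi (fun s => elt (B 2) 1%:M s *m G s)).
 rewrite -e => h;have h1:=nAM b1 (u - phi G);have h2:=nAM b1 (phi (fun s => elt (B 2) 1%:M s *m G s)).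
 have:=ler_wpM2l (ltW b0) small => h3;rewrite -/x in h1;move: h h1 h2 h3 lt;nra.
have /(chart_ext (dB 1) ddrop0)/(_ t t01): phi (elt (B 1) 1%:M) = phi (fun=> 0) by rewrite chart0;exact: nA_eq0.
rewrite /elt /B subrr normr0 mulr0 subr0 clamp1 // rc1 scale1r => /matrixP/(_ (Ordinal (pq_gt0 p0 q0)) (Ordinal (pq_gt0 p0 q0))).
by rewrite !mxE eqxx => /eqP;rewrite oner_eq0.
Qed.
End Chart.

(** * The fibres of the connecting maps *)

Section Restriction.
Variables (R: realType) (p q N: nat) (p0: (0 < p)%N) (q0: (0 < q)%N).
Local Notation C:=(Cplx R).
Local Opaque mulmx map_mx trmx mxtrace opb.
Variables (f: (R -> 'M[C]_(p * q)) -> 'M[C]_N) (e: emb_t R N).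
Hypotheses (rf: rep p0 q0 f) (N0: (0 < N)%N) (fe: forall g, ddrop p0 q0 g -> exists x, f g = e x).

(** Used at the two ends, where the fibre takes its values in [emb_l] or [emb_r]; tuples found for
    the smaller representation then satisfy the boundary condition. *)
Lemma rep_restrict: exists2 f', rep p0 q0 f' & forall g, ddrop p0 q0 g -> f g = e (f' g).
have /choice[f' hf'] g: exists x, ddrop p0 q0 g -> f g = e x.
 by have [/fe[x hx]|h]:=pselect (ddrop p0 q0 g);[exists x|exists 0 => /h].
exists f' => //;split=> [g h dg dh gh|k g h dg dh|g h dg dh|g dg|];apply: (emb_inj N0).
- by rewrite -!hf' // (rep_ext rf dg dh gh).
- by rewrite embL -!hf' ?(repL rf) //;exact: ddropL.
- by rewrite embM -!hf' ?(repM rf) //;exact: ddropM.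
- by rewrite emb_adj -!hf' ?(rep_adj rf) //;exact: ddrop_adj.
- by rewrite emb1 -hf' ?(rep1 rf) //;exact: ddrop1.
Qed.

Lemma std_emb n T: std n 1%:M T -> std n 1%:M (fun b a => e (T b a)).
move=> [[[eh ee] ew] Tt vv vw sq];have e0:=emb0 e.
have es (I: finType) (F: I -> 'M[C]_(edim e)): e (\sum_i F i) = \sum_i e (F i).
 elim: (index_enum I) => [|i r IH];first by rewrite !big_nil.
 by rewrite !big_cons -[X in X + _]scale1r embL scale1r IH.
split=> [|a|a b an bn|a an|].
- by rewrite /proj -emb_adj -!embM eh ee ew.
- by have [-> z]:=Tt a;split=> [|/z ->];[rewrite emb_adj;case: ifP;rewrite ?e0|].
- by rewrite -emb_adj -embM vv //;case: eqP.
- by rewrite -emb_adj -embM vw.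
- by under eq_bigr do rewrite -emb_adj -embM;rewrite -es sq emb1.
Qed.

Lemma cut_emb n K rr f' c T: (0 < n)%N -> (1 < K)%N -> (0 < rr)%N -> rep p0 q0 f' -> (forall g, ddrop p0 q0 g -> f g = e (f' g)) ->
 cut_at n K rr p0 q0 f' c T -> cut_at n K rr p0 q0 f c (fun b a => e (T b a)).
move=> n0 K1 r0 rf' ff' [hc kc [sT cT]];split=> //.
 move=> i;have d: ddrop p0 q0 (elt (cutf (R:=R) K rr c i) 1%:M) by apply: ddropS;exact: rcont_cutf.
 by have:=kc i;rewrite /cel (ff' _ d) -embM => ->.
split;first exact: std_emb.
move=> b a i x iK;have [_ [_ di]]:=cuts_adm (cutf_cuts n0 K1 r0 rf' hc kc) i.
by rewrite /cel (ff' _ (di x)) -!embM;congr (e _);apply: cT.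
Qed.
End Restriction.

Section Transition.
Variables (R: realType) (Z: cstarAlgType R) (u: Z) (p q P Q: nat).
Hypotheses (p0: (0 < p)%N) (q0: (0 < q)%N) (P0: (0 < P)%N) (Q0: (0 < Q)%N) (uu: unit_of u).
Local Notation C:=(Cplx R).
Local Opaque mulmx map_mx trmx mxtrace opb cel.
Variables (phi: (R -> 'M[C]_(p * q)) -> Z) (psi: (R -> 'M[C]_(P * Q)) -> Z).
Hypotheses (hphi: dimdrop_embedding u phi) (hpsi: dimdrop_embedding u psi).
Hypothesis sub: phi @` (@dimdrop R p q) `<=` psi @` (@dimdrop R P Q).

Lemma chart_lift z: (psi @` (@dimdrop R P Q)) z -> exists2 h, ddrop P0 Q0 h & psi h = z.
move=> [h dh <-];have dc:=clamp_ddrop P0 Q0 dh;exists (fun s => h (clamp s)) => //.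
by have [h1 _ _ _ _]:=hpsi;apply/(h1 _ _ (ddrop_of dc) dh) => s;rewrite in_itv /= => /clamp_id ->.
Qed.

(** [pi t g] lifts [phi g] through [psi] and evaluates at [t]. Lifts are unique on the unit
    interval, which makes each [pi t] a representation. *)
Lemma transition: exists pi: R -> (R -> 'M[C]_(p * q)) -> 'M[C]_(P * Q),
 (forall t, 0 <= t <= 1 -> rep p0 q0 (pi t)) /\
 forall g, ddrop p0 q0 g -> ddrop P0 Q0 (pi^~ g) /\ psi (pi^~ g) = phi g.
have /choice[h hh] (g: R -> 'M[C]_(p * q)): exists h, ddrop p0 q0 g -> ddrop P0 Q0 h /\ psi h = phi g.
 have [dg|?]:=pselect (ddrop p0 q0 g);last by exists (fun=> 0).
 have [|h dh hE]:=@chart_lift (phi g);first by apply: sub;exists g => //;exact: ddrop_of dg.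
 by exists h.
exists (fun t g => h g t);split=> // t t01.
have E g k: ddrop p0 q0 g -> ddrop P0 Q0 k -> psi k = phi g -> h g t = k t.
 by move=> dg dk kg;have [dh hE]:=hh g dg;apply: ((chart_ext hpsi dh dk).1 _ t t01);rewrite hE.
split=> [g g' dg dg' gg|k g g' dg dg'|g g' dg dg'|g dg|].
- by have [dh' h']:=hh g' dg';apply: E => //;rewrite h';apply/esym/(chart_ext hphi dg dg').
- have [dh hE]:=hh g dg;have [dh' h'E]:=hh g' dg'.
 apply: (E _ (fun s => k *: h g s + h g' s));[exact: ddropL|exact: ddropL|].
 by rewrite (chartL hpsi) // (chartL hphi) // hE h'E.
- have [dh hE]:=hh g dg;have [dh' h'E]:=hh g' dg'.
 apply: (E _ (fun s => h g s *m h g' s));[exact: ddropM|exact: ddropM|].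
 by rewrite (chartM hpsi) // (chartM hphi) // hE h'E.
- have [dh hE]:=hh g dg;apply: (E _ (fun s => (h g s)^h));[exact: ddrop_adj|exact: ddrop_adj|].
 by rewrite (chart_adj hpsi dh) (chart_adj hphi dg) hE.
- by apply: (E _ (fun=> 1%:M));[exact: ddrop1|exact: ddrop1|rewrite (chart1 hpsi) (chart1 hphi)].
Qed.

(* [r - r * r] for the ramp [r] under the plateau of [core i x] is not zero, but is killed by any representation killing [core i x]. *)
Definition hat n K i x (s: R): R:=let h:=(6 * cores p q n)%:R in
 let k:=(6 * cores p q n * i + 3 * cores p q n + 3 * x + 1)%:R in ramp K h k s - ramp K h k s * ramp K h k s.

Lemma rcontR_hat n K i x: rcontR (hat n K i x).
apply: rcontRB;first exact: rcont_ramp.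
by rewrite /rcontR;under eq_fun do rewrite rcM;apply: rcontM;apply: rcont_ramp.
Qed.
Lemma hat_neq0 n K i x: (1 < K)%N -> (i < K)%N -> (x < cores p q n)%N -> phi (elt (hat n K i x) 1%:M) != 0.
move=> K1 iK xc;have dh: ddrop p0 q0 (elt (hat n K i x) 1%:M) by apply: ddropS;exact: rcontR_hat.
apply/eqP;rewrite -(chart0 p0 q0 hphi) => /(chart_ext hphi dh (ddrop0 R p0 q0)).
set c:=cores p q n in xc;pose k:=(6 * c * i + 3 * c + 3 * x + 1)%N.
have cK: 0 < (6 * c * K)%:R :> R by rewrite ltr0n;move: xc K1;clear;nia.
have kc: k.*2.+1%:R / 2 <= (6 * c * K)%:R :> R.
 by rewrite ler_pdivrMr // -natrM ler_nat /k;move: xc iK;clear;nia.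
move=> /(_ (k.*2.+1%:R / 2 / (6 * c * K)%:R)) /(_ _)/matrixP/(_ (Ordinal (pq_gt0 p0 q0)) (Ordinal (pq_gt0 p0 q0))).
have r: ramp K (6 * c)%:R k%:R (k.*2.+1%:R / 2 / (6 * c * K)%:R) = 1 / 2 :> R.
 rewrite /ramp mulrA -natrM mulrC divfK ?gt_eqF //.
 have -> : k.*2.+1%:R / 2 - k%:R = 1 / 2 :> R by rewrite -natr1 -muln2 natrM;field.
 by rewrite clamp_id //;apply/andP;split;lra.
rewrite /elt /hat -/c -/k r !mxE eqxx mulr1 => h;have /(@rc_inj R): rc (1 / 2 - 1 / 2 * (1 / 2)) = rc (0: R).
 by apply: h;rewrite divr_ge0 //= ler_pdivrMr // mul1r.
lra.
Qed.

(** A fibre that kills a core kills the corresponding hat, so the sum that nearly equals [u]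
    vanishes at [t], against [chart_unit_far]. *)
Lemma transition_alive (pi: R -> (R -> 'M[C]_(p * q)) -> 'M[C]_(P * Q)) n K t: 0 <= t <= 1 ->
 (forall t, 0 <= t <= 1 -> rep p0 q0 (pi t)) ->
 (forall g, ddrop p0 q0 g -> ddrop P0 Q0 (pi^~ g) /\ psi (pi^~ g) = phi g) ->
 (forall i x, (i < K)%N -> (x < cores p q n)%N -> exists k (a b: nat -> Z),
 (forall j, (psi @` (@dimdrop R P Q)) (a j) /\ (psi @` (@dimdrop R P Q)) (b j)) /\
 nA (u - \sum_(j < k) a j ** phi (elt (hat n K i x) 1%:M) ** b j) < 1) -> alive n K (pi t).
move=> t01 rpi hpi span i x iK xc core0;have [k [a [b [ab near]]]]:=span i x iK xc.
have dh: ddrop p0 q0 (elt (hat n K i x) 1%:M) by apply: ddropS;exact: rcontR_hat.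
have [dH HE]:=hpi _ dh;have Ht: pi t (elt (hat n K i x) 1%:M) = 0.
 have c0: 0 < (6 * cores p q n)%:R :> R by rewrite ltr0n;move: xc;clear;lia.
 have cb: rcontR (core p q n K i x: R -> R) by exact: rcont_bump.
 have:=celM1 (rpi t t01) (rcontR_hat n K i x) cb;rewrite core0 mulmx0 => ->;congr (pi t);apply/funext => s.
 by rewrite /elt;congr (rc _ *: _);apply/esym;exact: ramp_bump.
have /choice[A hA] j: exists h, ddrop P0 Q0 h /\ psi h = a j by have [/chart_lift[h dh' hE] _]:=ab j;exists h.
have /choice[B hB] j: exists h, ddrop P0 Q0 h /\ psi h = b j by have [_ /chart_lift[h dh' hE]]:=ab j;exists h.
pose G l s :=\sum_(j < l) A j s *m pi s (elt (hat n K i x) 1%:M) *m B j s.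
have [dG GE]: ddrop P0 Q0 (G k) /\ psi (G k) = \sum_(j < k) a j ** phi (elt (hat n K i x) 1%:M) ** b j.
 elim: k {near} => [|k [dk kE]].
 have -> : G 0%N = fun=> 0 by apply/funext => s;rewrite /G big_ord0.
 by rewrite big_ord0 (chart0 P0 Q0 hpsi);split=> //;exact: ddrop0.
 have [dA AE]:=hA k;have [dB BE]:=hB k.
 have dT: ddrop P0 Q0 (fun s => A k s *m pi s (elt (hat n K i x) 1%:M) *m B k s) by apply: ddropM => //;exact: ddropM.
 have -> : G k.+1 = fun s => 1 *: G k s + A k s *m pi s (elt (hat n K i x) 1%:M) *m B k s.
 by apply/funext => s;rewrite /G big_ord_recr /= scale1r.
 split;first exact: ddropL.
 rewrite (chartL hpsi) // scale1r kE big_ord_recr /=;congr (_ + _).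
 by rewrite (chartM hpsi) ?(chartM hpsi dA dH) ?HE ?AE ?BE //;exact: ddropM.
have Gt: G k t = 0 by rewrite /G big1 // => j _;rewrite Ht mulmx0 mul0mx.
by have:=chart_unit_far uu hpsi dG t01 Gt;rewrite GE leNgt near.
Qed.
End Transition.

(** * Division in the Jiang-Su algebra *)

Definition divtuple (R: realType) (A: cstarAlgType R) n (X: bool -> nat -> A) :=
 [/\ forall a b, (a < n)%N -> (b < n)%N ->
 star (X true a) ** X true b = if a == b then star (X true 0%N) ** X true 0%N else 0,
 forall a, (a <= n)%N -> star (X true 0%N) ** X true 0%N ** X false a = X false a,
 forall a b, (a < n)%N -> (b < n)%N -> a != b -> X false a ** X true b = 0 &
 forall c a, nA (X c a) <= 1].

Definition divisible (R: realType) (A: cstarAlgType R) (u: A) :=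
 forall (F: seq A) n (eps: R), (0 < n)%N -> 0 < eps -> exists2 X, divtuple n X &
 \sum_(a < n.+1) star (X false a) ** X false a = u /\
 forall f, f \in F -> forall c a, nA (X c a ** f - f ** X c a) <= eps.

Section JiangSu.
Variables (R: realType) (Z: cstarAlgType R) (u: Z) (S: nat -> set Z).
Local Notation C:=(Cplx R).
Local Opaque mulmx map_mx trmx mxtrace opb.
Hypotheses (uu: unit_of u) (Z_simple: simple Z) (SS: forall n, S n `<=` S n.+1) (Sd: dense (\bigcup_n S n)).
Hypothesis Sdrop: forall m, prime_dimdrop_subalgebra u (S m).

Lemma chain_le m w: (m <= w)%N -> S m `<=` S w.
by move=> mw;rewrite -(subnK mw);elim: (w - m)%N => //= k IH x /IH/SS. Qed.
Lemma chain_near (x: Z) (e: R): 0 < e -> exists m y, S m y /\ nA (x - y) < e.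
by move=> e0;have [y [m _ Sy] xy]:=dense_nA x Sd e0;exists m, y. Qed.

(** By simplicity [u] is near a sum of terms [a j ** d ** b j], whose finitely many coefficients can
    be taken from one stage of the limit, and then from every later one. *)
Lemma span_near d: d != 0 -> exists W k (a b: nat -> Z), (forall w, (W <= w)%N -> forall j, S w (a j) /\ S w (b j)) /\
 nA (u - \sum_(j < k) a j ** d ** b j) < 1.
move=> d0;have q4: 0 < 4^-1 :> R by rewrite invr_gt0.
have [|k [a [b [ha hb uE]]]]:=simple_span Z_simple ((inAE (ui d)).2 erefl) _ ((inAE (ui u)).2 erefl) q4.
 by apply: contraNneq d0 => /ui_inj ->.
have aE j: a j = ui (a j).1 by apply: uz_eq => //;apply/inAE/ha.
have bE j: b j = ui (b j).1 by apply: uz_eq => //;apply/inAE/hb.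
have {}uE: nA (u - \sum_(j < k) (a j).1 ** d ** (b j).1) < 4^-1.
 rewrite -ui_nrm uiB ui_sum nrmC;congr (nrm (_ - _) < _): uE;apply: eq_bigr => j _;by rewrite !uiM -aE -bE.
pose e: R:=(k.+1%:R)^-1 / 4;have e0: 0 < e by rewrite divr_gt0 ?invr_gt0.
have /choice[B hB] j: exists B, exists2 m, S m B & (nA ((a j).1 ** d) + 1) * nA ((b j).1 - B) < e.
 have c0: 0 < nA ((a j).1 ** d) + 1 by rewrite ltr_wpDl ?nAge0.
 have [m [y [Sy yb]]]:=chain_near (b j).1 (divr_gt0 e0 c0);exists y, m => //.
 by rewrite mulrC -ltr_pdivlMr.
have /choice[A hA] j: exists A, exists2 m, S m A & nA ((a j).1 - A) * (nA (d ** B j) + 1) < e.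
 have c0: 0 < nA (d ** B j) + 1 by rewrite ltr_wpDl ?nAge0.
 have [m [y [Sy ya]]]:=chain_near (a j).1 (divr_gt0 e0 c0);exists y, m => //.
 by rewrite -ltr_pdivlMr.
have /choice[W hW] j: exists m, S m (A j) /\ S m (B j).
 have [m SA _]:=hA j;have [m' SB _]:=hB j;exists (maxn m m').
 by split;[apply: chain_le SA;exact: leq_maxl|apply: chain_le SB;exact: leq_maxr].
(* Truncating the index at [k] lets one stage [W] bound the coefficients for every [j]. *)
exists (\max_(j < k.+1) W j)%N, k, (fun j => A (minn j k)), (fun j => B (minn j k));split=> [w Ww j|].
 have [SA SB]:=hW (minn j k);have le: (W (minn j k) <= w)%N.
 apply: leq_trans Ww;have h: (minn j k < k.+1)%N by rewrite ltnS geq_minr.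
 exact: (@leq_bigmax _ (fun j: 'I_k.+1 => W j) (Ordinal h)).
 by split;apply: chain_le le _ _.
have -> : \sum_(j < k) A (minn j k) ** d ** B (minn j k) = \sum_(j < k) A j ** d ** B j.
 by apply: eq_bigr => j _;rewrite (minn_idPl (ltnW (ltn_ord j))).
have E j: (a j).1 ** d ** (b j).1 - A j ** d ** B j = ((a j).1 ** d) ** ((b j).1 - B j) + ((a j).1 - A j) ** (d ** B j).
 by rewrite cmulDr cmulNr cmulDl cmulNl !cmulA addrA subrK.
have -> : u - \sum_(j < k) A j ** d ** B j = (u - \sum_(j < k) (a j).1 ** d ** (b j).1) +
 \sum_(j < k) ((a j).1 ** d ** (b j).1 - A j ** d ** B j) by rewrite sumrB addrA subrK.
apply: le_lt_trans (nAD _ _) _;have sm: nA (\sum_(j < k) ((a j).1 ** d ** (b j).1 - A j ** d ** B j)) <= k%:R * (e + e).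
 rewrite -[k in leRHS]card_ord -sum1_card natr_sum mulr_suml;elim/big_ind2: _ => [|x y x' y' h h'|j _];first by rewrite nA0.
 by apply: le_trans (nAD _ _) _;apply: lerD.
 rewrite mul1r E;apply: le_trans (nAD _ _) _;have [_ _ h1]:=hB j;have [_ _ h2]:=hA j;apply: lerD.
 apply: le_trans (nAM _ _) _;apply: le_trans (ltW h1);by rewrite ler_wpM2r ?nAge0 // lerDl.
 apply: le_trans (nAM _ _) _;apply: le_trans (ltW h2);by rewrite ler_wpM2l ?nAge0 // lerDl.
have ke: k%:R * (e + e) <= 1 / 2.
 have -> : e + e = (k.+1%:R)^-1 / 2 by rewrite /e;field.
 by rewrite mulrA ler_pM2r // ler_pdivrMr // mul1r ler_nat.
lra.
Qed.

Lemma chart_sum p q (p0: (0 < p)%N) (q0: (0 < q)%N) (phi: (R -> 'M[C]_(p * q)) -> Z) (h: dimdrop_embedding u phi)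
 k (G: nat -> R -> 'M[C]_(p * q)): (forall i, ddrop p0 q0 (G i)) ->
 ddrop p0 q0 (fun s => \sum_(i < k) G i s) /\ phi (fun s => \sum_(i < k) G i s) = \sum_(i < k) phi (G i).
move=> dG;elim: k => [|k [dk kE]].
 have -> : (fun s => \sum_(i < 0) G i s) = fun=> 0 by apply/funext => s;rewrite big_ord0.
 by rewrite big_ord0 (chart0 p0 q0 h);split=> //;exact: ddrop0.
have -> : (fun s => \sum_(i < k.+1) G i s) = fun s => 1 *: (\sum_(i < k) G i s) + G k s.
 by apply/funext => s;rewrite big_ord_recr /= scale1r.
by rewrite (chartL h) // scale1r kE big_ord_recr;split=> //;apply: ddropL.
Qed.

(** The order of choices: a stage [M] that nearly contains [F], a mesh [K] for its chart, then a
    later stage [w] in which every hat of that mesh generates nearly the unit. The tuple is the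
    image under the chart of stage [w] of a path of matrices that almost commutes with the
    fibres. *)
Lemma jiang_su_division: divisible u.
move=> F n eps n0 e0;have e8: 0 < eps / 8 by rewrite divr_gt0.
have /choice[y hy] f: exists y, exists2 m, S m y & nA (f - y) < eps / 8 by have [m [y [Sy fy]]]:=chain_near f e8;exists y, m.
have /choice[mf hm] f: exists m, S m (y f) by have [m Sm _]:=hy f;exists m.
pose M:=(\max_(f <- F) mf f)%N;have SM f: f \in F -> S M (y f).
 by move=> fF;apply: chain_le (hm f);exact: leq_bigmax_seq.
have [p [q [phi [p0 q0 _ hphi SME]]]]:=Sdrop M.
have /choice[fam hfam] (i: 'I_(size F)): exists g, ddrop p0 q0 g /\ phi g = y (tnth (in_tuple F) i).
 have:=SM _ (mem_tnth i (in_tuple F));rewrite SME => /(chart_lift p0 q0 hphi)[g dg gE];by exists g.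
have dfam i: ddrop p0 q0 (fam i) by have []:=hfam i.
pose N2:=((p * q) * (p * q))%:R: R;have N20: 0 < N2 by rewrite ltr0n !muln_gt0 p0 q0.
pose d:=eps / 8 / (8 * N2);have d0: 0 < d by rewrite divr_gt0 ?mulr_gt0.
have [K0 _ hK]:=mcont_unif (fun i => let: And3 h _ _:=dfam i in h) d0.
pose K:=maxn K0 2;have K1: (1 < K)%N by rewrite leq_maxr.
have osc i s s' j k: 0 <= s <= 1 -> 0 <= s' <= 1 -> K%:R * `|s - s'| <= 2 -> absC (fam i s j k - fam i s' j k) <= d.
 by move=> s0 s1 /(hK K (leq_maxl _ _) i s s' s0 s1)[].
have /choice[Wf hW] (ix: nat * nat): exists W, (ix.1 < K)%N -> (ix.2 < cores p q n)%N -> exists k (a b: nat -> Z),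
 (forall w, (W <= w)%N -> forall j, S w (a j) /\ S w (b j)) /\ nA (u - \sum_(j < k) a j ** phi (elt (hat p q n K ix.1 ix.2) 1%:M) ** b j) < 1.
 case: (boolP ((ix.1 < K)%N && (ix.2 < cores p q n)%N)) => [/andP[iK xc]|h];last first.
 by exists 0%N => iK xc;rewrite iK xc in h.
 by have [W hW]:=span_near (hat_neq0 p0 q0 hphi K1 iK xc);exists W.
pose w:=maxn M (\max_(i < K) \max_(x < cores p q n) Wf (i: nat, x: nat))%N.
have [P [Q [psi [P0 Q0 _ hpsi SwE]]]]:=Sdrop w.
have sub: phi @` (@dimdrop R p q) `<=` psi @` (@dimdrop R P Q) by rewrite -SME -SwE;apply/chain_le/leq_maxl.
have [pi [rpi hpi]]:=transition p0 q0 P0 Q0 hphi hpsi sub.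
have api t: 0 <= t <= 1 -> alive n K (pi t).
 move=> t01;apply: (transition_alive uu hpsi t01 rpi hpi) => i x iK xc.
 have [k [a [b [ab near]]]]:=hW (i, x) iK xc;exists k, a, b;split=> // j;rewrite -SwE;apply: ab.
 apply: leq_trans (leq_maxr _ _);apply: leq_trans (leq_bigmax (Ordinal iK)).
 exact: (leq_trans (n:=Wf (i, x)) _ (leq_bigmax (F:=fun x: 'I_(cores p q n) => Wf (i, x: nat)) (Ordinal xc))).
have Drr: (2 * (P * Q) < (2 * (P * Q)).+1)%N by [].
have d_eta: 8 * (N2 * d) <= eps / 8 by rewrite mulrA /d mulrC divfK // gt_eqF // mulr_gt0.
have D0: (0 < P * Q)%N by rewrite muln_gt0 P0.
(* The tuple is found for the smaller representation that an end factors through; as the dimension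
   is not larger, the same number of candidate cuts suffices. *)
have ends t (e: emb_t R (P * Q)): 0 <= t <= 1 -> (edim e <= P * Q)%N -> (forall g, ddrop p0 q0 g -> exists x, pi t g = e x) ->
 exists c T, cut_at n K (2 * (P * Q)).+1 p0 q0 (pi t) c (fun b a => e (T b a)).
 move=> t01 ed he;have [f' rf' ff']:=rep_restrict (rpi t t01) D0 he.
 have Drr': (2 * edim e < (2 * (P * Q)).+1)%N by rewrite ltnS leq_mul2l ed orbT.
 have af: alive n K f'.
 move=> i x iK xc h;apply: (api t t01 i x iK xc);rewrite /cel ff' ?[X in e X]h ?emb0 //.
 by apply: ddropS;exact: rcont_bump.
 have [c [hc kc _]]:=killed_both n0 K1 (ltn0Sn _) Drr' rf' rf'.
 have [T hT]:=cut_exists n0 K1 Drr' dfam (ltW d0) osc d_eta rf' af hc kc.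
 by exists c, T;apply: cut_emb hT.
have [c [T0 h0]]: exists c T, cut_at n K (2 * (P * Q)).+1 p0 q0 (pi 0) c (fun b a => emb_l R Q P0 (T b a)).
 by apply: ends => [||g /hpi[[_ h _] _]] //;[rewrite lexx ler01|rewrite leq_pmulr].
have [c' [T1 h1]]: exists c T, cut_at n K (2 * (P * Q)).+1 p0 q0 (pi 1) c (fun b a => emb_r R P Q0 (T b a)).
 by apply: ends => [||g /hpi[[_ _ h] _]] //;[rewrite lexx ler01|rewrite leq_pmull].
have [|G [cG G0 G1 GA]]:=cut_path n0 K1 Drr dfam (ltW d0) osc d_eta e8 rpi api _ h0 h1.
 by move=> g /hpi[[]].
have dG b a: ddrop P0 Q0 (fun s => G s b a).
 by split;[exact: cG|exists (T0 b a);rewrite G0|exists (T1 b a);rewrite G1].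
have ext f g: ddrop P0 Q0 f -> ddrop P0 Q0 g -> (forall s, 0 <= s <= 1 -> f s = g s) -> psi f = psi g.
 by move=> df dg;exact: (chart_ext hpsi df dg).2.
have dA b a:=ddrop_adj (dG b a).
have sM b a b' a': star (psi (fun s => G s b a)) ** psi (fun s => G s b' a') = psi (fun s => (G s b a)^h *m G s b' a').
 by rewrite (chartM hpsi (dA b a) (dG b' a')) (chart_adj hpsi (dG b a)).
have dsM b a b' a':=ddropM (dA b a) (dG b' a').
exists (fun b a => psi (fun s => G s b a));first split=> [a b an bn|a an|a b an bn ab|b a].
- rewrite !sM;case: eqVneq => [<-|ne].
 by apply: ext => // s s01;have [[/(_ a a an an) + _ _ _ _] _]:=GA s s01;rewrite eqxx.
 rewrite -(chart0 P0 Q0 hpsi);apply: ext => // [|s s01];first exact: ddrop0.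
 by have [[/(_ a b an bn) + _ _ _ _] _]:=GA s s01;rewrite (negPf ne).
- rewrite sM -(chartM hpsi (dsM true 0%N true 0%N) (dG false a));apply: ext => // [|s s01];first exact: ddropM.
 by have [[_ /(_ a an) + _ _ _] _]:=GA s s01.
- rewrite -(chartM hpsi (dG false a) (dG true b)) -(chart0 P0 Q0 hpsi);apply: ext => // [||s s01];[exact: ddropM|exact: ddrop0|].
 by have [[_ _ /(_ a b an bn ab) + _ _] _]:=GA s s01.
- apply: (chart_le uu hpsi (dG b a)) => // s s01;have [[_ _ _ _ o] _]:=GA s s01;exact: o.
split=> [|f fF b a].
 have [ds sE]:=chart_sum hpsi n.+1 (fun a => dsM false a false a).
 under eq_bigr do rewrite sM;rewrite -sE -(chart1 hpsi);apply: ext => // [|s s01];first exact: ddrop1.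
 by have [[_ _ _ + _] _]:=GA s s01.
have /tnthP[i fi]: f \in in_tuple F by [].
set x:=psi _;have [dfi fiE]:=hfam i;have [dpi piE]:=hpi _ dfi.
have yc: nA (x ** y f - y f ** x) <= 2 * (eps / 8).
 rewrite fi -fiE -piE /x -(chartM hpsi dpi (dG b a)) -(chartM hpsi (dG b a) dpi) -[- psi _]scaleN1r addrC -(chartL hpsi);[|exact: ddropM|exact: ddropM].
 apply: (chart_le uu hpsi) => [||s s01];[by apply: ddropL;exact: ddropM|by rewrite mulr_ge0 // ltW|].
 by have [_ cS]:=GA s s01;rewrite scaleN1r addrC;exact: cS.
have x1: nA x <= 1 by apply: (chart_le uu hpsi (dG b a)) => // s s01;have [[_ _ _ _ o] _]:=GA s s01;exact: o.
have -> : x ** f - f ** x = (x ** y f - y f ** x) + (x ** (f - y f) - (f - y f) ** x).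
 by rewrite cmulDr cmulNr cmulDl cmulNl;exact: sub_split.
have [_ _ fy]:=hy f;apply: le_trans (nAD _ _) _.
have a1: nA (x ** (f - y f)) <= eps / 8 by apply: le_trans (nAM _ _) _;rewrite -[leRHS]mul1r ler_pM ?nAge0 // ltW.
have a2: nA ((f - y f) ** x) <= eps / 8 by apply: le_trans (nAM _ _) _;rewrite -[leRHS]mulr1 ler_pM ?nAge0 // ltW.
have:=nAD (x ** (f - y f)) (- ((f - y f) ** x));rewrite nAN;lra.
Qed.
End JiangSu.

(** * Tensor products, and transport into the tracial setting *)

Section StarHom.
Variables (R: realType) (A B: cstarAlgType R) (h: A -> B).
Hypothesis sh: star_hom h.

Lemma hom0: h 0 = 0.
by have [hl _ _]:=sh;have:=hl (-1) 0 0;rewrite scaler0 addr0 scaleN1r addNr. Qed.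
Lemma homD x y: h (x + y) = h x + h y.
by have [hl _ _]:=sh;have:=hl 1 x y;rewrite !scale1r. Qed.
Lemma homZ k x: h (k *: x) = k *: h x.
by have [hl _ _]:=sh;have:=hl k x 0;rewrite hom0 !addr0. Qed.
Lemma homB x y: h (x - y) = h x - h y.
by rewrite homD -scaleN1r homZ scaleN1r. Qed.

(* Extending [h] to the unitizations, the square root of [r ^ 2 - x^* x] is mapped to that of [r ^ 2 - (h x)^* (h x)]. *)
Lemma hom_le x: nA (h x) <= nA x.
have [hl hM hs]:=sh;pose H (a: unitz A): unitz B:=(h a.1, a.2).
have HM a b: H (a * b) = H a * H b.
 by apply: uz_eq;rewrite //= /uz_mul /= !homD !homZ hM.
have [|s [ss _ s2 _]]:=psqrt (@adjM_le _ _ (ui x) (nA x) _);first by rewrite ui_nrm.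
have Hs: adj (H s) = H s by rewrite -[in RHS]ss;apply: uz_eq;rewrite //= -hs.
have e: adj (ui (h x)) * ui (h x) + H s * H s = rc (nA x ^+ 2) *: 1.
 rewrite -HM s2 -!ui_adj -!uiM -hs -hM;apply: uz_eq => /=;rewrite ?scaler0 ?add0r ?subr0 //.
 by rewrite -homD addrN hom0.
have x2: 0 <= nA x ^+ 2 by rewrite sqr_ge0.
rewrite -(@ler_pXn2r _ 2) ?nnegrE ?nAge0 // -nA_cstar -ui_nrm uiM ui_adj.
by apply: pos_nrm x2 (padjM _) _;rewrite -e addrC addKr;apply: pos_sqr.
Qed.
End StarHom.

Lemma nA_sum (R: realType) (A: cstarAlgType R) (I: eqType) (r: seq I) (F: I -> A) (b: I -> R) :
 (forall i, i \in r -> nA (F i) <= b i) -> nA (\sum_(i <- r) F i) <= \sum_(i <- r) b i.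
move=> h;rewrite big_seq [leRHS]big_seq;elim/big_ind2: _ => [|x y x' y' h1 h2|i ir];first by rewrite nA0.
 by apply: le_trans (nAD _ _) _;apply: lerD.
exact: h.
Qed.

Section ApproxUnit.
Variables (R: realType) (D: cstarAlgType R).

(** Both cut-offs of one element that dominates a multiple of every [star d ** d] and [d ** star d];
    the upper one absorbs the lower, which makes [c] an exact unit for [c']. *)
Lemma nested_au (F: seq D) (e: R): 0 < e -> exists c c': D,
 [/\ star c = c /\ nA c <= 1, star c' = c' /\ nA c' <= 1, c ** c' = c' /\ c' ** c = c' &
 forall d, d \in F -> [/\ nA (d - d ** c) <= e, nA (d - c ** d) <= e, nA (d - d ** c') <= e & nA (d - c' ** d) <= e]].
move=> e0;pose W: unitz D :=\sum_(d <- F) (adj (ui d) * ui d + ui d * adj (ui d)).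
have pt d: pos (adj (ui d) * ui d + ui d * adj (ui d)) by apply: posD;[exact: padjM|exact: padjM2].
have ps (r: seq D): pos (\sum_(d <- r) (adj (ui d) * ui d + ui d * adj (ui d))).
 by elim: r => [|d r IH];rewrite ?big_nil ?big_cons;[exact: pos0|exact: posD].
have pW d: d \in F -> pos (W - (adj (ui d) * ui d + ui d * adj (ui d))).
 by move=> dF;rewrite /W (big_rem d dF) /= [_ + \sum_(_ <- _) _]addrC addrK.
pose r:=nrm W + 1;have r0: 0 < r by rewrite ltr_wpDl ?nrmge0.
have ir: 0 <= r^-1 by rewrite invr_ge0 ltW.
pose w:=rc r^-1 *: W;have pw: pos w:=posR ir (ps F).
pose d:=e ^+ 2 / 4 / r;have d0: 0 < d by rewrite !divr_gt0 ?exprn_gt0.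
have Aw: inA w.
 apply: inAZ;rewrite /W;elim/big_ind: _ => [|x y|x _];[exact: inA0|exact: inAD|].
 by apply: inAD;[apply: inAMr|apply: inAMl];exact: inA_ui.
have [[[c _ cE] [c' _ cE']] [[sl sh _] _ [hl lh _] _ _] [nh nl]] :=
 And3 (her_cut (@inA_her R D) d0 pw Aw) (cutP d0 pw) (nrm_cut d0 pw).
rewrite -cE in lh hl sl nl;rewrite -cE' in hl lh sh nh;rewrite -!uiM in hl lh.
rewrite ui_nrm in nl;rewrite ui_nrm in nh;rewrite -ui_adj in sl;rewrite -ui_adj in sh.
have {}hl:=ui_inj hl;have {}lh:=ui_inj lh;have {}sl:=ui_inj sl;have {}sh:=ui_inj sh.
have near x: pos (W - adj (ui x) * ui x) -> nA (x - x ** c') <= e / 2.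
 move=> px;pose y:=rc (Num.sqrt r^-1) *: ui x.
 have yy: adj y * y = rc r^-1 *: (adj (ui x) * ui x).
 by rewrite /y adjR -scalerAl -scalerAr scalerA -rcM -expr2 sqr_sqrtr.
 have py: pos (w - adj y * y) by rewrite yy -scalerBr;exact: posR.
 have:=hcut_close d0 pw py;rewrite -cE' /y -scalerAl -scalerBr -uiM -uiB nrmR ui_nrm exprMn.
 rewrite real_normK ?num_real // sqr_sqrtr // mulrC ler_pdivrMr // => h.
 rewrite -(@ler_pXn2r _ 2) ?nnegrE ?nAge0 ?divr_ge0 ?(ltW e0) //;apply: le_trans h _.
 by rewrite /d divfK ?gt_eqF // expr_div_n;lra.
have near2 x: nA (x - x ** c') <= e / 2 -> nA (x - x ** c) <= e.
 move=> hx;have -> : x - x ** c = (x - x ** c') - (x - x ** c') ** c.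
 by rewrite cmulDl cmulNl -cmulA hl opprB addrA subrK.
 apply: le_trans (nAD _ _) _;rewrite nAN;have:=nAM (x - x ** c') c;have:=nAge0 (x - x ** c');nra.
have flip x y: star y = y -> nA (x - y ** x) = nA (star x - star x ** y).
 by move=> sy;rewrite -nA_star starD -scaleN1r starZ rmorphN1 star_cmul sy scaleN1r.
exists c, c';split=> // x xF.
have px: pos (W - adj (ui x) * ui x).
 by have:=posD (pW x xF) (padjM2 (ui x));rewrite opprD addrA subrK.
have px': pos (W - adj (ui (star x)) * ui (star x)).
 by have:=posD (pW x xF) (padjM (ui x));rewrite ui_adj adjK opprD [X in W + X]addrC addrA subrK.
have e2: e / 2 <= e by lra.
have h1:=near _ px;have h2:=near _ px'.
by rewrite !flip //;split;rewrite ?near2 // (le_trans _ e2).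
Qed.
End ApproxUnit.

Section Tensor.
Variables (R: realType) (D Z T: cstarAlgType R) (u: Z) (t: D -> Z -> T).
Hypotheses (uu: unit_of u) (tt: is_tensor_product t).

Lemma tensM a b a' b': t a b ** t a' b' = t (a ** a') (b ** b').
by have [_ [h _] _ _]:=tt;apply: h. Qed.
Lemma tens_star a b: star (t a b) = t (star a) (star b).
by have [_ [_ h] _ _]:=tt;apply: h. Qed.
Lemma tensDl a a' b: t (a + a') b = t a b + t a' b.
by have [[h _] _ _ _]:=tt;have:=h b 1 a a';rewrite !scale1r. Qed.
Lemma tensDr a b b': t a (b + b') = t a b + t a b'.
by have [[_ h] _ _ _]:=tt;have:=h a 1 b b';rewrite !scale1r. Qed.
Lemma tens0 a: t a 0 = 0.
by apply: (addrI (t a 0));rewrite -tensDr !addr0. Qed.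
Lemma tensZr a k b: t a (k *: b) = k *: t a b.
by have [[_ h] _ _ _]:=tt;have:=h a k b 0;rewrite tens0 !addr0. Qed.
Lemma tens_sum a (I: finType) (F: I -> Z): t a (\sum_i F i) = \sum_i t a (F i).
by elim: (index_enum I) => [|i r IH];rewrite ?big_nil ?tens0 // !big_cons tensDr IH. Qed.

Lemma tensBl a a' b: t (a - a') b = t a b - t a' b.
by apply: (addIr (t a' b));rewrite -tensDl !subrK. Qed.
Lemma tensBr a b b': t a (b - b') = t a b - t a b'.
by apply: (addIr (t a b'));rewrite -tensDr !subrK. Qed.

Lemma unit_star: star u = u.
by have:=congr1 star (uu (star u)).2;rewrite star_cmul starK (uu _).2. Qed.

(** Some [y] satisfies [star z ** z + star y ** y = nA z ^+ 2 *: u]. So the square of [t a z] is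
    below a multiple of that of [t a u], and [t^~ u] is a *-homomorphism, hence contractive. *)
Lemma tens_nrm a z: nA (t a z) <= nA a * nA z.
have hu: star_hom (t^~ u).
 by split=> [k x y|x y|x];[have [[h _] _ _ _]:=tt;exact: h|rewrite tensM (uu u).1|rewrite tens_star unit_star].
have [|s [ss _ s2 _]]:=psqrt (@adjM_le _ _ (ui z) (nA z) _);first by rewrite ui_nrm.
have [y yE]: exists y, ui y = s * ui u by exists (s.1 ** u + s.2 *: u);rewrite ui_mull.
have e: star z ** z + star y ** y = rc (nA z ^+ 2) *: u.
 apply: ui_inj;rewrite uiD uiM ui_adj (uiM (star y)) ui_adj yE adjM ss -mulrA (mulrA s) s2 mulrBl mulrBr.
 have -> : adj (ui u) = ui u by rewrite -ui_adj unit_star.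
 by rewrite -ui_adj -scalerAl mul1r -scalerAr -!uiM -uiZ (uu u).1 (uu _).2 (uu _).1 addrC subrK.
have X2: pos (adj (ui (t a z)) * ui (t a z)) by exact: padjM.
have Z2: 0 <= nA z ^+ 2 by rewrite sqr_ge0.
have le: nrm (adj (ui (t a z)) * ui (t a z)) <= nrm (rc (nA z ^+ 2) *: (adj (ui (t a u)) * ui (t a u))).
 apply: nrm_mono X2 _;have:=padjM (ui (t a y));congr pos.
 rewrite -!ui_adj -!uiM -uiZ -uiB;congr ui;rewrite !tens_star !tensM -tensZr unit_star (uu u).1 -e tensDr.
 by rewrite addrC addKr.
rewrite -(@ler_pXn2r _ 2) ?nnegrE ?mulr_ge0 ?nAge0 //;move: le.
rewrite -!ui_adj -!uiM nrmR !ui_nrm !nA_cstar ger0_norm // exprMn mulrC => /le_trans;apply.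
by rewrite ler_wpM2r // lerXn2r ?nnegrE ?nAge0 // (hom_le hu).
Qed.
End Tensor.

Section Transport.
Variables (R: realType) (A D Z T: cstarAlgType R) (u: Z) (t: D -> Z -> T) (h: T -> A).
Hypotheses (uu: unit_of u) (tt: is_tensor_product t) (hh: star_hom h).
Hypothesis Z_divisible: divisible u.

Lemma hom_sum (I: finType) (F: I -> T): h (\sum_i F i) = \sum_i h (F i).
by elim: (index_enum I) => [|i r IH];rewrite ?big_nil ?(hom0 hh) // !big_cons (homD hh) IH. Qed.

Lemma div_transp (F: seq A) n (e: R): (0 < n)%N -> 0 < e ->
 (forall f, f \in F -> exists x, nA (f - h x) < e) -> exists2 X, divtuple n X &
 forall f, f \in F -> (forall c a, nA (X c a ** f - f ** X c a) <= 9 * e) /\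
 nA (f ** (\sum_(a < n.+1) star (X false a) ** X false a) - f) <= 9 * e.
move=> n0 e0 Fh.
have /choice[s hs] f: exists s: seq (D * Z), f \in F -> nA (f - h (\sum_(dz <- s) t dz.1 dz.2)) < 2 * e.
 have [fF|_]:=boolP (f \in F);last by exists [::].
 have [x fx]:=Fh f fF;have [_ _ _ dens]:=tt.
 have [_ [k [a [b ->]]] xy]:=dense_nA x dens e0.
 exists [seq (a i, b i) | i <- index_enum 'I_k] => _;rewrite big_map /=.
 have -> : f - h (\sum_i t (a i) (b i)) = (f - h x) + h (x - \sum_i t (a i) (b i)) by rewrite (homB hh) addrA subrK.
 by apply: le_lt_trans (nAD _ _) _;have:=hom_le hh (x - \sum_i t (a i) (b i));lra.
pose G:=flatten [seq s f | f <- F];pose m :=\sum_(dz <- G) (nA dz.1 + nA dz.2) + 1.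
have g0 (r: seq (D * Z)): 0 <= \sum_(dz <- r) (nA dz.1 + nA dz.2).
 by apply: sumr_ge0 => dz _;rewrite addr_ge0 ?nAge0.
have m0: 0 < m by rewrite ltr_wpDl.
pose d:=e / m;have d0: 0 < d by rewrite divr_gt0.
have small f: f \in F -> \sum_(dz <- s f) d * (nA dz.1 + nA dz.2) <= e.
 move=> fF;rewrite -mulr_sumr /d mulrAC ler_pdivrMr // ler_wpM2l ?ltW //.
 rewrite /m /G;elim: F fF {Fh hs G m m0 d d0} => // f' F IH;rewrite inE big_flatten /= big_cons -big_flatten => /orP[/eqP <-|/IH le].
 by rewrite -addrA ltrDl ltr_wpDl //;exact: g0.
 by apply: lt_le_trans le _;rewrite -addrA lerDr.
have [c [c' [[sc nc] [sc' nc'] [cc' c'c] au]]]:=nested_au [seq dz.1 | dz <- G] d0.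
have [X [X1 X2 X3 X5] [X4 X6]]:=Z_divisible [seq dz.2 | dz <- G] n0 d0.
(* The [p] are multiplied by [c] and the [X] by [c'], so that the first copy's [star p ** p] still
   fixes the [X] exactly. *)
pose k (b: bool):=if b then c else c'.
pose Y b a:=h (t (k b) (X b a)).
have [_ hM hS]:=hh.
have YM b a b' a': Y b a ** Y b' a' = h (t (k b ** k b') (X b a ** X b' a')) by rewrite /Y -hM (tensM tt).
have Ys b a: star (Y b a) = h (t (k b) (star (X b a))) by rewrite /Y -hS (tens_star tt);case: b;rewrite /k ?sc ?sc'.
have sM b a b' a': star (Y b a) ** Y b' a' = h (t (k b ** k b') (star (X b a) ** X b' a')) by rewrite Ys /Y -hM (tensM tt).
have Y1 b a: nA (Y b a) <= 1.
 apply: le_trans (hom_le hh _) _;apply: le_trans (tens_nrm uu tt _ _) _.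
 by rewrite -[1]mulr1 ler_pM ?nAge0 //;case: b.
have inG f dz: f \in F -> dz \in s f -> dz \in G by move=> fF dzs;apply/flattenP;exists (s f) => //;apply: map_f.
exists Y;first split=> // [a b an bn|a an|a b an bn ab].
- by rewrite !sM X1 //;case: eqP => // _;rewrite (tens0 tt) (hom0 hh).
- by rewrite sM /Y -hM (tensM tt) /= -cmulA cc' cc' X2.
- by rewrite YM X3 // (tens0 tt) (hom0 hh).
move=> f fF;set S :=\sum_(dz <- s f) t dz.1 dz.2;have fS:=hs f fF;rewrite -/S in fS.
have sub2 (x: A): nA x <= 1 -> nA (x ** (f - h S)) <= 2 * e /\ nA ((f - h S) ** x) <= 2 * e.
 move=> x1;have f0:=nAge0 (f - h S);have x0:=nAge0 x.
 by split;apply: le_trans (nAM _ _) _;nra.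
have auG dz: dz \in s f -> forall b, nA (dz.1 - dz.1 ** k b) <= d /\ nA (dz.1 - k b ** dz.1) <= d.
 by move=> /(inG f dz fF) dzG b;have [a1 a2 a3 a4]:=au dz.1 (map_f fst dzG);case: b.
split=> [b a|].
 have SY: nA (Y b a ** h S - h S ** Y b a) <= 2 * e.
 rewrite /Y -!hM -(homB hh);apply: le_trans (hom_le hh _) _.
 have -> : t (k b) (X b a) ** S - S ** t (k b) (X b a) = \sum_(dz <- s f) (t (k b) (X b a) ** t dz.1 dz.2 - t dz.1 dz.2 ** t (k b) (X b a)).
 rewrite sumrB;congr (_ - _);rewrite /S;elim: (s f) => [|x r IH];rewrite ?big_nil ?cmul0r ?cmul0l //.
 by rewrite !big_cons cmulDr IH.
 by rewrite !big_cons cmulDl IH.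
 apply: le_trans (nA_sum (b:=fun dz => 2 * (d * (nA dz.1 + nA dz.2))) _) _;last first.
 by rewrite -mulr_sumr ler_pM2l // small.
 move=> dz dzs;have [b1 b2]:=auG dz dzs b.
 have b3: nA (X b a ** dz.2 - dz.2 ** X b a) <= d by apply: X6;apply/map_f/(inG f).
 rewrite !(tensM tt);have -> : t (k b ** dz.1) (X b a ** dz.2) - t (dz.1 ** k b) (dz.2 ** X b a) =
 t (k b ** dz.1 - dz.1) (X b a ** dz.2) + (t dz.1 (X b a ** dz.2 - dz.2 ** X b a) + t (dz.1 - dz.1 ** k b) (dz.2 ** X b a)).
 by rewrite !(tensBl tt) (tensBr tt) !addrA !subrK.
 have x1:=X5 b a;have x0:=nAge0 (X b a);have z0:=nAge0 dz.2;have w0:=nAge0 dz.1.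
 have q1:=tens_nrm uu tt (k b ** dz.1 - dz.1) (X b a ** dz.2).
 have q2:=tens_nrm uu tt dz.1 (X b a ** dz.2 - dz.2 ** X b a).
 have q3:=tens_nrm uu tt (dz.1 - dz.1 ** k b) (dz.2 ** X b a).
 have r1: nA (k b ** dz.1 - dz.1) * nA (X b a ** dz.2) <= d * nA dz.2.
 rewrite -nAN opprB;apply: ler_pM;rewrite ?nAge0 //;apply: le_trans (nAM _ _) _;nra.
 have r2: nA dz.1 * nA (X b a ** dz.2 - dz.2 ** X b a) <= d * nA dz.1 by rewrite mulrC ler_wpM2r.
 have r3: nA (dz.1 - dz.1 ** k b) * nA (dz.2 ** X b a) <= d * nA dz.2.
 by apply: ler_pM;rewrite ?nAge0 //;apply: le_trans (nAM _ _) _;nra.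
 apply: le_trans (nAD _ _) _;apply: le_trans (lerD (lexx _) (nAD _ _)) _.
 have dw: 0 <= d * nA dz.1 by rewrite mulr_ge0 // ltW.
 rewrite mulrDr;lra.
 have -> : Y b a ** f - f ** Y b a = (Y b a ** h S - h S ** Y b a) + (Y b a ** (f - h S) - (f - h S) ** Y b a).
 by rewrite cmulDr cmulNr cmulDl cmulNl;exact: sub_split.
 have [b1 b2]:=sub2 _ (Y1 b a);apply: le_trans (nAD _ _) _.
 by have:=nAD (Y b a ** (f - h S)) (- ((f - h S) ** Y b a));rewrite nAN;lra.
have -> : \sum_(a < n.+1) star (Y false a) ** Y false a = h (t (c' ** c') u).
 by rewrite -X4 (tens_sum tt) hom_sum;apply: eq_bigr => a _;rewrite sM.
set E:=t _ u;have u1: nA u <= 1.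
 have:=nA_cstar u;rewrite (uu _).2 (unit_star uu) => e1;rewrite leNgt;apply/negP => u1.
 by move: e1 u1;have:=nAge0 u;nra.
have E1: nA (h E) <= 1.
 apply: le_trans (hom_le hh _) _;apply: le_trans (tens_nrm uu tt _ _) _;rewrite -[1]mulr1 ler_pM ?nAge0 //.
 by apply: le_trans (nAM _ _) _;rewrite -[1]mulr1 ler_pM ?nAge0.
have SE: nA (h S ** h E - h S) <= 2 * e.
 rewrite -hM -(homB hh);apply: le_trans (hom_le hh _) _.
 have -> : S ** E - S = \sum_(dz <- s f) (t dz.1 dz.2 ** E - t dz.1 dz.2).
 by rewrite sumrB;congr (_ - _);rewrite /S;elim: (s f) => [|x r IH];rewrite ?big_nil ?cmul0l // !big_cons cmulDl IH.
 apply: le_trans (nA_sum (b:=fun dz => 2 * (d * (nA dz.1 + nA dz.2))) _) _;last first.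
 by rewrite -mulr_sumr ler_pM2l // small.
 move=> dz dzs;have [b1 _]:=auG dz dzs false.
 rewrite /E (tensM tt) (uu dz.2).2 -(tensBl tt);apply: le_trans (tens_nrm uu tt _ _) _.
 have z0:=nAge0 dz.2;have w0:=nAge0 dz.1;set v:=dz.1 - dz.1 ** k false in b1.
 have -> : dz.1 ** (c' ** c') - dz.1 = - (v + v ** c') by rewrite /v cmulDl cmulNl -cmulA addrA subrK opprB.
 have v0:=nAge0 v;have vc: nA (v ** c') <= d by apply: le_trans (nAM _ _) _;nra.
 have dw: 0 <= d * nA dz.1 by rewrite mulr_ge0 // ltW.
 have q: nA (- (v + v ** c')) <= d + d by rewrite nAN;apply: le_trans (nAD _ _) _;apply: lerD.
 have:=ler_wpM2r z0 q;lra.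
have -> : f ** h E - f = (h S ** h E - h S) + ((f - h S) ** h E - (f - h S)).
 by rewrite cmulDl cmulNl;exact: sub_split.
have [_ b2]:=sub2 _ E1;apply: le_trans (nAD _ _) _.
by have:=nAD ((f - h S) ** h E) (- (f - h S));rewrite nAN;lra.
Qed.
End Transport.

Lemma tdiv_Z (R: realType) (A: cstarAlgType R) :
 essentially_tracially_in (@separable_jiang_su_stable R) A -> tdiv A.
(* The 16 absorbs the factor 9 lost in [div_transp]. *)
move=> TA F s n eps hF [s' _ sE] ps s0 n0 e0;have e16: 0 < eps / 16 by rewrite divr_gt0.
pose F' :=[seq f.1 | f: unitz A <- F].
have s1: s' <> 0 by move=> s'0;move: s0;rewrite -sE s'0 eqxx.
have [||e [B [[[v eE] e1] [[_ [D [f [PD hf _ rf]]]] _] ec eB [z zs]]]]:=TA [set` F'] (rc (eps / 16)) s' (finite_seq _) _ _ s1.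
- by rewrite -[0](rc0 R) rc_lt.
- by apply: pos_positive;rewrite sE.
have [_ [Z [T [t [[u [uu Zs _ [S [Sdrop SS Sd]]]] tt [g [hg [g' gg' g'g]]]]]]]]:=PD.
have hh: star_hom (f \o g).
 have [f1 f2 f3]:=hf;have [g1 g2 g3]:=hg.
 by split=> [k x y|x y|x] /=;rewrite ?g1 ?f1 ?g2 ?f2 ?g3 ?f3.
have [|X [X1 X2 X3 X4] X5]:=div_transp uu tt hh (jiang_su_division uu Zs SS Sd Sdrop) (F :=[seq x - e ** x | x <- F']) n0 e16.
 move=> _ /mapP[x' xF ->];have [[y [By xy]] _]:=eB x' xF.
 have: range f y by rewrite rf.
 by case=> d _ dy;exists (g' d);rewrite /= g'g dy -rc_lt -nAE.
have fE a: a \in F -> a = ui a.1 by move=> /hF/inAE a2;apply: uz_eq.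
have inF' a: a \in F -> a.1 \in F' by move=> aF;apply: map_f.
have se: star e = e by rewrite eE star_cmul starK.
(* [divtuple] controls the relation with [star p ** p] only for indices up to [n], [tdiv] asks for
   it at every index: beyond [n] the value is 0. *)
exists (ui e), (fun i => ui (X true i)), (fun i => ui (if (i <= n)%N then X false i else 0));split.
- split;[exact: inA_ui|by rewrite -ui_adj se|by rewrite ui_nrm -rc_le -nAE rc1|].
 have [N /(_ N (leqnn _)) h]:=(cvg_nAP _ _).1 zs eps e0;exists (ui (z N));first exact: inA_ui.
 by rewrite nrmC -sE -ui_adj -!uiM -uiB ui_nrm.
- move=> a aF;rewrite (fE a aF) -!uiM -!uiB !ui_nrm;have:=ec _ (inF' a aF);have [_]:=eB _ (inF' a aF).
 rewrite !nAE -rcB rc_le rc_lt => h1 h2;split;lra.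
- by move=> i;split;rewrite ui_nrm; (split;[exact: inA_ui|]) => //;case: ifP => // _;rewrite nA0.
- split=> [i j an bn|i|i j an bn ab];rewrite -?ui_adj -?uiM.
+ by rewrite X1 //;case: eqP.
+ by case: ifP => h;rewrite ?X2 ?cmul0r.
+ by rewrite ltnW // X3.
move=> a aF;rewrite (fE a aF) -uiM -uiB.
have [|c1 c2]:=X5 (a.1 - e ** a.1);first by apply: map_f;exact: inF'.
have lt9: 9 * (eps / 16) < eps by lra.
have cc b i: nrm (ui (a.1 - e ** a.1) * ui (X b i) - ui (X b i) * ui (a.1 - e ** a.1)) < eps.
 by rewrite -!uiM -uiB ui_nrm -nAN opprB;apply: le_lt_trans (c1 b i) lt9.
split=> [i|i|];[exact: cc|case: ifP => _;[exact: cc|]|].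
 by rewrite ui0 mulr0 mul0r subrr nrm0.
under eq_bigr => i _ do rewrite -ltnS ltn_ord -ui_adj -uiM.
rewrite -ui_sum.
by rewrite -uiM -uiB ui_nrm;apply: le_lt_trans c2 lt9.
Qed.

Theorem corollary5p10 (R : realType) (A : cstarAlgType R)
    (A_simple : simple A)
    (A_tracial : essentially_tracially_in (@separable_jiang_su_stable R) A)
    (A_not_pi : ~ purely_infinite A) :
  (unital A -> stable_rank_one A) /\
  (~ unital A -> almost_stable_rank_one A).
Proof. exact: sr1_div A_simple (tdiv_Z A_tracial) A_not_pi. Qed.
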